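(* Let $V$ be an $\mathbb{R}$-reflexive Banach module, let $T\in\mathcal{K}(V)$ be injective and bisectorial of angle $\omega\in(0,\frac{\pi}{2})$, and let $\theta\in(\omega,\frac{\pi}{2})$. For $f\in\mathcal{SH}_R^{\mathrm{poly}}(D_\theta)$, with $|f(s)|\le C(|s|^\alpha+|s|^{-\alpha})$ on $D_\theta$ for some $C,\alpha\ge 0$, define the right $H^\infty$-functional calculus $$f(T):=\overline{(fe)(T)\,e(T)^{-1}},\qquad e(s)=\frac{s^m}{(1+s^2)^m},\quad m\in\mathbb{N},\ m>\alpha,$$ where the closure is the closure in $V\times V$ in the sense of multivalued operators. Then this is well defined. In particular: i) $f(T)$ is independent of the chosen integer $m>\alpha$; ii) if $f\in\mathcal{N}^{\mathrm{poly}}(D_\theta)$, then $f(T)$ coincides with the left $H^\infty$-functional calculus of $f$ (i.e. with the graph of that operator); iii) if $f\in\mathcal{SH}_R^0(D_\theta)$, then $f(T)$ coincides with the right $\omega$-functional calculus of $f$ (i.e. with the graph of that operator).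
   Context: Clifford algebra. Fix $n\ge 1$; $\mathbb{N}=\{1,2,\dots\}$. $\mathbb{R}_n$ is the real Clifford algebra with units $e_1,\dots,e_n$, $e_i^2=-1$, $e_ie_j=-e_je_i$ for $i\ne j$, with basis $e_A=e_{i_1}\cdots e_{i_r}$, $A=(i_1<\dots<i_r)\in\mathcal{A}$, and $|s|^2=\sum_A s_A^2$. Paravectors: $\mathbb{R}^{n+1}=\{s_0+s_1e_1+\dots+s_ne_n\}\subseteq\mathbb{R}_n$, with $\overline{s}=s_0-s_1e_1-\dots-s_ne_n$. $\mathbb{S}=\{J\in\mathbb{R}^{n+1}: J_0=0,|J|=1\}$ and $\mathbb{C}_J=\{x+Jy:x,y\in\mathbb{R}\}$ for $J\in\mathbb{S}$. Modules and operators. For a real Banach space $V_\mathbb{R}$, the Banach module is $V=\{\sum_A v_A\otimes e_A: v_A\in V_\mathbb{R}\}$ with $\|v\|^2=\sum_A\|v_A\|_\mathbb{R}^2$ and the left and right multiplications by $\mathbb{R}_n$ induced by the product of $\mathbb{R}_n$. $V$ is $\mathbb{R}$-reflexive if it is reflexive with respect to its $\mathbb{R}$-linear dual (equivalently $V_\mathbb{R}$ is reflexive). $\mathcal{B}(V)$ is the set of bounded everywhere defined right linear operators; $\mathcal{K}(V)$ is the set of closed right linear operators $T:\operatorname{dom}(T)\subseteq V\to V$. A Clifford number $a$ is also regarded as the operator $v\mapsto av$; products of operators and Clifford numbers are compositions. Bisectorial operators. $Q_s[T]=T^2-2s_0T+|s|^2$ with domain $\operatorname{dom}(T^2)$; $\rho_S(T)=\{s\in\mathbb{R}^{n+1}:Q_s[T]^{-1}\in\mathcal{B}(V)\}$,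 $\sigma_S(T)=\mathbb{R}^{n+1}\setminus\rho_S(T)$; $S_L^{-1}(s,T)=Q_s[T]^{-1}\overline{s}-TQ_s[T]^{-1}$ and $S_R^{-1}(s,T)=(\overline{s}-T)Q_s[T]^{-1}$ for $s\in\rho_S(T)$. For $\omega\in(0,\frac{\pi}{2})$, $I_\omega=(-\omega,\omega)\cup(\pi-\omega,\pi+\omega)$ and $D_\omega=\{re^{J\phi}:r>0,J\in\mathbb{S},\phi\in I_\omega\}$. $T\in\mathcal{K}(V)$ is bisectorial of angle $\omega$ if $\sigma_S(T)\subseteq\overline{D_\omega}$ and for every $\varphi\in(\omega,\frac{\pi}{2})$ there is $C_\varphi\ge0$ with $\|S_L^{-1}(s,T)\|\le C_\varphi/|s|$ for all $s\in\mathbb{R}^{n+1}\setminus(D_\varphi\cup\{0\})$. Functions. For open axially symmetric $U\subseteq\mathbb{R}^{n+1}$ and $\mathcal{U}=\{(x,y)\in\mathbb{R}^2: x+\mathbb{S}y\subseteq U\}$, $f:U\to\mathbb{R}_n$ is left (resp. right) slice hyperholomorphic, $f\in\mathcal{SH}_L(U)$ (resp. $\mathcal{SH}_R(U)$), if there are $C^1$ functions $f_0,f_1:\mathcal{U}\to\mathbb{R}_n$ with $f(x+Jy)=f_0(x,y)+Jf_1(x,y)$ (resp. $f_0(x,y)+f_1(x,y)J$) for all $J\in\mathbb{S}$, $f_0(x,-y)=f_0(x,y)$, $f_1(x,-y)=-f_1(x,y)$, $\partial_xf_0=\partial_yf_1$, $\partial_yf_0=-\partial_xf_1$. It is intrinsic,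 $f\in\mathcal{N}(U)$, if $f_0,f_1$ are real valued. For $\theta\in(0,\frac\pi2)$, the spaces $\mathcal{SH}_L^0(D_\theta),\mathcal{SH}_R^0(D_\theta),\mathcal{N}^0(D_\theta)$ consist of the bounded $f$ in $\mathcal{SH}_L(D_\theta),\mathcal{SH}_R(D_\theta),\mathcal{N}(D_\theta)$ with $\int_0^\infty|f(re^{J\phi})|\frac{dr}{r}<\infty$ for all $J\in\mathbb{S},\phi\in I_\theta$. The spaces $\mathcal{SH}_L^{\mathrm{poly}}(D_\theta),\mathcal{SH}_R^{\mathrm{poly}}(D_\theta),\mathcal{N}^{\mathrm{poly}}(D_\theta)$ consist of the $f$ in $\mathcal{SH}_L(D_\theta),\mathcal{SH}_R(D_\theta),\mathcal{N}(D_\theta)$ for which there are $C,\alpha\ge0$ with $|f(s)|\le C(|s|^\alpha+|s|^{-\alpha})$ on $D_\theta$. $\omega$-functional calculus. Let $T$ be bisectorial of angle $\omega$, $\theta\in(\omega,\frac\pi2)$. For $f\in\mathcal{SH}_L^0(D_\theta)$: $f(T)=\frac{1}{2\pi}\int_{\partial D_\varphi\cap\mathbb{C}_J}S_L^{-1}(s,T)\,ds_J\,f(s)$; for $f\in\mathcal{SH}_R^0(D_\theta)$: $f(T)=\frac{1}{2\pi}\int_{\partial D_\varphi\cap\mathbb{C}_J}f(s)\,ds_J\,S_R^{-1}(s,T)$. Here $ds_J=ds/J$, the boundary is positively oriented ($D_\varphi\cap\mathbb{C}_J$ lies to the left), and $\varphi\in(\omega,\theta)$, $J\in\mathbb{S}$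 are arbitrary (the integrals do not depend on the choice). Both give operators in $\mathcal{B}(V)$, and they agree for intrinsic functions. Left $H^\infty$-functional calculus. For $T$ injective and bisectorial of angle $\omega$, $\theta\in(\omega,\frac\pi2)$ and $f\in\mathcal{SH}_L^{\mathrm{poly}}(D_\theta)$ with growth exponent $\alpha$, $f(T):=e(T)^{-1}(ef)(T)$, where $e(s)=\frac{s^m}{(1+s^2)^m}$, $m\in\mathbb{N}$, $m>\alpha$, and $e(T)$, $(ef)(T)$ are given by the $\omega$-functional calculus ($e(T)$ is injective; the result is known not to depend on $m$). In the right calculus, $(fe)(T)$ and $e(T)$ are likewise given by the $\omega$-functional calculus, and $(fe)(T)e(T)^{-1}$ has domain $\operatorname{ran}(e(T))$. Multivalued operators. A right linear multivalued operator is a right linear subspace $\mathcal{T}\subseteq V\times V$; operators are identified with their graphs. The closure is $\overline{\mathcal{T}}=\{(v,w): \exists (v_k,w_k)\in\mathcal{T},\ (v_k,w_k)\to(v,w)\}$. *)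

(* Defs.v *)
From HB Require Import structures.
From mathcomp Require Import all_boot.
From Stdlib Require Import Reals Lra FunctionalExtensionality ProofIrrelevance.
From Coquelicot Require Import Coquelicot.

Set Implicit Arguments.
Unset Strict Implicit.
Unset Printing Implicit Defensive.

Local Open Scope R_scope.

Section NormUniform.
Variables (M : ModuleSpace R_AbsRing) (N : M -> R).
Hypothesis Ntri : forall x y, N (plus x y) <= N x + N y.
Hypothesis Nhom : forall (l : R) x, N (scal l x) <= Rabs l * N x.

Definition norm_ball (x : M) (e : R) (y : M) : Prop := N (minus y x) < e.

Lemma norm_ball_center (x : M) (e : posreal) : norm_ball x e x.
Proof.
rewrite /norm_ball /minus plus_opp_r.
have := Nhom 0 zero; rewrite scal_zero_r Rabs_R0 Rmult_0_l => H.
by apply: Rle_lt_trans H (cond_pos e).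
Qed.

Lemma norm_ball_sym (x y : M) (e : R) : norm_ball x e y -> norm_ball y e x.
Proof.
rewrite /norm_ball -(opp_minus y x) -(scal_opp_one (minus y x)) => H.
apply: Rle_lt_trans H; have := Nhom (opp (one : R_AbsRing)) (minus y x).
by rewrite /opp /one /= Rabs_Ropp Rabs_R1 Rmult_1_l.
Qed.

Lemma norm_ball_triangle (x y z : M) (e1 e2 : R) :
  norm_ball x e1 y -> norm_ball y e2 z -> norm_ball x (e1 + e2) z.
Proof.
rewrite /norm_ball (minus_trans y z x) => H1 H2.
apply: Rle_lt_trans (Ntri _ _) _; lra.
Qed.

Definition norm_uniform_mixin : UniformSpace.mixin_of M :=
  @UniformSpace.Mixin M zero norm_ball norm_ball_center norm_ball_sym
    norm_ball_triangle.

End NormUniform.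

Section BoundedLinear.
Variables X Y : NormedModule R_AbsRing.

Record blin := Blin { blin_fun :> X -> Y; blin_linear : is_linear blin_fun }.

Lemma blin_eq (A B : blin) : (forall x, A x = B x) -> A = B.
Proof.
case: A B => [a ha] [b hb] /= H.
have E : a = b by apply: functional_extensionality.
by subst b; congr Blin; apply: proof_irrelevance.
Qed.

Lemma blin_plus_linear (A B : blin) : is_linear (fun x => plus (A x) (B x)).
Proof.
case: A B => [a [ap asc [Ma [Ma0 HMa]]]] [b [bp bsc [Mb [Mb0 HMb]]]] /=.
split=> [x y|k x|].
- rewrite ap bp -!plus_assoc; congr plus.
  by rewrite !plus_assoc [plus (a y) (b x)]plus_comm.
- by rewrite asc bsc scal_distr_l.
- exists (Ma + Mb); split; first lra.
  move=> x; apply: Rle_trans (norm_triangle _ _) _.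
  by rewrite Rmult_plus_distr_r; apply: Rplus_le_compat.
Qed.

Lemma blin_scal_linear (k : R) (A : blin) : is_linear (fun x => scal k (A x)).
Proof.
case: A => [a [ap asc [Ma [Ma0 HMa]]]] /=; split=> [x y|l x|].
- by rewrite ap scal_distr_l.
- by rewrite asc !scal_assoc /mult /= Rmult_comm.
- exists ((Rabs k + 1) * Ma); have := Rabs_pos k => hk; split.
    by apply: Rmult_lt_0_compat; lra.
  move=> x; apply: Rle_trans (norm_scal _ _) _.
  rewrite Rmult_assoc; apply: Rmult_le_compat => //.
  + exact: norm_ge_0.
  + by rewrite /abs /=; lra.
Qed.

Definition blin_zero : blin := Blin (@is_linear_zero R_AbsRing X Y).
Definition blin_plus (A B : blin) : blin := Blin (blin_plus_linear A B).
Definition blin_scal (k : R) (A : blin) : blin := Blin (blin_scal_linear k A).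
Definition blin_opp (A : blin) : blin := blin_scal (opp (one : R_AbsRing)) A.

Lemma blin_plus_comm A B : blin_plus A B = blin_plus B A.
Proof. by apply: blin_eq => x /=; apply: plus_comm. Qed.
Lemma blin_plus_assoc A B C :
  blin_plus A (blin_plus B C) = blin_plus (blin_plus A B) C.
Proof. by apply: blin_eq => x /=; apply: plus_assoc. Qed.
Lemma blin_plus_zero A : blin_plus A blin_zero = A.
Proof. by apply: blin_eq => x /=; apply: plus_zero_r. Qed.
Lemma blin_plus_opp A : blin_plus A (blin_opp A) = blin_zero.
Proof.
by apply: blin_eq => x /=; rewrite (scal_opp_one (A x)); apply: plus_opp_r.
Qed.

Definition blin_AbelianMonoid_mixin :=
  @AbelianMonoid.Mixin blin blin_plus blin_zero
    blin_plus_comm blin_plus_assoc blin_plus_zero.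
Canonical blin_AbelianMonoid :=
  AbelianMonoid.Pack blin blin_AbelianMonoid_mixin blin.
Definition blin_AbelianGroup_mixin :=
  @AbelianGroup.Mixin blin_AbelianMonoid blin_opp blin_plus_opp.
Canonical blin_AbelianGroup :=
  AbelianGroup.Pack blin (AbelianGroup.Class _ _ blin_AbelianGroup_mixin) blin.

Lemma blin_scal_assoc (x y : R) (A : blin) :
  blin_scal x (blin_scal y A) = blin_scal (mult x y) A.
Proof. by apply: blin_eq => v /=; apply: scal_assoc. Qed.
Lemma blin_scal_one (A : blin) : blin_scal one A = A.
Proof. by apply: blin_eq => v /=; apply: (scal_one (A v)). Qed.
Lemma blin_scal_distr_l (x : R) (A B : blin) :
  blin_scal x (plus A B) = plus (blin_scal x A) (blin_scal x B).
Proof. by apply: blin_eq => v /=; apply: scal_distr_l. Qed.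
Lemma blin_scal_distr_r (x y : R) (A : blin) :
  blin_scal (plus x y) A = plus (blin_scal x A) (blin_scal y A).
Proof. by apply: blin_eq => v /=; apply: (scal_distr_r x y (A v)). Qed.

Definition blin_ModuleSpace_mixin :=
  @ModuleSpace.Mixin R_AbsRing blin_AbelianGroup blin_scal
    blin_scal_assoc blin_scal_one blin_scal_distr_l blin_scal_distr_r.
Canonical blin_ModuleSpace :=
  ModuleSpace.Pack R_AbsRing blin
    (ModuleSpace.Class _ _ _ blin_ModuleSpace_mixin) blin.

Definition opnorm (A : blin) : R :=
  real (Lub_Rbar (fun r => exists x : X, norm x <= 1 /\ r = norm (A x))).

Lemma opnorm_lub (A : blin) :
  is_lub_Rbar (fun r => exists x : X, norm x <= 1 /\ r = norm (A x)) (opnorm A).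
Proof.
rewrite /opnorm; set E := (E in Lub_Rbar E).
have := Lub_Rbar_correct E; case: (Lub_Rbar E) => [r|[ub lub]|[ub lub]] //=.
- exfalso; case: (linear_norm _ (blin_linear A)) => M [M0 HM].
  have /= := lub (Finite M); apply=> _ [x [nx ->]] /=.
  apply: Rle_trans (HM x) _; rewrite -{2}[M]Rmult_1_r.
  by apply: Rmult_le_compat_l => //; lra.
- have /= : E 0.
    exists zero; rewrite norm_zero; split; first lra.
    by rewrite linear_zero ?norm_zero //; apply: blin_linear.
  by move=> /ub.
Qed.

Lemma opnorm_ge0 (A : blin) : 0 <= opnorm A.
Proof.
case: (opnorm_lub A) => ub _; apply: (ub 0); exists zero.
rewrite norm_zero; split; first lra.
by rewrite linear_zero ?norm_zero //; apply: blin_linear.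
Qed.

Lemma opnorm_bound (A : blin) (x : X) : norm (A x) <= opnorm A * norm x.
Proof.
case: (Rle_lt_or_eq_dec _ _ (norm_ge_0 x)) => [x0|/esym x0]; last first.
  rewrite (norm_eq_zero _ x0) linear_zero; last exact: blin_linear.
  by rewrite !norm_zero; lra.
have nz : norm x <> 0 by lra.
have E : x = scal (norm x) (scal (/ norm x) x).
  by rewrite scal_assoc /mult /= Rinv_r // (scal_one x).
have nx : norm (scal (/ norm x) x) <= 1.
  apply: Rle_trans (norm_scal _ _) _; rewrite /abs /= Rabs_pos_eq.
    by rewrite Rinv_l //; lra.
  by apply: Rlt_le; apply: Rinv_0_lt_compat.
rewrite {1}E (linear_scal _ (blin_linear A)).
apply: Rle_trans (norm_scal _ _) _.
rewrite /abs /= (Rabs_pos_eq _ (norm_ge_0 x)) Rmult_comm.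
apply: Rmult_le_compat_r; first lra.
by case: (opnorm_lub A) => ub _; apply: (ub (norm _)); eexists; split; first exact: nx.
Qed.

Lemma opnorm_le (A : blin) (c : R) :
  0 <= c -> (forall x, norm (A x) <= c * norm x) -> opnorm A <= c.
Proof.
move=> c0 H; case: (opnorm_lub A) => _ lub; apply: (lub (Finite c)).
move=> _ [x [nx ->]] /=; apply: Rle_trans (H x) _.
by rewrite -{2}[c]Rmult_1_r; apply: Rmult_le_compat_l.
Qed.

Lemma opnorm_triangle (A B : blin) : opnorm (plus A B) <= opnorm A + opnorm B.
Proof.
have := opnorm_ge0 A; have := opnorm_ge0 B => hB hA; apply: opnorm_le; first lra.
move=> x; apply: Rle_trans (norm_triangle _ _) _; rewrite Rmult_plus_distr_r.
by apply: Rplus_le_compat; apply: opnorm_bound.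
Qed.

Lemma opnorm_scal (l : R) (A : blin) : opnorm (scal l A) <= Rabs l * opnorm A.
Proof.
apply: opnorm_le.
  by apply: Rmult_le_pos; [apply: Rabs_pos | apply: opnorm_ge0].
move=> x; apply: Rle_trans (norm_scal _ _) _; rewrite Rmult_assoc.
by apply: Rmult_le_compat_l; [apply: Rabs_pos | apply: opnorm_bound].
Qed.

Lemma opnorm_eq0 (A : blin) : opnorm A = 0 -> A = zero.
Proof.
move=> H; apply: blin_eq => x /=; apply: norm_eq_zero.
by have := opnorm_bound A x; have := norm_ge_0 (A x); rewrite H; lra.
Qed.

Definition blin_UniformSpace_mixin :=
  norm_uniform_mixin opnorm_triangle opnorm_scal.
Canonical blin_UniformSpace :=
  UniformSpace.Pack blin blin_UniformSpace_mixin blin.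
Canonical blin_NormedModuleAux :=
  NormedModuleAux.Pack R_AbsRing blin
    (NormedModuleAux.Class _ _ (ModuleSpace.class _ blin_ModuleSpace)
       blin_UniformSpace_mixin) blin.

Lemma opnorm_ball_compat2 (A B : blin) (e : posreal) :
  ball A e B -> opnorm (minus B A) < 1 * e.
Proof. by rewrite Rmult_1_l. Qed.

Definition blin_NormedModule_mixin :=
  @NormedModule.Mixin R_AbsRing blin_NormedModuleAux opnorm 1
    opnorm_triangle opnorm_scal (fun _ _ _ H => H)
    opnorm_ball_compat2 opnorm_eq0.
Canonical blin_NormedModule :=
  NormedModule.Pack R_AbsRing blin
    (NormedModule.Class _ _ _ blin_NormedModule_mixin) blin.

End BoundedLinear.

Definition dual (X : NormedModule R_AbsRing) : NormedModule R_AbsRing :=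
  blin_NormedModule X R_NormedModule.

Definition reflexive_space (X : NormedModule R_AbsRing) : Prop :=
  forall Phi : dual (dual X), exists x : X,
    forall phi : blin X R_NormedModule, blin_fun Phi phi = phi x.

(* [v A] is the component of [v] at the basis element [e_A]. *)
Definition clmod (n : nat) (VR : NormedModule R_AbsRing) : Type :=
  {ffun {set 'I_n} -> VR}.

Section CliffordModule.
Variables (n : nat) (VR : NormedModule R_AbsRing).
Implicit Types v w : clmod n VR.

Definition clmod_zero : clmod n VR := [ffun=> zero].
Definition clmod_plus v w : clmod n VR := [ffun A => plus (v A) (w A)].
Definition clmod_opp v : clmod n VR := [ffun A => opp (v A)].
Definition clmod_scal (k : R) v : clmod n VR := [ffun A => scal k (v A)].

Lemma clmod_plus_comm v w : clmod_plus v w = clmod_plus w v.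
Proof. by apply/ffunP=> A; rewrite !ffunE; apply: plus_comm. Qed.
Lemma clmod_plus_assoc u v w :
  clmod_plus u (clmod_plus v w) = clmod_plus (clmod_plus u v) w.
Proof. by apply/ffunP=> A; rewrite !ffunE; apply: plus_assoc. Qed.
Lemma clmod_plus_zero v : clmod_plus v clmod_zero = v.
Proof. by apply/ffunP=> A; rewrite !ffunE; apply: plus_zero_r. Qed.
Lemma clmod_plus_opp v : clmod_plus v (clmod_opp v) = clmod_zero.
Proof. by apply/ffunP=> A; rewrite !ffunE; apply: plus_opp_r. Qed.

Definition clmod_AbelianMonoid_mixin :=
  @AbelianMonoid.Mixin (clmod n VR) clmod_plus clmod_zero
    clmod_plus_comm clmod_plus_assoc clmod_plus_zero.
Canonical clmod_AbelianMonoid :=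
  AbelianMonoid.Pack (clmod n VR) clmod_AbelianMonoid_mixin (clmod n VR).
Definition clmod_AbelianGroup_mixin :=
  @AbelianGroup.Mixin clmod_AbelianMonoid clmod_opp clmod_plus_opp.
Canonical clmod_AbelianGroup :=
  AbelianGroup.Pack (clmod n VR)
    (AbelianGroup.Class _ _ clmod_AbelianGroup_mixin) (clmod n VR).

Lemma clmod_scal_assoc (x y : R) v :
  clmod_scal x (clmod_scal y v) = clmod_scal (mult x y) v.
Proof. by apply/ffunP=> A; rewrite !ffunE; apply: scal_assoc. Qed.
Lemma clmod_scal_one v : clmod_scal one v = v.
Proof. by apply/ffunP=> A; rewrite !ffunE; apply: (scal_one (v A)). Qed.
Lemma clmod_scal_distr_l (x : R) v w :
  clmod_scal x (plus v w) = plus (clmod_scal x v) (clmod_scal x w).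
Proof. by apply/ffunP=> A; rewrite !ffunE; apply: scal_distr_l. Qed.
Lemma clmod_scal_distr_r (x y : R) v :
  clmod_scal (plus x y) v = plus (clmod_scal x v) (clmod_scal y v).
Proof. by apply/ffunP=> A; rewrite !ffunE; apply: (scal_distr_r x y (v A)). Qed.

Definition clmod_ModuleSpace_mixin :=
  @ModuleSpace.Mixin R_AbsRing clmod_AbelianGroup clmod_scal
    clmod_scal_assoc clmod_scal_one clmod_scal_distr_l clmod_scal_distr_r.
Canonical clmod_ModuleSpace :=
  ModuleSpace.Pack R_AbsRing (clmod n VR)
    (ModuleSpace.Class _ _ _ clmod_ModuleSpace_mixin) (clmod n VR).

Definition clmod_norm v : R :=
  sqrt (\big[Rplus/0]_(A : {set 'I_n}) (norm (v A)) ^ 2).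

Lemma sum_sqr_ge0 (I : Type) (r : seq I) (a : I -> R) :
  0 <= \big[Rplus/0]_(i <- r) (a i) ^ 2.
Proof.
elim: r => [|i r IH]; first by rewrite big_nil; lra.
by rewrite big_cons; have := pow2_ge_0 (a i); lra.
Qed.

Lemma sqrt_minkowski2 (a b c d : R) :
  sqrt ((a + b) ^ 2 + (c + d) ^ 2) <= sqrt (a ^ 2 + c ^ 2) + sqrt (b ^ 2 + d ^ 2).
Proof.
have P0 : 0 <= a ^ 2 + c ^ 2 by nra.
have Q0 : 0 <= b ^ 2 + d ^ 2 by nra.
have := sqrt_sqrt _ P0; have := sqrt_sqrt _ Q0.
have := sqrt_pos (a ^ 2 + c ^ 2); have := sqrt_pos (b ^ 2 + d ^ 2).
set p := sqrt (a ^ 2 + c ^ 2); set q := sqrt (b ^ 2 + d ^ 2) => q0 p0 qq pp.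
have CS : a * b + c * d <= p * q.
  case: (Rle_lt_dec (a * b + c * d) (p * q)) => // H; exfalso.
  have pq0 := Rmult_le_pos _ _ p0 q0.
  have H2 : (p * q) * (p * q) < (a * b + c * d) * (a * b + c * d) by nra.
  have E : (p * q) * (p * q) = (a ^ 2 + c ^ 2) * (b ^ 2 + d ^ 2).
    by rewrite -pp -qq; ring.
  by have := pow2_ge_0 (a * d - b * c); nra.
rewrite -(sqrt_Rsqr (p + q)); last lra.
by apply: sqrt_le_1_alt; rewrite /Rsqr; nra.
Qed.

Lemma sqrt_minkowski (I : Type) (r : seq I) (a b : I -> R) :
  sqrt (\big[Rplus/0]_(i <- r) (a i + b i) ^ 2) <=
  sqrt (\big[Rplus/0]_(i <- r) (a i) ^ 2) +
  sqrt (\big[Rplus/0]_(i <- r) (b i) ^ 2).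
Proof.
elim: r => [|i r IH]; first by rewrite !big_nil sqrt_0; lra.
rewrite !big_cons.
have sq (c : I -> R) : \big[Rplus/0]_(j <- r) (c j) ^ 2 =
    sqrt (\big[Rplus/0]_(j <- r) (c j) ^ 2) ^ 2.
  by rewrite pow2_sqrt //; apply: sum_sqr_ge0.
apply: (@Rle_trans _ (sqrt ((a i + b i) ^ 2 +
   (sqrt (\big[Rplus/0]_(j <- r) (a j) ^ 2) +
    sqrt (\big[Rplus/0]_(j <- r) (b j) ^ 2)) ^ 2))).
  apply: sqrt_le_1_alt; apply: Rplus_le_compat_l.
  rewrite (sq (fun j => a j + b j)); apply: pow_incr; split=> //.
  exact: sqrt_pos.
by rewrite {2}(sq a) {2}(sq b); apply: sqrt_minkowski2.
Qed.

Lemma sum_sqr_le (I : Type) (r : seq I) (a b : I -> R) :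
  (forall i, 0 <= a i <= b i) ->
  \big[Rplus/0]_(i <- r) (a i) ^ 2 <= \big[Rplus/0]_(i <- r) (b i) ^ 2.
Proof.
move=> H; elim: r => [|i r IH]; first by rewrite !big_nil; lra.
by rewrite !big_cons; apply: Rplus_le_compat => //; apply: pow_incr.
Qed.

Lemma clmod_norm_triangle v w :
  clmod_norm (plus v w) <= clmod_norm v + clmod_norm w.
Proof.
apply: Rle_trans (sqrt_minkowski _ _ _); apply: sqrt_le_1_alt.
apply: sum_sqr_le => A; rewrite ffunE; split; first exact: norm_ge_0.
exact: norm_triangle.
Qed.

Lemma clmod_norm_scal (l : R) v :
  clmod_norm (scal l v) <= Rabs l * clmod_norm v.
Proof.
rewrite -sqrt_Rsqr_abs -sqrt_mult_alt; last exact: Rle_0_sqr.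
apply: sqrt_le_1_alt.
have -> : Rsqr l * \big[Rplus/0]_(A : {set 'I_n}) (norm (v A)) ^ 2 =
    \big[Rplus/0]_(A : {set 'I_n}) (Rabs l * norm (v A)) ^ 2.
  rewrite (big_morph (Rmult (Rsqr l)) (Rmult_plus_distr_l _) (Rmult_0_r _)).
  apply: eq_bigr => A _; rewrite Rsqr_abs /Rsqr; ring.
apply: sum_sqr_le => A; rewrite ffunE; split; first exact: norm_ge_0.
exact: norm_scal.
Qed.

Lemma clmod_norm_eq0 v : clmod_norm v = 0 -> v = zero.
Proof.
move=> /sqrt_eq_0 => /(_ (sum_sqr_ge0 _ _)) H; apply/ffunP=> A; rewrite ffunE.
apply: norm_eq_zero; move: H; have : A \in index_enum {set 'I_n}.
  by rewrite mem_index_enum.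
elim: (index_enum _) => // B r IH; rewrite in_cons big_cons.
have := pow2_ge_0 (norm (v B)); have := sum_sqr_ge0 r (fun B => norm (v B)).
set S := \big[Rplus/0]_(i <- r) _ => h1 h2 /orP[/eqP ->|Ar] H.
  by apply: Rsqr_0_uniq; rewrite Rsqr_pow2; move: H h1 h2 => /=; lra.
by apply: IH => //; move: H h1 h2 => /=; rewrite -/S; lra.
Qed.

Definition clmod_UniformSpace_mixin :=
  norm_uniform_mixin clmod_norm_triangle clmod_norm_scal.
Canonical clmod_UniformSpace :=
  UniformSpace.Pack (clmod n VR) clmod_UniformSpace_mixin (clmod n VR).
Canonical clmod_NormedModuleAux :=
  NormedModuleAux.Pack R_AbsRing (clmod n VR)
    (NormedModuleAux.Class _ _ (ModuleSpace.class _ clmod_ModuleSpace)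
       clmod_UniformSpace_mixin) (clmod n VR).

Lemma clmod_ball_compat2 v w (e : posreal) :
  ball v e w -> clmod_norm (minus w v) < 1 * e.
Proof. by rewrite Rmult_1_l. Qed.

Definition clmod_NormedModule_mixin :=
  @NormedModule.Mixin R_AbsRing clmod_NormedModuleAux clmod_norm 1
    clmod_norm_triangle clmod_norm_scal (fun _ _ _ H => H)
    clmod_ball_compat2 clmod_norm_eq0.
Canonical clmod_NormedModule :=
  NormedModule.Pack R_AbsRing (clmod n VR)
    (NormedModule.Class _ _ _ clmod_NormedModule_mixin) (clmod n VR).

End CliffordModule.

Notation Cl n := (clmod n R_NormedModule).

(* [e_A e_B = cl_sign A B * e_(A symdiff B)]: one factor -1 for each
   transposition needed to sort the word [A B], and one for each [e_i ^ 2]. *)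
Definition cl_sign (n : nat) (A B : {set 'I_n}) : R :=
  (-1) ^ (#|[set p : 'I_n * 'I_n | [&& p.1 \in A, p.2 \in B & (p.2 < p.1)%nat]]|
          + #|A :&: B|)%nat.

Definition symdiff (n : nat) (A B : {set 'I_n}) : {set 'I_n} :=
  (A :\: B) :|: (B :\: A).

Section CliffordAlgebra.
Variables (n : nat) (VR : NormedModule R_AbsRing).

(* The components at [e_C] of the products [a v] and [v a]: the pairs [(A, B)]
   with [symdiff A B = C] are the pairs [(A, symdiff A C)]. *)
Definition lmul (a : Cl n) (v : clmod n VR) : clmod n VR :=
  [ffun C => \big[plus/zero]_(A : {set 'I_n})
     scal (cl_sign A (symdiff A C) * a A) (v (symdiff A C))].
Definition rmul (v : clmod n VR) (a : Cl n) : clmod n VR :=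
  [ffun C => \big[plus/zero]_(A : {set 'I_n})
     scal (cl_sign (symdiff A C) A * a A) (v (symdiff A C))].

End CliffordAlgebra.

Section Paravectors.
Variable n : nat.
Implicit Types s J : Cl n.

Definition cl_mul (a b : Cl n) : Cl n := lmul a b.
Definition cl_base (A : {set 'I_n}) : Cl n := [ffun B => if B == A then 1 else 0].
Definition cl_real (x : R) : Cl n := scal x (cl_base set0).
Definition cl_pow (a : Cl n) (m : nat) : Cl n := iter m (cl_mul a) (cl_real 1).

Definition paravector (s : Cl n) : Prop :=
  forall A : {set 'I_n}, (1 < #|A|)%nat -> s A = 0.

Definition Sc (s : Cl n) : R := s set0.

(* Conjugate and inverse, meaningful for paravectors only. *)
Definition cl_conj (s : Cl n) : Cl n := [ffun A => if A == set0 then s A else - s A].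
Definition cl_inv (s : Cl n) : Cl n := scal (/ (norm s) ^ 2) (cl_conj s).

Definition imag_unit (J : Cl n) : Prop :=
  paravector J /\ Sc J = 0 /\ norm J = 1.

Definition cplx (x y : R) (J : Cl n) : Cl n := plus (cl_real x) (scal y J).
Definition expJ (J : Cl n) (phi : R) : Cl n := cplx (cos phi) (sin phi) J.

Definition in_I (omega phi : R) : Prop :=
  - omega < phi < omega \/ PI - omega < phi < PI + omega.

Definition Dsec (omega : R) (s : Cl n) : Prop :=
  exists (r : R) (J : Cl n) (phi : R),
    0 < r /\ imag_unit J /\ in_I omega phi /\ s = scal r (expJ J phi).

End Paravectors.

Section CliffordBasis.
Variable n : nat.

Lemma symdiffK (A B : {set 'I_n}) : symdiff A (symdiff A B) = B.
Proof.
by apply/setP=> i; rewrite /symdiff !inE; case: (i \in A); case: (i \in B).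
Qed.

Lemma cl_mul_base (A B : {set 'I_n}) :
  cl_mul (cl_base A) (cl_base B) = scal (cl_sign A B) (cl_base (symdiff A B)).
Proof.
apply/ffunP=> C; rewrite !ffunE.
have E : forall r : seq {set 'I_n}, uniq r ->
    \big[plus/zero]_(i <- r) scal (cl_sign i (symdiff i C) * cl_base A i)
                                  (cl_base B (symdiff i C)) =
    if A \in r then scal (cl_sign A B) (cl_base (symdiff A B) C)
    else (zero : R_NormedModule).
  elim=> [|D r IH] /=; first by rewrite big_nil.
  move=> /andP[nD ur]; rewrite big_cons IH // in_cons !ffunE [D == A]eq_sym.
  case: eqP => [AD|nAD] /=.
    subst D; rewrite (negbTE nD) plus_zero_r Rmult_1_r.
    have -> : (symdiff A C == B) = (C == symdiff A B).
      by apply/eqP/eqP => [<-|->]; rewrite symdiffK.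
    case: eqP => [->|_]; first by rewrite symdiffK.
    by rewrite !(@scal_zero_r R_AbsRing R_NormedModule).
  by rewrite Rmult_0_r (@scal_zero_l R_AbsRing R_NormedModule) plus_zero_l ?ffunE.
by rewrite E ?index_enum_uniq // mem_index_enum ?ffunE.
Qed.

End CliffordBasis.

Section SliceFunctions.
Variable n : nat.
Implicit Types (U : Cl n -> Prop) (f : Cl n -> Cl n).

Definition slice_dom U (x y : R) : Prop :=
  forall J : Cl n, imag_unit J -> U (cplx x y J).

Definition C1_on (W : R -> R -> Prop) (g gx gy : R -> R -> Cl n) : Prop :=
  forall x y, W x y ->
    is_derive (fun t => g t y) x (gx x y) /\
    is_derive (fun t => g x t) y (gy x y) /\
    continuous (fun p : R * R => gx p.1 p.2) (x, y) /\
    continuous (fun p : R * R => gy p.1 p.2) (x, y).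

Definition slice_pair U (f0 f1 : R -> R -> Cl n) : Prop :=
  exists f0x f0y f1x f1y : R -> R -> Cl n,
    C1_on (slice_dom U) f0 f0x f0y /\ C1_on (slice_dom U) f1 f1x f1y /\
    forall x y, slice_dom U x y ->
      f0 x (- y) = f0 x y /\ f1 x (- y) = opp (f1 x y) /\
      f0x x y = f1y x y /\ f0y x y = opp (f1x x y).

Definition slice_left U f (f0 f1 : R -> R -> Cl n) : Prop :=
  forall x y J, slice_dom U x y -> imag_unit J ->
    f (cplx x y J) = plus (f0 x y) (cl_mul J (f1 x y)).
Definition slice_right U f (f0 f1 : R -> R -> Cl n) : Prop :=
  forall x y J, slice_dom U x y -> imag_unit J ->
    f (cplx x y J) = plus (f0 x y) (cl_mul (f1 x y) J).

Definition SH_L U f : Prop :=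
  exists f0 f1 : R -> R -> Cl n, slice_pair U f0 f1 /\ slice_left U f f0 f1.
Definition SH_R U f : Prop :=
  exists f0 f1 : R -> R -> Cl n, slice_pair U f0 f1 /\ slice_right U f f0 f1.
Definition intrinsic U f : Prop :=
  exists f0 f1 : R -> R -> Cl n, slice_pair U f0 f1 /\ slice_left U f f0 f1 /\
    forall x y, slice_dom U x y ->
      (exists a, f0 x y = cl_real n a) /\ (exists b, f1 x y = cl_real n b).

Definition bounded_integrable (theta : R) f : Prop :=
  (exists M, forall s, Dsec theta s -> norm (f s) <= M) /\
  (forall (J : Cl n) phi, imag_unit J -> in_I theta phi ->
     ex_RInt_gen (fun r => norm (f (scal r (expJ J phi))) / r)
       (at_right 0) (Rbar_locally p_infty)).

Definition SH_R0 theta f : Prop :=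
  SH_R (Dsec (n := n) theta) f /\ bounded_integrable theta f.
Definition intrinsic0 theta f : Prop :=
  intrinsic (Dsec (n := n) theta) f /\ bounded_integrable theta f.

Definition poly_bound (theta C alpha : R) f : Prop :=
  forall s, Dsec theta s ->
    norm (f s) <= C * (Rpower (norm s) alpha + Rpower (norm s) (- alpha)).

Definition intrinsic_poly theta f : Prop :=
  intrinsic (Dsec (n := n) theta) f /\
  exists C alpha, 0 <= C /\ 0 <= alpha /\ poly_bound theta C alpha f.

Definition e_reg (m : nat) (s : Cl n) : Cl n :=
  cl_mul (cl_pow s m) (cl_inv (cl_pow (plus (cl_real n 1) (cl_pow s 2)) m)).

End SliceFunctions.

Definition seq_closure (X : UniformSpace) (E : X -> Prop) (p : X) : Prop :=
  exists u : nat -> X, (forall k, E (u k)) /\ filterlim u eventually (locally p).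

Section Operators.
Variables (n : nat) (VR : NormedModule R_AbsRing).
Local Notation V := (clmod n VR).
Local Notation bop := (blin (clmod_NormedModule n VR) (clmod_NormedModule n VR)).

Definition mvop : Type := V * V -> Prop.
Implicit Types S T : mvop.

Definition mv_eq S T : Prop := forall p, S p <-> T p.
Definition graph (A : V -> V) : mvop := fun p => p.2 = A p.1.
Definition mv_comp S T : mvop := fun p => exists u, T (p.1, u) /\ S (u, p.2).
Definition mv_inv T : mvop := fun p => T (p.2, p.1).
Definition mv_plus S T : mvop :=
  fun p => exists u w, S (p.1, u) /\ T (p.1, w) /\ p.2 = plus u w.
Definition mv_minus S T : mvop :=
  fun p => exists u w, S (p.1, u) /\ T (p.1, w) /\ p.2 = minus u w.
Definition mv_cl (a : Cl n) : mvop := graph (lmul a).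

Definition mv_right_linear T : Prop :=
  T (zero, zero) /\
  (forall v w v' w', T (v, w) -> T (v', w') -> T (plus v v', plus w w')) /\
  (forall v w a, T (v, w) -> T (rmul v a, rmul w a)).
Definition single_valued T : Prop :=
  forall v w w', T (v, w) -> T (v, w') -> w = w'.
Definition mv_injective T : Prop := single_valued (mv_inv T).

Definition closed_operator T : Prop :=
  mv_right_linear T /\ single_valued T /\ forall p, seq_closure T p -> T p.

(* An element of [bop] is only R-linear; those satisfying [right_linear] are the
   elements of B(V), with the operator norm as [norm]. *)
Definition right_linear (A : bop) : Prop :=
  forall v a, A (rmul v a) = rmul (A v) a.

Definition is_bounded_op T (A : bop) : Prop :=
  right_linear A /\ mv_eq T (graph A).

Definition Qs (s : Cl n) T : mvop :=
  mv_plus (mv_minus (mv_comp T T) (mv_comp (mv_cl (cl_real n (2 * Sc s))) T))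
          (mv_cl (cl_real n (norm s ^ 2))).

Definition S_resolvent_set T (s : Cl n) : Prop :=
  paravector s /\ exists A : bop, is_bounded_op (mv_inv (Qs s T)) A.
Definition S_spectrum T (s : Cl n) : Prop :=
  paravector s /\ ~ S_resolvent_set T s.

Definition SL_inv (s : Cl n) T : mvop :=
  mv_minus (mv_comp (mv_inv (Qs s T)) (mv_cl (cl_conj s)))
           (mv_comp T (mv_inv (Qs s T))).
Definition SR_inv (s : Cl n) T : mvop :=
  mv_comp (mv_minus (mv_cl (cl_conj s)) T) (mv_inv (Qs s T)).

Definition bisectorial (omega : R) T : Prop :=
  (forall s, S_spectrum T s -> seq_closure (Dsec omega) s) /\
  (forall phi, omega < phi < PI / 2 -> exists C, 0 <= C /\
     forall s : Cl n, paravector s -> ~ Dsec phi s -> s <> zero ->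
       exists A : bop, is_bounded_op (SL_inv s T) A /\ norm A <= C / norm s).

(* The integral of the B(V)-valued form [G s ds_J] along the ray
   [s = r e^(J psi)], [0 < r < oo], in the direction of increasing [r] if
   [eps = 1] and of decreasing [r] if [eps = -1]. *)
Definition ray_integral (G : Cl n -> Cl n -> mvop) (J : Cl n) (psi eps : R)
    (A : bop) : Prop :=
  exists F : R -> bop,
    (forall r, 0 < r ->
       is_bounded_op
         (G (scal r (expJ J psi)) (cl_mul (scal eps (expJ J psi)) (cl_inv J)))
         (F r)) /\
    is_RInt_gen F (at_right 0) (Rbar_locally p_infty) A.

(* The boundary of [D_phi] in the plane [C_J] consists of four rays; [D_phi]
   lies to the left of the outgoing rays at angles [- phi], [PI - phi] and of the
   incoming ones at angles [phi], [PI + phi]. *)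
Definition contour_integral (G : Cl n -> Cl n -> mvop) (J : Cl n) (phi : R)
    (A : bop) : Prop :=
  exists A1 A2 A3 A4 : bop,
    ray_integral G J (- phi) 1 A1 /\ ray_integral G J phi (-1) A2 /\
    ray_integral G J (PI - phi) 1 A3 /\ ray_integral G J (PI + phi) (-1) A4 /\
    A = plus (plus A1 A2) (plus A3 A4).

(* The integrals do not depend on [phi] and [J]: [A] is their common value. *)
Definition omega_calc (G : Cl n -> Cl n -> mvop) (omega theta : R) (A : bop) :
    Prop :=
  forall phi J, omega < phi < theta -> imag_unit J ->
    exists B, contour_integral G J phi B /\ A = scal (/ (2 * PI)) B.

Definition omega_calc_L T (omega theta : R) (f : Cl n -> Cl n) : bop -> Prop :=
  omega_calc (fun s ds => mv_comp (SL_inv s T) (mv_comp (mv_cl ds) (mv_cl (f s))))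
    omega theta.
Definition omega_calc_R T (omega theta : R) (f : Cl n -> Cl n) : bop -> Prop :=
  omega_calc (fun s ds => mv_comp (mv_cl (f s)) (mv_comp (mv_cl ds) (SR_inv s T)))
    omega theta.

Definition omega_op_L T omega theta f : mvop :=
  fun p => exists A, omega_calc_L T omega theta f A /\ graph A p.
Definition omega_op_R T omega theta f : mvop :=
  fun p => exists A, omega_calc_R T omega theta f A /\ graph A p.

Definition Hinf_L T omega theta (m : nat) (f : Cl n -> Cl n) : mvop :=
  mv_comp (mv_inv (omega_op_L T omega theta (e_reg m)))
          (omega_op_L T omega theta (fun s => cl_mul (e_reg m s) (f s))).

Definition Hinf_R T omega theta (m : nat) (f : Cl n -> Cl n) : mvop :=
  seq_closure
    (mv_comp (omega_op_R T omega theta (fun s => cl_mul (f s) (e_reg m s)))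
             (mv_inv (omega_op_R T omega theta (e_reg m)))).

End Operators.

(* Main.v *)
Require Import Defs.
From HB Require Import structures.
From mathcomp Require Import all_boot.
From Stdlib Require Import Reals Lra Lia ClassicalEpsilon FunctionalExtensionality ProofIrrelevance PropExtensionality.
From Coquelicot Require Import Coquelicot.
From mathcomp Require boolp classical_sets.

(* Write s = x + J y with y > 0, z = x + i y, K_z = (T^2 - 2 x T + |z|^2)^-1,
   L_z = T K_z, P = x K_z - L_z and q = y K_z.  Then S_R^-1(s, T) = P - J q, while
   R(z) = P - i q is the resolvent of the complexification of T.  In the
   contour integral the rays at angles psi and - psi combine into
   Re (- i F(z) R(z) dz) on the upper ray, where J has disappeared and F is a
   complex function, one for each Clifford component of f.  So f(T) is the sum
   of e_A Phi(F_A) for a calculus Phi of scalar functions, which only needs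
   Cauchy's theorem in a sector for scalar functions (functionals of R(z)).
   With L = T (1 + T^2)^-1 one gets Phi(e_1 F) = Phi(F) L and Phi(e_1) = L from
     z R(z) = (1 + z^2) R(z) L + K - z L    (K = (1 + T^2)^-1),
   by rotating the scalar remainders onto the real axis, where their
   contributions vanish by the symmetry of F; hence e_m(T) = L^m.
   The operators H_nu = nu^2 (K_(i nu) - nu^-2 K_(i / nu) K_(i nu)) = L G_nu are
   bounded uniformly and satisfy L H_nu -> L, so reflexivity (a Banach limit)
   makes the range of L dense, whence H_nu -> 1 strongly.  Density of ran (L^j)
   gives the independence of m and the agreement with the omega-calculus; for
   intrinsic f all operators commute and H_nu^m approximates each point of
   the graph of the left calculus by points of the graph whose closure is taken
   in the right one. *)

Set Implicit Arguments.
Unset Strict Implicit.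
Unset Printing Implicit Defensive.

Local Open Scope R_scope.

(** [T] is only right linear, so it need not commute with left multiplication by [J] or by values of
    [f]. Hence [(fe)(T)] and [e(T)] do not commute in general: [(fe)(T) e(T)^-1] lives on the range
    of [e(T)], which shrinks as [m] grows, and the closure repairs this once these ranges are dense.
    The same obstacle forces the split of [f] into real components: every [e_A] stays on the far
    left, where it is not touched when [L] is multiplied from the right. The only products that
    occur are those with powers of [e_1], and the identity for [z R(z)] yields them within a single
    integral. The function 1 is not admissible, so [Phi(e_1) = L] needs an argument of its own. [V]
    is a real space, so [R(z)] is kept as a pair of real operators and tested with real functionals.
    [H_nu] has the symbol [nu^2 z^2 / ((nu^2 + z^2) (nu^-2 + z^2))]: it cuts off at infinity and at
    0, since the range of [L] lies in both the domain and the range of [T]. The bounds on [T] only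
    make [r |F R|] bounded and [F R] integrable on rays. The arcs in Cauchy's theorem then need not
    become small, whence the regulator. *)

Local Notation zinf f := (is_RInt_gen f (at_right 0) (Rbar_locally p_infty)).

(* [lra] compares atoms syntactically, whereas unification yields several
   convertible spellings of the ring of real numbers and of the structures
   underlying a normed module. *)
Ltac fold_normed X :=
  change (ModuleSpace.AbelianMonoid R_Ring (NormedModule.ModuleSpace R_AbsRing X))
    with (NormedModule.AbelianMonoid R_AbsRing X) in *;
  change (ModuleSpace.AbelianGroup R_Ring (NormedModule.ModuleSpace R_AbsRing X))
    with (NormedModule.AbelianGroup R_AbsRing X) in *;
  change (AbelianGroup.AbelianMonoid (NormedModule.AbelianGroup R_AbsRing X))
    with (NormedModule.AbelianMonoid R_AbsRing X) in *;
  change (ModuleSpace.sort R_Ring (NormedModule.ModuleSpace R_AbsRing X))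
    with (NormedModule.sort R_AbsRing X) in *.
Ltac fold_structures :=
  change (AbsRing.Ring R_AbsRing) with R_Ring in *;
  repeat match goal with
  | X : NormedModule R_AbsRing |- _ => progress fold_normed X
  | X : CompleteNormedModule R_AbsRing |- _ =>
    let Y := constr:(CompleteNormedModule.NormedModule R_AbsRing X) in
    progress (
      change (CompleteNormedModule.AbelianMonoid R_AbsRing X)
        with (NormedModule.AbelianMonoid R_AbsRing Y) in *;
      change (CompleteNormedModule.AbelianGroup R_AbsRing X)
        with (NormedModule.AbelianGroup R_AbsRing Y) in *;
      change (CompleteNormedModule.ModuleSpace R_AbsRing X)
        with (NormedModule.ModuleSpace R_AbsRing Y) in *;
      change (CompleteNormedModule.sort R_AbsRing X)
        with (NormedModule.sort R_AbsRing Y) in *;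
      fold_normed Y)
  end.
Ltac rlra := intros; first [ lra
  | change (AbsRing.Ring R_AbsRing) with R_Ring in *; lra
  | fold_structures; lra ].

(** * The Hahn-Banach theorem *)

Section HahnBanach.
Variable X : ModuleSpace R_AbsRing.

Definition sublinear (q : X -> R) : Prop :=
  (forall x y, q (plus x y) <= q x + q y) /\
  (forall t x, 0 <= t -> q (scal t x) <= t * q x).

Lemma sublinear0 (q : X -> R) : sublinear q -> q zero = 0.
Proof.
move=> [qD qZ]; have := qZ 0 zero (Rle_refl 0).
have := qD zero zero; rewrite plus_zero_l scal_zero_r; rlra.
Qed.

Lemma sublinearZ (q : X -> R) t x :
  sublinear q -> 0 <= t -> q (scal t x) = t * q x.
Proof.
move=> hq [t0|<-]; last first.
  by rewrite (@scal_zero_l R_AbsRing X) (sublinear0 hq); rlra.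
apply: Rle_antisym; first by apply: hq.2; rlra.
have := hq.2 (/ t) (scal t x) (Rlt_le _ _ (Rinv_0_lt_compat _ t0)).
rewrite scal_assoc /mult /= Rinv_l; last rlra.
rewrite (scal_one x) => H.
have := Rmult_le_compat_l t _ _ (Rlt_le _ _ t0) H.
by rewrite -Rmult_assoc Rinv_r ?Rmult_1_l //; rlra.
Qed.

Lemma sublinear_opp (q : X -> R) x : sublinear q -> - q (opp x) <= q x.
Proof.
by move=> hq; have := hq.1 x (opp x); rewrite plus_opp_r (sublinear0 hq); rlra.
Qed.

Lemma inf_exists (E : R -> Prop) (m : R) :
  (exists r, E r) -> (forall r, E r -> m <= r) ->
  exists l, (forall r, E r -> l <= r) /\
            (forall e, 0 < e -> exists r, E r /\ r < l + e).
Proof.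
move=> [r0 Er0] mE.
(* Completeness supplies suprema; the infimum of [E] is minus the supremum of the reflected set. *)
have [l [ub lub]] : {l | is_lub (fun s => E (- s)) l}.
  apply: completeness.
    by exists (- m) => s /mE; rlra.
  by exists (- r0); rewrite Ropp_involutive.
exists (- l); split.
  by move=> r Er; have := ub (- r); rewrite Ropp_involutive => /(_ Er); rlra.
move=> e e0; apply: NNPP => H.
have : l <= l - e.
  apply: lub => s Es; apply: Rnot_lt_le => hs; apply: H.
  by exists (- s); split=> //; rlra.
rlra.
Qed.

(** Infima enter the constructions below as functions obtained by choice. They are used only through
    approximating elements, so each estimate on them is an epsilon argument. *)
Lemma inf_fun_exists (A : Type) (E : A -> R -> Prop) (m : A -> R) :
  (forall x, exists r, E x r) -> (forall x r, E x r -> m x <= r) ->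
  exists q : A -> R, forall x, (forall r, E x r -> q x <= r) /\
    (forall e, 0 < e -> exists r, E x r /\ r < q x + e).
Proof.
move=> E0 mE; have H x := inf_exists (E0 x) (mE x).
exists (fun x => proj1_sig (constructive_indefinite_description _ (H x))) => x.
exact: (proj2_sig (constructive_indefinite_description _ (H x))).
Qed.

(* The sublinear functional [x |-> inf_(t >= 0) q (x + t y) - t q y] lies
   below [q] and takes the value [- q y] at [- y]; so a minimal sublinear
   functional is odd, hence linear. *)
Lemma sublinear_lower (q : X -> R) (y : X) : sublinear q ->
  exists q', sublinear q' /\ (forall x, q' x <= q x) /\ q' (opp y) <= - q y.
Proof.
move=> hq.
pose E x r := exists t, 0 <= t /\ r = q (plus x (scal t y)) - t * q y.
have lbE x r : E x r -> - q (opp x) <= r.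
  move=> [t [t0 ->]]; have := hq.1 (plus x (scal t y)) (opp x).
  rewrite (plus_comm x) -plus_assoc plus_opp_r plus_zero_r (sublinearZ y hq t0).
  rlra.
have [q' hq'] : exists q' : X -> R, forall x, (forall r, E x r -> q' x <= r) /\
    (forall e, 0 < e -> exists r, E x r /\ r < q' x + e).
  apply: inf_fun_exists lbE => x; exists (q x), 0; split; first rlra.
  by rewrite (@scal_zero_l R_AbsRing X) plus_zero_r; rlra.
exists q'; split; [split|split].
- move=> x z; apply: le_epsilon => e e0.
  have e2 : 0 < e / 2 by rlra.
  have [_ [[t [t0 ->]] Ht]] := (hq' x).2 _ e2.
  have [_ [[s [s0 ->]] Hs]] := (hq' z).2 _ e2.
  have := (hq' (plus x z)).1 _ (ex_intro _ (t + s) (conj (Rplus_le_le_0_compat _ _ t0 s0) erefl)).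
  have := hq.1 (plus x (scal t y)) (plus z (scal s y)).
  have -> : plus (plus x (scal t y)) (plus z (scal s y)) =
      plus (plus x z) (scal (t + s) y).
    rewrite (@scal_distr_r R_AbsRing X) -!plus_assoc; congr plus.
    by rewrite !plus_assoc (plus_comm _ z).
  rlra.
- move=> k x [k0|<-]; last first.
    rewrite (@scal_zero_l R_AbsRing X).
    have := (hq' zero).1 0; rewrite Rmult_0_l; apply; exists 0; split; first rlra.
    by rewrite (@scal_zero_l R_AbsRing X) plus_zero_r (sublinear0 hq); rlra.
  apply: le_epsilon => e e0.
  have ek : 0 < e / k by apply: Rdiv_lt_0_compat.
  have [_ [[t [t0 ->]] Ht]] := (hq' x).2 _ ek.
  have kt : 0 <= k * t by apply: Rmult_le_pos; rlra.
  have := (hq' (scal k x)).1 _ (ex_intro _ (k * t) (conj kt erefl)).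
  have -> : plus (scal k x) (scal (k * t) y) = scal k (plus x (scal t y)).
    by rewrite scal_distr_l scal_assoc.
  rewrite (sublinearZ _ hq); last rlra.
  have := Rmult_lt_compat_l k _ _ k0 Ht.
  have -> : k * (q' x + e / k) = k * q' x + e by field; rlra.
  rlra.
- move=> x; apply: (hq' x).1; exists 0; split; first rlra.
  by rewrite (@scal_zero_l R_AbsRing X) plus_zero_r; rlra.
- apply: (hq' (opp y)).1; exists 1; split; first rlra.
  by rewrite (scal_one y) plus_opp_l (sublinear0 hq); rlra.
Qed.

(** Zorn's lemma is applied below a functional [p0] already lowered at [x0]. An odd [f] below [p0]
    then satisfies [f (- x0) <= - p x0], which gives [f x0 = p x0]. *)
Lemma hahn_banach (p : X -> R) (x0 : X) : sublinear p ->
  exists f : X -> R, (forall x y, f (plus x y) = f x + f y) /\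
    (forall t x, f (scal t x) = t * f x) /\
    (forall x, f x <= p x) /\ f x0 = p x0.
Proof.
move=> hp; have [p0 [hp0 [p0p p0x]]] := sublinear_lower x0 hp.
pose S := {q : X -> R | sublinear q /\ forall x, q x <= p0 x}.
(* The order is reversed, so a maximal element for Zorn's lemma is a minimal sublinear
   functional. *)
pose le (q1 q2 : S) := boolp.asbool (forall x, proj1_sig q2 x <= proj1_sig q1 x).
have [] := @classical_sets.Zorn S le.
- by move=> t; apply/boolp.asboolP => x; apply: Rle_refl.
- move=> r s t /boolp.asboolP H1 /boolp.asboolP H2; apply/boolp.asboolP => x.
  exact: Rle_trans (H2 x) (H1 x).
- move=> [s hs] [t ht] /boolp.asboolP /= H1 /boolp.asboolP /= H2.
  have E : s = t by apply: functional_extensionality => x; apply: Rle_antisym.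
  by subst t; congr exist; apply: proof_irrelevance.
- move=> A totA.
  case: (classic (exists a, A a)) => [[a0 Aa0]|nA]; last first.
    exists (exist _ p0 (conj hp0 (fun x => Rle_refl (p0 x)))) => s As.
    by case: nA; exists s.
  (* The bound of a chain is its pointwise infimum, finite because each member at [x] is at least
     [- p0 (- x)]. Subadditivity holds because of two members one lies below the other. *)
  pose E x r := exists a : S, A a /\ r = proj1_sig a x.
  have lbE x r : E x r -> - p0 (opp x) <= r.
    move=> [[a [ha1 ha2]] [_ ->]] /=; have := sublinear_opp x ha1.
    by have := ha2 (opp x); rlra.
  have [q hq] := inf_fun_exists (fun x => ex_intro (E x) _ (ex_intro _ a0 (conj Aa0 erefl))) lbE.
  have qS : sublinear q /\ forall x, q x <= p0 x.
    split; [split|].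
    + move=> x z; apply: le_epsilon => e e0.
      have e2 : 0 < e / 2 by rlra.
      have [_ [[a [Aa ->]] Ha]] := (hq x).2 _ e2.
      have [_ [[b [Ab ->]] Hb]] := (hq z).2 _ e2.
      case: (totA _ _ Aa Ab) => /boolp.asboolP ab.
      * have := (hq (plus x z)).1 _ (ex_intro _ b (conj Ab erefl)).
        by have := (proj2_sig b).1.1 x z; have := ab x; rlra.
      * have := (hq (plus x z)).1 _ (ex_intro _ a (conj Aa erefl)).
        by have := (proj2_sig a).1.1 x z; have := ab z; rlra.
    + move=> k x [k0|<-]; last first.
        have := (hq (scal 0 x)).1 _ (ex_intro _ a0 (conj Aa0 erefl)).
        by rewrite (@scal_zero_l R_AbsRing X) (sublinear0 (proj2_sig a0).1); rlra.
      apply: le_epsilon => e e0.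
      have ek : 0 < e / k by apply: Rdiv_lt_0_compat.
      have [_ [[a [Aa ->]] Ha]] := (hq x).2 _ ek.
      have := (hq (scal k x)).1 _ (ex_intro _ a (conj Aa erefl)).
      have := (proj2_sig a).1.2 k x (Rlt_le _ _ k0).
      have := Rmult_lt_compat_l k _ _ k0 Ha.
      have -> : k * (q x + e / k) = k * q x + e by field; rlra.
      rlra.
    + move=> x; apply: Rle_trans ((proj2_sig a0).2 x).
      by apply: (hq x).1; exists a0.
  exists (exist _ q qS) => s As; apply/boolp.asboolP => x /=.
  by apply: (hq x).1; exists s.
move=> [f [hf fp0]] /= fmin.
(* By minimality [f] equals the functional lowered at [y], so [f (- y) <= - f y]. *)
have fopp y : f (opp y) = - f y.
  have [q [hq [qf qy]]] := sublinear_lower y hf.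
  have qp0 x : q x <= p0 x by apply: Rle_trans (qf x) (fp0 x).
  have := fmin (exist _ q (conj hq qp0)).
  move/(_ _)/(congr1 (@proj1_sig _ _)) => /= Eq.
  have {}Eq : q = f by apply: Eq; apply/boolp.asboolP.
  subst q; have := sublinear_opp y hf; rlra.
have fle x : f x <= p x := Rle_trans _ _ _ (fp0 x) (p0p x).
exists f; split; [|split; [|split=> //]].
- move=> x y; apply: Rle_antisym; first exact: hf.1.
  have := hf.1 (plus x y) (opp y).
  by rewrite -plus_assoc plus_opp_r plus_zero_r fopp; rlra.
- move=> t x; case: (Rle_lt_dec 0 t) => [t0|t0]; first exact: sublinearZ.
  have -> : scal t x = opp (scal (- t) x).
    by rewrite -(@scal_opp_l R_AbsRing X) /opp /= Ropp_involutive.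
  by rewrite fopp sublinearZ //; rlra.
- apply: Rle_antisym => //; have := fp0 (opp x0); rewrite fopp; rlra.
Qed.

End HahnBanach.

(** * Bounded functionals on normed modules *)

Section NormedFunctionals.
Variable X : NormedModule R_AbsRing.
Local Notation functional := (blin X R_NormedModule).

Lemma norm_plus_le (x y : X) a b :
  norm x <= a -> norm y <= b -> norm (plus x y) <= a + b.
Proof. by move=> *; apply: Rle_trans (norm_triangle _ _) _; apply: Rplus_le_compat. Qed.

Lemma norm_opp_le (x : X) a : norm x <= a -> norm (opp x) <= a.
Proof. by rewrite norm_opp. Qed.

Lemma norm_minus_le (x y : X) a b :
  norm x <= a -> norm y <= b -> norm (minus x y) <= a + b.
Proof. by move=> *; apply: norm_plus_le => //; apply: norm_opp_le. Qed.

Lemma norm_scal_le (k : R) (x : X) a :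
  norm x <= a -> norm (scal k x) <= Rabs k * a.
Proof.
move=> h; apply: Rle_trans (norm_scal _ _) _.
by apply: Rmult_le_compat_l h; apply: Rabs_pos.
Qed.

(** Domination by the norm makes the Hahn-Banach functional bounded with constant 1, hence a point
    of the dual space. *)
Lemma functional_of_seminorm (p : X -> R) (x0 : X) : sublinear p ->
  (forall x, p x <= norm x) ->
  exists l : functional, (forall x, l x <= p x) /\ l x0 = p x0.
Proof.
move=> hp pn; have [f [fD [fZ [fp fx0]]]] := hahn_banach x0 hp.
have lf : is_linear (f : X -> R_NormedModule).
  split=> //; exists 1; split; first rlra.
  move=> x; rewrite /norm /= /abs /= Rmult_1_l; apply: Rabs_le.
  have fo : f (opp x) = - f x by rewrite -(scal_opp_one x) fZ /opp /one /=; ring.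
  have /= := Rle_trans _ _ _ (fp (opp x)) (pn (opp x)); rewrite fo norm_opp.
  by have := Rle_trans _ _ _ (fp x) (pn x); rewrite /norm; rlra.
by exists (Blin lf).
Qed.

Lemma functional_separates (x y : X) :
  (forall l : functional, l x = l y) -> x = y.
Proof.
move=> H.
have hn : sublinear (norm : X -> R).
  split; first exact: norm_triangle.
  move=> t z t0; apply: Rle_trans (norm_scal _ _) _.
  by rewrite /abs /= Rabs_pos_eq //; rlra.
have [l [_ lE]] := functional_of_seminorm (minus x y) hn (fun z => Rle_refl (norm z)).
have : norm (minus x y) = 0.
  rewrite -lE /minus (linear_plus _ (blin_linear l)).
  by rewrite (linear_opp _ _ (blin_linear l)) H; apply: plus_opp_r.
move/norm_eq_zero => E; rewrite -(plus_zero_r x) -(plus_opp_l y) plus_assoc.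
by rewrite -/(minus x y) E plus_zero_l.
Qed.

(* The seminorm used is the distance to the subspace [Y]. *)
Lemma functional_off_subspace (Y : X -> Prop) (x0 : X) (d : R) :
  Y zero -> (forall x y, Y x -> Y y -> Y (plus x y)) ->
  (forall t x, Y x -> Y (scal t x)) -> 0 < d ->
  (forall y, Y y -> d <= norm (minus x0 y)) ->
  exists l : functional, (forall y, Y y -> l y = 0) /\ l x0 <> 0.
Proof.
move=> Y0 YD YZ d0 dY.
pose E x r := exists y, Y y /\ r = norm (minus x y).
have lbE x r : E x r -> 0 <= r by move=> [y [_ ->]]; apply: norm_ge_0.
have [q hq] := inf_fun_exists (fun x => ex_intro (E x) _ (ex_intro _ zero (conj Y0 erefl))) lbE.
have qge x : 0 <= q x.
  apply: le_epsilon => e e0; have [r [Er re]] := (hq x).2 _ e0.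
  by have := lbE _ _ Er; rlra.
have q_sub : sublinear q.
  split.
  - move=> x z; apply: le_epsilon => e e0.
    have e2 : 0 < e / 2 by rlra.
    have [_ [[y [Yy ->]] Hy]] := (hq x).2 _ e2.
    have [_ [[w [Yw ->]] Hw]] := (hq z).2 _ e2.
    have := (hq (plus x z)).1 _ (ex_intro _ (plus y w) (conj (YD _ _ Yy Yw) erefl)).
    have := norm_triangle (minus x y) (minus z w).
    have -> : plus (minus x y) (minus z w) = minus (plus x z) (plus y w).
      rewrite /minus opp_plus -!plus_assoc; congr plus.
      by rewrite !plus_assoc (plus_comm _ z).
    rlra.
  - move=> k x [k0|<-]; last first.
      have := (hq (scal 0 x)).1 _ (ex_intro _ zero (conj Y0 erefl)).
      by rewrite (@scal_zero_l R_AbsRing X) minus_zero_r norm_zero; rlra.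
    apply: le_epsilon => e e0.
    have ek : 0 < e / k by apply: Rdiv_lt_0_compat.
    have [_ [[y [Yy ->]] Hy]] := (hq x).2 _ ek.
    have := (hq (scal k x)).1 _ (ex_intro _ (scal k y) (conj (YZ _ _ Yy) erefl)).
    have -> : minus (scal k x) (scal k y) = scal k (minus x y).
      by rewrite /minus scal_distr_l scal_opp_r.
    have := norm_scal k (minus x y); rewrite /abs /= Rabs_pos_eq; last rlra.
    have := Rmult_lt_compat_l k _ _ k0 Hy.
    have -> : k * (q x + e / k) = k * q x + e by field; rlra.
    rlra.
have qn x : q x <= norm x.
  apply: (hq x).1; exists zero; split=> //; by rewrite minus_zero_r.
have [l [lq lx0]] := functional_of_seminorm x0 q_sub qn.
exists l; split.
- move=> y Yy; have qY z : Y z -> q z <= 0.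
    by move=> Yz; apply: (hq z).1; exists z; rewrite minus_eq_zero norm_zero.
  have := lq y; have := qY _ Yy.
  have := lq (opp y); rewrite (linear_opp _ _ (blin_linear l)).
  have := qY (opp y); rewrite -(scal_opp_one y) => /(_ (YZ _ _ Yy)).
  by rewrite /opp /=; rlra.
- rewrite lx0 => q0; have [_ [[y [Yy ->]] Hy]] := (hq x0).2 _ d0.
  by have := dY _ Yy; rlra.
Qed.

End NormedFunctionals.

Lemma blinD (X Y : NormedModule R_AbsRing) (A : blin X Y) x y :
  A (plus x y) = plus (A x) (A y).
Proof. exact: (linear_plus _ (blin_linear A)). Qed.
Lemma blinZ (X Y : NormedModule R_AbsRing) (A : blin X Y) k x :
  A (scal k x) = scal k (A x).
Proof. exact: (linear_scal _ (blin_linear A)). Qed.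
Lemma blinN (X Y : NormedModule R_AbsRing) (A : blin X Y) x : A (opp x) = opp (A x).
Proof. exact: (linear_opp _ _ (blin_linear A)). Qed.
Lemma blinB (X Y : NormedModule R_AbsRing) (A : blin X Y) x y :
  A (minus x y) = minus (A x) (A y).
Proof. by rewrite /minus blinD blinN. Qed.
Lemma blin0 (X Y : NormedModule R_AbsRing) (A : blin X Y) : A zero = zero.
Proof. exact: (linear_zero _ (blin_linear A)). Qed.

(** Application of a functional under a name of its own and with real values: [lin] rewrites with
    this head symbol and is left with an identity between reals. *)
Definition fval (X : NormedModule R_AbsRing) (l : blin X R_NormedModule) (x : X) : R :=
  l x.

Section FunctionalValue.
Variables (X : NormedModule R_AbsRing) (l : blin X R_NormedModule).

Lemma fvalD x y : fval l (plus x y) = fval l x + fval l y.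
Proof. exact: blinD. Qed.
Lemma fvalN x : fval l (opp x) = - fval l x.
Proof. exact: blinN. Qed.
Lemma fvalB x y : fval l (minus x y) = fval l x - fval l y.
Proof. exact: blinB. Qed.
Lemma fvalZ (k : R) x : fval l (scal k x) = k * fval l x.
Proof. exact: blinZ. Qed.
Lemma fval0 : fval l zero = 0.
Proof. exact: blin0. Qed.

End FunctionalValue.

Lemma fval_separates (X : NormedModule R_AbsRing) (x y : X) :
  (forall l, fval l x = fval l y) -> x = y.
Proof. exact: functional_separates. Qed.

(* Linear identities in a normed module are checked after applying an arbitrary
   functional, where they become identities between real numbers. *)
Ltac lin_push l := rewrite ?(fvalD, fvalN, fvalB, fvalZ, fval0);
  repeat match goal with |- context [fval l ?t] =>
    let z := fresh "z" in set z := fval l t; move: z => z end;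
  rewrite /opp /one /=; intros.
Ltac lin := let l := fresh "l" in
  apply: (@fval_separates _ _ _) => l; lin_push l.

HB.instance Definition _ := Monoid.isComLaw.Build R 0 Rplus
  (fun x y z => esym (Rplus_assoc x y z)) Rplus_comm Rplus_0_l.
HB.instance Definition _ (G : AbelianMonoid) :=
  Monoid.isComLaw.Build G zero plus plus_assoc plus_comm plus_zero_l.

(** * Completeness of modules and operator spaces *)

Section Completeness.

(** The structure asks for a limit defined on all filters. Choice provides it, with [x0] showing
    that the space is inhabited; two filters that refine each other are equal by extensionality and
    so receive the same limit. *)
Lemma complete_space_mixin (U : UniformSpace) (x0 : U) :
  (forall F : (U -> Prop) -> Prop, ProperFilter F -> cauchy F ->
     exists x, forall eps : posreal, F (ball x eps)) ->
  CompleteSpace.mixin_of U.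
Proof.
move=> H.
pose l (F : (U -> Prop) -> Prop) :=
  epsilon (inhabits x0) (fun x => forall eps : posreal, F (ball x eps)).
apply: (@CompleteSpace.Mixin U l) => [F PF cF|F1 F2 H1 H2].
  exact: (epsilon_spec (inhabits x0) _ (H F PF cF)).
have -> : F1 = F2.
  apply: functional_extensionality => P; apply: propositional_extensionality.
  by split; [apply: H2 | apply: H1].
by move=> eps; apply: ball_center.
Qed.

Lemma complete_lim (V : CompleteNormedModule R_AbsRing) (F : (V -> Prop) -> Prop) :
  ProperFilter F ->
  (forall e, 0 < e -> exists x : V, F (fun y => norm (minus y x) < e)) ->
  exists l : V, forall e, 0 < e -> F (fun y => norm (minus y l) < e).
Proof.
move=> PF cF; have CF : cauchy F.
  move=> e; have [x Fx] := cF e (cond_pos e); exists x.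
  by apply: filter_imp Fx => y; apply: norm_compat1.
exists (lim F) => e e0.
have k0 := @norm_factor_gt_0 _ V; set k := norm_factor in k0.
have ek : 0 < e / k by apply: Rdiv_lt_0_compat.
have := complete_cauchy F PF CF (mkposreal _ ek).
apply: filter_imp => y /norm_compat2; rewrite -/k /=.
by have -> : k * (e / k) = e by field; rlra.
Qed.

Lemma filter_forall_fin (T : Type) (I : finType) (F : (T -> Prop) -> Prop)
    (P : I -> T -> Prop) : Filter F ->
  (forall i, F (P i)) -> F (fun x => forall i, P i x).
Proof.
move=> FF H.
have: F (fun x => forall i, i \in enum I -> P i x).
  elim: (enum I) => [|j r IH]; first exact: filter_forall.
  apply: filter_imp (filter_and _ _ (H j) IH) => x [Pj Pr] i.
  by rewrite in_cons => /orP[/eqP ->|/Pr].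
by apply: filter_imp => x Hx i; apply: Hx; rewrite mem_enum.
Qed.

Lemma norm_lt_eq0 (X : NormedModule R_AbsRing) (x : X) :
  (forall e, 0 < e -> norm x <= e) -> x = zero.
Proof.
move=> H; apply: norm_eq_zero; apply: Rle_antisym; last exact: norm_ge_0.
by apply: le_epsilon => e e0; rewrite Rplus_0_l; apply: H.
Qed.

Variable n : nat.

Lemma clmod_norm_comp (VR : NormedModule R_AbsRing) (v : clmod n VR) A :
  norm (v A) <= norm v.
Proof.
rewrite -[norm (v A)]sqrt_Rsqr; last exact: norm_ge_0.
rewrite /norm /= /clmod_norm; apply: sqrt_le_1_alt.
rewrite (bigD1_seq A) ?mem_index_enum ?index_enum_uniq //.
have : 0 <= \big[Rplus/0]_(i <- index_enum {set 'I_n} | i != A) (norm (v i)) ^ 2.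
  rewrite -big_filter; exact: sum_sqr_ge0.
set S := (\big[_/_]_(_ <- _ | _) _) => S0.
by apply: (@Rle_trans _ ((norm (v A)) ^ 2 + 0)); [rewrite /Rsqr /= Rmult_1_r Rplus_0_r; apply: Rle_refl | apply: Rplus_le_compat_l].
Qed.

Lemma sqrt_sum_sqr_le (I : Type) (r : seq I) (a : I -> R) (c : R) :
  (forall i, 0 <= a i <= c) ->
  sqrt (\big[Rplus/0]_(i <- r) (a i) ^ 2) <= INR (size r) * c.
Proof.
move=> H; elim: r => [|i r IH]; first by rewrite big_nil sqrt_0 /=; rlra.
rewrite big_cons; set S := (\big[_/_]_(_ <- r) _) in IH *.
have S0 : 0 <= S by apply: sum_sqr_ge0.
apply: (@Rle_trans _ (a i + sqrt S)).
  apply: Rsqr_incr_0_var; last by have := sqrt_pos S; have := H i; rlra.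
  rewrite Rsqr_sqrt; last by have := pow2_ge_0 (a i); rlra.
  have := Rsqr_sqrt _ S0; rewrite /Rsqr.
  have := sqrt_pos S; have := H i; nra.
by have := H i; rewrite [size _]/= S_INR; rlra.
Qed.

(** A crude constant is enough: the norm only has to be comparable with the largest norm of a
    component. *)
Lemma clmod_norm_le (VR : NormedModule R_AbsRing) (v : clmod n VR) c :
  (forall A, norm (v A) <= c) -> norm v <= INR #|{: {set 'I_n}}| * c.
Proof.
move=> H; rewrite /norm /= /clmod_norm cardT.
rewrite -[enum _]/(enum predT) enumT; apply: sqrt_sum_sqr_le => A.
by split; [apply: norm_ge_0 | apply: H].
Qed.

Variable VR : CompleteNormedModule R_AbsRing.

(** The components converge separately. There are finitely many, so the filter contains a set on
    which all of them are close to their limits at once. *)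
Lemma clmod_cauchy_cvg (F : (clmod_NormedModule n VR -> Prop) -> Prop) :
  ProperFilter F -> cauchy F ->
  exists v : clmod_NormedModule n VR, forall eps : posreal, F (ball v eps).
Proof.
move=> PF cF; pose G A : (VR -> Prop) -> Prop := filtermap (fun v : clmod n VR => v A) F.
have cG A : exists l : VR, forall e, 0 < e -> G A (fun y => norm (minus y l) < e).
  apply: complete_lim => e e0; have [v Fv] := cF (mkposreal _ e0).
  exists (v A); change (F (fun w : clmod n VR => norm (minus (w A) (v A)) < e)).
  apply: filter_imp Fv => w vw; apply: Rle_lt_trans vw.
  by have := clmod_norm_comp (minus w v) A; rewrite !ffunE.
have [l Hl] : exists l : {set 'I_n} -> VR, forall A e, 0 < e ->
    G A (fun y => norm (minus y (l A)) < e).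
  exists (fun A => proj1_sig (constructive_indefinite_description _ (cG A))) => A.
  exact: (proj2_sig (constructive_indefinite_description _ (cG A))).
exists [ffun A => l A] => eps.
set N := INR #|{: {set 'I_n}}|; have N0 : 0 <= N by apply: pos_INR.
have e0 : 0 < eps / (N + 1) by apply: Rdiv_lt_0_compat; [apply: cond_pos|rlra].
apply: filter_imp (filter_forall_fin _ (fun A => Hl A _ e0)) => v Hv.
apply: (@Rle_lt_trans _ (N * (eps / (N + 1)))).
  apply: clmod_norm_le => A; rewrite !ffunE; apply: Rlt_le.
  exact: Hv.
have -> : N * (eps / (N + 1)) = eps - eps / (N + 1) by field; rlra.
have : 0 < eps / (N + 1).
  by apply: Rdiv_lt_0_compat; [apply: cond_pos|rlra].
rlra.
Qed.

Definition clmod_complete_mixin :=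
  @complete_space_mixin (clmod_NormedModule n VR) (clmod_zero n VR) clmod_cauchy_cvg.
Canonical clmod_CompleteNormedModule :=
  CompleteNormedModule.Pack R_AbsRing (clmod n VR)
    (CompleteNormedModule.Class _ _ (NormedModule.class _ (clmod_NormedModule n VR))
       clmod_complete_mixin) (clmod n VR).

End Completeness.

Section BoundedOperatorsComplete.
Variables (X : NormedModule R_AbsRing) (Y : CompleteNormedModule R_AbsRing).
Local Notation bop := (blin X Y).

(** The pointwise limit [a] is also the limit in operator norm, because the Cauchy estimate is
    uniform on bounded sets of [x]. *)
Lemma blin_cauchy_cvg (F : (blin_NormedModule X Y -> Prop) -> Prop) :
  ProperFilter F -> cauchy F ->
  exists A : blin_NormedModule X Y, forall eps : posreal, F (ball A eps).
Proof.
move=> PF cF.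
pose G (x : X) : (Y -> Prop) -> Prop := filtermap (fun A : bop => A x) F.
have cG x : exists l : Y, forall e, 0 < e -> G x (fun y => norm (minus y l) < e).
  apply: complete_lim => d d0; have d1 : 0 < d / (norm x + 1).
    by apply: Rdiv_lt_0_compat => //; have := norm_ge_0 x; rlra.
  have [A FA] := cF (mkposreal _ d1); exists (A x).
  change (F (fun B : bop => norm (minus (B x) (A x)) < d)).
  apply: filter_imp FA => B AB.
  have := opnorm_bound (minus B A) x.
  have -> : (minus B A : bop) x = minus (B x) (A x).
    by rewrite /minus /= (scal_opp_one (A x)).
  move=> H; apply: Rle_lt_trans H _.
  have n0 := norm_ge_0 x.
  have {}AB : opnorm (minus B A) < d / (norm x + 1) := AB.
  apply: (@Rle_lt_trans _ (d / (norm x + 1) * norm x)).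
    by apply: Rmult_le_compat_r => //; rlra.
  have -> : d / (norm x + 1) * norm x = d - d / (norm x + 1) by field; rlra.
  by rlra.
have [a cvg] : exists a : X -> Y, forall x e, 0 < e ->
    F (fun A : bop => norm (minus (A x) (a x)) < e).
  exists (fun x => proj1_sig (constructive_indefinite_description _ (cG x))) => x.
  exact: (proj2_sig (constructive_indefinite_description _ (cG x))).
have aD x y : a (plus x y) = plus (a x) (a y).
  have : minus (a (plus x y)) (plus (a x) (a y)) = zero.
    apply: norm_lt_eq0 => e e0; have e3 : 0 < e / 3 by rlra.
    have [A [[H1 H2] H3]] := filter_ex _
      (filter_and _ _ (filter_and _ _ (cvg x _ e3) (cvg y _ e3)) (cvg (plus x y) _ e3)).
    have -> : minus (a (plus x y)) (plus (a x) (a y)) =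
       plus (plus (minus (A x) (a x)) (minus (A y) (a y)))
            (opp (minus (A (plus x y)) (a (plus x y)))).
      by rewrite ?(linear_plus _ (blin_linear A)); lin; ring.
    have -> : e = e / 3 + e / 3 + e / 3 by field.
    by do 2?[apply: norm_plus_le | apply: norm_opp_le]; apply: Rlt_le.
  by move=> E; apply: fval_separates => l; move: (congr1 (fval l) E); lin_push l; rlra.
have aZ t x : a (scal t x) = scal t (a x).
  have : minus (a (scal t x)) (scal t (a x)) = zero.
    apply: norm_lt_eq0 => e e0.
    have e3 : 0 < e / 2 / (Rabs t + 1).
      by apply: Rdiv_lt_0_compat; [rlra|have := Rabs_pos t; rlra].
    have e2 : 0 < e / 2 by rlra.
    have [A [H1 H2]] := filter_ex _ (filter_and _ _ (cvg x _ e3) (cvg (scal t x) _ e2)).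
    have -> : minus (a (scal t x)) (scal t (a x)) =
       plus (scal t (minus (A x) (a x))) (opp (minus (A (scal t x)) (a (scal t x)))).
      by rewrite ?(linear_scal _ (blin_linear A)); lin; ring.
    apply: Rle_trans (norm_plus_le (norm_scal_le t (Rlt_le _ _ H1))
      (norm_opp_le (Rlt_le _ _ H2))) _.
    have t0 := Rabs_pos t.
    have : Rabs t * (e / 2 / (Rabs t + 1)) <= e / 2; last rlra.
    apply: (@Rle_trans _ ((Rabs t + 1) * (e / 2 / (Rabs t + 1)))).
      by apply: Rmult_le_compat_r; rlra.
    by apply: Req_le; field; rlra.
  by move=> E; apply: fval_separates => l; move: (congr1 (fval l) E); lin_push l; rlra.
(* The value [a x] is reached through an operator [B] of the filter that depends on [x] and [d]. It
   drops out of the final bound, which is therefore uniform. *)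
have close_a (e : posreal) : exists A0 : bop, F (ball (A0 : blin_NormedModule X Y) e) /\
    forall A : bop, ball (A0 : blin_NormedModule X Y) e A ->
      forall x, norm (minus (A x) (a x)) <= 2 * e * norm x.
  have [A0 FA0] := cF e; exists A0; split=> // A hA x.
  apply: le_epsilon => d d0.
  have [B [BA Bx]] := filter_ex _ (filter_and _ _ FA0 (cvg x _ d0)).
  have := opnorm_bound (minus A A0) x; have := opnorm_bound (minus B A0) x.
  have {}hA : opnorm (minus A A0) < e := hA.
  have {}BA : opnorm (minus B A0) < e := BA.
  have E (C : bop) : (minus C A0 : bop) x = minus (C x) (A0 x).
    by rewrite /minus /= (scal_opp_one (A0 x)).
  rewrite !E => HB HA; have n0 := norm_ge_0 x.
  have -> : minus (A x) (a x) =
      plus (plus (minus (A x) (A0 x)) (opp (minus (B x) (A0 x)))) (minus (B x) (a x)).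
    by lin; ring.
  apply: Rle_trans (norm_plus_le (norm_plus_le HA (norm_opp_le HB)) (Rlt_le _ _ Bx)) _.
  have := Rmult_le_compat_r _ _ _ n0 (Rlt_le _ _ hA).
  have := Rmult_le_compat_r _ _ _ n0 (Rlt_le _ _ BA).
  by rlra.
have la : is_linear (a : X -> Y).
  split=> //; have [A0 [FA0 H]] := close_a (mkposreal 1 Rlt_0_1).
  have [A hA] := filter_ex _ FA0.
  exists (opnorm A + 2); split; first by have := opnorm_ge0 A; rlra.
  move=> x; have := H A hA x; have := opnorm_bound A x => /= H1 H2.
  have -> : a x = plus (A x) (opp (minus (A x) (a x))).
    by lin; ring.
  by apply: Rle_trans (norm_plus_le H1 (norm_opp_le H2)) _; rlra.
exists (Blin la) => eps.
have e4 : 0 < eps / 4 by have := cond_pos eps; rlra.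
have [A0 [FA0 H]] := close_a (mkposreal _ e4).
apply: filter_imp FA0 => A hA.
have : opnorm (minus A (Blin la)) <= eps / 2.
  apply: opnorm_le; first by have := cond_pos eps; rlra.
  move=> x; have := H A hA x => /=.
  rewrite (_ : plus (A x) (scal (opp one) (a x)) = minus (A x) (a x)).
    by rlra.
  by rewrite /minus (scal_opp_one (a x)).
have := cond_pos eps => ? H2; change (opnorm (minus A (Blin la)) < eps); rlra.
Qed.

Definition blin_complete_mixin :=
  @complete_space_mixin (blin_NormedModule X Y) (blin_zero X Y) blin_cauchy_cvg.
Canonical blin_CompleteNormedModule :=
  CompleteNormedModule.Pack R_AbsRing (blin X Y)
    (CompleteNormedModule.Class _ _ (NormedModule.class _ (blin_NormedModule X Y))
       blin_complete_mixin) (blin X Y).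

End BoundedOperatorsComplete.

(** * Composition of bounded operators and integration *)

Section LinearMaps.
Variables X Y Z : NormedModule R_AbsRing.

Definition bcomp (A : blin Y Z) (B : blin X Y) : blin X Z :=
  Blin (is_linear_comp B A (blin_linear B) (blin_linear A)).
Definition bid : blin X X := Blin (@is_linear_id R_AbsRing X).

Lemma opnorm_comp (A : blin Y Z) (B : blin X Y) :
  opnorm (bcomp A B) <= opnorm A * opnorm B.
Proof.
have A0 := opnorm_ge0 A; have B0 := opnorm_ge0 B.
apply: opnorm_le; first exact: Rmult_le_pos.
move=> x /=; apply: Rle_trans (opnorm_bound A _) _; rewrite Rmult_assoc.
by apply: Rmult_le_compat_l => //; apply: opnorm_bound.
Qed.

Lemma blin_continuous (A : blin X Y) (x : X) : continuous (fun y => A y) x.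
Proof. exact: (linear_cont _ _ (blin_linear A)). Qed.

Lemma minus_blinE (A B : blin X Y) x : (minus A B : blin X Y) x = minus (A x) (B x).
Proof. by rewrite /minus /= (scal_opp_one (B x)). Qed.

End LinearMaps.

Lemma bcomp_linear_l (X Y Z : NormedModule R_AbsRing) (B : blin X Y) :
  is_linear (fun A : blin Y Z => bcomp A B).
Proof.
split=> [A A'|k A|]; try exact: blin_eq.
have B0 := opnorm_ge0 B; exists (opnorm B + 1); split; first rlra.
move=> A; have := opnorm_comp A B; have := opnorm_ge0 A; rewrite /norm /=; nra.
Qed.

Lemma bcomp_linear_r (X Y Z : NormedModule R_AbsRing) (A : blin Y Z) :
  is_linear (fun B : blin X Y => bcomp A B).
Proof.
split=> [B B'|k B|].
- by apply: blin_eq => x /=; apply: blinD.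
- by apply: blin_eq => x /=; apply: blinZ.
have A0 := opnorm_ge0 A; exists (opnorm A + 1); split; first rlra.
move=> B; have := opnorm_comp A B; have := opnorm_ge0 B; rewrite /norm /=; nra.
Qed.

(** Composition with a fixed operator as a bounded map between operator spaces: through
    [is_RInt_gen_blin] it lets operators pass under the integral sign. *)
Definition bcompl (X Y Z : NormedModule R_AbsRing) (A : blin Y Z) :
  blin (blin_NormedModule X Y) (blin_NormedModule X Z) := Blin (bcomp_linear_r X A).
Definition bcompr (X Y Z : NormedModule R_AbsRing) (B : blin X Y) :
  blin (blin_NormedModule Y Z) (blin_NormedModule X Z) := Blin (bcomp_linear_l Z B).

Section LinearIntegral.
Variables X Y : NormedModule R_AbsRing.

Lemma is_RInt_blin (A : blin X Y) (f : R -> X) a b I :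
  is_RInt f a b I -> is_RInt (fun r => A (f r)) a b (A I).
Proof.
rewrite /is_RInt => H.
have H2 := filterlim_comp _ _ _ _ _ _ _ _ H (@blin_continuous _ _ A I).
apply: filterlim_ext H2 => s; rewrite blinZ; congr scal.
elim/(@SF_cons_ind R): s => [x|h s IH].
  by rewrite /Riemann_sum /= blin0.
by rewrite !Riemann_sum_cons blinD blinZ IH.
Qed.

Lemma is_RInt_gen_blin (A : blin X Y) (f : R -> X) Fa Fb I :
  is_RInt_gen f Fa Fb I -> is_RInt_gen (fun r => A (f r)) Fa Fb (A I).
Proof.
move=> H P HP; have := H _ (@blin_continuous _ _ A I P HP).
case=> Q S FQ FS QS; exists Q S => // a b Qa Sb.
have [y [Hy Py]] := QS a b Qa Sb.
by exists (A y); split=> //; apply: is_RInt_blin.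
Qed.

End LinearIntegral.

Lemma at_right_0_lt p : 0 < p -> at_right 0 (fun a => 0 < a < p).
Proof.
move=> p0; exists (mkposreal _ p0) => a.
rewrite /ball /= /AbsRing_ball /abs /minus /plus /opp /= Ropp_0 Rplus_0_r => ha a0.
by split=> //; apply: Rle_lt_trans (Rle_abs a) ha.
Qed.

(** * Integrals over the half-line *)

Section ImproperIntegral.
Variable X : NormedModule R_AbsRing.

(** Absolute convergence, as a bound on the proper integrals of the norm over all [[a, b]]:
    dominated functions and finite sums inherit this form directly. *)
Definition abs_int (f : R -> X) : Prop :=
  (forall r, 0 < r -> continuous f r) /\
  exists M, forall a b, 0 < a <= b -> RInt (fun r => norm (f r)) a b <= M.

Lemma is_RInt_zinf_ext (f g : R -> X) I : (forall r, 0 < r -> f r = g r) ->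
  zinf f I -> zinf g I.
Proof.
move=> fg; apply: is_RInt_gen_ext.
exists (fun a => 0 < a) (fun b => 0 < b).
- by exists (mkposreal 1 Rlt_0_1).
- by exists 0.
- move=> a b a0 b0 x [h _]; apply: fg; apply: Rlt_trans h.
  by apply: Rmin_glb_lt.
Qed.

Lemma is_RInt_zinf_opp (f : R -> X) I : zinf f I -> zinf (fun r => opp (f r)) (opp I).
Proof. exact: is_RInt_gen_opp. Qed.

Lemma is_RInt_zinf_scal k (f : R -> X) I :
  zinf f I -> zinf (fun r => scal k (f r)) (scal k I).
Proof. exact: is_RInt_gen_scal. Qed.

Lemma is_RInt_zinf_plus (f g : R -> X) I J :
  zinf f I -> zinf g J -> zinf (fun r => plus (f r) (g r)) (plus I J).
Proof. exact: is_RInt_gen_plus. Qed.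

Lemma is_RInt_zinf_minus (f g : R -> X) I J :
  zinf f I -> zinf g J -> zinf (fun r => minus (f r) (g r)) (minus I J).
Proof. exact: is_RInt_gen_minus. Qed.

Lemma norm_continuous (f : R -> X) r :
  continuous f r -> continuous (fun r => norm (f r)) r.
Proof. by move=> H; apply: filterlim_comp H (filterlim_norm _). Qed.

Lemma ex_RInt_pos (Y : CompleteNormedModule R_AbsRing) (f : R -> Y) a b :
  (forall r, 0 < r -> continuous f r) -> 0 < a -> 0 < b -> ex_RInt f a b.
Proof.
move=> H a0 b0; apply: ex_RInt_continuous => z [hz _]; apply: H.
by apply: Rlt_le_trans hz; apply: Rmin_glb_lt.
Qed.

Lemma ex_RInt_norm (f : R -> X) a b :
  (forall r, 0 < r -> continuous f r) -> 0 < a -> 0 < b ->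
  ex_RInt (fun r => norm (f r)) a b.
Proof.
move=> H; apply: (@ex_RInt_pos R_CompleteNormedModule) => r r0.
by apply: norm_continuous; apply: H.
Qed.

Lemma RInt_norm_ge0 (f : R -> X) a b :
  (forall r, 0 < r -> continuous f r) -> 0 < a <= b ->
  0 <= RInt (fun r => norm (f r)) a b.
Proof.
move=> H ab; apply: RInt_ge_0; [rlra| |by move=> x _; apply: norm_ge_0].
by apply: ex_RInt_norm => //; rlra.
Qed.

Lemma RInt_norm_Chasles (f : R -> X) a b c :
  (forall r, 0 < r -> continuous f r) -> 0 < a -> 0 < b -> 0 < c ->
  RInt (fun r => norm (f r)) a b + RInt (fun r => norm (f r)) b c =
  RInt (fun r => norm (f r)) a c.
Proof.
by move=> H a0 b0 c0; apply: (@RInt_Chasles R_CompleteNormedModule); apply: ex_RInt_norm.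
Qed.

(** An interval whose integral is within [e] of the supremum of all such integrals leaves at most
    [e] outside itself. *)
Lemma abs_int_tail (f : R -> X) e : abs_int f -> 0 < e ->
  exists p q, 0 < p < q /\ forall a b, 0 < a <= b -> (b <= p \/ q <= a) ->
    RInt (fun r => norm (f r)) a b <= e.
Proof.
move=> [cf [M HM]] e0.
pose E r := exists a b, 0 < a <= b /\ r = - RInt (fun r => norm (f r)) a b.
have [l [lE ge]] : exists l, (forall r, E r -> l <= r) /\
    (forall e, 0 < e -> exists r, E r /\ r < l + e).
  apply: (@inf_exists E (- M)).
    by exists (- RInt (fun r => norm (f r)) 1 1), 1, 1; split=> //; rlra.
  by move=> _ [a [b [ab ->]]]; have := HM a b ab; rlra.
have [_ [[p [q [pq ->]]] Hpq]] := ge _ e0.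
have key a b : 0 < a <= p -> q <= b ->
    RInt (fun r => norm (f r)) a p + RInt (fun r => norm (f r)) q b <= e.
  move=> ap qb; have ab : 0 < a <= b by rlra.
  have := lE _ (ex_intro _ a (ex_intro _ b (conj ab erefl))).
  rewrite -(RInt_norm_Chasles cf (b := p)); try rlra.
  rewrite -(RInt_norm_Chasles (a := p) cf (b := q)); rlra.
(* [q + 1] instead of [q], because the interval nearly reaching the supremum may be degenerate. *)
exists p, (q + 1); split; first rlra.
move=> a b ab [bp|qa].
- have := key a q; rewrite (RInt_point q (fun r => norm (f r))) /zero /=.
  rewrite -(RInt_norm_Chasles cf (b := b)); try rlra.
  have : 0 <= RInt (fun r => norm (f r)) b p by apply: RInt_norm_ge0 => //; rlra.
  rlra.
- have := key p b; rewrite (RInt_point p (fun r => norm (f r))) /zero /=.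
  rewrite -(RInt_norm_Chasles (a := q) cf (b := a)); try rlra.
  have : 0 <= RInt (fun r => norm (f r)) q a by apply: RInt_norm_ge0 => //; rlra.
  rlra.
Qed.

Lemma abs_int_dom (f : R -> X) (g : R -> R) :
  (forall r, 0 < r -> continuous f r) -> (forall r, 0 < r -> continuous g r) ->
  (forall r, 0 < r -> norm (f r) <= g r) ->
  (exists M, forall a b, 0 < a <= b -> RInt g a b <= M) -> abs_int f.
Proof.
move=> cf cg fg [M HM]; split=> //; exists M => a b ab.
apply: Rle_trans (HM _ _ ab); apply: RInt_le; first rlra.
- by apply: ex_RInt_norm => //; rlra.
- by apply: (@ex_RInt_pos R_CompleteNormedModule) => //; rlra.
- by move=> r ar; apply: fg; rlra.
Qed.

End ImproperIntegral.

Lemma abs_int_le (X Y : NormedModule R_AbsRing) (f : R -> X) (g : R -> Y) c :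
  (forall r, 0 < r -> continuous f r) -> abs_int g ->
  (forall r, 0 < r -> norm (f r) <= c * norm (g r)) -> abs_int f.
Proof.
move=> cf [cg [M HM]] H.
apply: (@abs_int_dom _ f (fun r => Rabs c * norm (g r))) => //.
- move=> r r0; apply: (@continuous_scal_r _ R_AbsRing R_NormedModule (Rabs c)).
  by apply: norm_continuous; apply: cg.
- move=> r r0; apply: Rle_trans (H r r0) _; apply: Rmult_le_compat_r.
    exact: norm_ge_0.
  exact: Rle_abs.
- exists (Rabs c * M) => a b ab.
  have := RInt_scal (V := R_CompleteNormedModule) (fun r => norm (g r)) a b (Rabs c).
  rewrite /scal /= /mult /= => ->; last by apply: ex_RInt_norm => //; rlra.
  by apply: Rmult_le_compat_l; [apply: Rabs_pos|apply: HM].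
Qed.

Section AbsIntAlgebra.
Variables X Y : NormedModule R_AbsRing.

Lemma abs_int_plus (f g : R -> X) :
  abs_int f -> abs_int g -> abs_int (fun r => plus (f r) (g r)).
Proof.
move=> [cf [M HM]] [cg [N HN]].
apply: (@abs_int_dom _ _ (fun r => norm (f r) + norm (g r))).
- by move=> r r0; apply: continuous_plus; [apply: cf | apply: cg].
- move=> r r0; apply: (@continuous_plus _ R_AbsRing R_NormedModule).
    by apply: norm_continuous; apply: cf.
  by apply: norm_continuous; apply: cg.
- by move=> r r0; apply: norm_triangle.
- exists (M + N) => a b ab.
  have := RInt_plus (V := R_CompleteNormedModule) (fun r => norm (f r)) (fun r => norm (g r)) a b.
  rewrite /plus /= => ->; [|apply: ex_RInt_norm => //; rlra ..].
  by apply: Rplus_le_compat; [apply: HM|apply: HN].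
Qed.

End AbsIntAlgebra.

Section AbsIntConverges.
Variable X : CompleteNormedModule R_AbsRing.

Lemma is_RInt_zinfP (f : R -> X) I :
  (forall r, 0 < r -> continuous f r) ->
  (zinf f I <-> forall e, 0 < e -> exists p q, 0 < p /\ 0 < q /\
     forall a b, 0 < a < p -> q < b -> norm (minus (RInt f a b) I) < e).
Proof.
move=> cf; split.
- move=> H e e0.
  have k0 := @norm_factor_gt_0 _ X; set k := norm_factor in k0.
  have ek : 0 < e / k by apply: Rdiv_lt_0_compat.
  have := H _ (locally_ball I (mkposreal _ ek)).
  case=> P Q [d Pd] [M QM] PQ.
  have PM x : Rmax M 0 < x -> Q x.
    by move=> h; apply: QM; apply: Rle_lt_trans (Rmax_l _ _) h.
  exists d, (Rmax M 0 + 1); split; first exact: cond_pos.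
  split; first by have := Rmax_r M 0; rlra.
  move=> a b [a0 ad] Mb.
  have Pa : P a.
    apply: Pd => //; rewrite /ball /= /AbsRing_ball /abs /minus /plus /opp /=.
    by rewrite Ropp_0 Rplus_0_r Rabs_pos_eq; rlra.
  have Qb : Q b by apply: PM; rlra.
  have [y [Hy By]] := PQ a b Pa Qb.
  rewrite (is_RInt_unique _ _ _ _ Hy).
  have := norm_compat2 _ _ _ By; rewrite -/k /=.
  by have -> : k * (e / k) = e by field; rlra.
- move=> H P [d Pd].
  have [p [q [p0 [q0 Hpq]]]] := H _ (cond_pos d).
  exists (fun a => 0 < a < p) (fun b => q < b).
  + exact: at_right_0_lt.
  + by exists q.
  + move=> a b ha hb; exists (RInt f a b); split.
      by rewrite /=; apply: RInt_correct; apply: ex_RInt_pos => //; rlra.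
    by apply: Pd; apply: norm_compat1; apply: Hpq.
Qed.

Lemma is_RInt_zinf_unique (f : R -> X) I1 I2 : zinf f I1 -> zinf f I2 -> I1 = I2.
Proof. by move=> H1 H2; rewrite -(is_RInt_gen_unique _ _ H1) (is_RInt_gen_unique _ _ H2). Qed.

Lemma RInt_norm_bound (f : R -> X) a b : (forall r, 0 < r -> continuous f r) ->
  0 < a <= b -> norm (RInt f a b) <= RInt (fun r => norm (f r)) a b.
Proof.
move=> cf ab; apply: (@norm_RInt_le X f (fun r => norm (f r)) a b); first rlra.
- by move=> *; apply: Rle_refl.
- by apply: RInt_correct; apply: ex_RInt_pos => //; rlra.
- by apply: RInt_correct; apply: ex_RInt_norm => //; rlra.
Qed.

(** Cauchy criterion: the integrals over two large intervals differ by two end pieces, each inside a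
    tail. *)
Lemma abs_int_cvg (f : R -> X) : abs_int f -> exists I, zinf f I.
Proof.
move=> hf; have cf := hf.1.
pose FF := filter_prod (at_right 0) (Rbar_locally p_infty).
have PF : ProperFilter FF by apply: filter_prod_proper.
have [I HI] : exists I : X, filterlim (fun ab => RInt f ab.1 ab.2) FF (locally I).
  apply/(filterlim_locally_cauchy (F := FF)) => e.
  have e4 : 0 < e / 4 by have := cond_pos e; rlra.
  have [p [q [pq Hpq]]] := abs_int_tail hf e4.
  exists (fun ab => (0 < ab.1 < p) /\ q < ab.2); split.
    exists (fun a => 0 < a < p) (fun b => q < b) => //.
    + by apply: at_right_0_lt; rlra.
    + by exists q.
  move=> [a b] [a' b'] /= [ha hb] [ha' hb'].
  apply: norm_compat1.
  have seg x y : 0 < x -> 0 < y -> (Rmax x y <= p \/ q <= Rmin x y) ->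
      norm (RInt f x y) <= e / 4.
    move=> x0 y0; case: (Rle_lt_dec x y) => xy.
      rewrite Rmax_right // Rmin_left // => h.
      by apply: Rle_trans (Hpq x y _ h); [apply: RInt_norm_bound => //; rlra|rlra].
    rewrite Rmax_left ?Rmin_right; try rlra; move=> h.
    rewrite -(opp_RInt_swap f y x) ?norm_opp; last by apply: ex_RInt_pos.
    by apply: Rle_trans (Hpq y x _ h); [apply: RInt_norm_bound => //; rlra|rlra].
  have -> : minus (RInt f a' b') (RInt f a b) = plus (RInt f a' a) (RInt f b b').
    have E1 : plus (RInt f a' a) (plus (RInt f a b) (RInt f b b')) = RInt f a' b'.
      by rewrite !RInt_Chasles //; apply: ex_RInt_pos => //; rlra.
    rewrite -E1; move: (RInt f a' a) (RInt f a b) (RInt f b b') => u v w.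
    by lin; ring.
  apply: Rle_lt_trans (norm_triangle _ _) _.
  have h1 : norm (RInt f a' a) <= e / 4.
    by apply: seg; try rlra; left; apply: Rmax_lub; rlra.
  have h2 : norm (RInt f b b') <= e / 4.
    by apply: seg; try rlra; right; apply: Rmin_glb; rlra.
  by have := cond_pos e; rlra.
exists I; apply/(is_RInt_zinfP _ cf) => e e0.
have := HI _ (locally_ball_norm I (mkposreal _ e0)).
case=> P Q [d Pd] [M QM] PQ; exists d, (Rmax M 0 + 1).
split; first exact: cond_pos.
split; first by have := Rmax_r M 0; rlra.
move=> a b [a0 ad] Mb; apply: PQ.
  apply: Pd => //; rewrite /ball /= /AbsRing_ball /abs /minus /plus /opp /=.
  by rewrite Ropp_0 Rplus_0_r Rabs_pos_eq; rlra.
by apply: QM; have := Rmax_l M 0; rlra.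
Qed.

End AbsIntConverges.

(** * Complex derivatives *)

Section ComplexDerivative.
Local Open Scope C_scope.

Definition ccont (G : C -> C) (z : C) : Prop :=
  forall e, (0 < e)%R -> exists d, (0 < d)%R /\
    forall w, (Cmod (w - z) < d)%R -> (Cmod (G w - G z) < e)%R.

Definition cderiv (G : C -> C) (z d : C) : Prop :=
  forall e, (0 < e)%R -> exists r, (0 < r)%R /\ forall w, (Cmod (w - z) < r)%R ->
    (Cmod (G w - G z - d * (w - z)) <= e * Cmod (w - z))%R.

(** Continuity of the derivative belongs to the notion; differentiation under the integral sign
    relies on it below. *)
Definition hol (D : C -> Prop) (G G' : C -> C) : Prop :=
  forall z, D z -> cderiv G z (G' z) /\ ccont G' z.

Lemma Cmod_le_abs (z : C) : (Cmod z <= Rabs (fst z) + Rabs (snd z))%R.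
Proof.
rewrite -(Rabs_pos_eq (Cmod z)); last exact: Cmod_ge_0.
rewrite -(Rabs_pos_eq (_ + _)%R); last first.
  by have := Rabs_pos (fst z); have := Rabs_pos (snd z); rlra.
apply: Rsqr_le_abs_0; rewrite /Rsqr -[(Cmod z * Cmod z)%R]/(_) .
have := Cmod2_alt z; rewrite /Re /Im /=; rewrite !Rmult_1_r => ->.
have := Rabs_pos (fst z); have := Rabs_pos (snd z).
have := Rsqr_abs (fst z); have := Rsqr_abs (snd z); rewrite /Rsqr => -> ->; nra.
Qed.

Lemma im_le_Cmod (z : C) : (Rabs (Im z) <= Cmod z)%R.
Proof. exact: Rle_trans (Rmax_r _ _) (Rmax_Cmod z). Qed.

Lemma Csub_eq0 (z w : C) : z - w = 0 -> z = w.
Proof.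
move=> E; have H : z = (z - w) + w by ring.
by rewrite H E; ring.
Qed.

Lemma Cmod_sub_sym (z w : C) : Cmod (z - w) = Cmod (w - z).
Proof. by rewrite -(Cmod_opp (z - w)); congr Cmod; ring. Qed.

Lemma ccont_const (c z : C) : ccont (fun _ => c) z.
Proof.
move=> e e0; exists 1%R; split; first rlra.
by move=> w _; rewrite (_ : c - c = 0) ?Cmod_0 //; ring.
Qed.

Lemma ccont_plus (F G : C -> C) z : ccont F z -> ccont G z ->
  ccont (fun w => F w + G w) z.
Proof.
move=> HF HG e e0; have e2 : (0 < e / 2)%R by rlra.
have [d [d0 Hd]] := HF _ e2; have [r [r0 Hr]] := HG _ e2.
exists (Rmin d r); split; first exact: Rmin_glb_lt.
move=> w wz; have := Hd w (Rlt_le_trans _ _ _ wz (Rmin_l _ _)).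
have := Hr w (Rlt_le_trans _ _ _ wz (Rmin_r _ _)).
rewrite (_ : F w + G w - (F z + G z) = (F w - F z) + (G w - G z)); last ring.
by have := Cmod_triangle (F w - F z) (G w - G z); rlra.
Qed.

Lemma ccont_mult (F G : C -> C) z : ccont F z -> ccont G z ->
  ccont (fun w => F w * G w) z.
Proof.
move=> HF HG e e0; set a := Cmod (F z); set b := Cmod (G z).
have a0 : (0 <= a)%R by apply: Cmod_ge_0.
have b0 : (0 <= b)%R by apply: Cmod_ge_0.
pose m := Rmin 1 (e / (a + b + 1)).
have k0 : (0 < e / (a + b + 1))%R by apply: Rdiv_lt_0_compat; rlra.
have m0 : (0 < m)%R by apply: Rmin_glb_lt; rlra.
have [d [d0 Hd]] := HF _ m0; have [r [r0 Hr]] := HG _ m0.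
exists (Rmin d r); split; first exact: Rmin_glb_lt.
move=> w wz; have h1 := Hd w (Rlt_le_trans _ _ _ wz (Rmin_l _ _)).
have h2 := Hr w (Rlt_le_trans _ _ _ wz (Rmin_r _ _)).
rewrite (_ : F w * G w - F z * G z =
  (F w - F z) * (G w - G z) + ((F w - F z) * G z + F z * (G w - G z))); last ring.
apply: Rle_lt_trans (Cmod_triangle _ _) _.
have := Cmod_triangle ((F w - F z) * G z) (F z * (G w - G z)); rewrite !Cmod_mult -/a -/b.
move: h1 h2; set x := Cmod _; set y := Cmod _ => h1 h2.
have x0 : (0 <= x)%R by apply: Cmod_ge_0.
have y0 : (0 <= y)%R by apply: Cmod_ge_0.
have m1 : (m <= 1)%R by apply: Rmin_l.
have mk : (m * (a + b + 1) <= e)%R.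
  apply: Rle_trans (Rmult_le_compat_r _ _ _ _ (Rmin_r _ _)) _; first rlra.
  by apply: Req_le; field; rlra.
nra.
Qed.

Lemma ccont_inv (G : C -> C) z : ccont G z -> G z <> 0 -> ccont (fun w => / G w) z.
Proof.
move=> HG Gz e e0; have b0 := proj1 (Cmod_gt_0 _) Gz; set b := Cmod (G z) in b0.
pose m := Rmin (b / 2) (e * b * b / 4).
have m0 : (0 < m)%R.
  by apply: Rmin_glb_lt; [rlra|have := Rmult_lt_0_compat _ _ e0 b0; nra].
have [d [d0 Hd]] := HG _ m0; exists d; split=> // w /Hd h.
have hb : (b / 2 <= Cmod (G w))%R.
  have := Cmod_triangle (G w) (G z - G w).
  rewrite (_ : G w + (G z - G w) = G z) -/b ?(Cmod_sub_sym (G z)); last ring.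
  by have := Rmin_l (b / 2) (e * b * b / 4); rewrite -/m; rlra.
have Gw : G w <> 0 by apply/Cmod_gt_0; rlra.
rewrite (_ : / G w - / G z = - (G w - G z) * / (G w * G z)); last by field.
rewrite Cmod_mult Cmod_opp Cmod_inv; last by apply: Cmult_neq_0.
rewrite Cmod_mult -/b.
have hm : (Cmod (G w - G z) < e * b * b / 4)%R.
  by apply: Rlt_le_trans h (Rmin_r _ _).
apply: (@Rmult_lt_reg_r (Cmod (G w) * b)); first by apply: Rmult_lt_0_compat; rlra.
rewrite Rmult_assoc Rinv_l; last by apply: Rgt_not_eq; apply: Rmult_lt_0_compat; rlra.
rewrite Rmult_1_r; have := Rmult_lt_0_compat _ _ e0 b0; nra.
Qed.

Lemma cderiv_ccont (G : C -> C) z d : cderiv G z d -> ccont G z.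
Proof.
move=> H e e0; have [r [r0 Hr]] := H 1%R Rlt_0_1.
pose k := (1 + Cmod d)%R; have k1 : (1 <= k)%R by have := Cmod_ge_0 d; rewrite /k; rlra.
have ek : (0 < e / k)%R by apply: Rdiv_lt_0_compat; rlra.
exists (Rmin r (e / k)); split; first exact: Rmin_glb_lt.
move=> w wz; have := Hr w (Rlt_le_trans _ _ _ wz (Rmin_l _ _)).
have h := Rlt_le_trans _ _ _ wz (Rmin_r _ _).
have := Cmod_triangle (G w - G z - d * (w - z)) (d * (w - z)).
rewrite (_ : G w - G z - d * (w - z) + d * (w - z) = G w - G z); last ring.
rewrite Cmod_mult.
have : (k * Cmod (w - z) < e)%R.
  have -> : e = (k * (e / k))%R by field; rlra.
  by apply: Rmult_lt_compat_l => //; rlra.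
rewrite /k; nra.
Qed.

(* Caratheodory's form of the derivative. *)
Lemma cderiv_slope (G q : C -> C) z :
  (exists r, (0 < r)%R /\ forall w, (Cmod (w - z) < r)%R ->
     G w = G z + q w * (w - z)) ->
  ccont q z -> cderiv G z (q z).
Proof.
move=> [r [r0 Hr]] cq e e0; have [d [d0 Hd]] := cq e e0.
exists (Rmin r d); split; first exact: Rmin_glb_lt.
move=> w wz; rewrite (Hr w (Rlt_le_trans _ _ _ wz (Rmin_l _ _))).
rewrite (_ : G z + q w * (w - z) - G z - q z * (w - z) = (q w - q z) * (w - z)); last ring.
rewrite Cmod_mult; apply: Rmult_le_compat_r; first exact: Cmod_ge_0.
by apply: Rlt_le; apply: Hd; apply: Rlt_le_trans wz (Rmin_r _ _).
Qed.

Lemma cderiv_slopeE (G : C -> C) z d : cderiv G z d ->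
  exists q : C -> C, (forall w, G w = G z + q w * (w - z)) /\ ccont q z /\ q z = d.
Proof.
move=> H; pose q w := if excluded_middle_informative (w = z) then d
  else (G w - G z) / (w - z).
have qz : q z = d by rewrite /q; case: excluded_middle_informative.
exists q; split; [|split=> //].
- move=> w; rewrite /q; case: excluded_middle_informative => [E|wz].
    by rewrite /= E; ring.
  by rewrite /=; field => /Csub_eq0.
- move=> e e0; have e2 : (0 < e / 2)%R by rlra.
  have [r [r0 Hr]] := H _ e2; exists r; split=> // w wr.
  rewrite qz /q; case: excluded_middle_informative => [E|wz] /=.
    by rewrite (_ : d - d = 0) ?Cmod_0 //; ring.
  have nz : w - z <> 0.
    by move/Csub_eq0.
  have m0 := proj1 (Cmod_gt_0 _) nz.
  rewrite (_ : (G w - G z) / (w - z) - d = (G w - G z - d * (w - z)) * / (w - z)); last by field.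
  rewrite Cmod_mult Cmod_inv //; have := Hr w wr => h.
  apply: (@Rmult_lt_reg_r (Cmod (w - z))) => //.
  rewrite Rmult_assoc Rinv_l; last rlra.
  by rewrite Rmult_1_r; nra.
Qed.

Lemma cderiv_const (c z : C) : cderiv (fun _ => c) z 0.
Proof.
apply: (@cderiv_slope _ (fun _ => 0)); last exact: ccont_const.
by exists 1%R; split; [rlra|move=> w _; ring].
Qed.

Lemma cderiv_id (z : C) : cderiv (fun w => w) z 1.
Proof.
apply: (@cderiv_slope _ (fun _ => 1)); last exact: ccont_const.
by exists 1%R; split; [rlra|move=> w _; ring].
Qed.

Lemma cderiv_plus (F G : C -> C) z a b : cderiv F z a -> cderiv G z b ->
  cderiv (fun w => F w + G w) z (a + b).
Proof.
move=> /cderiv_slopeE [p [Hp [cp <-]]] /cderiv_slopeE [q [Hq [cq <-]]].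
apply: (@cderiv_slope _ (fun w => p w + q w)); last exact: ccont_plus.
exists 1%R; split; [rlra|move=> w _; rewrite (Hp w) (Hq w); ring].
Qed.

Lemma cderiv_mult (F G : C -> C) z a b : cderiv F z a -> cderiv G z b ->
  cderiv (fun w => F w * G w) z (a * G z + F z * b).
Proof.
move=> HF HG; have cG := cderiv_ccont HG; move: HF HG.
move=> /cderiv_slopeE [p [Hp [cp <-]]] /cderiv_slopeE [q [Hq [cq <-]]].
apply: (@cderiv_slope _ (fun w => p w * G w + F z * q w)).
  exists 1%R; split; [rlra|move=> w _; rewrite (Hp w) (Hq w); ring].
by apply: ccont_plus; apply: ccont_mult => //; apply: ccont_const.
Qed.

Lemma cderiv_inv (G : C -> C) z b : cderiv G z b -> G z <> 0 ->
  cderiv (fun w => / G w) z (- b / (G z * G z)).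
Proof.
move=> HG Gz; have cG := cderiv_ccont HG; move: (HG).
move=> /cderiv_slopeE [q [Hq [cq qb]]].
have -> : - b / (G z * G z) = -(1) * q z * (/ G z * / G z) by rewrite qb; field.
apply: (@cderiv_slope _ (fun w => -(1) * q w * (/ G w * / G z))).
  have b0 := proj1 (Cmod_gt_0 _) Gz.
  have [d [d0 Hd]] := cG _ b0; exists d; split=> // w /Hd h.
  have Gw : G w <> 0.
    by move=> E; move: h; rewrite E Cmod_sub_sym (_ : G z - 0 = G z) => [|]; [rlra|ring].
  have E : q w * (w - z) = G w - G z by rewrite (Hq w); ring.
  have -> : -(1) * q w * (/ G w * / G z) * (w - z) =
     -(1) * (q w * (w - z)) * (/ G w * / G z) by ring.
  by rewrite E; field.
apply: ccont_mult; first by apply: ccont_mult => //; apply: ccont_const.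
by apply: ccont_mult; [apply: ccont_inv|apply: ccont_const].
Qed.

Lemma hol_ccont D G G' z : hol D G G' -> D z -> ccont G z.
Proof. by move=> H /H [/cderiv_ccont]. Qed.

Lemma hol_const D (c : C) : hol D (fun _ => c) (fun _ => 0).
Proof. by split; [apply: cderiv_const|apply: ccont_const]. Qed.

Lemma hol_id D : hol D (fun z => z) (fun _ => 1).
Proof. by split; [apply: cderiv_id|apply: ccont_const]. Qed.

Lemma hol_plus D F F' G G' : hol D F F' -> hol D G G' ->
  hol D (fun z => F z + G z) (fun z => F' z + G' z).
Proof.
move=> HF HG z Dz; have [f1 f2] := HF z Dz; have [g1 g2] := HG z Dz.
by split; [apply: cderiv_plus|apply: ccont_plus].
Qed.

Lemma hol_mult D F F' G G' : hol D F F' -> hol D G G' ->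
  hol D (fun z => F z * G z) (fun z => F' z * G z + F z * G' z).
Proof.
move=> HF HG z Dz; have [f1 f2] := HF z Dz; have [g1 g2] := HG z Dz.
split; first exact: cderiv_mult.
by apply: ccont_plus; apply: ccont_mult => //; [apply: (hol_ccont HG)|apply: (hol_ccont HF)].
Qed.

Lemma hol_inv D G G' : hol D G G' -> (forall z, D z -> G z <> 0) ->
  hol D (fun z => / G z) (fun z => - G' z / (G z * G z)).
Proof.
move=> HG nz z Dz; have [g1 g2] := HG z Dz; have cG := hol_ccont HG Dz.
split; first by apply: cderiv_inv => //; apply: nz.
have -> : (fun w => - G' w / (G w * G w)) = (fun w => -(1) * G' w * / (G w * G w)).
  by apply: functional_extensionality => w; rewrite /Cdiv; ring.
apply: ccont_mult; first by apply: ccont_mult => //; apply: ccont_const.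
by apply: ccont_inv; [apply: ccont_mult|apply: Cmult_neq_0; apply: nz].
Qed.

Lemma hol_sub (D E : C -> Prop) G G' : (forall z, D z -> E z) -> hol E G G' -> hol D G G'.
Proof. by move=> DE H z /DE /H. Qed.

Definition holo (D : C -> Prop) (G : C -> C) : Prop := exists G', hol D G G'.

Lemma holo_const D (c : C) : holo D (fun _ => c).
Proof. by eexists; apply: hol_const. Qed.

Lemma holo_id D : holo D (fun z => z).
Proof. by eexists; apply: hol_id. Qed.

Lemma holo_plus D F G : holo D F -> holo D G -> holo D (fun z => F z + G z).
Proof. by move=> [F' HF] [G' HG]; exists (fun z => F' z + G' z); apply: hol_plus. Qed.

Lemma holo_mult D F G : holo D F -> holo D G -> holo D (fun z => F z * G z).
Proof.
by move=> [F' HF] [G' HG]; exists (fun z => F' z * G z + F z * G' z); apply: hol_mult.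
Qed.

Lemma holo_inv D G : holo D G -> (forall z, D z -> G z <> 0) -> holo D (fun z => / G z).
Proof. by move=> [G' HG] nz; exists (fun z => - G' z / (G z * G z)); apply: hol_inv. Qed.

Lemma holo_sub (D E : C -> Prop) G : (forall z, D z -> E z) -> holo E G -> holo D G.
Proof. by move=> DE [G' HG]; exists G'; apply: hol_sub HG. Qed.

Lemma ccont_comp_2d (G : C -> C) (X Y : R -> R -> R) x y :
  ccont G (X x y, Y x y) -> continuity_2d_pt X x y -> continuity_2d_pt Y x y ->
  continuity_2d_pt (fun u v => Re (G (X u v, Y u v))) x y /\
  continuity_2d_pt (fun u v => Im (G (X u v, Y u v))) x y.
Proof.
move=> HG HX HY.
have H e : (0 < e)%R -> locally_2d (fun u v =>
    (Cmod (G (X u v, Y u v) - G (X x y, Y x y)) < e)%R) x y.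
  move=> /HG [d [d0 Hd]]; have d2 : (0 < d / 2)%R by rlra.
  apply: locally_2d_impl (locally_2d_and _ _ _ _ (HX (mkposreal _ d2)) (HY (mkposreal _ d2))).
  apply: locally_2d_forall => u v [/= h1 h2]; apply: Hd.
  apply: Rle_lt_trans (Cmod_le_abs _) _ => /=.
  by rewrite /Rminus in h1 h2; rlra.
split=> e; have := H e (cond_pos e); apply: locally_2d_impl; apply: locally_2d_forall.
- move=> u v h; apply: Rle_lt_trans (re_le_Cmod _) h.
- move=> u v h; apply: Rle_lt_trans (im_le_Cmod _) h.
Qed.

Lemma cderiv_curve (G : C -> C) (x y : R -> R) t x' y' d :
  cderiv G (x t, y t) d -> is_derive x t x' -> is_derive y t y' ->
  is_derive (fun s => Re (G (x s, y s))) t (Re (d * (x', y'))) /\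
  is_derive (fun s => Im (G (x s, y s))) t (Im (d * (x', y'))).
Proof.
move=> HG /is_derive_Reals Hx /is_derive_Reals Hy.
have key e : (0 < e)%R -> exists r : posreal, forall h, h <> 0%R -> (Rabs h < r)%R ->
    (Cmod (G (x (t + h)%R, y (t + h)%R) - G (x t, y t) - RtoC h * (d * (x', y'))) < e * Rabs h)%R.
  move=> e0; pose m := (Rabs x' + Rabs y' + 2)%R.
  have m0 : (0 < m)%R by have := Rabs_pos x'; have := Rabs_pos y'; rewrite /m; rlra.
  have em : (0 < e / 2 / m)%R by apply: Rdiv_lt_0_compat; rlra.
  have [r [r0 Hr]] := HG _ em.
  (* The error will be at most [e / 2 + 2 e / 5] times [|h|], strictly below [e |h|]: the first part
     comes from [G], the second from linearising the curve, multiplied by [|d|]. The bound [k <= 1]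
     makes the increment of the curve at most [m |h|]. *)
  pose k := Rmin 1 (e / 5 / (Cmod d + 1)).
  have cd := Cmod_ge_0 d.
  have k0 : (0 < k)%R by apply: Rmin_glb_lt; [rlra|apply: Rdiv_lt_0_compat; rlra].
  have [rx Hrx] := Hx _ k0; have [ry Hry] := Hy _ k0.
  have rm : (0 < r / m)%R by apply: Rdiv_lt_0_compat.
  have p0 : (0 < Rmin (Rmin rx ry) (r / m))%R.
    by apply: Rmin_glb_lt => //; apply: Rmin_glb_lt; apply: cond_pos.
  exists (mkposreal _ p0) => h h0 /= hh.
  have h1 := Hrx h h0 (Rlt_le_trans _ _ _ hh (Rle_trans _ _ _ (Rmin_l _ _) (Rmin_l _ _))).
  have h2 := Hry h h0 (Rlt_le_trans _ _ _ hh (Rle_trans _ _ _ (Rmin_l _ _) (Rmin_r _ _))).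
  have h3 := Rlt_le_trans _ _ _ hh (Rmin_r _ _).
  have ah : (0 < Rabs h)%R by apply: Rabs_pos_lt.
  have dx (f : R -> R) f' : (Rabs ((f (t + h)%R - f t) / h - f') < k)%R ->
      (Rabs (f (t + h)%R - f t - h * f') <= k * Rabs h)%R.
    move=> H; have -> : (f (t + h) - f t - h * f' = ((f (t + h) - f t) / h - f') * h)%R.
      by field.
    by rewrite Rabs_mult; apply: Rmult_le_compat_r; rlra.
  have {}h1 := dx _ _ h1; have {}h2 := dx _ _ h2.
  set w : C := (x (t + h)%R, y (t + h)%R); set z : C := (x t, y t).
  have wz : (Cmod (w - z - RtoC h * (x', y')) <= 2 * k * Rabs h)%R.
    apply: Rle_trans (Cmod_le_abs _) _; rewrite /w /z /=.
    rewrite (_ : x (t + h) + - x t + - (h * x' - 0 * y') = x (t + h) - x t - h * x')%R; last ring.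
    rewrite (_ : y (t + h) + - y t + - (h * y' + 0 * x') = y (t + h) - y t - h * y')%R; last ring.
    rlra.
  have k1 : (k <= 1)%R by apply: Rmin_l.
  have wz2 : (Cmod (w - z) <= m * Rabs h)%R.
    apply: Rle_trans (Cmod_le_abs _) _; rewrite /w /z /=.
    have t1 := Rabs_triang (x (t + h) - x t - h * x')%R (h * x')%R.
    have t2 := Rabs_triang (y (t + h) - y t - h * y')%R (h * y')%R.
    rewrite (_ : x (t + h) - x t - h * x' + h * x' = x (t + h) + - x t)%R in t1; last ring.
    rewrite (_ : y (t + h) - y t - h * y' + h * y' = y (t + h) + - y t)%R in t2; last ring.
    rewrite !Rabs_mult in t1 t2; rewrite /m; nra.
  have wr : (Cmod (w - z) < r)%R.
    apply: Rle_lt_trans wz2 _; have -> : r = (m * (r / m))%R by field; rlra.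
    exact: Rmult_lt_compat_l.
  have := Hr w wr; rewrite -/z.
  have -> : G w - G z - RtoC h * (d * (x', y')) =
     (G w - G z - d * (w - z)) + d * (w - z - RtoC h * (x', y')) by ring.
  move=> H4; apply: Rle_lt_trans (Cmod_triangle _ _) _; rewrite Cmod_mult.
  have e1 : (e / 2 / m * Cmod (w - z) <= e / 2 * Rabs h)%R.
    apply: (@Rle_trans _ (e / 2 / m * (m * Rabs h))).
      by apply: Rmult_le_compat_l => //; rlra.
    by apply: Req_le; field; rlra.
  have e3 : (Cmod d * k <= e / 5)%R.
    apply: (@Rle_trans _ ((Cmod d + 1) * (e / 5 / (Cmod d + 1)))); last by apply: Req_le; field; rlra.
    by apply: Rmult_le_compat; [rlra|rlra|rlra|apply: Rmin_r].
  have e4 : (Cmod d * Cmod (w - z - RtoC h * (x', y')) <= e * 2 / 5 * Rabs h)%R.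
    apply: (@Rle_trans _ (Cmod d * (2 * k * Rabs h))); first exact: Rmult_le_compat_l.
    rewrite (_ : Cmod d * (2 * k * Rabs h) = Cmod d * k * 2 * Rabs h)%R; last ring.
    by apply: Rmult_le_compat_r; rlra.
  have := Rmult_lt_0_compat _ _ e0 ah; rlra.
split; apply/is_derive_Reals => e e0; have [r Hr] := key e e0; exists r => h h0 hr.
- have := Hr h h0 hr; set q := (X in Cmod X) => Hq.
  have -> : ((Re (G (x (t + h), y (t + h))) - Re (G (x t, y t))) / h - Re (d * (x', y')) =
     Re q / h)%R.
    by rewrite /q /Re /=; field.
  rewrite /Rdiv Rabs_mult Rabs_inv; have ah : (0 < Rabs h)%R by apply: Rabs_pos_lt.
  apply: (@Rmult_lt_reg_r (Rabs h)) => //; rewrite Rmult_assoc Rinv_l; last rlra.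
  by rewrite Rmult_1_r; apply: Rle_lt_trans (re_le_Cmod _) Hq.
- have := Hr h h0 hr; set q := (X in Cmod X) => Hq.
  have -> : ((Im (G (x (t + h), y (t + h))) - Im (G (x t, y t))) / h - Im (d * (x', y')) =
     Im q / h)%R.
    by rewrite /q /Im /=; field.
  rewrite /Rdiv Rabs_mult Rabs_inv; have ah : (0 < Rabs h)%R by apply: Rabs_pos_lt.
  apply: (@Rmult_lt_reg_r (Rabs h)) => //; rewrite Rmult_assoc Rinv_l; last rlra.
  by rewrite Rmult_1_r; apply: Rle_lt_trans (im_le_Cmod _) Hq.
Qed.

End ComplexDerivative.

(** * Integrals along rays in polar coordinates *)

Definition polar (r t : R) : C := (r * cos t, r * sin t).
Definition sector (a b : R) (z : C) : Prop :=
  exists r t, 0 < r /\ a < t < b /\ z = polar r t.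
(** On the ray at angle [t] one has [dz = e^(i t) dr], so this is the integrand of the real part of
    the integral of [G dz]. *)
Definition ray (G : C -> C) (t r : R) : R := Re (Cmult (polar 1 t) (G (polar r t))).

Lemma Cmod_polar r t : 0 <= r -> Cmod (polar r t) = r.
Proof.
move=> r0; rewrite /Cmod /polar /=.
have -> : r * cos t * (r * cos t * 1) + r * sin t * (r * sin t * 1) = r ^ 2.
  have := sin2_cos2 t; rewrite /Rsqr => H.
  by transitivity (r ^ 2 * (sin t * sin t + cos t * cos t)); [ring|rewrite H; ring].
exact: sqrt_pow2.
Qed.

Lemma is_derive_mult_R (f g : R -> R) x f' g' : is_derive f x f' -> is_derive g x g' ->
  is_derive (fun t => f t * g t) x (f' * g x + f x * g').
Proof. by move=> hf hg; apply: (is_derive_mult f g x f' g' hf hg) => u v; apply: Rmult_comm. Qed.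

Lemma is_derive_minus_R (f g : R -> R) x f' g' : is_derive f x f' -> is_derive g x g' ->
  is_derive (fun t => f t - g t) x (f' - g').
Proof. exact: is_derive_minus. Qed.

Lemma is_derive_plus_R (f g : R -> R) x f' g' : is_derive f x f' -> is_derive g x g' ->
  is_derive (fun t => f t + g t) x (f' + g').
Proof. exact: is_derive_plus. Qed.

Lemma is_derive_eq (f : R -> R) x l l' : is_derive f x l -> l = l' -> is_derive f x l'.
Proof. by move=> h <-. Qed.

Section PolarDerivatives.
Variables (G G' : C -> C) (a b : R).
Hypothesis HG : hol (sector a b) G G'.

(** With [z = r e^(i t)] this is the radial derivative of [Im (z G(z))]. The angular derivative of
    [Re (e^(i t) G(z))] is its negative, because differentiating in [t] brings a factor [i r] where
    differentiating in [r] brings none. *)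
Definition ray_rate (t r : R) : R :=
  Im (Cplus (Cmult (polar 1 t) (G (polar r t)))
            (Cmult (Cmult (RtoC r) (Cmult (polar 1 t) (polar 1 t))) (G' (polar r t)))).

Lemma is_derive_ray_angle r t : 0 < r -> a < t < b ->
  is_derive (fun s => ray G s r) t (- ray_rate t r).
Proof.
move=> r0 tab.
have [d1 _] := HG (ex_intro _ r (ex_intro _ t (conj r0 (conj tab erefl)))).
have hx : is_derive (fun s => r * cos s) t (- r * sin t) by auto_derive => //; ring.
have hy : is_derive (fun s => r * sin s) t (r * cos t) by auto_derive => //; ring.
have [hr hi] := @cderiv_curve G (fun s => r * cos s) (fun s => r * sin s) t _ _ _ d1 hx hy.
have hc : is_derive cos t (- sin t) by auto_derive => //; ring.
have hs : is_derive sin t (cos t) by auto_derive => //; ring.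
have := is_derive_minus_R (is_derive_mult_R hc hr) (is_derive_mult_R hs hi).
move=> H; apply: (@is_derive_eq _ _ _ _ (is_derive_ext _ _ _ _ _ H)).
  by move=> s; rewrite /ray /polar /Re /Im /=; ring.
by rewrite /ray_rate /polar /Re /Im /=; ring.
Qed.

Lemma is_derive_ray_radius r t : 0 < r -> a < t < b ->
  is_derive (fun s => Im (Cmult (polar s t) (G (polar s t)))) r (ray_rate t r).
Proof.
move=> r0 tab.
have [d1 _] := HG (ex_intro _ r (ex_intro _ t (conj r0 (conj tab erefl)))).
have hx : is_derive (fun s => s * cos t) r (cos t) by auto_derive => //; ring.
have hy : is_derive (fun s => s * sin t) r (sin t) by auto_derive => //; ring.
have [hr hi] := @cderiv_curve G (fun s => s * cos t) (fun s => s * sin t) r _ _ _ d1 hx hy.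
have := is_derive_plus_R (is_derive_mult_R hx hi) (is_derive_mult_R hy hr).
move=> H; apply: (@is_derive_eq _ _ _ _ (is_derive_ext _ _ _ _ _ H)).
  by move=> s; rewrite /ray /polar /Re /Im /=; ring.
by rewrite /ray_rate /polar /Re /Im /=; ring.
Qed.

Lemma polar_continuity_2d r t :
  continuity_2d_pt (fun u v => v * cos u) t r /\ continuity_2d_pt (fun u v => v * sin u) t r.
Proof.
split; apply: continuity_2d_pt_mult; try exact: continuity_2d_pt_id2.
- apply: (@continuity_1d_2d_pt_comp cos (fun u _ => u)); last exact: continuity_2d_pt_id1.
  exact: continuity_cos.
- apply: (@continuity_1d_2d_pt_comp sin (fun u _ => u)); last exact: continuity_2d_pt_id1.
  exact: continuity_sin.
Qed.

Lemma ray_rate_continuity r t : 0 < r -> a < t < b -> continuity_2d_pt ray_rate t r.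
Proof.
move=> r0 tab.
have Dz : sector a b (polar r t) by exists r, t.
have [px py] := polar_continuity_2d r t.
have [g1 g2] := @ccont_comp_2d G (fun u v => v * cos u) (fun u v => v * sin u) t r (hol_ccont HG Dz) px py.
have [h1 h2] := @ccont_comp_2d G' (fun u v => v * cos u) (fun u v => v * sin u) t r (HG Dz).2 px py.
have c1 : continuity_2d_pt (fun u _ => cos u) t r.
  apply: (@continuity_1d_2d_pt_comp cos (fun u _ => u)); last exact: continuity_2d_pt_id1.
  exact: continuity_cos.
have s1 : continuity_2d_pt (fun u _ => sin u) t r.
  apply: (@continuity_1d_2d_pt_comp sin (fun u _ => u)); last exact: continuity_2d_pt_id1.
  exact: continuity_sin.
have i2 := continuity_2d_pt_id2 t r.
have E u v : (cos u * Im (G (v * cos u, v * sin u)) + sin u * Re (G (v * cos u, v * sin u))) +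
   v * ((cos u * cos u - sin u * sin u) * Im (G' (v * cos u, v * sin u)) +
        (cos u * sin u + sin u * cos u) * Re (G' (v * cos u, v * sin u))) = ray_rate u v.
  by rewrite /ray_rate /polar /Re /Im /=; ring.
apply: continuity_2d_pt_ext E _.
by repeat first [assumption | apply: continuity_2d_pt_plus | apply: continuity_2d_pt_mult
  | apply: continuity_2d_pt_opp].
Qed.

Lemma continuity_2d_pt_snd (f : R -> R -> R) x y :
  continuity_2d_pt f x y -> continuous (f x) y.
Proof.
move=> H; apply/continuity_pt_filterlim/continuity_pt_locally => e.
have [d Hd] := H e; exists d => v hv; apply: Hd => //.
by rewrite Rminus_diag Rabs_R0; apply: cond_pos.
Qed.

Lemma ray_continuous r t : 0 < r -> a < t < b -> continuous (ray G t) r.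
Proof.
move=> r0 tab.
have Dz : sector a b (polar r t) by exists r, t.
have [px py] := polar_continuity_2d r t.
have [g1 g2] := @ccont_comp_2d G (fun u v => v * cos u) (fun u v => v * sin u) t r (hol_ccont HG Dz) px py.
apply: (@continuous_ext _ _ (fun v => cos t * Re (G (v * cos t, v * sin t)) -
                                     sin t * Im (G (v * cos t, v * sin t)))).
  by move=> v; rewrite /ray /polar /Re /Im /=; ring.
apply: (@continuous_minus _ R_AbsRing R_NormedModule).
- apply: (@continuous_scal_r _ R_AbsRing R_NormedModule (cos t)).
  exact: (continuity_2d_pt_snd g1).
- apply: (@continuous_scal_r _ R_AbsRing R_NormedModule (sin t)).
  exact: (continuity_2d_pt_snd g2).
Qed.

(** Under the integral sign the angular derivative becomes an exact radial derivative, so only the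
    two end points contribute. This is Cauchy's theorem in infinitesimal form. *)
Lemma is_derive_ray_integral p q t : 0 < p < q -> a < t < b ->
  is_derive (fun s => RInt (ray G s) p q) t
    (- (Im (Cmult (polar q t) (G (polar q t))) - Im (Cmult (polar p t) (G (polar p t))))).
Proof.
move=> pq tab.
have dtab : 0 < Rmin (t - a) (b - t) by apply: Rmin_glb_lt; rlra.
have near P : (forall s, a < s < b -> P s) -> locally t P.
  move=> HP; exists (mkposreal _ dtab) => s hs; apply: HP.
  have {}hs : Rabs (s - t) < Rmin (t - a) (b - t) := hs.
  have := Rlt_le_trans _ _ _ hs (Rmin_l _ _); have := Rlt_le_trans _ _ _ hs (Rmin_r _ _).
  by move=> /Rabs_def2 ? /Rabs_def2 ?; rlra.
have pq' r : Rmin p q <= r <= Rmax p q -> 0 < r by rewrite Rmin_left; rlra.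
have D s r : a < s < b -> 0 < r -> Derive (fun u => ray G u r) s = - ray_rate s r.
  by move=> hs r0; apply: is_derive_unique; apply: is_derive_ray_angle.
have := @is_derive_RInt_param (fun s r => ray G s r) p q t.
move=> H; apply: (is_derive_eq (H _ _ _)).
- apply: near => s hs r /pq' r0; exists (- ray_rate s r); exact: is_derive_ray_angle.
- move=> r /pq' r0.
  apply: (@continuity_2d_pt_ext_loc (fun u v => - ray_rate u v)).
    have d0 : 0 < Rmin (Rmin (t - a) (b - t)) r by apply: Rmin_glb_lt.
    exists (mkposreal _ d0) => u v /= hu hv.
    have := Rlt_le_trans _ _ _ hu (Rmin_l _ _).
    move=> hu2; have := Rlt_le_trans _ _ _ hu2 (Rmin_l _ _).
    have := Rlt_le_trans _ _ _ hu2 (Rmin_r _ _); have := Rlt_le_trans _ _ _ hv (Rmin_r _ _).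
    by move=> /Rabs_def2 ? /Rabs_def2 ? /Rabs_def2 ?; rewrite D //; rlra.
  by apply: continuity_2d_pt_opp; apply: ray_rate_continuity.
- apply: near => s hs; apply: (@ex_RInt_continuous R_CompleteNormedModule) => r /pq' r0.
  exact: ray_continuous.
- rewrite (@RInt_ext R_CompleteNormedModule _ (fun r => opp (ray_rate t r))); last first.
    by move=> r hr; apply: D => //; apply: pq'; rlra.
  rewrite RInt_opp; last first.
    apply: (@ex_RInt_continuous R_CompleteNormedModule) => r /pq' r0.
    exact: (continuity_2d_pt_snd (ray_rate_continuity r0 tab)).
  rewrite /opp /=; congr (- _); apply: is_RInt_unique.
  apply: (@is_RInt_derive R_CompleteNormedModule
    (fun s => Im (Cmult (polar s t) (G (polar s t)))) (ray_rate t)) => r /pq' r0.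
    exact: is_derive_ray_radius.
  exact: (continuity_2d_pt_snd (ray_rate_continuity r0 tab)).
Qed.

(** The mean value theorem in the angle takes the place of the integrals over the two arcs; [K]
    bounds both end point terms together. *)
Lemma ray_integral_diff p q t1 t2 K : 0 < p < q -> a < t1 -> t1 <= t2 -> t2 < b ->
  (forall t, t1 <= t <= t2 -> q * Cmod (G (polar q t)) + p * Cmod (G (polar p t)) <= K) ->
  Rabs (RInt (ray G t2) p q - RInt (ray G t1) p q) <= K * (t2 - t1).
Proof.
move=> pq at1 t12 t2b HK.
have [] := MVT_gen (fun s => RInt (ray G s) p q) t1 t2 (fun t =>
  - (Im (Cmult (polar q t) (G (polar q t))) - Im (Cmult (polar p t) (G (polar p t))))).
- by rewrite Rmin_left ?Rmax_right // => t ht; apply: is_derive_ray_integral => //; rlra.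
- rewrite Rmin_left ?Rmax_right // => t ht; have h : a < t < b by rlra.
  apply/continuity_pt_filterlim.
  have D := is_derive_ray_integral pq h.
  exact: (@ex_derive_continuous R_AbsRing R_NormedModule _ _ (ex_intro _ _ D)).
move=> t [ht ->]; rewrite Rmin_left // Rmax_right // in ht.
rewrite Rabs_mult (Rabs_pos_eq (t2 - t1)); last rlra.
apply: Rmult_le_compat_r; first rlra.
apply: Rle_trans (HK t ht); rewrite Rabs_Ropp.
have b1 := im_le_Cmod (Cmult (polar q t) (G (polar q t))).
have b2 := im_le_Cmod (Cmult (polar p t) (G (polar p t))).
rewrite Cmod_mult Cmod_polar in b1; last rlra.
rewrite Cmod_mult Cmod_polar in b2; last rlra.
apply: Rle_trans (Rabs_triang _ _) _; rewrite Rabs_Ropp; rlra.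
Qed.

End PolarDerivatives.

(** * Cauchy's theorem in a sector *)

Section SectorCauchy.
Variables (a b : R).
Hypotheses (a_lb : - PI < a) (b_ub : b < PI).

Lemma ray_le_Cmod G t r : Rabs (ray G t r) <= Cmod (G (polar r t)).
Proof.
apply: Rle_trans (re_le_Cmod _) _; rewrite Cmod_mult Cmod_polar; last rlra.
by rlra.
Qed.

(** If [r |G|] tends to 0 uniformly in the angle at both ends, the bound of [ray_integral_diff]
    vanishes in the limit. *)
Lemma sector_cauchy_decay G G' t1 t2 (I1 I2 : R) :
  hol (sector a b) G G' -> a < t1 -> t1 <= t2 -> t2 < b ->
  (forall e, 0 < e -> exists p q, 0 < p /\ forall r t, 0 < r -> (r <= p \/ q <= r) ->
     t1 <= t <= t2 -> r * Cmod (G (polar r t)) <= e) ->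
  zinf (ray G t1) I1 -> zinf (ray G t2) I2 -> I1 = I2.
Proof.
move=> HG at1 t12 t2b dec H1 H2.
have c1 r : 0 < r -> continuous (ray G t1) r by move=> r0; apply: (ray_continuous HG); rlra.
have c2 r : 0 < r -> continuous (ray G t2) r by move=> r0; apply: (ray_continuous HG); rlra.
have key e : 0 < e -> Rabs (I1 - I2) <= e.
  move=> e0; have e4 : 0 < e / 4 by rlra.
  have em : 0 < e / 4 / (t2 - t1 + 1) by apply: Rdiv_lt_0_compat; rlra.
  have [p [q [p0 Hpq]]] := dec _ em.
  have [p1 [q1 [p10 [q10 K1]]]] := proj1 (@is_RInt_zinfP R_CompleteNormedModule _ _ c1) H1 _ e4.
  have [p2 [q2 [p20 [q20 K2]]]] := proj1 (@is_RInt_zinfP R_CompleteNormedModule _ _ c2) H2 _ e4.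
  pose x := Rmin p (Rmin p1 p2) / 2; pose y := Rmax q (Rmax q1 q2) + x + 1.
  have m0 : 0 < Rmin p (Rmin p1 p2) by apply: Rmin_glb_lt => //; apply: Rmin_glb_lt.
  have x0 : 0 < x by rewrite /x; rlra.
  have xm : x < Rmin p (Rmin p1 p2) by rewrite /x; rlra.
  have := Rmin_l p (Rmin p1 p2); have := Rmin_r p (Rmin p1 p2).
  have := Rmin_l p1 p2; have := Rmin_r p1 p2 => ? ? ? ?.
  have := Rmax_l q (Rmax q1 q2); have := Rmax_r q (Rmax q1 q2).
  have := Rmax_l q1 q2; have := Rmax_r q1 q2 => ? ? ? ?.
  have xy : 0 < x < y by rewrite /y; rlra.
  have L1 : Rabs (RInt (ray G t1) x y - I1) < e / 4 by apply: K1; rewrite ?/y; rlra.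
  have L2 : Rabs (RInt (ray G t2) x y - I2) < e / 4 by apply: K2; rewrite ?/y; rlra.
  have := @ray_integral_diff G G' a b HG x y t1 t2 (e / 4 / (t2 - t1 + 1) + e / 4 / (t2 - t1 + 1)) xy at1 t12 t2b.
  move=> L3; have {}L3 := L3 (fun t ht => Rplus_le_compat _ _ _ _
     (Hpq y t _ (or_intror _) ht) (Hpq x t x0 (or_introl _) ht)).
  have {}L3 : Rabs (RInt (ray G t2) x y - RInt (ray G t1) x y) <= e / 2.
    apply: Rle_trans (L3 _ _ _) _; rewrite ?/y; try rlra.
    apply: (@Rle_trans _ ((e / 4 / (t2 - t1 + 1) + e / 4 / (t2 - t1 + 1)) * (t2 - t1 + 1))).
      by apply: Rmult_le_compat_l; rlra.
    by apply: Req_le; field; rlra.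
  move: L1 L2 L3 => /Rabs_def2 ? /Rabs_def2 ? /Rabs_le_between ?.
  by apply: Rabs_le; rlra.
apply: Rminus_diag_uniq; apply: NNPP => /Rabs_pos_lt h.
by have := key (Rabs (I1 - I2) / 2); rlra.
Qed.

(** The poles [- e] and [- 1 / e] lie on the negative real axis, outside every sector between [- PI]
    and [PI]. *)
Definition regulator (e : R) (z : C) : C :=
  Cmult (Cmult z (Cinv (Cplus (RtoC e) z))) (Cinv (Cplus (RtoC 1) (Cmult (RtoC e) z))).

Lemma shift_polar_neq0 c r t : 0 < c -> 0 < r -> - PI < t < PI ->
  Cplus (RtoC c) (polar r t) <> RtoC 0.
Proof.
move=> c0 r0 tp E.
have E1 : c + r * cos t = 0 := congr1 fst E.
have : 0 + r * sin t = 0 := congr1 snd E.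
rewrite Rplus_0_l => /Rmult_integral [|s0]; first rlra.
case: (Rtotal_order t 0) => [tn|[t0|tn]].
- have : 0 < sin (- t) by apply: sin_gt_0; rlra.
  by rewrite sin_neg; rlra.
- by move: E1; rewrite t0 cos_0; rlra.
- have : 0 < sin t by apply: sin_gt_0; rlra.
  by rlra.
Qed.

Lemma scaled_polar_neq0 e r t : 0 < e -> 0 < r -> - PI < t < PI ->
  Cplus (RtoC 1) (Cmult (RtoC e) (polar r t)) <> RtoC 0.
Proof.
move=> e0 r0 tp; have -> : Cmult (RtoC e) (polar r t) = polar (e * r) t.
  by rewrite /polar /Cmult /=; congr pair; ring.
by apply: shift_polar_neq0 => //; [rlra|apply: Rmult_lt_0_compat].
Qed.

Lemma hol_regulator e : 0 < e -> holo (sector a b) (regulator e).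
Proof.
move=> e0; apply: holo_mult; first apply: holo_mult.
- exact: holo_id.
- apply: holo_inv; first by apply: holo_plus; [apply: holo_const|apply: holo_id].
  by move=> _ [r [t [r0 [tab ->]]]]; apply: shift_polar_neq0 => //; rlra.
- apply: holo_inv.
    by apply: holo_plus; [apply: holo_const|apply: holo_mult; [apply: holo_const|apply: holo_id]].
  by move=> _ [r [t [r0 [tab ->]]]]; apply: scaled_polar_neq0 => //; rlra.
Qed.

(** In the right half-plane the cross term [2 c r cos t] of [|c + z|^2] is nonnegative. *)
Lemma Cmod_shift_polar c r t : 0 <= c -> 0 <= r -> - (PI / 2) <= t <= PI / 2 ->
  Rmax c r <= Cmod (Cplus (RtoC c) (polar r t)).
Proof.
move=> c0 r0 tp; have cs : 0 <= cos t by apply: cos_ge_0; rlra.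
have E : Cmod (Cplus (RtoC c) (polar r t)) ^ 2 = c ^ 2 + r ^ 2 + 2 * (c * r) * cos t.
  rewrite Cmod2_alt /Re /Im /polar /=.
  have := sin2_cos2 t; rewrite /Rsqr => H.
  transitivity (c ^ 2 + r ^ 2 * (sin t * sin t + cos t * cos t) + 2 * (c * r) * cos t); first ring.
  by rewrite H; ring.
have p0 : 0 <= 2 * (c * r) * cos t by have := Rmult_le_pos _ _ c0 r0; nra.
apply: Rmax_lub.
- by apply: Rsqr_incr_0_var; [rewrite /Rsqr; nra|apply: Cmod_ge_0].
- by apply: Rsqr_incr_0_var; [rewrite /Rsqr; nra|apply: Cmod_ge_0].
Qed.

(* [z / ((e + z) (1 + e z))] tends to 1 as [e -> 0] and makes an integrand
   bounded by [M / |z|] decay at 0 and at infinity. *)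
Section RegulatorBounds.
Variables (e r t : R).
Hypotheses (e0 : 0 < e) (r0 : 0 < r) (tp : - (PI / 2) <= t <= PI / 2).

Let A := Cmod (Cplus (RtoC e) (polar r t)).
Let B := Cmod (Cplus (RtoC 1) (Cmult (RtoC e) (polar r t))).

Let A_ge : e <= A /\ r <= A.
Proof.
have := @Cmod_shift_polar e r t (Rlt_le _ _ e0) (Rlt_le _ _ r0) tp.
by have := Rmax_l e r; have := Rmax_r e r; rewrite -/A; rlra.
Qed.

Let B_ge : 1 <= B /\ e * r <= B.
Proof.
have E : Cmult (RtoC e) (polar r t) = polar (e * r) t.
  by rewrite /polar /Cmult /=; congr pair; ring.
have er : 0 <= e * r by have := Rmult_lt_0_compat _ _ e0 r0; rlra.
have := @Cmod_shift_polar 1 (e * r) t Rle_0_1 er tp.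
by have := Rmax_l 1 (e * r); have := Rmax_r 1 (e * r); rewrite -E -/B; rlra.
Qed.

Let neqs : Cplus (RtoC e) (polar r t) <> RtoC 0 /\
  Cplus (RtoC 1) (Cmult (RtoC e) (polar r t)) <> RtoC 0.
Proof.
have := PI_RGT_0 => pi0.
by split; [apply: shift_polar_neq0|apply: scaled_polar_neq0] => //; rlra.
Qed.

Lemma Cmod_regulatorE : Cmod (regulator e (polar r t)) = r / A / B.
Proof.
have [n1 n2] := neqs.
by rewrite /regulator !Cmod_mult !Cmod_inv // Cmod_polar //; rlra.
Qed.

Lemma Cmod_regulator_le1 : Cmod (regulator e (polar r t)) <= 1.
Proof.
rewrite Cmod_regulatorE; have [a1 a2] := A_ge; have [b1 b2] := B_ge.
apply: (@Rmult_le_reg_r (A * B)); first nra.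
have -> : r / A / B * (A * B) = r by field; rlra.
nra.
Qed.

Lemma Cmod_regulator_small : Cmod (regulator e (polar r t)) <= r / e.
Proof.
rewrite Cmod_regulatorE; have [a1 a2] := A_ge; have [b1 b2] := B_ge.
apply: (@Rmult_le_reg_r (A * B * e)); first by apply: Rmult_lt_0_compat => //; nra.
have -> : r / A / B * (A * B * e) = r * e by field; rlra.
have -> : r / e * (A * B * e) = r * (A * B) by field; rlra.
by apply: Rmult_le_compat_l; nra.
Qed.

Lemma Cmod_regulator_large : Cmod (regulator e (polar r t)) <= / (e * r).
Proof.
rewrite Cmod_regulatorE; have [a1 a2] := A_ge; have [b1 b2] := B_ge.
have er := Rmult_lt_0_compat _ _ e0 r0.
apply: (@Rmult_le_reg_r (A * B * (e * r))).
  by apply: Rmult_lt_0_compat => //; nra.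
have -> : r / A / B * (A * B * (e * r)) = r * (e * r) by field; rlra.
have -> : / (e * r) * (A * B * (e * r)) = A * B by field; rlra.
by apply: Rmult_le_compat; rlra.
Qed.

(** [1 - z / ((e + z) (1 + e z))] has the numerator [e + e^2 z + e z^2], and the two factors of the
    denominator are at least [r] and 1. *)
Lemma Cmod_regulator_near1 :
  Cmod (Cminus (RtoC 1) (regulator e (polar r t))) <= e * (1 + e * r + r ^ 2) / r.
Proof.
have [n1 n2] := neqs; have [a1 a2] := A_ge; have [b1 b2] := B_ge.
have zr : Cmod (polar r t) = r by apply: Cmod_polar; rlra.
set z := polar r t in n1 n2 zr *.
have -> : Cminus (RtoC 1) (regulator e z) =
  Cmult (Cplus (RtoC e) (Cplus (Cmult (Cmult (RtoC e) (RtoC e)) z) (Cmult (RtoC e) (Cmult z z))))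
        (Cmult (Cinv (Cplus (RtoC e) z)) (Cinv (Cplus (RtoC 1) (Cmult (RtoC e) z)))).
  by rewrite /regulator; field.
rewrite !Cmod_mult !Cmod_inv // -/A -/B.
have h : Cmod (Cplus (RtoC e) (Cplus (Cmult (Cmult (RtoC e) (RtoC e)) z) (Cmult (RtoC e) (Cmult z z))))
    <= e * (1 + e * r + r ^ 2).
  apply: Rle_trans (Cmod_triangle _ _) _.
  have := Cmod_triangle (Cmult (Cmult (RtoC e) (RtoC e)) z) (Cmult (RtoC e) (Cmult z z)).
  rewrite !Cmod_mult !Cmod_R zr Rabs_pos_eq; last rlra.
  by move=> H; apply: Rle_trans (Rplus_le_compat_l _ _ _ H) _; apply: Req_le; ring.
apply: (@Rle_trans _ (e * (1 + e * r + r ^ 2) * (/ A * / B))).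
  apply: Rmult_le_compat_r h; apply: Rmult_le_pos; apply: Rlt_le; apply: Rinv_0_lt_compat; rlra.
apply: Rmult_le_compat_l; first by have := Cmod_ge_0 (Cplus (RtoC e) (Cplus (Cmult (Cmult (RtoC e) (RtoC e)) z) (Cmult (RtoC e) (Cmult z z)))); rlra.
rewrite -Rinv_mult; apply: Rinv_le_contravar => //; nra.
Qed.

End RegulatorBounds.

Lemma Cmod_ray_continuous G G' r t : hol (sector a b) G G' -> a < t < b -> 0 < r ->
  continuous (fun r => Cmod (G (polar r t))) r.
Proof.
move=> HG tab r0.
have Dz : sector a b (polar r t) by exists r, t.
have cG := hol_ccont HG Dz.
apply/continuity_pt_filterlim/continuity_pt_locally => e.
have [d [d0 Hd]] := cG e (cond_pos e).
exists (mkposreal _ d0) => s hs.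
have {}hs : Rabs (s - r) < d := hs.
have h : Cmod (Cminus (polar s t) (polar r t)) < d.
  rewrite (_ : Cminus (polar s t) (polar r t) = Cmult (RtoC (s - r)) (polar 1 t)).
    by rewrite Cmod_mult Cmod_R Cmod_polar; rlra.
  by rewrite /polar /Cminus /Cmult /Cplus /Copp /=; congr pair; ring.
have := Hd _ h; set u := G (polar s t); set v := G (polar r t) => uv.
apply: Rle_lt_trans uv; apply: Rabs_le.
have := Cmod_triangle (Cminus u v) v; have := Cmod_triangle (Cminus v u) u.
rewrite (Cmod_sub_sym v u).
have -> : Cplus (Cminus u v) v = u by ring.
have -> : Cplus (Cminus v u) u = v by ring.
rlra.
Qed.

(** Dominated convergence by hand: [1 - regulator] is at most 2 on the tails and of order [e] on
    [[p, q]]. The errors are [d / 8] for each tail, [d / 2] for the middle and [d / 4] for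
    truncating the improper integral. *)
Lemma regulated_close G G' t I d : hol (sector a b) G G' -> a < t < b ->
  - (PI / 2) <= t <= PI / 2 ->
  abs_int (fun r => Cmod (G (polar r t)) : R_NormedModule) ->
  zinf (ray G t) I -> 0 < d ->
  exists e0, 0 < e0 /\ forall e J, 0 < e < e0 ->
    zinf (ray (fun z => Cmult (regulator e z) (G z)) t) J -> Rabs (I - J) <= d.
Proof.
move=> HG tab tp hG HI d0.
have d16 : 0 < d / 16 by rlra.
have [p [q [pq tail]]] := abs_int_tail hG d16.
set c := (fun r => Cmod _) in hG tail.
have cc := hG.1.
set S := RInt (fun r => norm (c r : R_NormedModule)) p q.
have S0 : 0 <= S by apply: RInt_norm_ge0 => //; rlra.
(* For [e < 1] this bounds [(1 + e r + r^2) / r] on [[p, q]]. *)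
pose w := (1 + q + q ^ 2) / p.
have q2 : 0 <= q ^ 2 by apply: pow2_ge_0.
have w0 : 0 < w by apply: Rdiv_lt_0_compat; rlra.
have k0 : 0 < d / 2 / (w * (S + 1)).
  by apply: Rdiv_lt_0_compat; [rlra|apply: Rmult_lt_0_compat; rlra].
exists (Rmin 1 (d / 2 / (w * (S + 1)))); split; first by apply: Rmin_glb_lt; rlra.
move=> e J [e0 elt] HJ.
have e1 := Rlt_le_trans _ _ _ elt (Rmin_l _ _).
have e2 := Rlt_le_trans _ _ _ elt (Rmin_r _ _).
pose D r := ray G t r - ray (fun z => Cmult (regulator e z) (G z)) t r.
have DE r : D r = ray (fun z => Cmult (Cminus (RtoC 1) (regulator e z)) (G z)) t r.
  by rewrite /D /ray /Re /=; ring.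
have Dle r m : Cmod (Cminus (RtoC 1) (regulator e (polar r t))) <= m ->
    norm (D r : R_NormedModule) <= m * c r.
  move=> hm; rewrite DE; apply: Rle_trans (ray_le_Cmod _ _ _) _.
  by rewrite Cmod_mult; apply: Rmult_le_compat_r => //; apply: Cmod_ge_0.
have cn r : norm (c r : R_NormedModule) = c r.
  by rewrite /norm /= /abs /= Rabs_pos_eq //; apply: Cmod_ge_0.
have [h' Hh] := hol_regulator e0.
have HhG := hol_mult Hh HG.
have cD r : 0 < r -> continuous (D : R -> R_NormedModule) r.
  move=> r0; apply: (@continuous_minus _ R_AbsRing R_NormedModule).
    exact: (ray_continuous HG).
  exact: (ray_continuous HhG).
have HD : zinf (D : R -> R_NormedModule) (I - J) by apply: is_RInt_gen_minus.
have d4 : 0 < d / 4 by rlra.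
have [x1 [y1 [x10 [y10 HD2]]]] := proj1 (@is_RInt_zinfP R_CompleteNormedModule _ _ cD) HD _ d4.
pose x := Rmin x1 p / 2; pose y := Rmax y1 q + 1.
have mm : 0 < Rmin x1 p by apply: Rmin_glb_lt; rlra.
have xx1 : 0 < x < x1 by rewrite /x; have := Rmin_l x1 p; rlra.
have xp : 0 < x < p by rewrite /x; have := Rmin_r x1 p; rlra.
have yy1 : y1 < y by rewrite /y; have := Rmax_l y1 q; rlra.
have yq : q < y by rewrite /y; have := Rmax_r y1 q; rlra.
have L : Rabs (RInt D x y - (I - J)) < d / 4 by apply: HD2.
have nD u v m k : 0 < u <= v -> 0 <= m ->
    (forall r, u <= r <= v -> Cmod (Cminus (RtoC 1) (regulator e (polar r t))) <= m) ->
    RInt (fun r => norm (c r : R_NormedModule)) u v <= k ->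
    RInt (fun r => norm (D r : R_NormedModule)) u v <= m * k.
  move=> uv m0 hm hk.
  apply: (@Rle_trans _ (RInt (fun r => m * norm (c r : R_NormedModule)) u v)).
    apply: RInt_le; first rlra.
    - by apply: ex_RInt_norm => //; rlra.
    - apply: (@ex_RInt_scal R_NormedModule (fun r => norm (c r : R_NormedModule)) u v m).
      by apply: ex_RInt_norm => //; rlra.
    - by move=> r hr; rewrite cn; apply: Dle; apply: hm; rlra.
  have := RInt_scal (V := R_CompleteNormedModule) (fun r => norm (c r : R_NormedModule)) u v m.
  rewrite /scal /= /mult /= => ->; last by apply: ex_RInt_norm => //; rlra.
  exact: Rmult_le_compat_l.
have m2 r : 0 < r -> Cmod (Cminus (RtoC 1) (regulator e (polar r t))) <= 2.
  move=> r0; have := Cmod_regulator_le1 e0 r0 tp.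
  have := Cmod_triangle (RtoC 1) (Copp (regulator e (polar r t))).
  by rewrite Cmod_opp Cmod_1 -/(Cminus _ _); rlra.
have B1 : RInt (fun r => norm (D r : R_NormedModule)) x p <= 2 * (d / 16).
  apply: nD; try rlra; first by move=> r hr; apply: m2; rlra.
  by apply: tail; [rlra|left; rlra].
have B3 : RInt (fun r => norm (D r : R_NormedModule)) q y <= 2 * (d / 16).
  apply: nD; try rlra; first by move=> r hr; apply: m2; rlra.
  by apply: tail; [rlra|right; rlra].
have B2 : RInt (fun r => norm (D r : R_NormedModule)) p q <= (e * w) * S.
  apply: nD; [rlra|by apply: Rmult_le_pos; rlra| |exact: Rle_refl].
  move=> r hr; have r0 : 0 < r by rlra.
  apply: Rle_trans (Cmod_regulator_near1 e0 r0 tp) _.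
  rewrite /Rdiv Rmult_assoc; apply: Rmult_le_compat_l; first rlra.
  apply: Rmult_le_compat; try (apply: Rlt_le; apply: Rinv_0_lt_compat; rlra).
  - by have := pow2_ge_0 r; nra.
  - by nra.
  - by apply: Rinv_le_contravar; rlra.
have B2' : (e * w) * S <= d / 2.
  have ew : 0 <= e * w by apply: Rmult_le_pos; rlra.
  apply: (@Rle_trans _ (e * w * (S + 1))); first by apply: Rmult_le_compat_l; rlra.
  have -> : d / 2 = d / 2 / (w * (S + 1)) * (w * (S + 1)) by field; rlra.
  rewrite Rmult_assoc; apply: Rmult_le_compat_r; last rlra.
  by apply: Rmult_le_pos; rlra.
have T : Rabs (RInt D x y) <= d / 16 * 4 + d / 2.
  apply: Rle_trans (@RInt_norm_bound R_CompleteNormedModule D x y cD _) _; first rlra.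
  have [p0 [q0 [x0 y0]]] : 0 < p /\ 0 < q /\ 0 < x /\ 0 < y by rlra.
  have := RInt_norm_Chasles cD x0 p0 y0; have := RInt_norm_Chasles cD p0 q0 y0.
  by move=> <- <-; rlra.
move: L T => /Rabs_def2 ? /Rabs_le_between ?; apply: Rabs_le; rlra.
Qed.

(** A bound on [r |G|] does not make the arcs small. The regulator adds decay at both ends, and
    [regulated_close] removes it in the limit; the angles stay in the right half-plane, where its
    modulus is at most 1. *)
Lemma sector_cauchy G G' t1 t2 M (I1 I2 : R) :
  hol (sector a b) G G' -> a < t1 -> t1 <= t2 -> t2 < b ->
  - (PI / 2) <= t1 -> t2 <= PI / 2 ->
  (forall r t, 0 < r -> t1 <= t <= t2 -> r * Cmod (G (polar r t)) <= M) ->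
  abs_int (fun r => Cmod (G (polar r t1)) : R_NormedModule) ->
  abs_int (fun r => Cmod (G (polar r t2)) : R_NormedModule) ->
  zinf (ray G t1) I1 -> zinf (ray G t2) I2 -> I1 = I2.
Proof.
move=> HG at1 t12 t2b t1p t2p HM A1 A2 H1 H2.
have tab1 : a < t1 < b by rlra.
have tab2 : a < t2 < b by rlra.
have tp1 : - (PI / 2) <= t1 <= PI / 2 by rlra.
have tp2 : - (PI / 2) <= t2 <= PI / 2 by rlra.
have M0 : 0 <= M.
  have := HM 1 t1 Rlt_0_1 (conj (Rle_refl _) t12).
  by have := Cmod_ge_0 (G (polar 1 t1)); rlra.
have key d : 0 < d -> Rabs (I1 - I2) <= d.
  move=> d0; have d2 : 0 < d / 2 by rlra.
  have [e1 [e10 K1]] := regulated_close HG tab1 tp1 A1 H1 d2.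
  have [e2 [e20 K2]] := regulated_close HG tab2 tp2 A2 H2 d2.
  pose e := Rmin e1 e2 / 2.
  have m0 : 0 < Rmin e1 e2 by apply: Rmin_glb_lt.
  have e0 : 0 < e by rewrite /e; rlra.
  have [h' Hh] := hol_regulator e0.
  have HhG := hol_mult Hh HG.
  have ex t : a < t < b -> - (PI / 2) <= t <= PI / 2 ->
      abs_int (fun r => Cmod (G (polar r t)) : R_NormedModule) ->
      exists J : R, zinf (ray (fun z => Cmult (regulator e z) (G z)) t) J.
    move=> tab tp hA; apply: (@abs_int_cvg R_CompleteNormedModule).
    apply: (@abs_int_le R_NormedModule R_NormedModule _ _ 1) hA _.
      by move=> r r0; apply: (ray_continuous HhG).
    move=> r r0; apply: Rle_trans (ray_le_Cmod _ _ _) _.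
    rewrite Cmod_mult /norm /= /abs /= Rabs_pos_eq; last exact: Cmod_ge_0.
    apply: Rmult_le_compat_r; first exact: Cmod_ge_0.
    exact: Cmod_regulator_le1.
  have [J1 HJ1] := ex t1 tab1 tp1 A1; have [J2 HJ2] := ex t2 tab2 tp2 A2.
  have E : J1 = J2.
    apply: (sector_cauchy_decay HhG at1 t12 t2b _ HJ1 HJ2) => k k0.
    (* The radii come from [|regulator| <= r / e] near 0 and [|regulator| <= 1 / (e r)] at infinity,
       each multiplied by [M]. *)
    pose q := M / (e * k) + 1.
    exists (e * k / (M + 1)), q; split.
      by apply: Rdiv_lt_0_compat; [apply: Rmult_lt_0_compat|rlra].
    move=> r t r0 hr ht; have tp : - (PI / 2) <= t <= PI / 2 by rlra.
    rewrite Cmod_mult.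
    have hM := HM r t r0 ht; have G0 := Cmod_ge_0 (G (polar r t)).
    have h0 := Cmod_ge_0 (regulator e (polar r t)).
    have -> : r * (Cmod (regulator e (polar r t)) * Cmod (G (polar r t))) =
       Cmod (regulator e (polar r t)) * (r * Cmod (G (polar r t))) by ring.
    apply: (@Rle_trans _ (Cmod (regulator e (polar r t)) * M)); first exact: Rmult_le_compat_l.
    have ek := Rmult_lt_0_compat _ _ e0 k0.
    case: hr => hr.
    - have h := Cmod_regulator_small e0 r0 tp.
      apply: (@Rle_trans _ (r / e * M)); first exact: Rmult_le_compat_r.
      apply: (@Rle_trans _ (e * k / (M + 1) / e * (M + 1))); last by apply: Req_le; field; rlra.
      have re : 0 < / e by apply: Rinv_0_lt_compat.
      apply: Rmult_le_compat; [|rlra| |rlra].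
        by apply: Rmult_le_pos; rlra.
      by apply: Rmult_le_compat_r hr; rlra.
    - have h := Cmod_regulator_large e0 r0 tp.
      apply: (@Rle_trans _ (/ (e * r) * M)); first exact: Rmult_le_compat_r.
      have er := Rmult_lt_0_compat _ _ e0 r0.
      apply: (@Rmult_le_reg_l (e * r)) => //.
      have -> : e * r * (/ (e * r) * M) = M by field; rlra.
      apply: (@Rle_trans _ (e * k * q)).
        by rewrite /q; have -> : e * k * (M / (e * k) + 1) = M + e * k by [field; rlra]; rlra.
      have -> : e * r * k = e * k * r by ring.
      by apply: Rmult_le_compat_l; rlra.
  have b1 : 0 < e < e1 by rewrite /e; have := Rmin_l e1 e2; rlra.
  have b2 : 0 < e < e2 by rewrite /e; have := Rmin_r e1 e2; rlra.
  have := K1 e J1 b1 HJ1; have := K2 e J2 b2 HJ2; rewrite E.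
  by move=> /Rabs_le_between ? /Rabs_le_between ?; apply: Rabs_le; rlra.
apply: Rminus_diag_uniq; apply: NNPP => /Rabs_pos_lt h.
by have := key (Rabs (I1 - I2) / 2); rlra.
Qed.

End SectorCauchy.

(** * Cauchy's theorem in the left half-plane *)

Section LeftHalfPlane.

Lemma ccont_reflect (G : C -> C) z : ccont G (Copp z) -> ccont (fun w => G (Copp w)) z.
Proof.
move=> H e /H [d [d0 Hd]]; exists d; split=> // w wz; apply: Hd.
by rewrite (_ : Cminus (Copp w) (Copp z) = Copp (Cminus w z)) ?Cmod_opp //; ring.
Qed.

Lemma hol_reflect (D : C -> Prop) G G' : hol D G G' ->
  hol (fun z => D (Copp z)) (fun z => G (Copp z)) (fun z => Copp (G' (Copp z))).
Proof.
move=> HG z /HG [h1 h2]; split.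
- move=> e /h1 [r [r0 Hr]]; exists r; split=> // w wz.
  have E : Cmod (Cminus (Copp w) (Copp z)) = Cmod (Cminus w z).
    by rewrite -(Cmod_opp (Cminus w z)); congr Cmod; ring.
  have := Hr (Copp w); rewrite E => /(_ wz).
  set u := Cminus _ _; set v := Cminus (Cminus _ _) (Cmult (Copp _) _).
  by have -> : u = v by [rewrite /u /v; ring].
- move=> e /(ccont_reflect h2) [d [d0 Hd]]; exists d; split=> // w /Hd.
  set u := Cminus _ _; set v := Cminus _ _ => h.
  by rewrite (_ : v = Copp u) ?Cmod_opp // /u /v; ring.
Qed.

Lemma polar_add_pi r t : polar r (t + PI) = Copp (polar r t).
Proof. by rewrite /polar neg_cos neg_sin /Copp /=; congr pair; ring. Qed.

Lemma polar_sub_pi r t : polar r (t - PI) = Copp (polar r t).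
Proof.
by rewrite -{2}[t](_ : t - PI + PI = t); [rewrite polar_add_pi; ring|ring].
Qed.

Lemma ray_reflect G t r : ray (fun z => G (Copp z)) (t - PI) r = - ray G t r.
Proof.
rewrite /ray !polar_sub_pi.
have -> : Copp (Copp (polar r t)) = polar r t by ring.
by rewrite /Re /=; ring.
Qed.

(** The map [z -> - z] leads back to the right half-plane. It changes the sign of [dz], hence of
    both integrals. *)
Lemma sector_cauchy_left (a b : R) G G' t1 t2 M (I1 I2 : R) :
  0 < a -> b < 2 * PI ->
  hol (sector a b) G G' -> a < t1 -> t1 <= t2 -> t2 < b ->
  PI / 2 <= t1 -> t2 <= 3 * (PI / 2) ->
  (forall r t, 0 < r -> t1 <= t <= t2 -> r * Cmod (G (polar r t)) <= M) ->
  abs_int (fun r => Cmod (G (polar r t1)) : R_NormedModule) ->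
  abs_int (fun r => Cmod (G (polar r t2)) : R_NormedModule) ->
  zinf (ray G t1) I1 -> zinf (ray G t2) I2 -> I1 = I2.
Proof.
move=> a0 b2 HG at1 t12 t2b t1p t2p HM A1 A2 H1 H2.
have HG' : hol (sector (a - PI) (b - PI)) (fun z => G (Copp z)) (fun z => Copp (G' (Copp z))).
  apply: hol_sub (hol_reflect HG) => _ [r [t [r0 [tab ->]]]].
  by exists r, (t + PI); split=> //; split; [rlra|rewrite polar_add_pi].
have E t r : Copp (polar r (t - PI)) = polar r t by rewrite polar_sub_pi; ring.
have zr t I : zinf (ray G t) I -> zinf (ray (fun z => G (Copp z)) (t - PI)) (- I).
  move=> H; have H' := is_RInt_zinf_opp H.
  by apply: (is_RInt_zinf_ext _ H') => r _; rewrite ray_reflect.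
have L := @sector_cauchy (a - PI) (b - PI) _ _ _ _ (t1 - PI) (t2 - PI) M (- I1) (- I2) HG'.
have : - I1 = - I2.
  apply: L; try rlra.
  - move=> r t r0 ht; have := HM r (t + PI) r0; rewrite polar_add_pi; apply; rlra.
  - by move: A1; congr abs_int; apply: functional_extensionality => r; rewrite E.
  - by move: A2; congr abs_int; apply: functional_extensionality => r; rewrite E.
  - exact: zr.
  - exact: zr.
by rlra.
Qed.

End LeftHalfPlane.

(** * The function [1 + z^2] and the arctangent integral *)

Definition one_plus_sq (z : C) : C := Cplus (RtoC 1) (Cmult z z).

(** The difference of the squares is [sin^2 t (1 - r^2)^2]. *)
Lemma Cmod_one_plus_sq r t : Rabs (cos t) * (1 + r ^ 2) <= Cmod (one_plus_sq (polar r t)).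
Proof.
apply: Rsqr_incr_0_var; last exact: Cmod_ge_0.
rewrite !Rsqr_pow2 Cmod2_alt /one_plus_sq /polar /Re /Im /=.
have := sin2_cos2 t; rewrite /Rsqr; set c := cos t; set s := sin t => H.
have c1 : 0 <= s * s := Rle_0_sqr s.
have -> : Rabs c * (1 + r * (r * 1)) * (Rabs c * (1 + r * (r * 1)) * 1) =
    (c * c) * (1 + r * r) * (1 + r * r).
  by have := Rsqr_abs c; rewrite /Rsqr => ->; ring.
have E : s * s = 1 - c * c by rlra.
have : 0 <= (s * s) * ((1 - r * r) * (1 - r * r)).
  by apply: Rmult_le_pos => //; apply: Rle_0_sqr.
have -> : (1 + (r * c * (r * c) - r * s * (r * s))) * ((1 + (r * c * (r * c) - r * s * (r * s))) * 1)
  + (0 + (r * c * (r * s) + r * s * (r * c))) * ((0 + (r * c * (r * s) + r * s * (r * c))) * 1) =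
  1 + 2 * (r * r) * (c * c - s * s) + (r * r) * (r * r) * ((c * c + s * s) * (c * c + s * s)) by ring.
have -> : c * c + s * s = 1 by rlra.
rewrite E; nra.
Qed.

Lemma one_plus_sq_neq0 r t : cos t <> 0 -> one_plus_sq (polar r t) <> RtoC 0.
Proof.
move=> ct; apply/Cmod_gt_0; apply: Rlt_le_trans (Cmod_one_plus_sq r t).
by apply: Rmult_lt_0_compat; [apply: Rabs_pos_lt|have := pow2_ge_0 r; rlra].
Qed.

Lemma holo_one_plus_sq D : holo D one_plus_sq.
Proof. by apply: holo_plus; [apply: holo_const|apply: holo_mult; apply: holo_id]. Qed.

Lemma in_I_cos_lb theta t : 0 < theta < PI / 2 -> in_I theta t -> cos theta <= Rabs (cos t).
Proof.
move=> th [ht|ht].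
- have c0 : cos theta <= cos t.
    case: (Rle_lt_dec 0 t) => t0; first by apply: cos_decr_1; rlra.
    by rewrite -(cos_neg t); apply: cos_decr_1; rlra.
  by apply: Rle_trans c0 _; apply: Rle_abs.
- have c0 : cos theta <= cos (t - PI).
    case: (Rle_lt_dec 0 (t - PI)) => t0; first by apply: cos_decr_1; rlra.
    by rewrite -(cos_neg (t - PI)); apply: cos_decr_1; rlra.
  have E : cos t = - cos (t - PI).
    by rewrite -neg_cos; congr cos; ring.
  by rewrite E Rabs_Ropp; apply: Rle_trans c0 _; apply: Rle_abs.
Qed.

Lemma in_I_one_plus_sq theta t r : 0 < theta < PI / 2 -> in_I theta t ->
  cos theta * (1 + r ^ 2) <= Cmod (one_plus_sq (polar r t)).
Proof.
move=> th ht; apply: Rle_trans (Cmod_one_plus_sq r t).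
by apply: Rmult_le_compat_r; [have := pow2_ge_0 r; rlra|apply: in_I_cos_lb].
Qed.

Lemma in_I_one_plus_sq_neq0 theta t r : 0 < theta < PI / 2 -> in_I theta t ->
  one_plus_sq (polar r t) <> RtoC 0.
Proof.
move=> th ht; apply: one_plus_sq_neq0 => E.
have := in_I_cos_lb th ht; rewrite E Rabs_R0.
by have := cos_gt_0 theta; rlra.
Qed.

Lemma inv_one_plus_sqr_integral a b : 0 < a <= b ->
  RInt (fun r => / (1 + r ^ 2)) a b = atan b - atan a.
Proof.
move=> ab; apply: is_RInt_unique.
apply: (@is_RInt_derive R_CompleteNormedModule atan (fun r => / (1 + r ^ 2))) => r _.
  apply/is_derive_Reals; have := derivable_pt_lim_atan r.
  by rewrite /Rsqr /=; congr derivable_pt_lim; rewrite Rmult_1_r.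
apply: (@ex_derive_continuous R_AbsRing R_NormedModule); auto_derive.
by have := pow2_ge_0 r => /=; rlra.
Qed.

Lemma abs_int_inv_one_plus_sqr : abs_int (fun r => / (1 + r ^ 2) : R_NormedModule).
Proof.
have p r : 0 < / (1 + r ^ 2) by apply: Rinv_0_lt_compat; have := pow2_ge_0 r; rlra.
have c r : continuous (fun r => / (1 + r ^ 2) : R_NormedModule) r.
  apply: (@ex_derive_continuous R_AbsRing R_NormedModule); auto_derive.
  by have := pow2_ge_0 r => /=; rlra.
apply: (@abs_int_dom _ _ (fun r => / (1 + r ^ 2))) => //.
  by move=> r _; rewrite /norm /= /abs /= Rabs_pos_eq; [apply: Rle_refl|apply: Rlt_le; apply: (p r)].
exists PI => a b ab; rewrite inv_one_plus_sqr_integral //.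
by have := atan_bound a; have := atan_bound b; rlra.
Qed.

Lemma inv_one_plus_sqr_zinf : zinf (fun r => / (1 + r ^ 2) : R_NormedModule) (PI / 2).
Proof.
have [I HI] := @abs_int_cvg R_CompleteNormedModule _ abs_int_inv_one_plus_sqr.
suff -> : PI / 2 = I by [].
apply: Rminus_diag_uniq; apply: NNPP => /Rabs_pos_lt h.
set d := Rabs _ in h; have d4 : 0 < d / 4 by rlra.
have [p [q [p0 [q0 H]]]] := proj1 (@is_RInt_zinfP R_CompleteNormedModule _ _ abs_int_inv_one_plus_sqr.1) HI _ d4.
(* With [a <= tan (k / 2)] and [b > tan (PI / 2 - k / 2)], the proper integral is within [k] of
   [PI / 2]; the cap 1 keeps [k] below [PI / 2]. *)
pose k := Rmin (d / 4) 1; have k0 : 0 < k by apply: Rmin_glb_lt; rlra.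
have k1 : k <= 1 := Rmin_r _ _.
have kp : k < PI / 2 by have := PI2_1; rlra.
have t0 : 0 < tan (k / 2) by apply: tan_gt_0; rlra.
pose a := Rmin (p / 2) (tan (k / 2)); pose b := Rmax (q + 1) (tan (PI / 2 - k / 2)) + a.
have a0 : 0 < a by apply: Rmin_glb_lt; rlra.
have ap : a < p by have := Rmin_l (p / 2) (tan (k / 2)); rewrite -/a; rlra.
have bq : q < b by have := Rmax_l (q + 1) (tan (PI / 2 - k / 2)); rewrite /b; rlra.
have ab : 0 < a <= b by have := Rmax_l (q + 1) (tan (PI / 2 - k / 2)); rewrite /b; rlra.
have := H a b (conj a0 ap) bq; rewrite inv_one_plus_sqr_integral //.
have h1 : atan a <= k / 2.
  have E : atan (tan (k / 2)) = k / 2 by apply: atan_tan; rlra.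
  have am : a <= tan (k / 2) := Rmin_r _ _.
  by rewrite -E; case: am => [/atan_increasing|->]; rlra.
have h2 : PI / 2 - k / 2 <= atan b.
  have E : atan (tan (PI / 2 - k / 2)) = PI / 2 - k / 2 by apply: atan_tan; rlra.
  have : tan (PI / 2 - k / 2) < b.
    by have := Rmax_r (q + 1) (tan (PI / 2 - k / 2)); rewrite /b; rlra.
  by move/atan_increasing; rlra.
have h3 : 0 < atan a by rewrite -atan_0; apply: atan_increasing.
have h4 := atan_bound b.
have h5 : k <= d / 4 := Rmin_l _ _.
rewrite /norm /= /abs /minus /plus /opp /= => /Rabs_def2 h6.
have : Rabs (PI / 2 - I) < d by apply: Rabs_def1; rlra.
by rewrite -/d; rlra.
Qed.

(** * The calculus for scalar functions *)

(** The hypotheses on one complex component of a function on [Dsec theta]. Symmetry under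
    conjugation is recorded as reality on the two half-axes, the form in which the rotation of
    contours uses it. *)
Record admissible (theta : R) (F : C -> C) : Prop := Admissible {
  adm_right : holo (sector (- theta) theta) F;
  adm_left : holo (sector (PI - theta) (PI + theta)) F;
  adm_real : forall r, 0 < r -> Im (F (polar r 0)) = 0 /\ Im (F (polar r PI)) = 0;
  adm_bounded : exists M, 0 <= M /\ forall r t, 0 < r -> in_I theta t ->
    Cmod (F (polar r t)) <= M;
  adm_int : forall t, in_I theta t ->
    abs_int (fun r => Cmod (F (polar r t)) / r : R_NormedModule) }.

Definition e_one (z : C) : C := Cmult z (Cinv (one_plus_sq z)).

Lemma is_RInt_zinf_zero (X : CompleteNormedModule R_AbsRing) (f : R -> X) :
  (forall r, 0 < r -> f r = zero) -> zinf f (zero : X).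
Proof.
move=> H.
have c0 : forall r, 0 < r -> continuous (fun _ : R => zero : X) r.
  by move=> r _; apply: continuous_const.
apply: (@is_RInt_zinf_ext _ (fun _ : R => zero : X)); first by move=> r /H.
apply/(is_RInt_zinfP _ c0) => e e0; exists 1, 1; split; [rlra|split; [rlra|]].
move=> a b _ _; have -> : RInt (fun _ : R => zero : X) a b = zero.
  by rewrite RInt_const scal_zero_r.
by rewrite minus_eq_zero norm_zero.
Qed.

Lemma norm_R_pos (x : R) : 0 <= x -> norm (x : R_NormedModule) = x.
Proof. exact: Rabs_pos_eq. Qed.

Lemma blin_app_eq (Y Z : NormedModule R_AbsRing) (A B : blin Y Z) :
  A = B -> forall x, A x = B x.
Proof. by move=> ->. Qed.

Lemma fval_bound (Y : NormedModule R_AbsRing) (l : blin Y R_NormedModule) x :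
  Rabs (fval l x) <= opnorm l * norm x.
Proof. exact: (opnorm_bound l x). Qed.

Lemma fval_zinf (Y : NormedModule R_AbsRing) (l : blin Y R_NormedModule) (f : R -> Y) I :
  zinf f I -> zinf (fun r => fval l (f r) : R_NormedModule) (fval l I).
Proof. exact: is_RInt_gen_blin. Qed.
Arguments fval_zinf {Y} l {f I}.

Lemma admissible_ray_continuous theta F c t r : admissible theta F -> in_I theta t -> 0 < r ->
  continuous (ray (fun z => Cmult c (F z)) t) r.
Proof.
move=> [[F1 H1] [F2 H2] _ _ _] ht r0.
case: ht => ht.
- by have [H' h] := holo_mult (@holo_const _ c) (ex_intro _ _ H1); apply: (ray_continuous h).
- by have [H' h] := holo_mult (@holo_const _ c) (ex_intro _ _ H2); apply: (ray_continuous h).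
Qed.

Section ScalarIntegrals.
Variables (theta : R) (F kappa : C -> C) (c : R).
Hypotheses (theta_bounds : 0 < theta < PI / 2) (HF : admissible theta F).
Hypotheses (kappa_right : holo (sector (- theta) theta) kappa)
  (kappa_left : holo (sector (PI - theta) (PI + theta)) kappa)
  (kappa_real : forall r, 0 < r -> Im (kappa (polar r 0)) = 0 /\ Im (kappa (polar r PI)) = 0)
  (c_ge0 : 0 <= c)
  (kappa_bound : forall r t, 0 < r -> in_I theta t -> r * Cmod (kappa (polar r t)) <= c).

Let G z := Cmult (Copp Ci) (Cmult (F z) (kappa z)).

Let G_hol : (holo (sector (- theta) theta) G) /\
  holo (sector (PI - theta) (PI + theta)) G.
Proof.
by split; apply: holo_mult (@holo_const _ (Copp Ci)) _; apply: holo_mult => //;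
  [apply: adm_right HF|apply: adm_left HF].
Qed.

Let Cmod_G z : Cmod (G z) = Cmod (F z) * Cmod (kappa z).
Proof. by rewrite /G !Cmod_mult Cmod_opp Cmod_Ci Rmult_1_l. Qed.

Let G_abs_int t : in_I theta t -> abs_int (fun r => Cmod (G (polar r t)) : R_NormedModule).
Proof.
move=> ht; have [[G1 H1] [G2 H2]] := G_hol.
apply: (@abs_int_le _ _ _ _ c) (adm_int HF ht) _ => r r0.
  by case: ht => ht; [apply: (Cmod_ray_continuous H1)|apply: (Cmod_ray_continuous H2)].
have h := kappa_bound r0 ht; have f0 := Cmod_ge_0 (F (polar r t)).
have k0 := Cmod_ge_0 (kappa (polar r t)).
have fr : 0 <= Cmod (F (polar r t)) / r.
  by apply: Rmult_le_pos => //; apply: Rlt_le; apply: Rinv_0_lt_compat.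
have fk := Rmult_le_pos _ _ f0 k0.
rewrite Cmod_G /norm /= /abs /= !Rabs_pos_eq //.
apply: (@Rle_trans _ (Cmod (F (polar r t)) * (c / r))).
  apply: Rmult_le_compat_l => //; apply: (@Rmult_le_reg_l r) => //.
  by have -> : r * (c / r) = c by [field; rlra].
by apply: Req_le; field; rlra.
Qed.

(** [F] and [kappa] are real on the real axis, so the real part of [- i F kappa dz] vanishes there.
    Both are holomorphic in a sector around the axis, so the ray at angle [t] can be turned onto
    it. *)
Lemma scalar_integral_zero t : 0 <= t < theta \/ PI - theta < t <= PI ->
  zinf (ray G t) (0 : R).
Proof.
move=> ht; have [[G1 H1] [G2 H2]] := G_hol.
have ht' : in_I theta t by case: ht => ht; [left|right]; rlra.
have [M [M0 HM]] := adm_bounded HF.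
have bd r s : 0 < r -> in_I theta s -> r * Cmod (G (polar r s)) <= M * c.
  move=> r0 hs; rewrite Cmod_G.
  have -> : r * (Cmod (F (polar r s)) * Cmod (kappa (polar r s))) =
    Cmod (F (polar r s)) * (r * Cmod (kappa (polar r s))) by ring.
  apply: Rmult_le_compat; [exact: Cmod_ge_0| |exact: HM|exact: kappa_bound].
  by apply: Rmult_le_pos; [rlra|apply: Cmod_ge_0].
have ex s : in_I theta s -> exists I : R, zinf (ray G s) I.
  move=> hs; apply: (@abs_int_cvg R_CompleteNormedModule).
  apply: (@abs_int_le _ R_NormedModule _ _ 1) (G_abs_int hs) _ => r r0.
    by case: hs => hs; [apply: (ray_continuous H1)|apply: (ray_continuous H2)].
  rewrite Rmult_1_l; apply: Rle_trans (ray_le_Cmod _ _ _) _.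
  by rewrite /norm /= /abs /= Rabs_pos_eq; [apply: Rle_refl|apply: Cmod_ge_0].
have z0 r : 0 < r -> ray G 0 r = 0 /\ ray G PI r = 0.
  move=> r0; have [f1 f2] := adm_real HF r0; have [k1 k2] := kappa_real r0.
  rewrite /ray /G /polar sin_0 cos_0 sin_PI cos_PI; move: f1 f2 k1 k2.
  rewrite /polar sin_0 cos_0 sin_PI cos_PI; set u := F _; set v := F _; set u' := kappa _; set v' := kappa _.
  by rewrite /Re /Im /= => -> -> -> ->; split; ring.
have zz : zinf (ray G 0) (0 : R) by apply: (@is_RInt_zinf_zero R_CompleteNormedModule) => r /z0 [].
have zp : zinf (ray G PI) (0 : R) by apply: (@is_RInt_zinf_zero R_CompleteNormedModule) => r /z0 [].
have [I HI] := ex t ht'; suff E : I = 0; first by rewrite E in HI.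
case: ht => ht.
- apply: esym; apply: (@sector_cauchy (- theta) theta _ _ G G1 0 t (M * c) 0 I H1) zz HI; try rlra.
  + by move=> r s r0 hs; apply: bd => //; left; rlra.
  + by apply: G_abs_int; left; rlra.
  + exact: G_abs_int.
- apply: (@sector_cauchy_left (PI - theta) (PI + theta) G G2 t PI (M * c) I 0 _ _ H2) HI zp; try rlra.
  + by move=> r s r0 hs; apply: bd => //; right; rlra.
  + exact: G_abs_int.
  + by apply: G_abs_int; right; rlra.
Qed.

End ScalarIntegrals.

(** * The calculus of an abstract resolvent *)

Section ScalarCalculus.
Variables (X : CompleteNormedModule R_AbsRing) (w : R).
Local Notation bop := (blin_NormedModule X X).
Variables (P q : C -> bop) (K L : bop).

(** The complex-linear extension of the real functional [l], applied to [P z - i q z]; it is this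
    scalar function of [z] that is holomorphic. *)
Definition rval (l : blin bop R_NormedModule) (z : C) : C := (fval l (P z), - fval l (q z)).
Definition fcomp (l : blin bop R_NormedModule) (B : bop) : blin bop R_NormedModule :=
  bcomp l (bcompr X B).

(* [P z - i q z] plays the role of the resolvent [(z - T)^-1] of the
   complexification of an operator [T], and [K = (1 + T^2)^-1], [L = T K];
   the last two fields are [R L = z R K - K] and [R (1 - K) = z R L - L]. *)
Record resolvent_data : Prop := ResolventData {
  res_angle : 0 < w < PI / 2;
  res_hol : forall l, holo (sector w (PI - w)) (rval l);
  res_cont : forall r t, 0 < r -> w < t < PI - w ->
    continuous (fun r => P (polar r t)) r /\ continuous (fun r => q (polar r t)) r;
  res_bound : forall phi, w < phi < PI / 2 -> exists c, 0 <= c /\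
    forall r t, 0 < r -> phi <= t <= PI - phi ->
      norm (P (polar r t)) <= c / r /\ norm (q (polar r t)) <= c / r;
  res_L : forall l z, sector w (PI - w) z ->
    rval (fcomp l L) z = Cminus (Cmult z (rval (fcomp l K) z)) (RtoC (fval l K));
  res_K : forall l z, sector w (PI - w) z ->
    Cminus (rval l z) (rval (fcomp l K) z) =
    Cminus (Cmult z (rval (fcomp l L) z)) (RtoC (fval l L)) }.

Hypothesis Rd : resolvent_data.

(** The real part of [- i F (P - i q) dz], which is [Re (- i F dz) P - Re (F dz) q]. *)
Definition op_ray (F : C -> C) (t r : R) : bop :=
  minus (scal (ray (fun z => Cmult (Copp Ci) (F z)) t r) (P (polar r t)))
        (scal (ray (fun z => Cmult (RtoC 1) (F z)) t r) (q (polar r t))).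

Lemma fval_op_ray l F t r :
  fval l (op_ray F t r) = ray (fun z => Cmult (Copp Ci) (Cmult (F z) (rval l z))) t r.
Proof.
rewrite /op_ray fvalB !fvalZ /ray /rval /Re /=.
move: (fval l (P _)) (fval l (q _)) => u v; ring.
Qed.

Lemma op_rayE F t r x : op_ray F t r x =
  minus (scal (ray (fun z => Cmult (Copp Ci) (F z)) t r) (P (polar r t) x))
        (scal (ray (fun z => Cmult (RtoC 1) (F z)) t r) (q (polar r t) x)).
Proof. by rewrite /op_ray minus_blinE. Qed.

Lemma fval_fcomp l B A : fval (fcomp l B) A = fval l (bcomp A B).
Proof. by []. Qed.

Lemma rval_bound l phi : w < phi < PI / 2 -> exists c, 0 <= c /\
  forall r t, 0 < r -> phi <= t <= PI - phi -> r * Cmod (rval l (polar r t)) <= c.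
Proof.
move=> /(res_bound Rd) [c [c0 Hc]]; exists (opnorm l * (2 * c)).
have l0 := opnorm_ge0 l.
split; first by apply: Rmult_le_pos; rlra.
move=> r t r0 ht; have [h1 h2] := Hc r t r0 ht.
have := Cmod_le_abs (rval l (polar r t)); rewrite /rval /= Rabs_Ropp.
have g1 := Rle_trans _ _ _ (fval_bound l _) (Rmult_le_compat_l _ _ _ l0 h1).
have g2 := Rle_trans _ _ _ (fval_bound l _) (Rmult_le_compat_l _ _ _ l0 h2).
move=> g3; apply: (@Rle_trans _ (r * (opnorm l * (c / r) + opnorm l * (c / r)))).
  by apply: Rmult_le_compat_l; [rlra|apply: Rle_trans g3 _; apply: Rplus_le_compat].
by apply: Req_le; field; rlra.
Qed.

Variable theta : R.
Hypothesis theta_bounds : w < theta < PI / 2.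

Definition ray_angle (t : R) : Prop := w < t < theta \/ PI - theta < t < PI - w.

Lemma ray_angleW t : ray_angle t ->
  in_I theta t /\ w < t < PI - w /\ exists phi, w < phi < PI / 2 /\ phi <= t <= PI - phi.
Proof.
have [w0 _] := res_angle Rd; move=> [ht|ht].
- by split; [left; rlra|split; [rlra|exists t; rlra]].
- by split; [right; rlra|split; [rlra|exists (PI - t); rlra]].
Qed.

(** [|F| / r] is integrable and the resolvent is of size [c / r]. The factor [k] covers [Ci F] as
    well, which in general is not real on the axis and so not admissible. *)
Lemma abs_int_op_ray_mult F k t : admissible theta F -> ray_angle t ->
  abs_int (op_ray (fun z => Cmult k (F z)) t).
Proof.
move=> HF /ray_angleW [ht [ht2 [phi [hp hpt]]]].
have [c [c0 Hc]] := res_bound Rd hp.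
have Ec u : (fun z => Cmult u (Cmult k (F z))) = (fun z => Cmult (Cmult u k) (F z)).
  by apply: functional_extensionality => z; ring.
apply: (@abs_int_le _ _ _ _ (2 * (Cmod k * c))) (adm_int HF ht) _.
- move=> r r0; have [cP cq] := res_cont Rd r0 ht2.
  rewrite /op_ray !Ec; apply: continuous_minus; apply: continuous_scal => //.
  + exact: (@admissible_ray_continuous theta F (Cmult (Copp Ci) k) t r HF ht r0).
  + exact: (@admissible_ray_continuous theta F (Cmult (RtoC 1) k) t r HF ht r0).
- move=> r r0; have [h1 h2] := Hc r t r0 hpt.
  have r1 : Rabs (ray (fun z => Cmult (Copp Ci) (Cmult k (F z))) t r) <= Cmod k * Cmod (F (polar r t)).
    by apply: Rle_trans (ray_le_Cmod _ _ _) _; rewrite !Cmod_mult Cmod_opp Cmod_Ci; rlra.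
  have r2 : Rabs (ray (fun z => Cmult (RtoC 1) (Cmult k (F z))) t r) <= Cmod k * Cmod (F (polar r t)).
    by apply: Rle_trans (ray_le_Cmod _ _ _) _; rewrite !Cmod_mult Cmod_1; rlra.
  apply: Rle_trans (norm_minus_le (norm_scal_le _ h1) (norm_scal_le _ h2)) _.
  have cr : 0 <= c / r by apply: Rmult_le_pos => //; apply: Rlt_le; apply: Rinv_0_lt_compat.
  have f0 := Cmod_ge_0 (F (polar r t)).
  rewrite norm_R_pos; last first.
    by apply: Rmult_le_pos => //; apply: Rlt_le; apply: Rinv_0_lt_compat.
  apply: (@Rle_trans _ (Cmod k * Cmod (F (polar r t)) * (c / r) + Cmod k * Cmod (F (polar r t)) * (c / r))).
    by apply: Rplus_le_compat; apply: Rmult_le_compat_r.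
  by apply: Req_le; field; rlra.
Qed.

Lemma abs_int_op_ray F t : admissible theta F -> ray_angle t -> abs_int (op_ray F t).
Proof.
move=> HF ht; have := abs_int_op_ray_mult (RtoC 1) HF ht.
by congr abs_int; congr op_ray; apply: functional_extensionality => z; ring.
Qed.

Lemma holo_right F l : admissible theta F ->
  holo (sector w theta) (fun z => Cmult (Copp Ci) (Cmult (F z) (rval l z))).
Proof.
move=> HF; have [w0 _] := res_angle Rd; apply: holo_mult (@holo_const _ _) _.
apply: holo_mult; [apply: holo_sub (adm_right HF)|apply: holo_sub (res_hol Rd l)];
  by move=> _ [s [u [s0 [hu ->]]]]; exists s, u; split=> //; split=> //; rlra.
Qed.

Lemma holo_left F l : admissible theta F ->
  holo (sector (PI - theta) (PI - w)) (fun z => Cmult (Copp Ci) (Cmult (F z) (rval l z))).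
Proof.
move=> HF; have [w0 _] := res_angle Rd; apply: holo_mult (@holo_const _ _) _.
apply: holo_mult; [apply: holo_sub (adm_left HF)|apply: holo_sub (res_hol Rd l)];
  by move=> _ [s [u [s0 [hu ->]]]]; exists s, u; split=> //; split=> //; rlra.
Qed.

Lemma abs_int_scalar_ray F t l : admissible theta F -> ray_angle t ->
  abs_int (fun r => Cmod (Cmult (Copp Ci) (Cmult (F (polar r t)) (rval l (polar r t))))
           : R_NormedModule).
Proof.
move=> HF ht; have [ht1 [ht2 [phi [hp hpt]]]] := ray_angleW ht.
have [c [c0 Hc]] := rval_bound l hp.
apply: (@abs_int_le _ _ _ _ c) (adm_int HF ht1) _ => r r0.
- case: ht => ht.
  + by have [d Hh] := holo_right l HF; apply: (Cmod_ray_continuous Hh).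
  + by have [d Hh] := holo_left l HF; apply: (Cmod_ray_continuous Hh).
- have h := Hc r t r0 hpt; have f0 := Cmod_ge_0 (F (polar r t)).
  have k0 := Cmod_ge_0 (rval l (polar r t)).
  have fr : 0 <= Cmod (F (polar r t)) / r.
    by apply: Rmult_le_pos => //; apply: Rlt_le; apply: Rinv_0_lt_compat.
  have fk := Rmult_le_pos _ _ f0 k0.
  rewrite !Cmod_mult Cmod_opp Cmod_Ci Rmult_1_l /norm /= /abs /= !Rabs_pos_eq //.
  apply: (@Rle_trans _ (Cmod (F (polar r t)) * (c / r))).
    apply: Rmult_le_compat_l => //; apply: (@Rmult_le_reg_l r) => //.
    by have -> : r * (c / r) = c by [field; rlra].
  by apply: Req_le; field; rlra.
Qed.

Lemma fval_eq (A B : bop) : (forall l, fval l A = fval l B) -> A = B.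
Proof. exact: fval_separates. Qed.

(** Functionals separate operators, and after applying one of them this is the scalar theorem: [|F|]
    is bounded and [r |rval l|] is bounded between the two rays. *)
Lemma op_ray_integral_right F t1 t2 A1 A2 : admissible theta F ->
  w < t1 -> t1 <= t2 -> t2 < theta ->
  zinf (op_ray F t1) A1 -> zinf (op_ray F t2) A2 -> A1 = A2.
Proof.
move=> HF wt1 t12 t2th H1 H2; have [w0 wp] := res_angle Rd.
apply: fval_eq => l; have [d Hd] := holo_right l HF.
have p1 : w < t1 < PI / 2 by rlra.
have [c [c0 Hc]] := rval_bound l p1; have [M [M0 HM]] := adm_bounded HF.
have ray_of t A : zinf (op_ray F t) A ->
    zinf (ray (fun z => Cmult (Copp Ci) (Cmult (F z) (rval l z))) t) (fval l A).
  move/(fval_zinf l); apply: is_RInt_zinf_ext => r _; exact: fval_op_ray.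
apply: (@sector_cauchy w theta _ _ _ d t1 t2 (M * c) _ _ Hd) (ray_of _ _ H1) (ray_of _ _ H2); try rlra.
- move=> r t r0 ht; rewrite !Cmod_mult Cmod_opp Cmod_Ci Rmult_1_l.
  have -> : r * (Cmod (F (polar r t)) * Cmod (rval l (polar r t))) =
    Cmod (F (polar r t)) * (r * Cmod (rval l (polar r t))) by ring.
  apply: Rmult_le_compat; [exact: Cmod_ge_0| |by apply: HM => //; left; rlra|by apply: Hc => //; rlra].
  by apply: Rmult_le_pos; [rlra|apply: Cmod_ge_0].
- by apply: abs_int_scalar_ray => //; left; rlra.
- by apply: abs_int_scalar_ray => //; left; rlra.
Qed.

Lemma op_ray_integral_left F t1 t2 A1 A2 : admissible theta F ->
  PI - theta < t1 -> t1 <= t2 -> t2 < PI - w ->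
  zinf (op_ray F t1) A1 -> zinf (op_ray F t2) A2 -> A1 = A2.
Proof.
move=> HF wt1 t12 t2th H1 H2; have [w0 wp] := res_angle Rd.
apply: fval_eq => l; have [d Hd] := holo_left l HF.
have p1 : w < PI - t2 < PI / 2 by rlra.
have [c [c0 Hc]] := rval_bound l p1; have [M [M0 HM]] := adm_bounded HF.
have ray_of t A : zinf (op_ray F t) A ->
    zinf (ray (fun z => Cmult (Copp Ci) (Cmult (F z) (rval l z))) t) (fval l A).
  move/(fval_zinf l); apply: is_RInt_zinf_ext => r _; exact: fval_op_ray.
apply: (@sector_cauchy_left (PI - theta) (PI - w) _ d t1 t2 (M * c) _ _ _ _ Hd) (ray_of _ _ H1) (ray_of _ _ H2); try rlra.
- move=> r t r0 ht; rewrite !Cmod_mult Cmod_opp Cmod_Ci Rmult_1_l.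
  have -> : r * (Cmod (F (polar r t)) * Cmod (rval l (polar r t))) =
    Cmod (F (polar r t)) * (r * Cmod (rval l (polar r t))) by ring.
  apply: Rmult_le_compat; [exact: Cmod_ge_0| |by apply: HM => //; right; rlra|by apply: Hc => //; rlra].
  by apply: Rmult_le_pos; [rlra|apply: Cmod_ge_0].
- by apply: abs_int_scalar_ray => //; right; rlra.
- by apply: abs_int_scalar_ray => //; right; rlra.
Qed.

(** [A2 - A1] encodes the orientation, outgoing at [PI - phi] and incoming at [phi]. The lower rays
    repeat the upper ones, which turns [1 / (2 PI)] into [1 / PI]. *)
Definition calculus_value (F : C -> C) (A : bop) : Prop :=
  forall phi, w < phi < theta -> exists A1 A2 : bop,
    zinf (op_ray F phi) A1 /\ zinf (op_ray F (PI - phi)) A2 /\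
    A = scal (/ PI) (minus A2 A1).

Lemma calculus_value_exists F : admissible theta F -> exists A, calculus_value F A.
Proof.
move=> HF; have [w0 wp] := res_angle Rd.
have ex phi : w < phi < theta -> exists A1 A2, zinf (op_ray F phi) A1 /\ zinf (op_ray F (PI - phi)) A2.
  move=> hp; have r1 : ray_angle phi by left.
  have r2 : ray_angle (PI - phi) by right; rlra.
  have [A1 H1] := @abs_int_cvg (blin_CompleteNormedModule X X) _ (abs_int_op_ray HF r1).
  have [A2 H2] := @abs_int_cvg (blin_CompleteNormedModule X X) _ (abs_int_op_ray HF r2).
  by exists A1, A2.
(* The middle angle serves as reference; Cauchy's theorem carries its value to every other [phi]. *)
have mid : w < (w + theta) / 2 < theta by rlra.
have [A1 [A2 [H1 H2]]] := ex _ mid; exists (scal (/ PI) (minus A2 A1)) => phi hp.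
have [B1 [B2 [J1 J2]]] := ex _ hp; exists B1, B2; split=> //; split=> //.
have -> : A1 = B1.
  case: (Rle_lt_dec phi ((w + theta) / 2)) => h.
    by apply: esym; apply: (op_ray_integral_right HF _ _ _ J1 H1); rlra.
  by apply: (op_ray_integral_right HF _ _ _ H1 J1); rlra.
have -> // : A2 = B2.
case: (Rle_lt_dec phi ((w + theta) / 2)) => h.
  by apply: (op_ray_integral_left HF _ _ _ H2 J2); rlra.
by apply: esym; apply: (op_ray_integral_left HF _ _ _ J2 H2); rlra.
Qed.

Lemma bop_zinf_unique (f : R -> bop) A B : zinf f A -> zinf f B -> A = B.
Proof. exact: (@is_RInt_zinf_unique (blin_CompleteNormedModule X X)). Qed.

Lemma sector_ray r t : 0 < r -> ray_angle t -> sector w (PI - w) (polar r t).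
Proof. by move=> r0 /ray_angleW [_ [ht _]]; exists r, t. Qed.

Lemma theta_pos : 0 < theta < PI / 2.
Proof. by have := res_angle Rd; rlra. Qed.

(** [R K] is eliminated between the fields [res_L] and [res_K]. *)
Lemma one_plus_sq_resolvent l z : sector w (PI - w) z ->
  Cmult z (rval l z) = Cplus (Cmult (one_plus_sq z) (rval (fcomp l L) z))
    (Cminus (RtoC (fval l K)) (Cmult z (RtoC (fval l L)))).
Proof.
move=> Dz; have h1 := res_L Rd l Dz; have h2 := res_K Rd l Dz.
have -> : rval l z = Cplus (rval (fcomp l K) z)
    (Cminus (Cmult z (rval (fcomp l L) z)) (RtoC (fval l L))) by rewrite -h2; ring.
by rewrite /one_plus_sq h1; ring.
Qed.

Section Kernel.

(** Dividing the previous identity by [1 + z^2] gives [e_one R = R L + kappa1 K - kappa2 L]; the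
    kernels are the coefficients of the two remainders. *)
Definition kappa1 (z : C) : C := Cinv (one_plus_sq z).
Definition kappa2 (z : C) : C := Cmult z (kappa1 z).

Lemma kappa1_facts : holo (sector (- theta) theta) kappa1 /\
  holo (sector (PI - theta) (PI + theta)) kappa1 /\
  (forall r, 0 < r -> Im (kappa1 (polar r 0)) = 0 /\ Im (kappa1 (polar r PI)) = 0) /\
  (forall r t, 0 < r -> in_I theta t ->
     r * Cmod (kappa1 (polar r t)) <= / cos theta /\
     r ^ 2 * Cmod (kappa1 (polar r t)) <= / cos theta).
Proof.
have th := theta_pos; split; [|split; [|split]].
- apply: holo_inv; first exact: holo_one_plus_sq.
  by move=> _ [r [t [r0 [ht ->]]]]; apply: (@in_I_one_plus_sq_neq0 theta _ _ th); left.
- apply: holo_inv; first exact: holo_one_plus_sq.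
  by move=> _ [r [t [r0 [ht ->]]]]; apply: (@in_I_one_plus_sq_neq0 theta _ _ th); right.
- move=> r r0; rewrite /kappa1 /one_plus_sq /polar sin_0 cos_0 sin_PI cos_PI /Im /=.
  by split; rewrite /Rdiv; ring.
- move=> r t r0 ht; have h := in_I_one_plus_sq r th ht.
  have c0 : 0 < cos theta by apply: cos_gt_0; rlra.
  rewrite Cmod_inv; last exact: (@in_I_one_plus_sq_neq0 theta _ _ th).
  have r2 := pow2_ge_0 r; have p : 0 < cos theta * (1 + r ^ 2) by apply: Rmult_lt_0_compat; rlra.
  set m := Cmod _ in h *; have m0 : 0 < m by rlra.
  have i0 : 0 < / cos theta by apply: Rinv_0_lt_compat.
  split; apply: (@Rmult_le_reg_r (m * cos theta)); try by apply: Rmult_lt_0_compat.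
  + have -> : r * / m * (m * cos theta) = r * cos theta by field; rlra.
    have -> : / cos theta * (m * cos theta) = m by field; rlra.
    apply: Rle_trans h; rewrite Rmult_comm; apply: Rmult_le_compat_l; first rlra.
    by have := pow2_ge_0 (r - 1); rewrite /=; nra.
  + have -> : r ^ 2 * / m * (m * cos theta) = r ^ 2 * cos theta by field; rlra.
    have -> : / cos theta * (m * cos theta) = m by field; rlra.
    by apply: Rle_trans h; rewrite Rmult_comm; apply: Rmult_le_compat_l; rlra.
Qed.

Lemma kappa2_facts : holo (sector (- theta) theta) kappa2 /\
  holo (sector (PI - theta) (PI + theta)) kappa2 /\
  (forall r, 0 < r -> Im (kappa2 (polar r 0)) = 0 /\ Im (kappa2 (polar r PI)) = 0) /\
  (forall r t, 0 < r -> in_I theta t -> r * Cmod (kappa2 (polar r t)) <= / cos theta).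
Proof.
have [h1 [h2 [h3 h4]]] := kappa1_facts; split; [|split; [|split]].
- by apply: holo_mult => //; apply: holo_id.
- by apply: holo_mult => //; apply: holo_id.
- move=> r r0; have [] := h3 r r0; rewrite /kappa2 /polar sin_0 cos_0 sin_PI cos_PI.
  by move: (kappa1 _) (kappa1 _) => u v; rewrite /Im /= => -> ->; split; ring.
- move=> r t r0 ht; have [_] := h4 r t r0 ht.
  rewrite /kappa2 Cmod_mult Cmod_polar; last rlra.
  by move=> h; apply: Rle_trans h; apply: Req_le; ring.
Qed.

End Kernel.

Lemma scalar_kernel_zero F t : admissible theta F -> ray_angle t ->
  zinf (ray (fun z => Cmult (Copp Ci) (Cmult (F z) (kappa1 z))) t) (0 : R) /\
  zinf (ray (fun z => Cmult (Copp Ci) (Cmult (F z) (kappa2 z))) t) (0 : R).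
Proof.
move=> HF ht; have th := theta_pos; have [w0 wp] := res_angle Rd.
have c0 : 0 < cos theta by apply: cos_gt_0; rlra.
have i0 : 0 <= / cos theta by apply: Rlt_le; apply: Rinv_0_lt_compat.
have ht' : 0 <= t < theta \/ PI - theta < t <= PI.
  by case: ht => ht; [left|right]; rlra.
have [a1 [a2 [a3 a4]]] := kappa1_facts; have [b1 [b2 [b3 b4]]] := kappa2_facts.
split; apply: (@scalar_integral_zero theta F _ (/ cos theta)) => //.
by move=> r s r0 hs; apply: (a4 r s r0 hs).1.
Qed.

(** After multiplication by [F] the remainders are constants times scalar integrals, which vanish by
    [scalar_kernel_zero]; the term [F R L] is left. *)
Lemma op_ray_e_one F t A B : admissible theta F -> ray_angle t ->
  zinf (op_ray F t) A -> zinf (op_ray (fun z => Cmult (e_one z) (F z)) t) B ->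
  B = bcomp A L.
Proof.
move=> HF ht HA HB; apply: fval_eq => l; rewrite -fval_fcomp.
have [z1 z2] := scalar_kernel_zero HF ht.
have HB' := fval_zinf l HB; have HA' := fval_zinf (fcomp l L) HA.
have H := is_RInt_zinf_plus HA' (is_RInt_zinf_minus (@is_RInt_zinf_scal _ (fval l K) _ _ z1)
  (@is_RInt_zinf_scal _ (fval l L) _ _ z2)).
have E : fval (fcomp l L) A = plus (fval (fcomp l L) A)
    (minus (scal (fval l K) (0 : R_NormedModule)) (scal (fval l L) (0 : R_NormedModule))).
  by rewrite /minus /plus /opp /scal /= /mult /= !Rmult_0_r Ropp_0 !Rplus_0_r.
rewrite E; apply: (@is_RInt_zinf_unique R_CompleteNormedModule _ _ _ HB').
apply: is_RInt_zinf_ext H => r r0.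
have Dz := sector_ray r0 ht; have h := one_plus_sq_resolvent l Dz.
have nz : one_plus_sq (polar r t) <> RtoC 0.
  by apply: (@in_I_one_plus_sq_neq0 theta _ _ theta_pos); case: (ray_angleW ht).
rewrite !fval_op_ray; set z := polar r t in h nz *.
rewrite /plus /minus /opp /scal /= /mult /= /plus /= /ray -/z.
have -> : Cmult (Copp Ci) (Cmult (Cmult (e_one z) (F z)) (rval l z)) =
  Cplus (Cmult (Copp Ci) (Cmult (F z) (rval (fcomp l L) z)))
   (Cminus (Cmult (RtoC (fval l K)) (Cmult (Copp Ci) (Cmult (F z) (kappa1 z))))
           (Cmult (RtoC (fval l L)) (Cmult (Copp Ci) (Cmult (F z) (kappa2 z))))).
  transitivity (Cmult (Copp Ci) (Cmult (F z) (Cmult (Cinv (one_plus_sq z)) (Cmult z (rval l z))))).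
    by rewrite /e_one; ring.
  by rewrite h /kappa2 /kappa1; field.
by rewrite /Re /=; ring.
Qed.

Lemma calculus_value_e_one F A : admissible theta F ->
  admissible theta (fun z => Cmult (e_one z) (F z)) ->
  calculus_value F A -> calculus_value (fun z => Cmult (e_one z) (F z)) (bcomp A L).
Proof.
move=> HF HeF HA phi hp; have [A1 [A2 [H1 [H2 ->]]]] := HA phi hp.
have [w0 wp] := res_angle Rd.
have r1 : ray_angle phi by left.
have r2 : ray_angle (PI - phi) by right; rlra.
have [B1 J1] := @abs_int_cvg (blin_CompleteNormedModule X X) _ (abs_int_op_ray HeF r1).
have [B2 J2] := @abs_int_cvg (blin_CompleteNormedModule X X) _ (abs_int_op_ray HeF r2).
exists B1, B2; split=> //; split=> //.
rewrite (op_ray_e_one HF r1 H1 J1) (op_ray_e_one HF r2 H2 J2).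
by apply: blin_eq => x; rewrite /= ?minus_blinE.
Qed.

(** An operator that commutes with all [P z] and [q z] passes under the integral. The result is
    applied to right multiplications and to the resolvents of [T] themselves. *)
Lemma calculus_value_commute F A B : admissible theta F ->
  (forall z, sector w (PI - w) z -> bcomp B (P z) = bcomp (P z) B /\ bcomp B (q z) = bcomp (q z) B) ->
  calculus_value F A -> bcomp B A = bcomp A B.
Proof.
move=> HF HB HA; have [w0 wp] := res_angle Rd.
have mid : w < (w + theta) / 2 < theta by rlra.
have [A1 [A2 [H1 [H2 ->]]]] := HA _ mid.
have key t I : ray_angle t -> zinf (op_ray F t) I -> bcomp B I = bcomp I B.
  move=> ht H.
  have J1 := @is_RInt_gen_blin _ _ (bcompl X B) _ _ _ _ H.
  have J2 := @is_RInt_gen_blin _ _ (bcompr X B) _ _ _ _ H.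
  apply: bop_zinf_unique J1 _; apply: is_RInt_zinf_ext J2 => r r0.
  have [/blin_app_eq hP /blin_app_eq hq] := HB _ (sector_ray r0 ht).
  apply: blin_eq => x; have /= hPx := hP x; have /= hqx := hq x.
  by rewrite -[LHS]/(op_ray F t r (B x)) -[RHS]/(B (op_ray F t r x)) !op_rayE blinB !blinZ hPx hqx.
have r1 : ray_angle ((w + theta) / 2) by left.
have r2 : ray_angle (PI - (w + theta) / 2) by right; rlra.
have /blin_app_eq e1 := key _ _ r1 H1; have /blin_app_eq e2 := key _ _ r2 H2.
apply: blin_eq => x; have /= e1x := e1 x; have /= e2x := e2 x.
rewrite -[LHS]/(B (scal (/ PI) ((minus A2 A1 : bop) x))).
by rewrite -[RHS]/(scal (/ PI) ((minus A2 A1 : bop) (B x))) !minus_blinE blinZ blinB e1x e2x.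
Qed.

(** * The value of the calculus at [z / (1 + z^2)] *)

Section BaseCase.
Variable l : blin bop R_NormedModule.

(** In [R L + kappa1 K - kappa2 L] the terms [R L] and [kappa2 L] decay only like [1 / r].
    Subtracting [L / (z + i)], whose pole is in the lower half-plane, from the first leaves
    quadratic decay, and adding it to the second leaves [- i L / (1 + z^2)]. *)
Definition outer_part (z : C) : C :=
  Cmult (Copp Ci) (Cminus (rval (fcomp l L) z) (Cmult (RtoC (fval l L)) (Cinv (Cplus z Ci)))).
Definition inner_part (z : C) : C :=
  Cmult (Cmult (Copp Ci) (Cminus (RtoC (fval l K)) (Cmult Ci (RtoC (fval l L))))) (kappa1 z).

Lemma plus_Ci_bound r t : 0 < r -> 0 <= t <= PI ->
  1 <= Cmod (Cplus (polar r t) Ci) /\ r <= Cmod (Cplus (polar r t) Ci).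
Proof.
move=> r0 ht; have s0 : 0 <= sin t by apply: sin_ge_0; rlra.
have E : Cmod (Cplus (polar r t) Ci) ^ 2 = 1 + r ^ 2 + 2 * r * sin t.
  rewrite Cmod2_alt /Re /Im /polar /=.
  have := sin2_cos2 t; rewrite /Rsqr => H.
  transitivity (1 + r ^ 2 * (sin t * sin t + cos t * cos t) + 2 * r * sin t); first ring.
  by rewrite H; ring.
have p0 : 0 <= 2 * r * sin t by apply: Rmult_le_pos; rlra.
by split; apply: Rsqr_incr_0_var; try exact: Cmod_ge_0; rewrite /Rsqr; nra.
Qed.

Lemma plus_Ci_neq0 z : sector w (PI - w) z -> Cplus z Ci <> RtoC 0.
Proof.
have [w0 wp] := res_angle Rd; move=> [r [t [r0 [ht ->]]]]; apply/Cmod_gt_0.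
by have [] := @plus_Ci_bound r t r0; rlra.
Qed.

Lemma outer_inner_split z : sector w (PI - w) z -> one_plus_sq z <> RtoC 0 ->
  Cmult (Copp Ci) (Cmult (e_one z) (rval l z)) = Cplus (outer_part z) (inner_part z).
Proof.
move=> Dz nz; have h := one_plus_sq_resolvent l Dz; have nC := plus_Ci_neq0 Dz.
have i2 : Cmult Ci Ci = Copp (RtoC 1) by rewrite /Ci /Cmult /Copp /RtoC /=; congr pair; ring.
have E : Cinv (Cplus z Ci) = Cmult (Cminus z Ci) (Cinv (one_plus_sq z)).
  have -> : one_plus_sq z = Cmult (Cplus z Ci) (Cminus z Ci).
    transitivity (Cminus (Cmult z z) (Cmult Ci Ci)); last ring.
    by rewrite i2 /one_plus_sq; ring.
  field; split=> // n2; apply: nz.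
  transitivity (Cminus (Cmult z z) (Cmult Ci Ci)).
    by rewrite i2 /one_plus_sq; ring.
  transitivity (Cmult (Cplus z Ci) (Cminus z Ci)); first ring.
  by rewrite n2; ring.
transitivity (Cmult (Copp Ci) (Cmult (Cinv (one_plus_sq z)) (Cmult z (rval l z)))).
  by rewrite /e_one; ring.
by rewrite h /outer_part /inner_part /kappa1 E; field.
Qed.

(** Write [D] for [R L - L / (z + i)]. By [res_L], [R L = z R K - K] bounds [|D|] by [c2 + a + b];
    by [res_K], [z^2 D = z (R - R K) + i z L / (z + i)] bounds [r^2 |D|] by [c1 + c2 + b]. The
    constant is the sum of the two. *)
Lemma outer_bound phi : w < phi < PI / 2 -> exists c, 0 <= c /\
  forall r t, 0 < r -> phi <= t <= PI - phi ->
    Cmod (outer_part (polar r t)) <= c * / (1 + r ^ 2).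
Proof.
move=> hp; have [w0 wp] := res_angle Rd.
have [c1 [c10 H1]] := rval_bound l hp; have [c2 [c20 H2]] := rval_bound (fcomp l K) hp.
set a := Rabs (fval l K); set b := Rabs (fval l L).
have a0 : 0 <= a by apply: Rabs_pos.
have b0 : 0 <= b by apply: Rabs_pos.
exists (c1 + 2 * c2 + a + 2 * b); split; first rlra.
move=> r t r0 ht; have Dz : sector w (PI - w) (polar r t) by exists r, t; split=> //; split=> //; rlra.
have ht' : 0 <= t <= PI by rlra.
have [n1 n2] := plus_Ci_bound r0 ht'; have nC := plus_Ci_neq0 Dz.
have hL := res_L Rd l Dz; have hK := res_K Rd l Dz.
have h1 := H1 r t r0 ht; have h2 := H2 r t r0 ht.
have zr : Cmod (polar r t) = r by apply: Cmod_polar; rlra.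
have z0 : polar r t <> RtoC 0 by apply/Cmod_gt_0; rlra.
rewrite /outer_part Cmod_mult Cmod_opp Cmod_Ci Rmult_1_l.
set z := polar r t in Dz n1 n2 nC hL hK h1 h2 zr z0 *.
set m := Cmod (Cminus _ _).
have m1 : m <= c2 + a + b.
  rewrite /m hL; apply: Rle_trans (Cmod_triangle _ _) _.
  apply: Rplus_le_compat.
    apply: Rle_trans (Cmod_triangle _ _) _.
    by rewrite Cmod_opp Cmod_mult zr Cmod_R -/a; rlra.
  rewrite Cmod_opp Cmod_mult Cmod_R -/b Cmod_inv //.
  rewrite -[X in _ <= X](Rmult_1_r b); apply: Rmult_le_compat_l => //.
  by rewrite -Rinv_1; apply: Rinv_le_contravar; rlra.
have m2 : r ^ 2 * m <= c1 + c2 + b.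
  have -> : r ^ 2 * m = Cmod (Cplus (Cmult z (Cminus (rval l z) (rval (fcomp l K) z)))
      (Cmult (RtoC (fval l L)) (Cmult Ci (Cmult z (Cinv (Cplus z Ci)))))).
    rewrite /m -zr -Cmod_pow -Cmod_mult; congr Cmod.
    by rewrite hK !Cpow_S /=; field_simplify_eq.
  apply: Rle_trans (Cmod_triangle _ _) _; apply: Rplus_le_compat.
    rewrite Cmod_mult zr.
    have := Cmod_triangle (rval l z) (Copp (rval (fcomp l K) z)).
    rewrite Cmod_opp => h; apply: Rle_trans (Rmult_le_compat_l _ _ _ _ h) _; first rlra.
    by rlra.
  rewrite !Cmod_mult Cmod_R -/b Cmod_Ci zr Cmod_inv // Rmult_1_l.
  rewrite -[X in _ <= X](Rmult_1_r b); apply: Rmult_le_compat_l => //.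
  apply: (@Rmult_le_reg_r (Cmod (Cplus z Ci))); first rlra.
  by rewrite Rmult_assoc Rinv_l; rlra.
have p : 0 < 1 + r ^ 2 by have := pow2_ge_0 r; rlra.
apply: (@Rmult_le_reg_r (1 + r ^ 2)) => //; rewrite Rmult_assoc Rinv_l; last rlra.
by rlra.
Qed.

Lemma holo_outer : holo (sector w (PI - w)) outer_part.
Proof.
apply: holo_mult; first exact: holo_const.
have E : (fun z => Cminus (rval (fcomp l L) z) (Cmult (RtoC (fval l L)) (Cinv (Cplus z Ci)))) =
  (fun z => Cplus (rval (fcomp l L) z) (Cmult (Copp (RtoC (fval l L))) (Cinv (Cplus z Ci)))).
  by apply: functional_extensionality => z; ring.
rewrite E; apply: holo_plus; first exact: res_hol.
apply: holo_mult; first exact: holo_const.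
apply: holo_inv; last exact: plus_Ci_neq0.
by apply: holo_plus; [apply: holo_id|apply: holo_const].
Qed.

Lemma inv_one_plus_sqr_pos r : 0 < / (1 + r ^ 2).
Proof. by apply: Rinv_0_lt_compat; have := pow2_ge_0 r; rlra. Qed.

Lemma r_inv_one_plus_sqr r c : 0 < r -> 0 <= c -> r * (c * / (1 + r ^ 2)) <= c.
Proof.
move=> r0 c0; have p : 0 < 1 + r ^ 2 by have := pow2_ge_0 r; rlra.
apply: (@Rmult_le_reg_r (1 + r ^ 2)) => //.
have -> : r * (c * / (1 + r ^ 2)) * (1 + r ^ 2) = c * r by field; rlra.
by apply: Rmult_le_compat_l => //; have := pow2_ge_0 (r - 1); rewrite /=; nra.
Qed.

Lemma abs_int_of_bound G a b t c : holo (sector a b) G -> a < t < b ->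
  (forall r, 0 < r -> Cmod (G (polar r t)) <= c * / (1 + r ^ 2)) ->
  abs_int (fun r => Cmod (G (polar r t)) : R_NormedModule).
Proof.
move=> [G' HG] ht H; apply: (@abs_int_le _ _ _ _ c) abs_int_inv_one_plus_sqr _ => r r0.
  exact: (Cmod_ray_continuous HG).
rewrite !norm_R_pos; [exact: H|apply: Rlt_le; exact: inv_one_plus_sqr_pos|exact: Cmod_ge_0].
Qed.

Lemma zinf_of_abs_int G a b t : holo (sector a b) G -> a < t < b ->
  abs_int (fun r => Cmod (G (polar r t)) : R_NormedModule) -> exists I : R, zinf (ray G t) I.
Proof.
move=> [G' HG] ht H; apply: (@abs_int_cvg R_CompleteNormedModule).
apply: (@abs_int_le _ R_NormedModule _ _ 1) H _ => r r0.
  exact: (ray_continuous HG).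
rewrite Rmult_1_l norm_R_pos; last exact: Cmod_ge_0.
exact: ray_le_Cmod.
Qed.

(** The outer part is holomorphic across the imaginary axis, so the two rays give the same integral.
    Cauchy's theorem is used on each side of that axis in turn. *)
Lemma outer_integrals phi : w < phi < theta -> exists I : R,
  zinf (ray outer_part phi) I /\ zinf (ray outer_part (PI - phi)) I.
Proof.
move=> hp; have [w0 wp] := res_angle Rd; have [G' HG] := holo_outer.
have p1 : w < phi < PI / 2 by rlra.
have [c [c0 Hc]] := outer_bound p1.
have ai t : phi <= t <= PI - phi -> abs_int (fun r => Cmod (outer_part (polar r t)) : R_NormedModule).
  by move=> ht; apply: (abs_int_of_bound holo_outer (c := c)); [rlra|move=> r r0; apply: Hc].
have bd r t : 0 < r -> phi <= t <= PI - phi -> r * Cmod (outer_part (polar r t)) <= c.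
  move=> r0 ht; apply: Rle_trans (r_inv_one_plus_sqr r0 c0).
  by apply: Rmult_le_compat_l; [rlra|apply: Hc].
have ex t : phi <= t <= PI - phi -> exists I : R, zinf (ray outer_part t) I.
  by move=> ht; apply: (zinf_of_abs_int holo_outer); [rlra|apply: ai].
have hm1 : phi <= phi <= PI - phi by rlra.
have hm2 : phi <= PI / 2 <= PI - phi by rlra.
have hm3 : phi <= PI - phi <= PI - phi by rlra.
have [I1 HI1] := ex _ hm1; have [I2 HI2] := ex _ hm2; have [I3 HI3] := ex _ hm3.
have E1 : I1 = I2.
  apply: (@sector_cauchy w (PI - w) _ _ _ G' phi (PI / 2) c _ _ HG) HI1 HI2; try rlra.
  - by move=> r t r0 ht; apply: bd => //; rlra.
  - exact: ai.
  - exact: ai.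
have E2 : I2 = I3.
  apply: (@sector_cauchy_left w (PI - w) _ G' (PI / 2) (PI - phi) c _ _ _ _ HG) HI2 HI3; try rlra.
  - by move=> r t r0 ht; apply: bd => //; rlra.
  - exact: ai.
  - exact: ai.
by exists I1; split=> //; rewrite E1 E2.
Qed.

(** The inner part is a multiple of [kappa1], which extends across the real axis. Turned onto the
    positive or negative half-axis, the integrand becomes minus or plus [l L / (1 + r^2)]. *)
Lemma inner_integrals phi : w < phi < theta ->
  zinf (ray inner_part phi) (- (fval l L * (PI / 2))) /\
  zinf (ray inner_part (PI - phi)) (fval l L * (PI / 2)).
Proof.
move=> hp; have [w0 wp] := res_angle Rd; have th := theta_pos.
have [k1 [k2 _]] := kappa1_facts.
have c0 : 0 < cos theta by apply: cos_gt_0; rlra.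
have i0 : 0 < / cos theta by apply: Rinv_0_lt_compat.
set u := Cmult (Copp Ci) (Cminus (RtoC (fval l K)) (Cmult Ci (RtoC (fval l L)))).
have h1 : holo (sector (- theta) theta) inner_part by apply: holo_mult => //; apply: holo_const.
have h2 : holo (sector (PI - theta) (PI + theta)) inner_part by apply: holo_mult => //; apply: holo_const.
pose c := Cmod u * / cos theta.
have cc : 0 <= c by apply: Rmult_le_pos; [apply: Cmod_ge_0|rlra].
have bd r t : 0 < r -> in_I theta t -> Cmod (inner_part (polar r t)) <= c * / (1 + r ^ 2).
  move=> r0 ht; rewrite /inner_part -/u Cmod_mult /c Rmult_assoc.
  apply: Rmult_le_compat_l; first exact: Cmod_ge_0.
  rewrite Cmod_inv; last exact: (@in_I_one_plus_sq_neq0 theta _ _ th).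
  rewrite -Rinv_mult; apply: Rinv_le_contravar; last exact: in_I_one_plus_sq.
  by apply: Rmult_lt_0_compat => //; have := pow2_ge_0 r; rlra.
have bd2 r t : 0 < r -> in_I theta t -> r * Cmod (inner_part (polar r t)) <= c.
  move=> r0 ht; apply: Rle_trans (r_inv_one_plus_sqr r0 cc).
  by apply: Rmult_le_compat_l; [rlra|apply: bd].
have ai1 t : - theta < t < theta -> abs_int (fun r => Cmod (inner_part (polar r t)) : R_NormedModule).
  by move=> ht; apply: (abs_int_of_bound h1 (c := c)) => // r r0; apply: bd => //; left.
have ai2 t : PI - theta < t < PI + theta -> abs_int (fun r => Cmod (inner_part (polar r t)) : R_NormedModule).
  by move=> ht; apply: (abs_int_of_bound h2 (c := c)) => // r r0; apply: bd => //; right.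
have r0E r : 0 < r -> ray inner_part 0 r = - fval l L * / (1 + r ^ 2).
  move=> r0; have p := pow2_ge_0 r.
  rewrite /ray /inner_part /kappa1 /one_plus_sq /polar sin_0 cos_0 /Re /=; field.
  by move: p => /=; nra.
have rpE r : 0 < r -> ray inner_part PI r = fval l L * / (1 + r ^ 2).
  move=> r0; have p := pow2_ge_0 r.
  rewrite /ray /inner_part /kappa1 /one_plus_sq /polar sin_PI cos_PI /Re /=; field.
  by move: p => /=; nra.
have z1 : zinf (ray inner_part 0) (- (fval l L * (PI / 2))).
  have := @is_RInt_zinf_scal _ (- fval l L) _ _ inv_one_plus_sqr_zinf.
  rewrite /scal /= /mult /= Ropp_mult_distr_l; apply: is_RInt_zinf_ext => r r0.
  by rewrite r0E.
have z2 : zinf (ray inner_part PI) (fval l L * (PI / 2)).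
  have := @is_RInt_zinf_scal _ (fval l L) _ _ inv_one_plus_sqr_zinf.
  by rewrite /scal /= /mult /=; apply: is_RInt_zinf_ext => r r0; rewrite rpE.
have hp1 : - theta < phi < theta by rlra.
have hp2 : PI - theta < PI - phi < PI + theta by rlra.
have hp0 : - theta < 0 < theta by rlra.
have hpp : PI - theta < PI < PI + theta by rlra.
have [I1 HI1] := zinf_of_abs_int h1 hp1 (ai1 _ hp1).
have [I2 HI2] := zinf_of_abs_int h2 hp2 (ai2 _ hp2).
have [d1 H1] := h1; have [d2 H2] := h2.
split.
- suff -> : - (fval l L * (PI / 2)) = I1 by [].
  apply: (@sector_cauchy (- theta) theta _ _ _ d1 0 phi c _ _ H1) z1 HI1; try rlra.
  + by move=> r t r0 ht; apply: bd2 => //; left; rlra.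
  + exact: ai1.
  + exact: ai1.
- suff <- : I2 = fval l L * (PI / 2) by [].
  apply: (@sector_cauchy_left (PI - theta) (PI + theta) _ d2 (PI - phi) PI c _ _ _ _ H2) HI2 z2; try rlra.
  + by move=> r t r0 ht; apply: bd2 => //; right; rlra.
  + exact: ai2.
  + exact: ai2.
Qed.

End BaseCase.

(** The outer integrals cancel in [A2 - A1], and the inner ones add up to [PI] times [L]. *)
Lemma calculus_value_base : admissible theta e_one -> calculus_value e_one L.
Proof.
move=> He phi hp; have [w0 wp] := res_angle Rd.
have r1 : ray_angle phi by left.
have r2 : ray_angle (PI - phi) by right; rlra.
have [A1 H1] := @abs_int_cvg (blin_CompleteNormedModule X X) _ (abs_int_op_ray He r1).
have [A2 H2] := @abs_int_cvg (blin_CompleteNormedModule X X) _ (abs_int_op_ray He r2).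
exists A1, A2; split=> //; split=> //; apply: fval_eq => l.
have [I [O1 O2]] := outer_integrals l hp; have [N1 N2] := inner_integrals l hp.
have key t A J : ray_angle t -> zinf (op_ray e_one t) A -> zinf (ray (outer_part l) t) I ->
    zinf (ray (inner_part l) t) J -> fval l A = I + J.
  move=> ht HA HO HN; apply: (@is_RInt_zinf_unique R_CompleteNormedModule _ _ _ (fval_zinf l HA)).
  apply: is_RInt_zinf_ext (is_RInt_zinf_plus HO HN) => r r0.
  have nz : one_plus_sq (polar r t) <> RtoC 0.
    by apply: (@in_I_one_plus_sq_neq0 theta _ _ theta_pos); case: (ray_angleW ht).
  rewrite fval_op_ray {3}/ray (outer_inner_split l (sector_ray r0 ht) nz) /plus /= /ray.
  by rewrite /Re /=; ring.
have e1 := key _ _ _ r1 H1 O1 N1; have e2 := key _ _ _ r2 H2 O2 N2.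
rewrite fvalZ fvalB e1 e2; have := PI_RGT_0 => p; field; rlra.
Qed.

End ScalarCalculus.

HB.instance Definition _ := Monoid.isComLaw.Build R 1 Rmult
  (fun x y z => esym (Rmult_assoc x y z)) Rmult_comm Rmult_1_l.

(** * Clifford algebra *)

Section CliffordSign.
Variable n : nat.
Implicit Types A B C : {set 'I_n}.

Lemma symdiff_comm A B : symdiff A B = symdiff B A.
Proof. by apply/setP => i; rewrite /symdiff !inE; case: (i \in A); case: (i \in B). Qed.

Lemma symdiff_assoc A B C : symdiff A (symdiff B C) = symdiff (symdiff A B) C.
Proof.
by apply/setP => i; rewrite /symdiff !inE; case: (i \in A); case: (i \in B); case: (i \in C).
Qed.

Lemma symdiff_id A : symdiff A A = set0.
Proof. by apply/setP => i; rewrite /symdiff !inE; case: (i \in A). Qed.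

Lemma symdiff0 A : symdiff A set0 = A.
Proof. by apply/setP => i; rewrite /symdiff !inE; case: (i \in A). Qed.

Lemma symdiff_inj A : injective (symdiff A).
Proof. by move=> B C H; rewrite -(symdiffK A B) H symdiffK. Qed.

Lemma signR_card (I : finType) (S : {set I}) :
  (-1) ^ #|S| = \big[Rmult/1]_(i : I) (if i \in S then -1 else 1).
Proof.
rewrite -big_mkcond /= -sum1_card.
by apply: (big_ind2 (fun m x => (-1) ^ m = x)) => [|a x b y <- <-|i _] //=; [exact: pow_add|ring].
Qed.

Lemma cl_signE A B : cl_sign A B =
  \big[Rmult/1]_(p : 'I_n * 'I_n) (if [&& p.1 \in A, p.2 \in B & (p.2 < p.1)%nat] then -1 else 1) *
  \big[Rmult/1]_(i : 'I_n) (if (i \in A) && (i \in B) then -1 else 1).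
Proof.
rewrite /cl_sign pow_add !signR_card; congr Rmult.
- by apply: eq_bigr => p _; rewrite inE.
- by apply: eq_bigr => p _; rewrite inE.
Qed.

(** The sign is a product of local factors, one for each pair and each index, and an index lying in
    both [A] and [A'] contributes a square. This bimultiplicativity is the source of
    associativity. *)
Lemma cl_signMl A A' B : cl_sign (symdiff A A') B = cl_sign A B * cl_sign A' B.
Proof.
rewrite !cl_signE [RHS]Rmult_comm -Rmult_assoc [_ * _ * _]Rmult_comm.
have -> (a b c d : R) : b * (c * d * a) = (a * c) * (b * d) by ring.
rewrite -!big_split; congr Rmult; apply: eq_bigr => p _ /=; rewrite /symdiff !inE.
- by case: (p.1 \in A); case: (p.1 \in A'); case: (p.2 \in B); case: (p.2 < p.1)%nat => /=; ring.
- by case: (p \in A); case: (p \in A'); case: (p \in B) => /=; ring.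
Qed.

Lemma cl_signMr A B B' : cl_sign A (symdiff B B') = cl_sign A B * cl_sign A B'.
Proof.
rewrite !cl_signE [RHS]Rmult_comm -Rmult_assoc [_ * _ * _]Rmult_comm.
have -> (a b c d : R) : b * (c * d * a) = (a * c) * (b * d) by ring.
rewrite -!big_split; congr Rmult; apply: eq_bigr => p _ /=; rewrite /symdiff !inE.
- by case: (p.1 \in A); case: (p.2 \in B); case: (p.2 \in B'); case: (p.2 < p.1)%nat => /=; ring.
- by case: (p \in A); case: (p \in B); case: (p \in B') => /=; ring.
Qed.

Lemma cl_sign_sqr A B : cl_sign A B * cl_sign A B = 1.
Proof. by rewrite /cl_sign -Rpow_mult_distr (_ : -1 * -1 = 1) ?pow1 //; ring. Qed.

Lemma cl_sign0l B : cl_sign set0 B = 1.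
Proof.
have h := cl_signMl set0 set0 B; rewrite symdiff_id in h.
have := cl_sign_sqr set0 B; rewrite -h; exact.
Qed.

Lemma cl_sign0r A : cl_sign A set0 = 1.
Proof.
have h := cl_signMr A set0 set0; rewrite symdiff_id in h.
have := cl_sign_sqr A set0; rewrite -h; exact.
Qed.

Lemma Rabs_cl_sign A B : Rabs (cl_sign A B) = 1.
Proof. by rewrite /cl_sign -RPow_abs Rabs_Ropp Rabs_R1 pow1. Qed.

Lemma cl_sign1 (i j : 'I_n) :
  cl_sign [set i] [set j] = if (i == j) || (j < i)%nat then -1 else 1.
Proof.
rewrite /cl_sign.
have -> : [set p : 'I_n * 'I_n | [&& p.1 \in [set i], p.2 \in [set j] & (p.2 < p.1)%nat]] =
    if (j < i)%nat then [set (i, j)] else set0.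
  apply/setP => -[a b]; rewrite !inE /=; case: (ltnP j i) => ji; rewrite ?inE ?xpair_eqE.
  - by case: eqP => [->|] //=; case: eqP => [->|] //=; rewrite ji.
  - case: eqP => [->|] //=; case: eqP => [->|] //=.
    by rewrite ltnNge ji.
have -> : [set i] :&: [set j] = if i == j then [set i] else set0.
  apply/setP => a; rewrite !inE; case: (altP (i =P j)) => [->|ij]; rewrite ?inE ?andbb //.
  by case: eqP => [->|] //=; rewrite (negbTE ij).
case: (altP (i =P j)) => [->|ij]; first by rewrite ltnn cards0 cards1 /=; ring.
by case: (ltnP j i) => ji; rewrite ?cards1 ?cards0 /=; ring.
Qed.

End CliffordSign.

Section BigSums.
Variable X : NormedModule R_AbsRing.

Lemma norm_sum_le (I : Type) (r : seq I) (F : I -> X) (c : I -> R) :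
  (forall i, norm (F i) <= c i) ->
  norm (\big[plus/zero]_(i <- r) F i) <= \big[Rplus/0]_(i <- r) c i.
Proof.
move=> H; elim: r => [|i r IH]; first by rewrite !big_nil norm_zero; apply: Rle_refl.
by rewrite !big_cons; apply: norm_plus_le.
Qed.

Lemma scal_sum (I : Type) (r : seq I) (F : I -> X) (k : R) :
  scal k (\big[plus/zero]_(i <- r) F i) = \big[plus/zero]_(i <- r) scal k (F i).
Proof.
elim: r => [|i r IH]; first by rewrite !big_nil; apply: scal_zero_r.
by rewrite !big_cons -IH; apply: scal_distr_l.
Qed.

Lemma blin_sum (Y : NormedModule R_AbsRing) (A : blin X Y) (I : Type) (r : seq I) (F : I -> X) :
  A (\big[plus/zero]_(i <- r) F i) = \big[plus/zero]_(i <- r) A (F i).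
Proof.
elim: r => [|i r IH]; first by rewrite !big_nil; apply: blin0.
by rewrite !big_cons blinD IH.
Qed.

End BigSums.

Lemma sum_blinE (X Y : NormedModule R_AbsRing) (I : Type) (r : seq I)
    (F : I -> blin_NormedModule X Y) (x : X) :
  (\big[plus/zero]_(i <- r) F i : blin X Y) x = \big[plus/zero]_(i <- r) (F i : blin X Y) x.
Proof.
elim: r => [|i r IH]; first by rewrite !big_nil.
by rewrite !big_cons -IH.
Qed.

(** * Left and right Clifford multiplication as operators *)

Section CliffordModuleOperators.
Variables (n : nat) (VR : NormedModule R_AbsRing).
Local Notation V := (clmod_NormedModule n VR).
Implicit Types (A B C : {set 'I_n}) (v : clmod n VR) (a b : Cl n).

Lemma clmod_sumE (I : Type) (r : seq I) (F : I -> V) C :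
  (\big[plus/zero]_(i <- r) F i : clmod n VR) C = \big[plus/zero]_(i <- r) (F i : clmod n VR) C.
Proof.
elim: r => [|i r IH]; first by rewrite !big_nil ffunE.
by rewrite !big_cons ffunE -IH.
Qed.

(** Left and right multiplication by [e_A] are signed permutations of the components; as bounded
    operators they can be moved through integrals. *)
Definition eop_fun A v : clmod n VR :=
  [ffun C => scal (cl_sign A (symdiff A C)) (v (symdiff A C))].
Definition rop_fun A v : clmod n VR :=
  [ffun C => scal (cl_sign (symdiff A C) A) (v (symdiff A C))].

Lemma signed_shift_linear (s : {set 'I_n} -> R) A :
  (forall C, Rabs (s C) = 1) ->
  is_linear (fun v : V => [ffun C => scal (s C) ((v : clmod n VR) (symdiff A C))] : V).
Proof.
move=> hs; split.
- by move=> v v'; apply/ffunP => C; rewrite !ffunE scal_distr_l.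
- move=> k v; apply/ffunP => C; rewrite !ffunE !scal_assoc; congr scal.
  exact: Rmult_comm.
- exists (INR #|{: {set 'I_n}}| + 1); split; first by have := pos_INR #|{: {set 'I_n}}|; rlra.
  move=> v; apply: (@Rle_trans _ (INR #|{: {set 'I_n}}| * norm v)).
    apply: clmod_norm_le => C; rewrite ffunE.
    apply: Rle_trans (norm_scal_le _ (clmod_norm_comp v (symdiff A C))) _.
    by rewrite hs Rmult_1_l; apply: Rle_refl.
  by apply: Rmult_le_compat_r; [apply: norm_ge_0|rlra].
Qed.

Definition eop A : blin V V :=
  @Blin V V (eop_fun A) (@signed_shift_linear (fun C => cl_sign A (symdiff A C)) A
    (fun C => Rabs_cl_sign _ _)).
Definition rop A : blin V V :=
  @Blin V V (rop_fun A) (@signed_shift_linear (fun C => cl_sign (symdiff A C) A) A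
    (fun C => Rabs_cl_sign _ _)).

Definition lop a : blin_NormedModule V V :=
  \big[plus/zero]_(A : {set 'I_n}) scal (a A : R) (eop A : blin_NormedModule V V).
Definition rmop a : blin_NormedModule V V :=
  \big[plus/zero]_(A : {set 'I_n}) scal (a A : R) (rop A : blin_NormedModule V V).

Lemma lopE a v : (lop a : blin V V) v = lmul a v.
Proof.
rewrite /lop sum_blinE; apply/ffunP => C; rewrite clmod_sumE ffunE.
apply: eq_bigr => A _; rewrite !ffunE scal_assoc; congr scal.
by rewrite /mult /=; ring.
Qed.

Lemma rmopE a v : (rmop a : blin V V) v = rmul v a.
Proof.
rewrite /rmop sum_blinE; apply/ffunP => C; rewrite clmod_sumE ffunE.
apply: eq_bigr => A _; rewrite !ffunE scal_assoc; congr scal.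
by rewrite /mult /=; ring.
Qed.

Lemma eop_eop A B v : eop A (eop B v) = scal (cl_sign A B) (eop (symdiff A B) v).
Proof.
apply/ffunP => C; rewrite !ffunE !scal_assoc.
have -> : symdiff B (symdiff A C) = symdiff (symdiff A B) C.
  by rewrite (symdiff_comm A B) symdiff_assoc.
congr scal; set C' := symdiff (symdiff A B) C.
have -> : symdiff A C = symdiff B C'.
  apply/setP => i; rewrite /C' /symdiff !inE.
  by case: (i \in A); case: (i \in B); case: (i \in C).
by rewrite cl_signMl cl_signMr /mult /=; ring.
Qed.

Lemma eop_rop A B v : eop A (rop B v) = rop B (eop A v).
Proof.
apply/ffunP => C; rewrite !ffunE !scal_assoc.
have E : symdiff B (symdiff A C) = symdiff A (symdiff B C).
  by rewrite !symdiff_assoc (symdiff_comm A B).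
rewrite E; congr scal; set C' := symdiff A (symdiff B C).
have -> : symdiff A C = symdiff B C' by rewrite /C' -E symdiffK.
have -> : symdiff B C = symdiff A C' by rewrite /C' symdiffK.
by rewrite !cl_signMl !cl_signMr /mult /=; ring.
Qed.

Lemma lmul_sumE a v : lmul a v = \big[plus/zero]_(A : {set 'I_n}) scal (a A : R) (eop A v : V).
Proof. by rewrite -lopE /lop sum_blinE. Qed.

Lemma lmulDl a b v : lmul (plus a b) v = plus (lmul a v : V) (lmul b v).
Proof.
rewrite !lmul_sumE -big_split; apply: eq_bigr => A _ /=.
by rewrite ffunE; apply: (@scal_distr_r R_AbsRing V).
Qed.

Lemma lmulZl (k : R) a v : lmul (scal k a) v = scal k (lmul a v : V).
Proof.
rewrite !lmul_sumE scal_sum; apply: eq_bigr => A _ /=.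
by rewrite ffunE scal_assoc.
Qed.

Lemma lmul0l v : lmul (zero : Cl n) v = (zero : V).
Proof. by have := lmulZl 0 zero v; rewrite !(@scal_zero_l R_AbsRing). Qed.

Lemma lmulDr a v w : lmul a (plus v w : V) = plus (lmul a v : V) (lmul a w).
Proof. by rewrite -!lopE blinD. Qed.

Lemma lmulZr (k : R) a v : lmul a (scal k v : V) = scal k (lmul a v : V).
Proof. by rewrite -!lopE blinZ. Qed.

Lemma lmul_suml (I : Type) (r : seq I) (F : I -> Cl n) v :
  lmul (\big[plus/zero]_(i <- r) (F i : clmod_NormedModule n R_NormedModule)) v =
  \big[plus/zero]_(i <- r) (lmul (F i) v : V).
Proof.
elim: r => [|i r IH]; first by rewrite !big_nil lmul0l.
by rewrite !big_cons lmulDl IH.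
Qed.

Lemma lmul_base A v : lmul (cl_base A) v = eop A v.
Proof.
rewrite lmul_sumE (bigD1 A) //= big1; last first.
  by move=> B /negbTE BA; rewrite ffunE BA; apply: (@scal_zero_l R_AbsRing V).
by rewrite ffunE eqxx plus_zero_r; apply: (@scal_one R_AbsRing V).
Qed.

Lemma lmul_rmul a v b : lmul a (rmul v b) = rmul (lmul a v) b.
Proof.
rewrite -!lopE -!rmopE /lop /rmop !sum_blinE.
rewrite [LHS](eq_bigr (fun A => \big[plus/zero]_(B : {set 'I_n}) scal (b B : R) (scal (a A : R) (eop A (rop B v) : V)))); last first.
  move=> A _; rewrite -[LHS]/(scal (a A : R) (eop A _ : V)) blin_sum scal_sum.
  apply: eq_bigr => B _; rewrite -[X in eop A X]/(scal (b B : R) (rop B v : V)) blinZ !scal_assoc.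
  by congr scal; apply: Rmult_comm.
rewrite exchange_big; apply: eq_bigr => B _ /=.
rewrite -[RHS]/(scal (b B : R) (rop B _ : V)) blin_sum scal_sum.
by apply: eq_bigr => A _; rewrite -[X in rop B X]/(scal (a A : R) (eop A v : V)) blinZ -eop_rop.
Qed.

End CliffordModuleOperators.
Arguments eop {n VR} A.
Arguments rop {n VR} A.
Arguments lop {n} VR a.
Arguments rmop {n} VR a.

Section CliffordAlgebraLaws.
Variable n : nat.
Local Notation A_n := (clmod_NormedModule n R_NormedModule).
Implicit Types (a b c J : Cl n).

Lemma cl_expand a : a = \big[plus/zero]_(A : {set 'I_n}) (scal (a A : R) (cl_base A : A_n)).
Proof.
apply/ffunP => C; rewrite clmod_sumE (bigD1 C) //= big1; last first.
  move=> B /negbTE BC; rewrite !ffunE eq_sym BC; exact: Rmult_0_r.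
by rewrite !ffunE eqxx plus_zero_r; apply: esym; apply: Rmult_1_r.
Qed.

(** By linearity the claim reduces to basis elements, where it is [eop_eop]. *)
Lemma lmulA (VR : NormedModule R_AbsRing) a b (v : clmod n VR) :
  lmul (cl_mul a b) v = lmul a (lmul b v).
Proof.
have key A : lmul (cl_mul (cl_base A) b) v = eop A (lmul b v).
  rewrite /cl_mul lmul_base {1}(cl_expand b) blin_sum lmul_suml lmul_sumE.
  rewrite blin_sum; apply: eq_bigr => B _.
  rewrite !blinZ lmulZl eop_eop; congr scal.
  by rewrite -lmul_base -/(cl_mul _ _) cl_mul_base lmulZl lmul_base.
rewrite {1}/cl_mul (lmul_sumE a b) lmul_suml [RHS]lmul_sumE; apply: eq_bigr => A _.
by rewrite lmulZl -key /cl_mul lmul_base.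
Qed.

Lemma cl_mulA a b c : cl_mul (cl_mul a b) c = cl_mul a (cl_mul b c).
Proof. exact: lmulA. Qed.

Lemma lmul_real (VR : NormedModule R_AbsRing) (x : R) (v : clmod n VR) :
  lmul (cl_real n x) v = scal x (v : clmod_NormedModule n VR).
Proof.
rewrite /cl_real lmulZl lmul_base; congr scal; apply/ffunP => C.
by rewrite ffunE cl_sign0l symdiff_comm symdiff0; apply: (scal_one (v C)).
Qed.

Lemma cl_mul_real_r a (x : R) : cl_mul a (cl_real n x) = scal x (a : A_n).
Proof.
rewrite /cl_mul /cl_real lmulZr; congr scal; apply/ffunP => C.
rewrite !ffunE (bigD1 C) //= big1; last first.
  move=> B BC; rewrite !ffunE; case: eqP => [E|_].
    by move: BC; rewrite -(symdiff0 B) -E symdiffK eqxx.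
  exact: Rmult_0_r.
rewrite symdiff_id ffunE eqxx cl_sign0r plus_zero_r /scal /= /mult /=; ring.
Qed.

Lemma cl_mulDl a b c : cl_mul (plus a b) c = plus (cl_mul a c : A_n) (cl_mul b c).
Proof. exact: lmulDl. Qed.
Lemma cl_mulDr a b c : cl_mul a (plus (b : A_n) c) = plus (cl_mul a b : A_n) (cl_mul a c).
Proof. exact: lmulDr. Qed.
Lemma cl_mulZl (k : R) a b : cl_mul (scal k a) b = scal k (cl_mul a b : A_n).
Proof. exact: lmulZl. Qed.
Lemma cl_mulZr (k : R) a b : cl_mul a (scal k (b : A_n)) = scal k (cl_mul a b : A_n).
Proof. exact: lmulZr. Qed.

Lemma imag_unit_support J A : imag_unit J -> J A <> 0 -> exists i, A = [set i].
Proof.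
move=> [pJ [J0 _]] JA; have : #|A| = 1%nat.
  apply/eqP; rewrite eqn_leq; apply/andP; split.
    by rewrite leqNgt; apply/negP => /pJ.
  rewrite lt0n cards_eq0; apply/eqP => A0; apply: JA.
  by rewrite A0.
by move/eqP/cards1P.
Qed.

Lemma imag_unit_norm2 J : imag_unit J -> \big[Rplus/0]_(A : {set 'I_n}) (J A) ^ 2 = 1.
Proof.
move=> [_ [_ nJ]].
have {}nJ : sqrt (\big[Rplus/0]_(A : {set 'I_n}) (norm (J A : R_NormedModule)) ^ 2) = 1 := nJ.
transitivity (\big[Rplus/0]_(A : {set 'I_n}) (norm (J A : R_NormedModule)) ^ 2).
  by apply: eq_bigr => A _; rewrite pow2_abs.
rewrite -(pow2_sqrt (\big[_/_]_(_ <- _ | _) _)); last exact: sum_sqr_ge0.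
by rewrite nJ; ring.
Qed.

(** For nonempty [C] the terms of [J^2] at [A] and [symdiff C A] cancel, as distinct [e_i]
    anticommute, so the component equals its own negative. For empty [C] minus the squared norm
    remains. *)
Lemma imag_unit_sqr J : imag_unit J -> cl_mul J J = cl_real n (-1).
Proof.
move=> hJ; apply/ffunP => C.
pose t A := cl_sign A (symdiff A C) * J A * J (symdiff A C).
have -> : cl_mul J J C = \big[Rplus/0]_(A : {set 'I_n}) t A by rewrite ffunE.
case: (altP (C =P set0)) => [C0|C0].
  rewrite C0 !ffunE eqxx.
  transitivity (\big[Rplus/0]_(A : {set 'I_n}) (- (J A) ^ 2)).
    apply: eq_bigr => A _; rewrite /t C0 symdiff0.
    case: (Req_dec (J A) 0) => [->|/(imag_unit_support hJ) [i ->]]; first by rewrite /=; ring.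
    by rewrite cl_sign1 eqxx /=; ring.
  rewrite -(big_morph Ropp Ropp_plus_distr Ropp_0) imag_unit_norm2 //.
  by rewrite /scal /= /mult /=; ring.
rewrite !ffunE (negbTE C0).
have E A : t (symdiff C A) = - t A.
  rewrite /t (symdiff_comm (symdiff C A)) symdiffK (symdiff_comm A C).
  case: (Req_dec (J A) 0) => [->|/(imag_unit_support hJ) [i Ei]]; first by ring.
  case: (Req_dec (J (symdiff C A)) 0) => [->|/(imag_unit_support hJ) [j Ej]]; first by ring.
  rewrite Ej Ei !cl_sign1.
  have ij : i != j.
    apply/eqP => ij; move: Ej C0; rewrite -ij -Ei => H.
    by rewrite -(symdiffK A C) (symdiff_comm A C) H symdiff_id eqxx.
  rewrite (eq_sym j) (negbTE ij) /=; case: ltngtP => [||/val_inj] ji; try ring.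
  by rewrite ji eqxx in ij.
set S := (\big[_/_]_(_ <- _ | _) _).
have S2 : S = - S.
  rewrite {1}/S (reindex_inj (@symdiff_inj n C)) (eq_bigr _ (fun A _ => E A)).
  by rewrite -(big_morph Ropp Ropp_plus_distr Ropp_0).
by rewrite /scal /= /mult /= Rmult_0_r; rlra.
Qed.

End CliffordAlgebraLaws.

(** With [t = acos (x / r)] the hypotheses read [r sin (t - phi) > 0] and [r sin (t + phi) > 0]: the
    point lies above the rays at angles [phi] and [PI - phi]. *)
Lemma polar_coordinates phi x y : 0 <= phi < PI / 2 ->
  0 < y * cos phi - x * sin phi -> 0 < y * cos phi + x * sin phi ->
  exists r t, 0 < r /\ phi < t < PI - phi /\ ((x, y) : C) = polar r t.
Proof.
move=> hp h1 h2; have c0 : 0 < cos phi by apply: cos_gt_0; rlra.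
have y0 : 0 < y by nra.
pose r := sqrt (x ^ 2 + y ^ 2).
have s0 : 0 < x ^ 2 + y ^ 2 by have := pow2_ge_0 x; have := pow_lt y 2 y0; rlra.
have r0 : 0 < r by apply: sqrt_lt_R0.
have rr : r * r = x ^ 2 + y ^ 2 by apply: sqrt_sqrt; rlra.
have xr : -1 <= x / r <= 1.
  have xx : Rabs x <= r by rewrite -sqrt_Rsqr_abs; apply: sqrt_le_1_alt; rewrite /Rsqr; nra.
  move: xx => /Rabs_le_between xx.
  split; apply: (@Rmult_le_reg_r r) => //; rewrite /Rdiv Rmult_assoc Rinv_l; rlra.
pose t := acos (x / r).
have ct : r * cos t = x by rewrite /t cos_acos //; field; rlra.
have tb : 0 <= t <= PI by apply: acos_bound.
have st : r * sin t = y.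
  have sp : 0 <= sin t by apply: sin_ge_0; rlra.
  have := sin2_cos2 t; rewrite /Rsqr => e.
  apply: Rsqr_inj; [by apply: Rmult_le_pos; rlra|rlra|].
  rewrite /Rsqr; have -> : r * sin t * (r * sin t) = r * r * (sin t * sin t) by ring.
  have -> : sin t * sin t = 1 - cos t * cos t by rlra.
  have -> : r * r * (1 - cos t * cos t) = r * r - (r * cos t) * (r * cos t) by ring.
  by rewrite rr ct; ring.
exists r, t; split=> //; split; last by rewrite /polar ct st.
have e1 : r * sin (t - phi) = y * cos phi - x * sin phi by rewrite sin_minus -ct -st; ring.
have e2 : r * sin (t + phi) = y * cos phi + x * sin phi by rewrite sin_plus -ct -st; ring.
split.
- apply: Rnot_le_lt => h.
  have : 0 <= sin (phi - t) by apply: sin_ge_0; rlra.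
  have -> : phi - t = - (t - phi) by ring.
  by rewrite sin_neg; nra.
- apply: Rnot_le_lt => h.
  have : 0 <= sin (t + phi - PI) by apply: sin_ge_0; rlra.
  have -> : t + phi - PI = - (PI - (t + phi)) by ring.
  by rewrite sin_neg sin_PI_x; nra.
Qed.

(** * Pseudo-resolvents *)

Section NormContinuity.
Variable X : NormedModule R_AbsRing.
Local Notation bop := (blin_NormedModule X X).
Implicit Types F G : C -> bop.

Definition ncont F (z : C) : Prop := forall e, 0 < e -> exists d, 0 < d /\
  forall u, Cmod (Cminus u z) < d -> norm (minus (F u) (F z)) < e.

Lemma ncont_comp F G z : ncont F z -> ncont G z -> ncont (fun u => bcomp (F u) (G u)) z.
Proof.
move=> HF HG e e0; set a := norm (F z); set b := norm (G z).
have a0 : 0 <= a by apply: norm_ge_0.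
have b0 : 0 <= b by apply: norm_ge_0.
pose m := Rmin 1 (e / (a + b + 1) / 2).
have k0 : 0 < e / (a + b + 1) / 2.
  by apply: Rdiv_lt_0_compat; [apply: Rdiv_lt_0_compat|]; rlra.
have m0 : 0 < m by apply: Rmin_glb_lt; rlra.
have [d [d0 Hd]] := HF _ m0; have [r [r0 Hr]] := HG _ m0.
exists (Rmin d r); split; first exact: Rmin_glb_lt.
move=> u uz; have h1 := Rlt_le _ _ (Hd u (Rlt_le_trans _ _ _ uz (Rmin_l _ _))).
have h2 := Rlt_le _ _ (Hr u (Rlt_le_trans _ _ _ uz (Rmin_r _ _))).
set x := minus (F u) (F z) in h1; set y := minus (G u) (G z) in h2.
have E : minus (bcomp (F u) (G u) : bop) (bcomp (F z) (G z)) =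
    plus (bcomp x y : bop) (plus (bcomp x (G z) : bop) (bcomp (F z) y)).
  apply: blin_eq => v; rewrite minus_blinE.
  have xE w : (x : blin X X) w = minus (F u w) (F z w) by rewrite /x minus_blinE.
  have yE : (y : blin X X) v = minus (G u v) (G z v) by rewrite /y minus_blinE.
  rewrite -[RHS]/(plus ((x : blin X X) ((y : blin X X) v)) (plus ((x : blin X X) (G z v)) (F z ((y : blin X X) v)))).
  rewrite !xE !yE -[bcomp (F u) _ _]/(F u (G u v)) -[bcomp (F z) _ _]/(F z (G z v)) !blinB.
  by lin; ring.
rewrite E.
have nc (A B : bop) p q : norm A <= p -> norm B <= q -> 0 <= p -> 0 <= q -> norm (bcomp A B : bop) <= p * q.
  move=> hA hB p0 q0; apply: Rle_trans (opnorm_comp A B) _.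
  by apply: Rmult_le_compat => //; apply: opnorm_ge0.
have m1 : m <= 1 by apply: Rmin_l.
have := norm_plus_le (nc _ _ _ _ h1 h2 (Rlt_le _ _ m0) (Rlt_le _ _ m0))
   (norm_plus_le (nc _ _ _ _ h1 (Rle_refl b) (Rlt_le _ _ m0) b0)
                 (nc _ _ _ _ (Rle_refl a) h2 a0 (Rlt_le _ _ m0))).
move=> H; apply: Rle_lt_trans H _.
have mk : m * (a + b + 1) <= e / 2.
  apply: Rle_trans (Rmult_le_compat_r _ _ _ _ (Rmin_r _ _)) _; first rlra.
  by apply: Req_le; field; rlra.
nra.
Qed.

Lemma ncont_fval (l m : blin bop R_NormedModule) F G z : ncont F z -> ncont G z ->
  ccont (fun u => ((fval l (F u), fval m (G u)) : C)) z.
Proof.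
move=> HF HG e e0; have l0 := opnorm_ge0 l; have m0 := opnorm_ge0 m.
have e1 : 0 < e / 4 / (opnorm l + 1) by apply: Rdiv_lt_0_compat; rlra.
have e2 : 0 < e / 4 / (opnorm m + 1) by apply: Rdiv_lt_0_compat; rlra.
have [d [d0 Hd]] := HF _ e1; have [r [r0 Hr]] := HG _ e2.
exists (Rmin d r); split; first exact: Rmin_glb_lt.
move=> u uz; have h1 := Rlt_le _ _ (Hd u (Rlt_le_trans _ _ _ uz (Rmin_l _ _))).
have h2 := Rlt_le _ _ (Hr u (Rlt_le_trans _ _ _ uz (Rmin_r _ _))).
apply: Rle_lt_trans (Cmod_le_abs _) _ => /=.
have k (k : blin bop R_NormedModule) (A B : bop) : norm (minus A B) <= e / 4 / (opnorm k + 1) ->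
    Rabs (fval k A + - fval k B) <= e / 4.
  move=> h; have k0 := opnorm_ge0 k; rewrite -[_ + - _]/(fval k A - fval k B) -fvalB.
  apply: Rle_trans (fval_bound k _) _.
  apply: (@Rle_trans _ ((opnorm k + 1) * (e / 4 / (opnorm k + 1)))); last by apply: Req_le; field; rlra.
  by apply: Rmult_le_compat => //; [apply: norm_ge_0|rlra].
have := k _ _ _ h1; have := k _ _ _ h2; rlra.
Qed.

Lemma ncont_continuous F r t : ncont F (polar r t) -> continuous (fun s => F (polar s t)) r.
Proof.
move=> H; apply/filterlim_locally => e; have [d [d0 Hd]] := H e (cond_pos e).
exists (mkposreal _ d0) => s hs; apply: norm_compat1; apply: Hd.
have {}hs : Rabs (s - r) < d := hs.
rewrite (_ : Cminus (polar s t) (polar r t) = Cmult (RtoC (s - r)) (polar 1 t)).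
  by rewrite Cmod_mult Cmod_R Cmod_polar; rlra.
by rewrite /polar /Cminus /Cmult /Cplus /Copp /=; congr pair => /=; ring.
Qed.

End NormContinuity.

Section OperatorResolvent.
Variable X : CompleteNormedModule R_AbsRing.
Local Notation bop := (blin_NormedModule X X).
Variable T : X -> X -> Prop.
Hypotheses (T_add : forall u v s t, T u s -> T v t -> T (plus u v) (plus s t))
  (T_scal : forall (k : R) u s, T u s -> T (scal k u) (scal k s))
  (T_fun : forall u s t, T u s -> T u t -> s = t).

(* [K] is the inverse of [T^2 - 2 x T + N] and [L] is [T K]. *)
Definition pseudo_resolvent (x N : R) (K L : bop) : Prop :=
  (forall u v, (exists t1 t2, T u t1 /\ T t1 t2 /\
      v = plus (minus t2 (scal (2 * x) t1)) (scal N u)) <-> u = K v) /\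
  (forall v, T (K v) (L v)).

(** The inclusion of [B T] in [T B] as relations. *)
Definition commutes_with (B : bop) : Prop := forall u t, T u t -> T (B u) (B t).

Lemma T_comb u v s t (a b : R) : T u s -> T v t ->
  T (plus (scal a u) (scal b v)) (plus (scal a s) (scal b t)).
Proof. by move=> h1 h2; apply: T_add; apply: T_scal. Qed.

Lemma T_eq u u' s s' : T u s -> u = u' -> s = s' -> T u' s'.
Proof. by move=> h <- <-. Qed.

Section OnePoint.
Variables (x N : R) (K L : bop).
Hypothesis HK : pseudo_resolvent x N K L.

Lemma pseudo_resolvent_TL v : T (L v) (plus v (minus (scal (2 * x) (L v)) (scal N (K v)))).
Proof.
have [t1 [t2 [h1 [h2 hv]]]] := proj2 (HK.1 (K v) v) erefl.
have E := T_fun h1 (HK.2 v); rewrite E in h2 hv.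
by apply: T_eq h2 erefl _; move: (L v) (K v) hv => a b ->; lin; ring.
Qed.

(** [T^2 - 2 x T + N] sends [L u] to [T u], so [L u] is [K (T u)]. *)
Lemma pseudo_resolvent_TK u t : T u t -> L u = K t.
Proof.
move=> h; apply/(HK.1 (L u) t).
have H := pseudo_resolvent_TL u; have HT := HK.2 u.
exists (plus u (minus (scal (2 * x) (L u)) (scal N (K u)))).
exists (plus t (minus (scal (2 * x) (plus u (minus (scal (2 * x) (L u)) (scal N (K u))))) (scal N (L u)))).
split=> //; split.
- apply: T_eq (T_add h (T_comb (2 * x) (- N) H HT)) _ _; lin; ring.
- by lin; ring.
Qed.

Lemma pseudo_resolvent_commutes : commutes_with K /\ commutes_with L.
Proof.
split=> u t h; first by rewrite -(pseudo_resolvent_TK h); apply: HK.2.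
by rewrite (pseudo_resolvent_TK h); apply: HK.2.
Qed.

Lemma commutes_with_pseudo_resolvent B : commutes_with B ->
  bcomp B K = bcomp K B /\ bcomp B L = bcomp L B.
Proof.
move=> HB; have BK v : B (K v) = K (B v).
  have [t1 [t2 [h1 [h2 hv]]]] := proj2 (HK.1 (K v) v) erefl.
  apply/(HK.1 _ _); exists (B t1), (B t2); split; [exact: HB|split; [exact: HB|]].
  by have := congr1 (fun y => B y) hv; rewrite !(blinB, blinD, blinZ).
split; apply: blin_eq => v; first exact: BK.
have h := HB _ _ (HK.2 v); rewrite BK in h.
exact: T_fun h (HK.2 (B v)).
Qed.

Lemma pseudo_resolvent_unique K' L' : pseudo_resolvent x N K' L' -> K = K' /\ L = L'.
Proof.
move=> HK'; have E v : K v = K' v.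
  by apply/(HK'.1 _ _); apply/(HK.1 _ _).
split; apply: blin_eq => v //.
by apply: T_fun (HK.2 v) _; rewrite E; apply: HK'.2.
Qed.

End OnePoint.

Section TwoPoints.
Variables (x N x' N' : R) (K L K' L' : bop).
Hypotheses (HK : pseudo_resolvent x N K L) (HK' : pseudo_resolvent x' N' K' L').

(** [K'] and [L'] are applied to [K v], [L v] and [T (L v)]. The table expresses all products at two
    points through a few of them, so the resolvent identities become linear algebra. *)
Lemma pseudo_resolvent_products v :
  [/\ K' (L v) = L' (K v),
      L' (L v) = plus (K v) (minus (scal (2 * x') (L' (K v))) (scal N' (K' (K v)))),
      K' v = plus (minus (L' (L v)) (scal (2 * x) (L' (K v)))) (scal N (K' (K v))) &
      L' v = plus (minus (plus (L v) (minus (scal (2 * x') (L' (L v))) (scal N' (K' (L v)))))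
                         (scal (2 * x) (L' (L v)))) (scal N (L' (K v)))].
Proof.
have h1 := HK.2 v; have h2 := pseudo_resolvent_TL HK v.
set c := plus v _ in h2.
have e1 := pseudo_resolvent_TK HK' h1; have e2 := pseudo_resolvent_TK HK' h2.
have e3 : L' (L v) = plus (K v) (minus (scal (2 * x') (L' (K v))) (scal N' (K' (K v)))).
  apply: T_fun (HK'.2 (L v)) _; rewrite -e1; exact: pseudo_resolvent_TL HK' (K v).
have e4 : L' c = plus (L v) (minus (scal (2 * x') (L' (L v))) (scal N' (K' (L v)))).
  apply: T_fun (HK'.2 c) _; rewrite -e2; exact: pseudo_resolvent_TL HK' (L v).
have cv : v = plus (minus c (scal (2 * x) (L v))) (scal N (K v)) by rewrite /c; lin; ring.
clearbody c; split=> //.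
- by have := congr1 (fun y => K' y) cv; rewrite !(blinB, blinD, blinZ) -e2 e1.
- by have := congr1 (fun y => L' y) cv; rewrite !(blinB, blinD, blinZ) e4.
Qed.

End TwoPoints.

Variables (w : R) (Kz Lz : C -> bop).
Hypothesis w_bounds : 0 < w < PI / 2.
Hypothesis HKz : forall z, sector w (PI - w) z ->
  pseudo_resolvent (Re z) (Cmod z ^ 2) (Kz z) (Lz z).

Definition Pz (z : C) : bop := minus (scal (Re z) (Kz z)) (Lz z).
Definition qz (z : C) : bop := scal (Im z) (Kz z).

Hypothesis z_bound : forall phi, w < phi < PI / 2 -> exists c, 0 <= c /\
  forall r t, 0 < r -> phi <= t <= PI - phi ->
    norm (Pz (polar r t)) <= c / r /\ norm (qz (polar r t)) <= c / r.

Lemma PzE z v : Pz z v = minus (scal (Re z) (Kz z v)) (Lz z v).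
Proof. by rewrite /Pz minus_blinE. Qed.
Lemma qzE z v : qz z v = scal (Im z) (Kz z v).
Proof. by []. Qed.

(* Otherwise unification unfolds [Pz z] into a difference when rewriting. *)
#[local] Opaque Pz qz.

Lemma Cmod_sqr_ReIm (z : C) : Cmod z ^ 2 = Re z * Re z + Im z * Im z.
Proof. by rewrite Cmod2_alt /=; ring. Qed.

Lemma resolvent_identity u z v : sector w (PI - w) u -> sector w (PI - w) z ->
  let A := minus (Pz u (Pz z v)) (qz u (qz z v)) in
  let B := plus (Pz u (qz z v)) (qz u (Pz z v)) in
  minus (Pz z v) (Pz u v) = plus (scal (Re u - Re z) A) (scal (Im u - Im z) B) /\
  minus (qz z v) (qz u v) = minus (scal (Re u - Re z) B) (scal (Im u - Im z) A).
Proof.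
move=> Du Dz.
have [e1 e2 e3 e4] := pseudo_resolvent_products (HKz Dz) (HKz Du) v.
move=> A B; rewrite /A /B !PzE !qzE ?PzE !(blinB, blinD, blinZ) e3 e4 !e2 !e1 !Cmod_sqr_ReIm.
by split; lin; ring.
Qed.

Lemma z_bound_near z : sector w (PI - w) z -> exists d c, 0 < d /\ 0 <= c /\
  forall u, Cmod (Cminus u z) < d ->
    sector w (PI - w) u /\ norm (Pz u) <= c /\ norm (qz u) <= c.
Proof.
move=> [r [t [r0 [ht ->]]]]; pose phi := (w + Rmin t (PI - t)) / 2.
have m1 := Rmin_l t (PI - t); have m2 := Rmin_r t (PI - t).
have m3 : w < Rmin t (PI - t) by apply: Rmin_glb_lt; rlra.
have hp : w < phi < PI / 2 by rewrite /phi; rlra.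
have hpt : phi < t < PI - phi by rewrite /phi; rlra.
have [c [c0 Hc]] := z_bound hp.
(* The distances of the point to the lines at angles [phi] and [PI - phi]. The term [r / 2] in [d]
   keeps the modulus away from 0. *)
pose a := r * sin (t - phi); pose b := r * sin (t + phi).
have a0 : 0 < a by apply: Rmult_lt_0_compat => //; apply: sin_gt_0; rlra.
have b0 : 0 < b by apply: Rmult_lt_0_compat => //; apply: sin_gt_0; rlra.
pose d := Rmin (r / 2) (Rmin (a / 2) (b / 2)).
have d0 : 0 < d by apply: Rmin_glb_lt; [rlra|apply: Rmin_glb_lt; rlra].
have d1 : d <= r / 2 := Rmin_l _ _.
have d2 : d <= a / 2 := Rle_trans _ _ _ (Rmin_r _ _) (Rmin_l _ _).
have d3 : d <= b / 2 := Rle_trans _ _ _ (Rmin_r _ _) (Rmin_r _ _).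
exists d, (c / (r / 2)); split=> //; split.
  by apply: Rmult_le_pos => //; apply: Rlt_le; apply: Rinv_0_lt_compat; rlra.
move=> [x y] hu.
have hx : Rabs (x - r * cos t) < d.
  exact: Rle_lt_trans (re_le_Cmod _) hu.
have hy : Rabs (y - r * sin t) < d.
  exact: Rle_lt_trans (im_le_Cmod _) hu.
move: hx hy => /Rabs_def2 hx /Rabs_def2 hy.
have cb := COS_bound phi; have sb := SIN_bound phi.
have c0' : 0 < cos phi by apply: cos_gt_0; rlra.
have s0' : 0 < sin phi by apply: sin_gt_0; rlra.
have g1 : 0 < y * cos phi - x * sin phi.
  have : a = r * sin t * cos phi - r * cos t * sin phi by rewrite /a sin_minus; ring.
  nra.
have g2 : 0 < y * cos phi + x * sin phi.
  have : b = r * sin t * cos phi + r * cos t * sin phi by rewrite /b sin_plus; ring.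
  nra.
have hp0 : 0 <= phi < PI / 2 by rlra.
have [r' [t' [r'0 [ht' E]]]] := polar_coordinates hp0 g1 g2.
rewrite E; split; first by exists r', t'; split=> //; split=> //; rlra.
have ht2 : phi <= t' <= PI - phi by rlra.
have [n1 n2] := Hc r' t' r'0 ht2.
have rr : r / 2 <= r'.
  have := Cmod_triangle (polar r' t') (Cminus (polar r t) (polar r' t')).
  rewrite (_ : Cplus (polar r' t') (Cminus (polar r t) (polar r' t')) = polar r t); last ring.
  rewrite !Cmod_polar; try rlra.
  by rewrite -E Cmod_sub_sym; rlra.
have cc : c / r' <= c / (r / 2).
  by apply: Rmult_le_compat_l => //; apply: Rinv_le_contravar; rlra.
by split; [apply: Rle_trans n1 cc|apply: Rle_trans n2 cc].
Qed.

(** The resolvent identity and a local bound [c] give the Lipschitz constant [4 c^2]: each of its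
    two combinations of products has norm at most [2 c^2]. *)
Lemma ncont_resolvent z : sector w (PI - w) z -> ncont Pz z /\ ncont qz z.
Proof.
move=> Dz; have [d [c [d0 [c0 Hd]]]] := z_bound_near Dz.
have zz : Cmod (Cminus z z) < d by rewrite (_ : Cminus z z = RtoC 0) ?Cmod_0 //; ring.
have [_ [Pc qc]] := Hd z zz.
have bd (F G : bop) v : norm F <= c -> norm G <= c -> norm (F (G v)) <= c * c * norm v.
  move=> hF hG; apply: Rle_trans (opnorm_bound F _) _; rewrite Rmult_assoc.
  apply: Rmult_le_compat => //; [exact: opnorm_ge0|exact: norm_ge_0|].
  by apply: Rle_trans (opnorm_bound G v) _; apply: Rmult_le_compat_r => //; apply: norm_ge_0.
have key u : Cmod (Cminus u z) < d ->
    norm (minus (Pz u) (Pz z)) <= 4 * (c * c) * Cmod (Cminus u z) /\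
    norm (minus (qz u) (qz z)) <= 4 * (c * c) * Cmod (Cminus u z).
  move=> hu; have [Du [Pu qu]] := Hd u hu.
  have m0 := Cmod_ge_0 (Cminus u z).
  have cc : 0 <= c * c by nra.
  have re : Rabs (Re u - Re z) <= Cmod (Cminus u z) := re_le_Cmod (Cminus u z).
  have im : Rabs (Im u - Im z) <= Cmod (Cminus u z) := im_le_Cmod (Cminus u z).
  have sc (k a : R) (v y : X) : Rabs k <= Cmod (Cminus u z) -> norm y <= a * norm v -> 0 <= a ->
      norm (scal k y) <= Cmod (Cminus u z) * (a * norm v).
    move=> hk hy a0; apply: Rle_trans (norm_scal_le _ hy) _.
    by apply: Rmult_le_compat_r => //; apply: Rmult_le_pos => //; apply: norm_ge_0.
  split; (apply: opnorm_le; first by apply: Rmult_le_pos => //; rlra);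
    move=> v; rewrite minus_blinE -opp_minus norm_opp;
    have [e1 e2] := resolvent_identity v Du Dz; rewrite ?e1 ?e2.
  - apply: Rle_trans (norm_plus_le
      (sc _ (c * c + c * c) v _ re _ _) (sc _ (c * c + c * c) v _ im _ _)) _; try rlra.
    + by rewrite Rmult_plus_distr_r; apply: norm_minus_le; apply: bd.
    + by rewrite Rmult_plus_distr_r; apply: norm_plus_le; apply: bd.
  - apply: Rle_trans (norm_minus_le
      (sc _ (c * c + c * c) v _ re _ _) (sc _ (c * c + c * c) v _ im _ _)) _; try rlra.
    + by rewrite Rmult_plus_distr_r; apply: norm_plus_le; apply: bd.
    + by rewrite Rmult_plus_distr_r; apply: norm_minus_le; apply: bd.
have fin F : (forall u, Cmod (Cminus u z) < d ->
    norm (minus (F u) (F z)) <= 4 * (c * c) * Cmod (Cminus u z)) -> ncont F z.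
  move=> HF e e0; have cc : 0 <= c * c by nra.
  have k0 : 0 < e / (4 * (c * c) + 1) by apply: Rdiv_lt_0_compat; rlra.
  exists (Rmin d (e / (4 * (c * c) + 1))); split; first exact: Rmin_glb_lt.
  move=> u hu; apply: Rle_lt_trans (HF u (Rlt_le_trans _ _ _ hu (Rmin_l _ _))) _.
  have h := Rlt_le_trans _ _ _ hu (Rmin_r _ _).
  apply: (@Rle_lt_trans _ ((4 * (c * c) + 1) * Cmod (Cminus u z))).
    by apply: Rmult_le_compat_r; [apply: Cmod_ge_0|rlra].
  have -> : e = (4 * (c * c) + 1) * (e / (4 * (c * c) + 1)) by field; rlra.
  by apply: Rmult_lt_compat_l => //; rlra.
by split; apply: fin => u /key [].
Qed.

Local Notation rv := (rval Pz qz).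

(** The slope is [- l (R(u) R(z))], with the right factor split into [P z - i q z] and absorbed into
    the functional. *)
Lemma rval_slope l u z : sector w (PI - w) u -> sector w (PI - w) z ->
  rv l u = Cplus (rv l z) (Cmult (Cminus (Cmult Ci (rv (fcomp l (qz z)) u)) (rv (fcomp l (Pz z)) u))
                                 (Cminus u z)).
Proof.
move=> Du Dz.
have E1 : minus (Pz z) (Pz u) = plus
    (scal (Re u - Re z) (minus (bcomp (Pz u) (Pz z) : bop) (bcomp (qz u) (qz z))))
    (scal (Im u - Im z) (plus (bcomp (Pz u) (qz z) : bop) (bcomp (qz u) (Pz z)))) :> bop.
  apply: blin_eq => v; have [e _] := resolvent_identity v Du Dz.
  rewrite minus_blinE e.
  by rewrite -[RHS]/(plus (scal (Re u - Re z) ((minus (bcomp (Pz u) (Pz z) : bop) (bcomp (qz u) (qz z)) : blin X X) v))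
    (scal (Im u - Im z) (plus (Pz u (qz z v)) (qz u (Pz z v)))))
    (minus_blinE (bcomp (Pz u) (Pz z))).
have E2 : minus (qz z) (qz u) = minus
    (scal (Re u - Re z) (plus (bcomp (Pz u) (qz z) : bop) (bcomp (qz u) (Pz z))))
    (scal (Im u - Im z) (minus (bcomp (Pz u) (Pz z) : bop) (bcomp (qz u) (qz z)))) :> bop.
  apply: blin_eq => v; have [_ e] := resolvent_identity v Du Dz.
  rewrite (minus_blinE (qz z)) minus_blinE e.
  by rewrite -[RHS]/(minus (scal (Re u - Re z) (plus (Pz u (qz z v)) (qz u (Pz z v))))
    (scal (Im u - Im z) ((minus (bcomp (Pz u) (Pz z) : bop) (bcomp (qz u) (qz z)) : blin X X) v)))
    (minus_blinE (bcomp (Pz u) (Pz z))).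
have := congr1 (fval l) E1; have := congr1 (fval l) E2.
rewrite /rval !fval_fcomp !(fvalB, fvalD, fvalZ).
move: (fval l (bcomp _ _)) (fval l (bcomp _ _)) (fval l (bcomp _ _)) (fval l (bcomp _ _)).
move=> a b c d h2 h1; rewrite /Cplus /Cmult /Cminus /Copp /Ci /Re /Im /= in h1 h2 *.
by congr pair => /=; rlra.
Qed.

(** The point [i] has real part 0 and modulus 1, so the pair there is [(1 + T^2)^-1] and
    [T (1 + T^2)^-1]. The two linear fields are the product table for [i] and [z], and the
    derivative is the slope at [u = z]. *)
Lemma resolvent_data_of_operator :
  resolvent_data w Pz qz (Kz (polar 1 (PI / 2))) (Lz (polar 1 (PI / 2))).
Proof.
have Di : sector w (PI - w) (polar 1 (PI / 2)).
  by exists 1, (PI / 2); split; [rlra|split=> //; rlra].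
have Hi := HKz Di; have h1 : Cmod (polar 1 (PI / 2)) ^ 2 = 1 by rewrite Cmod_polar; [ring|rlra].
have h0 : Re (polar 1 (PI / 2)) = 0 by rewrite /polar /Re /= cos_PI2; ring.
rewrite h1 h0 in Hi; set K := Kz _ in Hi *; set L := Lz _ in Hi *.
split=> //.
- move=> l; exists (fun z => Cminus (Cmult Ci (rv (fcomp l (qz z)) z)) (rv (fcomp l (Pz z)) z)).
  move=> z Dz; have [d [c [d0 [_ Hd]]]] := z_bound_near Dz.
  have [cP cq] := ncont_resolvent Dz.
  have neg (m : blin bop R_NormedModule) F G : ncont F z -> ncont G z ->
      ccont (fun u => ((fval m (F u), - fval m (G u)) : C)) z.
    move=> hF hG; have := @ncont_fval _ m (blin_opp m) F G z hF hG.
    have -> // : (fun u => ((fval m (F u), fval (blin_opp m) (G u)) : C)) =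
       (fun u => ((fval m (F u), - fval m (G u)) : C)).
    apply: functional_extensionality => u; congr pair.
    by rewrite /fval /= /scal /= /mult /= /opp /one /=; ring.
  have minusC F G : ccont F z -> ccont G z -> ccont (fun u => Cminus (Cmult Ci (F u)) (G u)) z.
    move=> hF hG.
    have -> : (fun u => Cminus (Cmult Ci (F u)) (G u)) =
       (fun u => Cplus (Cmult Ci (F u)) (Cmult (Copp (RtoC 1)) (G u))).
      by apply: functional_extensionality => u; ring.
    by apply: ccont_plus; apply: ccont_mult => //; apply: ccont_const.
  split.
  + apply: (@cderiv_slope _ (fun u => Cminus (Cmult Ci (rv (fcomp l (qz z)) u)) (rv (fcomp l (Pz z)) u))).
      by exists d; split=> // u /Hd [Du _]; apply: rval_slope.
    by apply: minusC; apply: neg.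
  + by apply: minusC; apply: (neg l (fun u => bcomp (Pz u) _) (fun u => bcomp (qz u) _)); apply: ncont_comp.
- move=> r t r0 ht; have Dz : sector w (PI - w) (polar r t) by exists r, t.
  by have [cP cq] := ncont_resolvent Dz; split; apply: ncont_continuous.
- move=> l z Dz.
  have H v := pseudo_resolvent_products Hi (HKz Dz) v.
  have E1 : bcomp (Pz z) L = minus (plus (scal (Re z) (bcomp (Pz z) K : bop)) (scal (Im z) (bcomp (qz z) K : bop))) K :> bop.
    apply: blin_eq => v; have [e1 e2 _ _] := H v; rewrite (minus_blinE _ K).
    rewrite -[LHS]/(Pz z (L v)) -[X in minus X _]/(plus (scal (Re z) (Pz z (K v))) (scal (Im z) (qz z (K v)))).
    by rewrite !PzE !qzE e1 e2 Cmod_sqr_ReIm; lin; ring.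
  have E2 : bcomp (qz z) L = minus (scal (Re z) (bcomp (qz z) K : bop)) (scal (Im z) (bcomp (Pz z) K : bop)) :> bop.
    apply: blin_eq => v; have [e1 _ _ _] := H v; rewrite minus_blinE.
    rewrite -[LHS]/(qz z (L v)) -[X in minus X _]/(scal (Re z) (qz z (K v))) -[X in minus _ X]/(scal (Im z) (Pz z (K v))).
    by rewrite !PzE !qzE e1; lin; ring.
  rewrite /rval !fval_fcomp E1 E2 !(fvalB, fvalD, fvalZ).
  by rewrite /Cplus /Cmult /Cminus /Copp /Re /Im /=; congr pair => /=; ring.
- move=> l z Dz.
  have H v := pseudo_resolvent_products Hi (HKz Dz) v.
  have E1 : minus (Pz z) (bcomp (Pz z) K) = minus (plus (scal (Re z) (bcomp (Pz z) L : bop)) (scal (Im z) (bcomp (qz z) L : bop))) L :> bop.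
    apply: blin_eq => v; have [e1 e2 e3 e4] := H v; rewrite (minus_blinE (Pz z)) (minus_blinE _ L).
    rewrite -[X in minus _ X = _]/(Pz z (K v)) -[X in _ = minus X _]/(plus (scal (Re z) (Pz z (L v))) (scal (Im z) (qz z (L v)))).
    by rewrite !PzE !qzE e4 e3 e1 e2 Cmod_sqr_ReIm; lin; ring.
  have E2 : minus (qz z) (bcomp (qz z) K) = minus (scal (Re z) (bcomp (qz z) L : bop)) (scal (Im z) (bcomp (Pz z) L : bop)) :> bop.
    apply: blin_eq => v; have [e1 e2 e3 e4] := H v; rewrite (minus_blinE (qz z)) minus_blinE.
    rewrite -[X in minus _ X = _]/(qz z (K v)) -[X in _ = minus X _]/(scal (Re z) (qz z (L v))) -[X in _ = minus _ X]/(scal (Im z) (Pz z (L v))).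
    by rewrite !PzE !qzE e3 e1 e2; lin; ring.
  have := congr1 (fval l) E1; have := congr1 (fval l) E2.
  rewrite /rval !fval_fcomp !(fvalB, fvalD, fvalZ).
  move: (fval l (bcomp _ _)) (fval l (bcomp _ _)) (fval l (bcomp _ _)) (fval l (bcomp _ _)) (fval l K) (fval l L).
  move=> a b c d k m g2 g1.
  rewrite /Cplus /Cmult /Cminus /Copp /Re /Im /= in g1 g2 *; congr pair => /=; rlra.
Qed.

End OperatorResolvent.

(** * Density of the range and approximate identities *)

Section Density.
Variable X : CompleteNormedModule R_AbsRing.
Local Notation bop := (blin_NormedModule X X).

(** The upper limit of [phi (x m)] is sublinear in [phi] and dominates a linear functional.
    Domination at [phi] and at [- phi] fixes the value whenever the sequence converges. *)
Lemma banach_limit (x : nat -> X) (B : R) : (forall m, norm (x m) <= B) ->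
  exists Phi : blin (dual X) R_NormedModule, forall (phi : blin X R_NormedModule) a,
    (forall e, 0 < e -> exists N, forall m, (N <= m)%nat -> Rabs (phi (x m) - a) <= e) ->
    Phi phi = a.
Proof.
move=> HB; have B0 : 0 <= B by apply: Rle_trans (HB 0%nat); apply: norm_ge_0.
pose E (phi : dual X) r := exists N, forall m, (N <= m)%nat -> (phi : blin X R_NormedModule) (x m) <= r.
have bd (phi : dual X) m : Rabs ((phi : blin X R_NormedModule) (x m)) <= B * norm phi.
  apply: Rle_trans (opnorm_bound phi (x m)) _; rewrite Rmult_comm.
  by apply: Rmult_le_compat_r => //; apply: opnorm_ge0.
have lb phi r : E phi r -> - (B * norm phi) <= r.
  by move=> [N /(_ N (leqnn N))]; have /Rabs_le_between := bd phi N; rlra.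
have ub phi : E phi (B * norm phi).
  by exists 0%nat => m _; have /Rabs_le_between := bd phi m; rlra.
have [p hp] := inf_fun_exists (fun phi => ex_intro (E phi) _ (ub phi)) lb.
have psub : sublinear p.
  split.
  - move=> phi psi; apply: le_epsilon => e e0; have e2 : 0 < e / 2 by rlra.
    have [r [[N HN] hr]] := (hp phi).2 _ e2; have [s [[M HM] hs]] := (hp psi).2 _ e2.
    apply: (@Rle_trans _ (r + s)); last rlra.
    apply: (hp _).1; exists (maxn N M) => m; rewrite geq_max => /andP[h1 h2].
    by apply: Rplus_le_compat; [apply: HN|apply: HM].
  - move=> k phi [k0|<-]; last first.
      rewrite Rmult_0_l; apply: (hp _).1; exists 0%nat => m _.
      rewrite -[blin_fun _ (x m)]/(0 * (phi : blin X R_NormedModule) (x m)) Rmult_0_l.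
      exact: Rle_refl.
    apply: le_epsilon => e e0; have ek : 0 < e / k by apply: Rdiv_lt_0_compat.
    have [r [[N HN] hr]] := (hp phi).2 _ ek.
    apply: (@Rle_trans _ (k * r)).
      apply: (hp _).1; exists N => m h; apply: Rmult_le_compat_l; [rlra|exact: HN].
    have := Rmult_lt_compat_l k _ _ k0 hr.
    have -> : k * (p phi + e / k) = k * p phi + e by field; rlra.
    rlra.
have [f [fD [fZ [fp _]]]] := hahn_banach zero psub.
have fopp phi : f (opp phi) = - f phi.
  by rewrite -(scal_opp_one phi) fZ /opp /one /=; ring.
have pB phi : p phi <= B * norm phi by apply: (hp phi).1; apply: ub.
have lf : is_linear (f : dual X -> R_NormedModule).
  split=> //; exists (B + 1); split; first rlra.
  move=> phi; apply: Rabs_le.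
  have h1 := Rle_trans _ _ _ (fp phi) (pB phi).
  have h2 := Rle_trans _ _ _ (fp (opp phi)) (pB (opp phi)).
  rewrite fopp norm_opp in h2; have n0 := norm_ge_0 phi; rlra.
exists (Blin lf) => phi a ha /=.
have h1 : f phi <= a.
  apply: le_epsilon => e e0; have [N HN] := ha e e0.
  apply: Rle_trans (fp phi) _; apply: (hp phi).1; exists N => m /HN.
  by move/Rabs_le_between; rlra.
have h2 : f (opp phi) <= - a.
  apply: le_epsilon => e e0; have [N HN] := ha e e0.
  apply: Rle_trans (fp (opp phi)) _; apply: (hp _).1; exists N => m /HN.
  move/Rabs_le_between => h; change (-1 * phi (x m) <= - a + e).
  by change (- e <= fval phi (x m) - a <= e) in h; rewrite -[blin_fun _ _]/(fval phi (x m)); rlra.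
rewrite fopp in h2; apply: Rle_antisym; rlra.
Qed.

Variable T : X -> X -> Prop.
Hypotheses (T_add : forall u v s t, T u s -> T v t -> T (plus u v) (plus s t))
  (T_scal : forall (k : R) u s, T u s -> T (scal k u) (scal k s))
  (T_fun : forall u s t, T u s -> T u t -> s = t)
  (T_inj : forall u v s, T u s -> T v s -> u = v).
Variables (Ky Ly : R -> bop).
Hypothesis HKy : forall y, 0 < y -> pseudo_resolvent T 0 (y ^ 2) (Ky y) (Ly y).
Hypothesis Ky_bound : exists c, 0 <= c /\
  forall y, 0 < y -> y ^ 2 * norm (Ky y) <= c /\ y * norm (Ly y) <= c.

Local Notation K := (Ky 1).
Local Notation L := (Ly 1).

Let HK1 : pseudo_resolvent T 0 1 K L.
Proof. by have := HKy Rlt_0_1; rewrite pow1. Qed.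

Lemma Ky_commute y y' : 0 < y -> 0 < y' ->
  [/\ forall v, Ky y (Ky y' v) = Ky y' (Ky y v), forall v, Ky y (Ly y' v) = Ly y' (Ky y v) &
      forall v, Ly y (Ly y' v) = Ly y' (Ly y v)].
Proof.
move=> y0 y'0; have [cK cL] := pseudo_resolvent_commutes T_add T_scal T_fun (HKy y0).
have [/blin_app_eq h1 /blin_app_eq h2] := commutes_with_pseudo_resolvent T_fun (HKy y'0) cK.
by have [_ /blin_app_eq h3] := commutes_with_pseudo_resolvent T_fun (HKy y'0) cL.
Qed.

(* Chosen so that [L] times this operator is [nu^2 (K_nu - nu^-2 K_(1/nu) K_nu)],
   which tends to 1 strongly as [nu -> oo]. *)
Definition approx_factor (nu : R) : bop :=
  scal (nu ^ 2) (bcomp (Ly (/ nu)) (plus (bid X : bop) (scal (1 - nu ^ 2) (Ky nu)))).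
Definition approx (nu : R) : bop := bcomp L (approx_factor nu).

Lemma approx_factorE nu v : approx_factor nu v =
  scal (nu ^ 2) (Ly (/ nu) (plus v (scal (1 - nu ^ 2) (Ky nu v)))).
Proof. by []. Qed.

Lemma approxE nu v : 0 < nu -> approx nu v =
  scal (nu ^ 2) (minus (Ky nu v) (scal ((/ nu) ^ 2) (Ky (/ nu) (Ky nu v)))).
Proof.
move=> nu0; have mu0 := Rinv_0_lt_compat _ nu0.
rewrite -[LHS]/(L (approx_factor nu v)) approx_factorE blinZ; congr scal.
(* [g] is [(1 + T^2) K_nu v], so [K g = K_nu v]; the product table then turns [L L_(1/nu) g] into
   [K g - nu^-2 K_(1/nu) K g]. *)
set g := plus v _.
have Kg : Ky nu v = K g.
  apply/(HK1.1 _ _); have h1 := (HKy nu0).2 v.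
  have h2 := pseudo_resolvent_TL T_fun (HKy nu0) v.
  exists (Ly nu v); eexists; split; [exact: h1|split; [exact: h2|]].
  by rewrite /g; lin; ring.
have [_ e2 _ _] := pseudo_resolvent_products T_add T_scal T_fun HK1 (HKy mu0) g.
have [_ _ cL] := Ky_commute Rlt_0_1 mu0.
by rewrite cL e2 -Kg; lin; ring.
Qed.

Lemma opnorm_scaled (k c : R) (A : bop) v : 0 <= k -> k * norm A <= c ->
  norm (scal k (A v)) <= c * norm v.
Proof.
move=> k0 h; apply: Rle_trans (norm_scal_le k (opnorm_bound A v)) _.
rewrite Rabs_pos_eq // -Rmult_assoc; apply: Rmult_le_compat_r => //; exact: norm_ge_0.
Qed.

Lemma approx_bound : exists b, 0 <= b /\ forall nu v, 0 < nu -> norm (approx nu v) <= b * norm v.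
Proof.
have [c [c0 Hc]] := Ky_bound; exists (c + c * c); split; first by nra.
move=> nu v nu0; have mu0 := Rinv_0_lt_compat _ nu0.
have [h1 _] := Hc nu nu0; have [h2 _] := Hc _ mu0.
rewrite approxE //.
have -> : scal (nu ^ 2) (minus (Ky nu v) (scal ((/ nu) ^ 2) (Ky (/ nu) (Ky nu v)))) =
   minus (scal (nu ^ 2) (Ky nu v)) (scal ((/ nu) ^ 2) (Ky (/ nu) (scal (nu ^ 2) (Ky nu v)))).
  by rewrite !blinZ; lin; ring.
have n1 := opnorm_scaled v (pow2_ge_0 nu) h1.
have n2 := opnorm_scaled (scal (nu ^ 2) (Ky nu v)) (pow2_ge_0 (/ nu)) h2.
apply: Rle_trans (norm_minus_le n1 (Rle_trans _ _ _ n2 (Rmult_le_compat_l _ _ _ c0 n1))) _.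
by apply: Req_le; ring.
Qed.

(** [L H_nu - L = - nu^-2 L_(1/nu) K (nu^2 K_nu) - L_nu (1 - K)], and both [L_nu] and
    [nu^-2 L_(1/nu)] have norm at most [c / nu]. *)
Lemma approx_L_close : exists b, 0 <= b /\ forall nu v, 0 < nu ->
  norm (minus (L (approx nu v)) (L v)) <= b / nu * norm v.
Proof.
have [c [c0 Hc]] := Ky_bound; set k := norm K; have k0 : 0 <= k by apply: norm_ge_0.
exists (c * k * c + c * (1 + k)); split.
  by apply: Rplus_le_le_0_compat; apply: Rmult_le_pos; try rlra; apply: Rmult_le_pos.
move=> nu v nu0; have mu0 := Rinv_0_lt_compat _ nu0.
have [h1 h2] := Hc nu nu0; have [_ h3] := Hc _ mu0.
have [_ cK _] := Ky_commute mu0 Rlt_0_1; have [_ cKn _] := Ky_commute nu0 Rlt_0_1.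
pose b := scal (nu ^ 2) (Ky nu v).
have [e1 _ _ _] := pseudo_resolvent_products T_add T_scal T_fun HK1 (HKy mu0) b.
have [_ _ _ e4] := pseudo_resolvent_products T_add T_scal T_fun HK1 (HKy nu0) v.
have E : minus (L (approx nu v)) (L v) =
    minus (opp (scal ((/ nu) ^ 2) (Ly (/ nu) (K b)))) (minus (Ly nu v) (Ly nu (K v))).
  rewrite approxE // -e1 cK e4 cKn /b !(blinB, blinZ).
  by lin; ring.
rewrite E; have nb := opnorm_scaled v (pow2_ge_0 nu) h1.
have nKb : norm (K b) <= k * (c * norm v).
  by apply: Rle_trans (opnorm_bound K b) _; apply: Rmult_le_compat_l.
have nKv : norm (K v) <= k * norm v := opnorm_bound K v.
have n3 x y : norm x <= y -> norm (Ly nu x) <= c / nu * y.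
  move=> hx; apply: Rle_trans (opnorm_bound _ x) _; apply: Rmult_le_compat => //.
  - exact: opnorm_ge0.
  - exact: norm_ge_0.
  - by apply: (@Rmult_le_reg_l nu) => //; have -> : nu * (c / nu) = c by [field; rlra].
have n4 : norm (scal ((/ nu) ^ 2) (Ly (/ nu) (K b))) <= c / nu * (k * (c * norm v)).
  have -> : scal ((/ nu) ^ 2) (Ly (/ nu) (K b)) = scal (/ nu) (scal (/ nu) (Ly (/ nu) (K b))).
    by lin; ring.
  have := opnorm_scaled (K b) (Rlt_le _ _ mu0) h3 => h.
  apply: Rle_trans (norm_scal_le (/ nu) h) _; rewrite Rabs_pos_eq; last rlra.
  have -> : c / nu * (k * (c * norm v)) = / nu * (c * (k * (c * norm v))) by field; rlra.
  by apply: Rmult_le_compat_l; [rlra|apply: Rmult_le_compat_l].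
have := norm_minus_le (norm_opp_le n4) (norm_minus_le (n3 _ _ (Rle_refl (norm v))) (n3 _ _ nKv)).
by move=> h; apply: Rle_trans h _; apply: Req_le; field; rlra.
Qed.

Lemma L_injective v v' : L v = L v' -> v = v'.
Proof.
move=> h; have Kv : K v = K v' by apply: T_inj (HK1.2 v) _; rewrite h; apply: HK1.2.
have [t1 [t2 [a1 [a2 a3]]]] := proj2 (HK1.1 _ v) erefl.
have [s1 [s2 [b1 [b2 b3]]]] := proj2 (HK1.1 _ v') erefl.
rewrite a3 b3 Kv; rewrite Kv in a1; have E := T_fun a1 b1; rewrite E in a2.
by rewrite E (T_fun a2 b2).
Qed.

Hypothesis X_reflexive : reflexive_space X.

(** Otherwise a functional [l] vanishes on the range but not at [x]. By reflexivity the Banach limit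
    of [H_nu x] is a vector [y]. Then [l y = 0], as every [H_nu x] is in the range, while
    [L y = L x], as [L H_nu x] tends to [L x]; injectivity gives [y = x], a contradiction. *)
Lemma range_L_dense (x : X) e : 0 < e -> exists v, norm (minus x (L v)) < e.
Proof.
move=> e0; apply: NNPP => H.
have [] := @functional_off_subspace X (fun y => exists v, y = L v) x e _ _ _ e0 _.
- by exists zero; rewrite blin0.
- by move=> _ _ [u ->] [v ->]; exists (plus u v); rewrite blinD.
- by move=> k _ [v ->]; exists (scal k v); rewrite blinZ.
- by move=> _ [v ->]; apply: Rnot_lt_le => h; apply: H; exists v.
move=> l [lL lx].
have [b [b0 Hb]] := approx_bound.
have nu0 m : 0 < INR m.+1 by apply: lt_0_INR; apply/ltP.
have [Phi HPhi] := @banach_limit (fun m => approx (INR m.+1) x) (b * norm x)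
  (fun m => Hb _ x (nu0 m)).
have [y Hy] := X_reflexive Phi.
have Phil : l y = 0.
  rewrite -Hy; apply: HPhi => d d0; exists 0%nat => m _.
  rewrite (lL (approx (INR m.+1) x)); last by exists (approx_factor (INR m.+1) x).
  by rewrite Rminus_0_r Rabs_R0; rlra.
have Lyx : L y = L x.
  apply: functional_separates => psi.
  have := Hy (bcomp psi L) => /= <-; apply: HPhi => d d0.
  have [c [c0 Hc]] := approx_L_close; have p0 := opnorm_ge0 psi; have n0 := norm_ge_0 x.
  pose M := opnorm psi * (c * norm x).
  have M0 : 0 <= M by apply: Rmult_le_pos => //; apply: Rmult_le_pos.
  have [N HN] := INR_archimed d M d0.
  exists N => m hm; have := Hc _ x (nu0 m) => h.
  rewrite -[_ - _]/(fval psi (L (approx (INR m.+1) x)) - fval psi (L x)) -fvalB.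
  apply: Rle_trans (fval_bound psi _) _.
  apply: Rle_trans (Rmult_le_compat_l _ _ _ p0 h) _.
  apply: (@Rmult_le_reg_r (INR m.+1)); first exact: nu0.
  have -> : opnorm psi * (c / INR m.+1 * norm x) * INR m.+1 = M.
    by rewrite /M; field; have := nu0 m; rlra.
  apply: Rle_trans (Rlt_le _ _ HN) _; rewrite Rmult_comm; apply: Rmult_le_compat_l; first rlra.
  by apply: le_INR; apply/leP; apply: leqW.
by apply: lx; rewrite -(L_injective Lyx).
Qed.

Fixpoint bpow (A : bop) (k : nat) : bop := if k is k'.+1 then bcomp A (bpow A k') else bid X.

Lemma bpowSr A k v : bpow A k.+1 v = bpow A k (A v).
Proof. by elim: k v => [|k IH] v //; rewrite -[LHS]/(A (bpow A k.+1 v)) IH. Qed.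

Lemma bpow_add A j k v : bpow A (j + k) v = bpow A j (bpow A k v).
Proof.
by elim: j => [|j IH] //; rewrite addSn -[LHS]/(A (bpow A (j + k) v)) IH.
Qed.

Lemma bpow_commute (A B : bop) k : (forall v, A (B v) = B (A v)) ->
  forall v, bpow A k (B v) = B (bpow A k v).
Proof.
move=> AB; elim: k => [|k IH] v //.
by rewrite -[LHS]/(A (bpow A k (B v))) IH AB.
Qed.

Lemma bpow_L_injective k v v' : bpow L k v = bpow L k v' -> v = v'.
Proof. by elim: k v v' => [|k IH] v v' //= h; apply: IH; apply: L_injective. Qed.

Lemma range_bpow_L_dense k (x : X) e : 0 < e -> exists v, norm (minus x (bpow L k v)) < e.
Proof.
elim: k x e => [|k IH] x e e0; first by exists x; rewrite minus_eq_zero norm_zero.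
have e2 : 0 < e / 2 by rlra.
have [y Hy] := range_L_dense x e2; have n0 := opnorm_ge0 L.
have e3 : 0 < e / 2 / (opnorm L + 1) by apply: Rdiv_lt_0_compat; rlra.
have [v Hv] := IH y _ e3; exists v.
have -> : minus x (bpow L k.+1 v) = plus (minus x (L y)) (L (minus y (bpow L k v))).
  by rewrite -[bpow L k.+1 v]/(L (bpow L k v)) blinB; lin; ring.
have h : norm (L (minus y (bpow L k v))) <= e / 2.
  apply: Rle_trans (opnorm_bound L _) _.
  apply: (@Rle_trans _ ((opnorm L + 1) * (e / 2 / (opnorm L + 1)))); last by apply: Req_le; field; rlra.
  by apply: Rmult_le_compat; [|exact: norm_ge_0|rlra|exact: Rlt_le].
have := norm_triangle (minus x (L y)) (L (minus y (bpow L k v))).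
by move=> h'; apply: Rle_lt_trans h' _; apply: (@Rlt_le_trans _ (e / 2 + e / 2)); [apply: Rplus_lt_le_compat|rlra].
Qed.

Lemma approx_commute nu (B : bop) : 0 < nu ->
  (forall y, 0 < y -> (forall v, B (Ky y v) = Ky y (B v)) /\ forall v, B (Ly y v) = Ly y (B v)) ->
  (forall v, B (approx_factor nu v) = approx_factor nu (B v)) /\
  forall v, B (approx nu v) = approx nu (B v).
Proof.
move=> nu0 HB; have mu0 := Rinv_0_lt_compat _ nu0.
have h v : B (approx_factor nu v) = approx_factor nu (B v).
  by rewrite !approx_factorE blinZ (HB _ mu0).2 blinD blinZ (HB _ nu0).1.
split=> // v; rewrite -[approx nu v]/(L (approx_factor nu v)) (HB _ Rlt_0_1).2 h.
by [].
Qed.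

(** By uniform boundedness it suffices to converge on the dense range of [L], where
    [H_nu L u = L H_nu u] tends to [L u]. *)
Lemma approx_strong v e : 0 < e ->
  exists N, forall m, (N <= m)%nat -> norm (minus (approx (INR m.+1) v) v) <= e.
Proof.
move=> e0; have [b [b0 Hb]] := approx_bound; have [c [c0 Hc]] := approx_L_close.
have nu0 m : 0 < INR m.+1 by apply: lt_0_INR; apply/ltP.
have e3 : 0 < e / 3 / (b + 1) by apply: Rdiv_lt_0_compat; rlra.
have [u Hu] := range_L_dense v e3.
have e3' : 0 < e / 3 by rlra.
have [N HN] := INR_archimed (e / 3) (c * norm u) e3'.
exists N => m hm; set nu := INR m.+1.
have hL y : 0 < y -> (forall v, L (Ky y v) = Ky y (L v)) /\ forall v, L (Ly y v) = Ly y (L v).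
  move=> y0; have [h1 h2 _] := Ky_commute y0 Rlt_0_1; have [_ _ h3] := Ky_commute Rlt_0_1 y0.
  by split=> // x; rewrite h2.
have [_ cH] := approx_commute (nu0 m) hL.
have -> : minus (approx nu v) v = plus (plus (approx nu (minus v (L u))) (minus (L (approx nu u)) (L u)))
    (opp (minus v (L u))).
  by rewrite blinB /nu -cH; lin; ring.
have h1 : norm (approx nu (minus v (L u))) <= e / 3.
  apply: Rle_trans (Hb nu _ (nu0 m)) _.
  apply: (@Rle_trans _ ((b + 1) * (e / 3 / (b + 1)))); last by apply: Req_le; field; rlra.
  by apply: Rmult_le_compat; [|exact: norm_ge_0|rlra|exact: Rlt_le].
have h2 : norm (minus (L (approx nu u)) (L u)) <= e / 3.
  apply: Rle_trans (Hc nu u (nu0 m)) _.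
  apply: (@Rmult_le_reg_r nu); first exact: nu0.
  have -> : c / nu * norm u * nu = c * norm u by field; have := nu0 m; rewrite /nu; rlra.
  apply: Rle_trans (Rlt_le _ _ HN) _; rewrite Rmult_comm; apply: Rmult_le_compat_l; first rlra.
  by apply: le_INR; apply/leP; apply: leqW.
have h3 : norm (minus v (L u)) <= e / 3.
  apply: Rle_trans (Rlt_le _ _ Hu) _; rewrite /Rdiv -[X in _ <= X]Rmult_1_r.
  apply: Rmult_le_compat_l; first by have := e3'; rewrite /Rdiv; rlra.
  by rewrite -Rinv_1; apply: Rinv_le_contravar; rlra.
have -> : e = e / 3 + e / 3 + e / 3 by field.
by apply: norm_plus_le; [apply: norm_plus_le|apply: norm_opp_le].
Qed.

Lemma approx_pow_strong k v e : 0 < e ->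
  exists N, forall m, (N <= m)%nat -> norm (minus (bpow (approx (INR m.+1)) k v) v) <= e.
Proof.
elim: k e => [|k IH] e e0.
  by exists 0%nat => m _; rewrite minus_eq_zero norm_zero; rlra.
have [b [b0 Hb]] := approx_bound.
have nu0 m : 0 < INR m.+1 by apply: lt_0_INR; apply/ltP.
have e1 : 0 < e / 2 / (b + 1) by apply: Rdiv_lt_0_compat; rlra.
have e2 : 0 < e / 2 by rlra.
have [N HN] := IH _ e1; have [M HM] := approx_strong v e2.
exists (maxn N M) => m; rewrite geq_max => /andP[h1 h2]; set A := approx _.
have -> : minus (bpow A k.+1 v) v = plus (A (minus (bpow A k v) v)) (minus (A v) v).
  by rewrite -[bpow A k.+1 v]/(A (bpow A k v)) blinB; lin; ring.
have -> : e = e / 2 + e / 2 by field.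
apply: norm_plus_le (HM m h2); apply: Rle_trans (Hb _ _ (nu0 m)) _.
apply: (@Rle_trans _ ((b + 1) * (e / 2 / (b + 1)))); last by apply: Req_le; field; rlra.
by apply: Rmult_le_compat; [|exact: norm_ge_0|rlra|exact: HN].
Qed.

End Density.

Ltac rring := match goal with |- @eq _ ?a ?b => change (@eq R a b) end;
  cbv [plus opp scal zero one minus]; simpl; cbv [mult plus zero one]; simpl; first [ring | apply: Rminus_diag_uniq; ring].

(** * Paravectors and the double sectors *)

Section Paravectors.
Variable n : nat.
Local Notation A_n := (clmod_NormedModule n R_NormedModule).
Implicit Types (J s : Cl n).

Lemma cplxE (x y : R) J A : cplx x y J A = (if A == set0 then x else 0) + y * J A.
Proof.
rewrite /cplx ffunE /cl_real !ffunE /plus /scal /= /mult /=; case: eqP => _; ring.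
Qed.

Lemma Sc_cplx (x y : R) J : imag_unit J -> Sc (cplx x y J) = x.
Proof. by move=> [_ [J0 _]]; rewrite /Sc cplxE eqxx -/(Sc J) J0; ring. Qed.

Lemma Cl_norm_sqr (a : Cl n) : (norm (a : A_n)) ^ 2 = \big[Rplus/0]_(A : {set 'I_n}) (a A) ^ 2.
Proof.
rewrite /norm /= /clmod_norm -[LHS]/(sqrt _ ^ 2) pow2_sqrt; last exact: sum_sqr_ge0.
by apply: eq_bigr => A _; apply: pow2_abs.
Qed.

Lemma norm_cplx (x y : R) J : imag_unit J -> norm (cplx x y J : A_n) = Cmod (x, y).
Proof.
move=> hJ; have [_ [J0 _]] := hJ.
apply: Rsqr_inj; [exact: norm_ge_0|exact: Cmod_ge_0|rewrite !Rsqr_pow2].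
rewrite Cl_norm_sqr Cmod2_alt /Re /Im -[(x, y).1]/x -[(x, y).2]/y.
have E : \big[Rplus/0]_(A : {set 'I_n}) (cplx x y J A) ^ 2 =
  \big[Rplus/0]_(A : {set 'I_n}) ((if A == set0 then x ^ 2 else 0) + y ^ 2 * (J A) ^ 2).
  apply: eq_bigr => A _; rewrite cplxE; case: eqP => [->|_]; last by ring.
  by rewrite -/(Sc J) J0; ring.
rewrite E big_split /=; congr Rplus.
  by rewrite (bigD1 set0) //= eqxx big1 => [|A /negbTE ->]; rewrite ?Rplus_0_r.
rewrite -(big_morph (Rmult (y * (y * 1))) (Rmult_plus_distr_l _) (Rmult_0_r _)).
by rewrite (imag_unit_norm2 hJ); ring.
Qed.

Lemma paravector_cplx (x y : R) J : imag_unit J -> paravector (cplx x y J).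
Proof.
move=> [pJ _] A hA; rewrite cplxE (pJ A hA); case: eqP => [A0|_]; last by rring.
by rewrite A0 cards0 in hA.
Qed.

Lemma cl_conj_cplx (x y : R) J : imag_unit J -> cl_conj (cplx x y J) = cplx x (- y) J.
Proof.
move=> [_ [J0 _]]; apply/ffunP => A; rewrite ffunE !cplxE; case: eqP => [->|_]; last by rring.
by rewrite -/(Sc J) J0; rring.
Qed.

Lemma lmul_cplx (VR : NormedModule R_AbsRing) (x y : R) J (v : clmod_NormedModule n VR) :
  lmul (cplx x y J) v = plus (scal x v) (scal y (lmul J v : clmod_NormedModule n VR)).
Proof. by rewrite /cplx lmulDl lmul_real lmulZl. Qed.

Lemma lmul_imag_unit2 (VR : NormedModule R_AbsRing) J (v : clmod_NormedModule n VR) :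
  imag_unit J -> lmul J (lmul J v) = opp v.
Proof.
move=> hJ; rewrite -lmulA imag_unit_sqr // lmul_real.
by rewrite -(scal_opp_one v); congr scal.
Qed.

Lemma cplx_mul (a b c d : R) J : imag_unit J ->
  cl_mul (cplx a b J) (cplx c d J) = cplx (a * c - b * d) (a * d + b * c) J.
Proof.
move=> hJ; rewrite /cl_mul lmul_cplx.
have -> : lmul J (cplx c d J) = plus (scal c (J : A_n)) (scal d (cl_real n (-1) : A_n)).
  by rewrite -(imag_unit_sqr hJ) /cplx lmulDr lmulZr -/(cl_mul _ _) cl_mul_real_r.
apply/ffunP => A; rewrite !(ffunE, cplxE); case: eqP => _; rring.
Qed.

Lemma cplx1 J : cplx 1 0 J = cl_real n 1.
Proof. by apply/ffunP => A; rewrite cplxE !ffunE; case: eqP => _; rring. Qed.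

Lemma cplx_expJ r t J : scal r (expJ J t : A_n) = cplx (r * cos t) (r * sin t) J.
Proof.
apply/ffunP => A; rewrite ffunE /expJ !cplxE /scal /= /mult /=; case: eqP => _; rring.
Qed.

Lemma cl_pow_cplx z J m : imag_unit J ->
  cl_pow (cplx (Re z) (Im z) J) m = cplx (Re (Cpow z m)) (Im (Cpow z m)) J.
Proof.
move=> hJ; elim: m => [|m IH]; first by rewrite /= /Re /Im /= cplx1.
rewrite /cl_pow iterS -/(cl_pow _ _) IH cplx_mul // Cpow_S.
Qed.

Lemma cl_inv_cplx z J : imag_unit J -> z <> RtoC 0 ->
  cl_inv (cplx (Re z) (Im z) J) = cplx (Re (Cinv z)) (Im (Cinv z)) J.
Proof.
move=> hJ z0; rewrite /cl_inv cl_conj_cplx // norm_cplx // -surjective_pairing Cmod2_alt.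
have p : Re z ^ 2 + Im z ^ 2 <> 0.
  by rewrite -Cmod2_alt; have := proj1 (Cmod_gt_0 z) z0 => h; apply: pow_nonzero; rlra.
case: z p {z0} => x y p; rewrite /Re /Im /= in p *; rewrite /Re /Im /= /Cinv /=.
apply/ffunP => A; rewrite ffunE !cplxE.
by case: eqP => _; cbv [scal]; simpl; cbv [mult]; simpl;
  match goal with |- @eq _ ?a ?b => change (@eq R a b) end; field; intro h; apply: p; rewrite -h; ring.
Qed.

Lemma imag_unit_opp J : imag_unit J -> imag_unit (opp (J : A_n)).
Proof.
move=> [pJ [J0 nJ]]; split; [|split].
- by move=> A hA; rewrite ffunE pJ //; apply: Ropp_0.
- by rewrite /Sc ffunE -/(Sc J) J0; apply: Ropp_0.
- by rewrite norm_opp.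
Qed.

Lemma cplx_opp (x y : R) J : cplx x y (opp (J : A_n)) = cplx x (- y) J.
Proof. by apply/ffunP => A; rewrite !cplxE ffunE /opp /=; rring. Qed.

(** The unit [e_1]. The hypothesis [1 <= n] enters the whole proof through this lemma. *)
Lemma imag_unit_exists : (1 <= n)%nat -> exists J, imag_unit J.
Proof.
move=> n0; pose i := Ordinal n0; exists (cl_base [set i]).
split; [|split].
- move=> A hA; rewrite ffunE; case: eqP => // AE.
  by rewrite AE cards1 in hA.
- rewrite /Sc ffunE; case: eqP => // E.
  by have := cards1 i; rewrite -E cards0.
- apply: Rsqr_inj; [exact: norm_ge_0|rlra|rewrite Rsqr_pow2 Cl_norm_sqr].
  rewrite (bigD1 [set i]) //= big1 => [|A /negbTE h]; rewrite !ffunE ?eqxx ?h; rewrite /Rsqr; rring.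
Qed.

Lemma norm_paravector_polar r t J : 0 <= r -> imag_unit J ->
  norm (cplx (r * cos t) (r * sin t) J : A_n) = r.
Proof. by move=> r0 hJ; rewrite norm_cplx // -/(polar r t) Cmod_polar. Qed.

(** Strictness is gained by passing to a smaller angle [o'], halfway between [omega] and the
    distance of [t] to 0 or to [PI]. *)
Lemma in_I_cos omega t : 0 < omega < PI / 2 -> in_I omega t -> cos omega < Rabs (cos t).
Proof.
move=> ho ht.
have [o' [h1 h2]] : exists o', 0 < o' < omega /\ in_I o' t.
  case: ht => ht.
  - exists ((omega + Rmax (Rabs t) 0) / 2).
    have : Rabs t < omega by apply: Rabs_def1; rlra.
    have := Rmax_l (Rabs t) 0; have := Rmax_r (Rabs t) 0; have := Rabs_pos t.
    move=> a b c d; rewrite Rmax_left in b c *; try rlra.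
    split; first rlra; left; have /Rabs_le_between := Rle_refl (Rabs t); rlra.
  - exists ((omega + Rmax (Rabs (t - PI)) 0) / 2).
    have : Rabs (t - PI) < omega by apply: Rabs_def1; rlra.
    have := Rmax_l (Rabs (t - PI)) 0; have := Rmax_r (Rabs (t - PI)) 0; have := Rabs_pos (t - PI).
    move=> a b c d; rewrite Rmax_left in b c *; try rlra.
    split; first rlra; right; have /Rabs_le_between := Rle_refl (Rabs (t - PI)); rlra.
have ho' : 0 < o' < PI / 2 by rlra.
apply: Rlt_le_trans (in_I_cos_lb ho' h2); apply: cos_decreasing_1; rlra.
Qed.

(** A condition on [s_0] and [|s|] alone, free of the choice of [J] and of the angle, so that it
    survives limits. *)
Lemma Dsec_norm omega s : 0 < omega < PI / 2 -> Dsec omega s ->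
  norm (s : A_n) * cos omega < Rabs (Sc s).
Proof.
move=> ho [r [J [t [r0 [hJ [ht ->]]]]]].
rewrite cplx_expJ norm_paravector_polar //; last rlra.
rewrite Sc_cplx // Rabs_mult (Rabs_pos_eq r); last rlra.
by apply: Rmult_lt_compat_l => //; apply: in_I_cos.
Qed.

Lemma Sc_lipschitz (s s' : Cl n) : Rabs (Sc s - Sc s') <= norm (minus (s : A_n) s').
Proof.
have := clmod_norm_comp (minus (s : A_n) s' : clmod n R_NormedModule) set0.
by rewrite /Sc !ffunE.
Qed.

Lemma Dsec_closure_norm omega s : 0 < omega < PI / 2 ->
  seq_closure (X := A_n) (Dsec omega) s -> norm (s : A_n) * cos omega <= Rabs (Sc s).
Proof.
move=> ho [u [Du cu]]; apply: Rnot_lt_le => h.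
have c1 := COS_bound omega; have c0 : 0 < cos omega by apply: cos_gt_0; rlra.
(* A third of the gap: replacing [s] by a close [u N] costs at most [eta] in the norm and [eta] in
   the scalar part, so a gap of at least [eta] remains. *)
set eta := (norm (s : A_n) * cos omega - Rabs (Sc s)) / 3.
have e0 : 0 < eta by rewrite /eta; rlra.
have [N HN] := cu _ (locally_ball_norm (s : A_n) (mkposreal _ e0)).
have {}HN := HN N (Nat.le_refl N).
have h1 : norm (minus (u N : A_n) s) < eta := HN.
have h2 := Dsec_norm ho (Du N).
have h3 := Sc_lipschitz (u N) s.
have h4 : norm (s : A_n) <= norm (u N : A_n) + eta.
  have -> : (s : A_n) = minus (u N : A_n) (minus (u N : A_n) s).
    by lin; ring.
  by apply: norm_minus_le; [apply: Rle_refl|apply: Rlt_le].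
have h5 : Rabs (Sc (u N)) <= Rabs (Sc s) + eta.
  have := Rabs_triang (Sc s) (Sc (u N) - Sc s).
  by rewrite (_ : Sc s + (Sc (u N) - Sc s) = Sc (u N)); [rlra|ring].
have h6 := Rmult_le_compat_r _ _ _ (Rlt_le _ _ c0) h4.
have h7 : norm (s : A_n) * cos omega - Rabs (Sc s) = 3 * eta by rewrite /eta; field.
nra.
Qed.

Lemma Dsec_polar theta r t J : 0 < r -> in_I theta t -> imag_unit J ->
  Dsec theta (cplx (r * cos t) (r * sin t) J).
Proof. by move=> r0 ht hJ; exists r, J, t; rewrite cplx_expJ. Qed.

Lemma slice_dom_polar theta r t : 0 < r -> in_I theta t ->
  slice_dom (Dsec (n := n) theta) (r * cos t) (r * sin t).
Proof. by move=> r0 ht J hJ; apply: Dsec_polar. Qed.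

(** Scalar part and norm of [x + J y] determine [x] and [|y|], whatever unit and angle witness the
    membership. A wrong sign of [y] is corrected by reflecting the angle. *)
Lemma slice_domP theta x y : (1 <= n)%nat -> slice_dom (Dsec (n := n) theta) x y ->
  exists r t, 0 < r /\ in_I theta t /\ ((x, y) : C) = polar r t.
Proof.
move=> n0 H; have [J hJ] := imag_unit_exists n0.
have [r [J' [t [r0 [hJ' [ht E]]]]]] := H J hJ.
rewrite cplx_expJ in E.
have ex : x = r * cos t by rewrite -(Sc_cplx x y hJ) E Sc_cplx.
have := congr1 (norm : A_n -> R) E; rewrite norm_paravector_polar //; last rlra.
rewrite norm_cplx // => nr.
have ey : y = r * sin t \/ y = - (r * sin t).
  apply: Rsqr_eq; have := Cmod2_alt (x, y); rewrite nr /Re /Im /= ex /Rsqr => h.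
  have := sin2_cos2 t; rewrite /Rsqr => sc.
  have : r * r * (sin t * sin t + cos t * cos t) = r * r by rewrite sc; ring.
  nra.
case: ey => ey; first by exists r, t; rewrite /polar -ex -ey.
case: ht => ht.
- exists r, (- t); split=> //; split; first by left; rlra.
  by rewrite /polar cos_neg sin_neg -ex ey; congr pair; ring.
(* One period brings the reflected angle back to the interval around [PI]. *)
- exists r, (- t + 2 * PI); split=> //; split; first by right; rlra.
  have -> : - t + 2 * PI = - t + 2 * INR 1 * PI by rewrite /=; ring.
  by rewrite /polar cos_period sin_period cos_neg sin_neg -ex ey; congr pair; ring.
Qed.

Lemma cos_abs_le phi t : 0 < phi < PI / 2 -> phi <= t <= PI - phi -> Rabs (cos t) <= cos phi.
Proof.
move=> hp ht; apply: Rabs_le; split.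
- have -> : - cos phi = cos (PI - phi) by rewrite Rtrigo_facts.cos_pi_minus.
  by apply: cos_decr_1; rlra.
- by apply: cos_decr_1; rlra.
Qed.

Lemma not_Dsec_polar phi r t J (y : R) : 0 < phi < PI / 2 -> 0 < r -> phi <= t <= PI - phi ->
  imag_unit J -> y = r * sin t \/ y = - (r * sin t) ->
  norm (cplx (r * cos t) y J : A_n) = r /\ ~ Dsec phi (cplx (r * cos t) y J).
Proof.
move=> hp r0 ht hJ hy.
have ny : norm (cplx (r * cos t) y J : A_n) = r.
  case: hy => ->; first by apply: norm_paravector_polar => //; rlra.
  have -> : - (r * sin t) = r * sin (- t) by rewrite sin_neg; ring.
  by rewrite -{1}(cos_neg t); apply: norm_paravector_polar => //; rlra.
split=> // /(Dsec_norm hp); rewrite ny Sc_cplx // Rabs_mult (Rabs_pos_eq r); last rlra.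
by have := Rmult_le_compat_l _ _ _ (Rlt_le _ _ r0) (cos_abs_le hp ht); rlra.
Qed.

End Paravectors.

(** * The resolvents of a bisectorial operator *)

Section CliffordOperator.
Variables (n : nat) (VR : CompleteNormedModule R_AbsRing) (T : mvop n VR).
Local Notation V := (clmod_NormedModule n VR).
Local Notation X := (clmod_CompleteNormedModule n VR).
Local Notation A_n := (clmod_NormedModule n R_NormedModule).
Local Notation bop := (blin_NormedModule V V).
Local Notation rlin := (@right_linear n VR).
Implicit Types (J : Cl n).

Definition op_rel : V -> V -> Prop := fun u t => T (u, t).

(** Right linear relations are real linear for this reason: real multiples are right multiples by
    real Clifford numbers. *)
Lemma rmul_real (v : clmod n VR) (x : R) : rmul v (cl_real n x) = scal x (v : V).
Proof.
apply/ffunP => C; rewrite !ffunE (bigD1 set0) //= big1; last first.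
  move=> B /negbTE B0; rewrite !ffunE B0 /scal /= /mult /= !Rmult_0_r.
  exact: (@scal_zero_l R_AbsRing VR).
rewrite plus_zero_r !ffunE eqxx cl_sign0r symdiff_comm symdiff0.
by congr scal; rewrite /scal /= /mult /=; ring.
Qed.

Hypotheses (T_closed : closed_operator T) (T_injective : mv_injective T).

Lemma op_rel_add u v s t : op_rel u s -> op_rel v t -> op_rel (plus u v) (plus s t).
Proof. by case: T_closed => [[_ [Tadd _]] _]; apply: Tadd. Qed.

Lemma op_rel_scal (k : R) u s : op_rel u s -> op_rel (scal k u) (scal k s).
Proof.
case: T_closed => [[_ [_ Tmul]] _] H.
by have := Tmul _ _ (cl_real n k) H; rewrite !rmul_real.
Qed.

Lemma op_rel_rmul a u s : op_rel u s -> op_rel (rmul u a) (rmul s a).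
Proof. by case: T_closed => [[_ [_ Tmul]] _]; apply: Tmul. Qed.

Lemma op_rel_fun u s t : op_rel u s -> op_rel u t -> s = t.
Proof. by case: T_closed => [_ [Tfun _]]; apply: Tfun. Qed.

Lemma op_rel_inj u v s : op_rel u s -> op_rel v s -> u = v.
Proof. exact: T_injective. Qed.

Lemma QsP (s : Cl n) u v : Qs s T (u, v) <->
  exists t1 t2, op_rel u t1 /\ op_rel t1 t2 /\
    v = plus (minus t2 (scal (2 * Sc s) t1)) (scal (norm (s : A_n) ^ 2) u).
Proof.
split.
- move=> [a [b [[t2 [c [[t1 [h1 h2]] [[t1' [h1' h3]] h4]]]] [h5 h6]]]].
  rewrite /mv_cl /graph /= in h1 h2 h1' h3 h4 h5 h6; exists t1, t2; split=> //; split=> //.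
  by rewrite h6 h4 h3 h5 /= !lmul_real (op_rel_fun h1 h1').
- move=> [t1 [t2 [h1 [h2 ->]]]].
  exists (minus t2 (scal (2 * Sc s) t1)), (scal (norm (s : A_n) ^ 2) u); split.
    exists t2, (scal (2 * Sc s) t1); split; first by exists t1.
    by split=> //; exists t1; split=> //; rewrite /mv_cl /graph /= lmul_real.
  by split=> //; rewrite /mv_cl /graph /= lmul_real.
Qed.

Lemma minus_right_linear (A B : bop) : rlin A -> rlin B -> rlin (minus A B : bop).
Proof. by move=> hA hB v a; rewrite !minus_blinE hA hB -!rmopE blinB. Qed.

Lemma lop_right_linear a : rlin (lop VR a).
Proof. by move=> v b; rewrite !lopE lmul_rmul. Qed.

Lemma bcomp_right_linear (A B : bop) : rlin A -> rlin B -> rlin (bcomp A B).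
Proof. by move=> hA hB v a; rewrite /= hB hA. Qed.

Section OnePoint.
Variables (K L : bop) (x y : R).
Hypotheses (HK : pseudo_resolvent (X := X) op_rel x (x ^ 2 + y ^ 2) K L).
Variable J : Cl n.
Hypothesis (hJ : imag_unit J).

(** [Q_s] depends on [s] only through [s_0] and [|s|], so it is the same at [s] and at its
    conjugate; [sigma] is 1 or -1. *)
Lemma Qs_pseudo_resolvent sigma u v : sigma ^ 2 = 1 ->
  Qs (cplx x (sigma * y) J) T (u, v) <-> u = K v.
Proof.
move=> hs; rewrite QsP Sc_cplx // norm_cplx // Cmod2_alt /Re /Im /=.
have -> : x * (x * 1) + sigma * y * (sigma * y * 1) = x ^ 2 + y ^ 2.
  by transitivity (x ^ 2 + sigma ^ 2 * y ^ 2); [ring|rewrite hs; ring].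
exact: (proj1 HK).
Qed.

(** [J] stays on the right of [K], with which it need not commute; for [S_R^-1] in the next lemma it
    stays on the left. *)
Lemma SL_invE sigma v u : sigma ^ 2 = 1 -> SL_inv (cplx x (sigma * y) J) T (v, u) <->
  u = minus (minus (scal x (K v)) (L v)) (scal (sigma * y) (K (lmul J v))).
Proof.
move=> hs; have E : K (lmul (cl_conj (cplx x (sigma * y) J)) v) =
    minus (scal x (K v)) (scal (sigma * y) (K (lmul J v))).
  rewrite cl_conj_cplx // lmul_cplx blinD !blinZ /minus; congr plus.
  by lin; ring.
split.
- move=> [a [b [[c [h1 h2]] [[d [h3 h4]] h5]]]]; rewrite /mv_cl /graph /= in h1 h2 h3 h4 h5.
  have ha : a = K c by apply/(Qs_pseudo_resolvent _ _ hs).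
  rewrite h1 E in ha.
  have hd : d = K v by apply/(Qs_pseudo_resolvent _ _ hs).
  rewrite hd in h4.
  by rewrite h5 ha (op_rel_fun h4 (proj2 HK v)); lin; ring.
- move=> ->; exists (K (lmul (cl_conj (cplx x (sigma * y) J)) v)), (L v).
  split; first by exists (lmul (cl_conj (cplx x (sigma * y) J)) v); split=> //; apply/(Qs_pseudo_resolvent _ _ hs).
  split; first by exists (K v); split; [apply/(Qs_pseudo_resolvent _ _ hs)|apply: (proj2 HK)].
  by rewrite E /=; lin; ring.
Qed.

Lemma SR_invE sigma v u : sigma ^ 2 = 1 -> SR_inv (cplx x (sigma * y) J) T (v, u) <->
  u = minus (minus (scal x (K v)) (L v)) (scal (sigma * y) (lmul J (K v) : V)).
Proof.
move=> hs; have E : lmul (cl_conj (cplx x (sigma * y) J)) (K v) =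
    minus (scal x (K v)) (scal (sigma * y) (lmul J (K v) : V)).
  rewrite cl_conj_cplx // lmul_cplx /minus; congr plus.
  by lin; ring.
split.
- move=> [a [h1 [b [c [h2 [h3 h4]]]]]]; rewrite /mv_cl /graph /= in h1 h2 h3 h4.
  have ha : a = K v by apply/(Qs_pseudo_resolvent _ _ hs).
  subst a.
  by rewrite h4 h2 /= E (op_rel_fun h3 (proj2 HK v)); lin; ring.
- move=> ->; exists (K v); split; first by apply/(Qs_pseudo_resolvent _ _ hs).
  exists (lmul (cl_conj (cplx x (sigma * y) J)) (K v)), (L v); split=> //; split; first exact: (proj2 HK).
  by rewrite E /=; lin; ring.
Qed.

End OnePoint.

Section Existence.
Variable omega : R.
Hypotheses (n_ge1 : (1 <= n)%nat) (omega_bounds : 0 < omega < PI / 2) (T_bisect : bisectorial omega T).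

(** A spectral point would satisfy [|s| cos omega <= |s_0|] by passage to the closure, whereas here
    [|s_0| <= |s| cos phi] for some [phi > omega]. *)
Lemma resolvent_set_polar r t J y : 0 < r -> omega < t < PI - omega -> imag_unit J ->
  y = r * sin t \/ y = - (r * sin t) -> S_resolvent_set T (cplx (r * cos t) y J).
Proof.
move=> r0 ht hJ hy; apply: NNPP => nr.
have [phi [hp hpt]] : exists phi, omega < phi < PI / 2 /\ phi <= t <= PI - phi.
  case: (Rle_lt_dec t (PI / 2)) => ht2.
  - by exists ((omega + t) / 2); split; rlra.
  - by exists ((omega + (PI - t)) / 2); split; rlra.
have hp' : 0 < phi < PI / 2 by rlra.
have [ns _] := not_Dsec_polar hp' r0 hpt hJ hy.
have := Dsec_closure_norm omega_bounds ((proj1 T_bisect) _ (conj (paravector_cplx _ _ hJ) nr)).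
rewrite ns Sc_cplx // Rabs_mult (Rabs_pos_eq r); last rlra.
have h1 : cos phi < cos omega by apply: cos_decreasing_1; rlra.
have h2 := Rmult_lt_compat_l _ _ _ r0 h1.
have h3 := Rmult_le_compat_l _ _ _ (Rlt_le _ _ r0) (cos_abs_le hp' hpt).
by rlra.
Qed.

(* The action of [S_L^-1] at [s] and at the conjugate of [s] determines both
   the real part [x K - L] and the imaginary part [y K] of the resolvent. *)
Lemma pseudo_resolvent_exists phi : omega < phi < PI / 2 -> exists c, 0 <= c /\
  forall r t, 0 < r -> phi <= t <= PI - phi -> exists K L : bop,
    [/\ pseudo_resolvent (X := X) op_rel (r * cos t) ((r * cos t) ^ 2 + (r * sin t) ^ 2) K L,
        rlin K, rlin L,
        norm (minus (scal (r * cos t) K) L) <= c / r & norm (scal (r * sin t) K) <= c / r].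
Proof.
move=> hp; have [C [C0 HC]] := proj2 T_bisect phi hp.
have [J hJ] := imag_unit_exists n_ge1.
have hp' : 0 < phi < PI / 2 by rlra.
set j := norm (lop VR J : bop); have j0 : 0 <= j by apply: norm_ge_0.
exists (C * (1 + j)); split; first by apply: Rmult_le_pos; rlra.
move=> r t r0 ht; set x := r * cos t; set y := r * sin t.
have hy1 : y = r * sin t \/ y = - (r * sin t) by left.
have hy2 : - y = r * sin t \/ - y = - (r * sin t) by right.
have [n1 d1] := not_Dsec_polar hp' r0 ht hJ hy1.
have [n2 d2] := not_Dsec_polar hp' r0 ht hJ hy2.
have nz (s : A_n) : norm s = r -> s <> zero by move=> h E; rewrite E norm_zero in h; rlra.
have [A1 [[_ E1] b1]] := HC _ (paravector_cplx _ _ hJ) d1 (nz _ n1).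
have [A2 [[_ E2] b2]] := HC _ (paravector_cplx _ _ hJ) d2 (nz _ n2).
have ht' : omega < t < PI - omega by rlra.
have [_ [K [rK EK]]] := resolvent_set_polar r0 ht' hJ hy1.
have HKu u v : Qs (cplx x y J) T (u, v) <-> u = K v by exact: (EK (v, u)).
set sb := cl_conj (cplx x y J).
(* [S_L^-1] is [K] composed with the conjugate of [s], minus [T K]; so this difference is [T K], now
   seen to be bounded. *)
pose L : bop := minus (bcomp K (lop VR sb)) A1.
have TL v : op_rel (K v) (L v).
  have /(E1 (v, A1 v)) [a [b [[c [h1 h2]] [[d [h3 h4]] h5]]]] : graph A1 (v, A1 v) by [].
  rewrite /mv_cl /graph /= in h1 h2 h3 h4 h5.
  have ha : a = K c by apply/HKu.
  have hd : d = K v by apply/HKu.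
  subst d; have -> : L v = b; last by [].
  rewrite /L minus_blinE -[bcomp _ _ v]/(K (lop VR sb v)) lopE h5 ha h1.
  by lin; ring.
have HK : pseudo_resolvent (X := X) op_rel x (x ^ 2 + y ^ 2) K L.
  split=> // u v; rewrite -HKu QsP Sc_cplx // norm_cplx // Cmod2_alt /Re /Im /=.
  by have -> : x * (x * 1) + y * (y * 1) = x ^ 2 + y ^ 2 by ring.
have s1 : 1 ^ 2 = 1 by ring.
have s2 : (- 1) ^ 2 = 1 by ring.
have F1 v : A1 v = minus (minus (scal x (K v)) (L v)) (scal y (K (lmul J v))).
  have := proj1 (SL_invE HK hJ v (A1 v) s1).
  by rewrite !Rmult_1_l; apply; apply/(E1 (v, A1 v)).
have F2 v : A2 v = minus (minus (scal x (K v)) (L v)) (scal (- y) (K (lmul J v))).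
  have := proj1 (SL_invE HK hJ v (A2 v) s2).
  have -> : - 1 * y = - y by ring.
  by apply; apply/(E2 (v, A2 v)).
have B1 : norm A1 <= C / r by rewrite n1 in b1.
have B2 : norm A2 <= C / r by rewrite n2 in b2.
have cr : 0 <= C / r by apply: Rmult_le_pos => //; apply: Rlt_le; apply: Rinv_0_lt_compat.
have cj : 0 <= C / r * j by apply: Rmult_le_pos.
have EC : C * (1 + j) / r = C / r + C / r * j by field; rlra.
exists K, L; split=> //.
- apply: minus_right_linear; first by apply: bcomp_right_linear => //; apply: lop_right_linear.
  move=> v a; have rL w : L (rmul w a) = rmul (L w) a.
    apply: op_rel_fun (TL _) _; rewrite rK; exact: op_rel_rmul.
  rewrite !F1 rK lmul_rmul rK rL -!rmopE.
  by rewrite !blinB !blinZ.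
- have -> : minus (scal x K) L = scal (/ 2) (plus A1 A2 : bop).
    apply: blin_eq => v; rewrite minus_blinE.
    rewrite -[RHS]/(scal (/ 2) (plus (A1 v) (A2 v))) F1 F2.
    by rewrite -[(scal x K : bop) v]/(scal x (K v)); lin; field.
  apply: Rle_trans (norm_scal_le _ (norm_plus_le B1 B2)) _.
  rewrite EC Rabs_pos_eq; rlra.
(* [A1 - A2 = - 2 y K J]; composition with [J] on the right isolates [y K], at the cost of the
   factor [j] in the constant. *)
- have -> : scal y K = bcomp (scal (/ 2) (minus A1 A2 : bop)) (lop VR J).
    apply: blin_eq => v.
    rewrite -[RHS]/(scal (/ 2) ((minus A1 A2 : bop) (lop VR J v))) lopE minus_blinE F1 F2.
    rewrite lmul_imag_unit2 // blinN.
    by rewrite -[(scal y K : bop) v]/(scal y (K v)); lin; field.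
  apply: Rle_trans (opnorm_comp _ _) _; rewrite -/j.
  have h := norm_scal_le (/ 2) (norm_minus_le B1 B2).
  apply: Rle_trans (Rmult_le_compat_r _ _ _ j0 h) _.
  rewrite EC Rabs_pos_eq; last rlra.
  by rlra.
Qed.

(** One pair is chosen for each [z], while the bounds come with pairs depending on [phi]; uniqueness
    of the pseudo-resolvent identifies them. *)
Lemma resolvent_family : exists Kz Lz : C -> bop,
  (forall z, sector omega (PI - omega) z ->
     [/\ pseudo_resolvent (X := X) op_rel (Re z) (Cmod z ^ 2) (Kz z) (Lz z), rlin (Kz z) & rlin (Lz z)]) /\
  forall phi, omega < phi < PI / 2 -> exists c, 0 <= c /\
    forall r t, 0 < r -> phi <= t <= PI - phi ->
      norm (Pz (X := X) Kz Lz (polar r t)) <= c / r /\ norm (qz (X := X) Kz (polar r t)) <= c / r.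
Proof.
pose good (z : C) (KL : bop * bop) := sector omega (PI - omega) z ->
  [/\ pseudo_resolvent (X := X) op_rel (Re z) (Cmod z ^ 2) KL.1 KL.2, rlin KL.1 & rlin KL.2].
have ex z : exists KL, good z KL.
  case: (classic (sector omega (PI - omega) z)) => [|nz]; last by exists (zero, zero).
  move=> [r [t [r0 [ht ->]]]].
  have [phi [hp hpt]] : exists phi, omega < phi < PI / 2 /\ phi <= t <= PI - phi.
    case: (Rle_lt_dec t (PI / 2)) => ht2.
    - by exists ((omega + t) / 2); split; rlra.
    - by exists ((omega + (PI - t)) / 2); split; rlra.
  have [c [_ Hc]] := pseudo_resolvent_exists hp.
  have [K [L [HK rK rL _ _]]] := Hc r t r0 hpt.
  by exists (K, L) => _; split=> //; rewrite Cmod2_alt.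
pose KL z := proj1_sig (constructive_indefinite_description _ (ex z)).
have HKL z : good z (KL z) := proj2_sig (constructive_indefinite_description _ (ex z)).
exists (fun z => (KL z).1), (fun z => (KL z).2); split; first by [].
move=> phi hp; have [c [c0 Hc]] := pseudo_resolvent_exists hp.
exists c; split=> // r t r0 ht; have [K [L [HK _ _ bP bq]]] := Hc r t r0 ht.
have Dz : sector omega (PI - omega) (polar r t).
  by exists r, t; split=> //; split=> //; rlra.
have [HK' _ _] := HKL _ Dz; rewrite Cmod2_alt in HK'.
have [EK EL] := @pseudo_resolvent_unique X op_rel op_rel_fun _ _ _ _ HK _ _ HK'.
by rewrite /Pz /qz -EK -EL.
Qed.

Section AxisBounds.
Variables (Kz Lz : C -> bop).
Hypotheses (HKz : forall z, sector omega (PI - omega) z ->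
     [/\ pseudo_resolvent (X := X) op_rel (Re z) (Cmod z ^ 2) (Kz z) (Lz z), rlin (Kz z) & rlin (Lz z)])
  (z_bound : forall phi, omega < phi < PI / 2 -> exists c, 0 <= c /\
    forall r t, 0 < r -> phi <= t <= PI - phi ->
      norm (Pz (X := X) Kz Lz (polar r t)) <= c / r /\ norm (qz (X := X) Kz (polar r t)) <= c / r).

Lemma axis_pseudo_resolvent y : 0 < y ->
  pseudo_resolvent (X := X) op_rel 0 (y ^ 2) (Kz (polar y (PI / 2))) (Lz (polar y (PI / 2))).
Proof.
move=> y0; have Dz : sector omega (PI - omega) (polar y (PI / 2)).
  by exists y, (PI / 2); split=> //; split=> //; rlra.
have [H _ _] := HKz Dz; move: H; rewrite Cmod_polar; last rlra.
by rewrite {1}/polar {1}/Re /= cos_PI2 Rmult_0_r.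
Qed.

(** On the imaginary axis [P = - L] and [q = y K]. *)
Lemma axis_bound : exists c, 0 <= c /\ forall y, 0 < y ->
  y ^ 2 * norm (Kz (polar y (PI / 2))) <= c /\ y * norm (Lz (polar y (PI / 2))) <= c.
Proof.
have hp : omega < (omega + PI / 2) / 2 < PI / 2 by rlra.
have [c [c0 Hc]] := z_bound hp; exists c; split=> // y y0.
have ht : (omega + PI / 2) / 2 <= PI / 2 <= PI - (omega + PI / 2) / 2 by rlra.
have [h1 h2] := Hc y (PI / 2) y0 ht.
have cy : y * (c / y) = c by field; rlra.
split.
- have -> : Kz (polar y (PI / 2)) = scal (/ y) (qz (X := X) Kz (polar y (PI / 2))).
    rewrite /qz scal_assoc {2}/polar /Im /= sin_PI2 /mult /= Rmult_1_r Rinv_l; last rlra.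
    by apply: esym; apply: (@scal_one R_AbsRing bop).
  have h := norm_scal_le (/ y) h2.
  apply: (@Rle_trans _ (y ^ 2 * (Rabs (/ y) * (c / y)))).
    by apply: Rmult_le_compat_l => //; apply: pow2_ge_0.
  apply: Req_le; rewrite Rabs_pos_eq; first by field; rlra.
  by apply: Rlt_le; apply: Rinv_0_lt_compat.
- have -> : Lz (polar y (PI / 2)) = opp (Pz (X := X) Kz Lz (polar y (PI / 2))).
    rewrite /Pz {2}/polar /Re /= cos_PI2 Rmult_0_r.
    by rewrite (@scal_zero_l R_AbsRing bop) /minus plus_zero_l opp_opp.
  rewrite norm_opp; apply: Rle_trans (Req_le _ _ cy).
  by apply: Rmult_le_compat_l h1; rlra.
Qed.

End AxisBounds.
End Existence.
End CliffordOperator.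

Section RightLinear.
Variables (n : nat) (VR : NormedModule R_AbsRing).
Local Notation V := (clmod_NormedModule n VR).
Local Notation bop := (blin_NormedModule V V).
Local Notation rlin := (@right_linear n VR).

(** As commutation with bounded operators, right linearity is inherited by the calculus through
    [calculus_value_commute]. *)
Lemma right_linearP (B : bop) : rlin B <-> forall a, bcomp (rmop VR a) B = bcomp B (rmop VR a).
Proof.
split=> [H a|H v a].
- by apply: blin_eq => v; rewrite /= !rmopE H.
- by have := blin_app_eq (H a) v; rewrite /= !rmopE.
Qed.

Lemma scal_right_linear (k : R) (B : bop) : rlin B -> rlin (scal k B : bop).
Proof. by move=> H v a; rewrite /= H -!rmopE blinZ. Qed.

Lemma eop_right_linear A : rlin (eop A).
Proof. by move=> v a; rewrite -!rmopE -!lmul_base rmopE lmul_rmul rmopE. Qed.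

Lemma sum_right_linear (I : Type) (r : seq I) (F : I -> bop) :
  (forall i, rlin (F i)) -> rlin (\big[plus/zero]_(i <- r) F i : bop).
Proof.
move=> H v a; rewrite !sum_blinE -[RHS]rmopE blin_sum; apply: eq_bigr => i _.
by rewrite H rmopE.
Qed.

Lemma is_bounded_op_unique (S : mvop n VR) (A B : bop) :
  is_bounded_op S A -> is_bounded_op S B -> A = B.
Proof.
move=> [_ hA] [_ hB]; apply: blin_eq => v.
by have /hA /hB : graph A (v, A v) by [].
Qed.

Lemma is_RInt_zinf_sum (Y : NormedModule R_AbsRing) (I : Type) (s : seq I) (F : I -> R -> Y) (J : I -> Y) :
  (forall i, zinf (F i) (J i)) ->
  s <> nil -> zinf (fun r => \big[plus/zero]_(i <- s) F i r) (\big[plus/zero]_(i <- s) J i).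
Proof.
move=> H; elim: s => // i [|j s] IH _.
  rewrite big_seq1; apply: is_RInt_zinf_ext (H i) => r _; by rewrite big_seq1.
rewrite big_cons; apply: is_RInt_zinf_ext (is_RInt_zinf_plus (H i) (IH _)) => // r _.
by rewrite [RHS]big_cons.
Qed.

End RightLinear.

(** * Contour integrals *)

Section Contours.
Variables (n : nat) (VR : CompleteNormedModule R_AbsRing).
Local Notation V := (clmod_NormedModule n VR).
Local Notation A_n := (clmod_NormedModule n R_NormedModule).
Local Notation bop := (blin_NormedModule V V).
Variable G : Cl n -> Cl n -> mvop n VR.

Lemma ray_integral_unique J psi eps (A B : bop) :
  ray_integral G J psi eps A -> ray_integral G J psi eps B -> A = B.
Proof.
move=> [F [HF IF]] [H [HH IH]].
apply: (@bop_zinf_unique (clmod_CompleteNormedModule n VR)) IF _.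
apply: is_RInt_zinf_ext IH => r r0.
exact: is_bounded_op_unique (HH r r0) (HF r r0).
Qed.

(** The relation quantifies over all [phi] and [J]; it determines the value because an admissible
    angle and an imaginary unit exist. *)
Lemma omega_calc_unique omega theta (A B : bop) : (1 <= n)%nat -> omega < theta ->
  omega_calc G omega theta A -> omega_calc G omega theta B -> A = B.
Proof.
move=> n0 wt HA HB; have [J hJ] := imag_unit_exists n0.
have mid : omega < (omega + theta) / 2 < theta by rlra.
have [A' [[A1 [A2 [A3 [A4 [h1 [h2 [h3 [h4 ->]]]]]]]] ->]] := HA _ _ mid hJ.
have [B' [[B1 [B2 [B3 [B4 [k1 [k2 [k3 [k4 ->]]]]]]]] ->]] := HB _ _ mid hJ.
by rewrite (ray_integral_unique h1 k1) (ray_integral_unique h2 k2) (ray_integral_unique h3 k3)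
  (ray_integral_unique h4 k4).
Qed.

(* On the ray [x + sigma J y], [x + i y = r e^(i t)], the form [G s ds_J]
   splits into a part odd in [sigma] and one even in [sigma]; only the former
   survives in the contour integral. *)
Definition ray_form J (t : R) (M N : R -> bop) : Prop :=
  forall r sigma eps, 0 < r -> sigma ^ 2 = 1 ->
    is_bounded_op (G (cplx (r * cos t) (sigma * (r * sin t)) J)
                     (scal eps (cplx (sigma * sin t) (- cos t) J : A_n)))
                  (scal eps (minus (scal sigma (M r)) (N r)) : bop).

Lemma ray_integral_of_form J t psi sigma eps (M N : R -> bop) (IM IN : bop) : imag_unit J ->
  sigma ^ 2 = 1 -> cos psi = cos t -> sin psi = sigma * sin t ->
  ray_form J t M N -> zinf M IM -> zinf N IN ->
  ray_integral G J psi eps (scal eps (minus (scal sigma IM) IN)).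
Proof.
move=> hJ hs hc hsin HG HM HN; exists (fun r => scal eps (minus (scal sigma (M r)) (N r))); split.
- move=> r r0; have := HG r sigma eps r0 hs.
  have -> : scal r (expJ J psi : A_n) = cplx (r * cos t) (sigma * (r * sin t)) J.
    by rewrite cplx_expJ hc hsin; congr cplx; ring.
  (* [J^-1 = - J], so [e^(J psi) J^-1 = sin psi - J cos psi]. *)
  have -> // : cl_mul (scal eps (expJ J psi : A_n)) (cl_inv J) =
    scal eps (cplx (sigma * sin t) (- cos t) J : A_n).
  rewrite cl_mulZl; congr scal.
  have -> : cl_inv J = cplx 0 (- 1) J.
    have -> : J = cplx (Re Ci) (Im Ci) J by apply/ffunP => A; rewrite cplxE /=; case: eqP => _; rring.
    rewrite cl_inv_cplx //; first last.
      by move=> /(congr1 Im) /=; rewrite /Im /=; rlra.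
    have -> : Cinv Ci = Copp Ci by rewrite /Cinv /Copp /Ci /=; congr pair; field.
    by apply/ffunP => A; rewrite !cplxE /= /Re /Im /=; case: eqP => _; rring.
  by rewrite /expJ cplx_mul // hc hsin; congr cplx; ring.
- apply: is_RInt_zinf_scal; apply: is_RInt_zinf_minus => //; exact: is_RInt_zinf_scal.
Qed.

(** The two rays in each half-plane carry opposite [sigma] and opposite [eps]: the parts even in
    [sigma] cancel and the odd ones double. *)
Lemma contour_of_forms J phi (M N M' N' : R -> bop) (IM IN IM' IN' : bop) : imag_unit J ->
  ray_form J phi M N -> ray_form J (PI - phi) M' N' ->
  zinf M IM -> zinf N IN -> zinf M' IM' -> zinf N' IN' ->
  contour_integral G J phi (scal 2 (minus IM' IM)).
Proof.
move=> hJ HG HG' HM HN HM' HN'.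
have s1 : 1 ^ 2 = 1 by ring.
have s2 : (- 1) ^ 2 = 1 by ring.
exists (scal 1 (minus (scal (- 1) IM) IN)), (scal (- 1) (minus (scal 1 IM) IN)),
  (scal 1 (minus (scal 1 IM') IN')), (scal (- 1) (minus (scal (- 1) IM') IN')).
split; first by apply: (ray_integral_of_form (t := phi)) HG HM HN => //; rewrite ?cos_neg ?sin_neg //; ring.
split; first by apply: (ray_integral_of_form (t := phi)) HG HM HN => //; ring.
split; first by apply: (ray_integral_of_form (t := PI - phi)) HG' HM' HN' => //; ring.
split.
  apply: (ray_integral_of_form (t := PI - phi)) HG' HM' HN' => //.
  - by rewrite Rtrigo_facts.cos_pi_plus Rtrigo_facts.cos_pi_minus.
  - by rewrite Rtrigo_facts.sin_pi_plus Rtrigo_facts.sin_pi_minus; ring.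
by lin; ring.
Qed.

End Contours.

Lemma fun_choice (A B : Type) (Q : A -> B -> Prop) : (forall a, exists b, Q a b) ->
  exists f, forall a, Q a (f a).
Proof.
move=> H; exists (fun a => proj1_sig (constructive_indefinite_description _ (H a))) => a.
exact: proj2_sig (constructive_indefinite_description _ (H a)).
Qed.

(** * Complex representations of slice functions *)

Section Representations.
Variable n : nat.
Local Notation A_n := (clmod_NormedModule n R_NormedModule).

(* [f (x + J y) = f0 (x, y) + f1 (x, y) J], with [f0] and [f1] read off the
   complex functions [F A = f0_A + i f1_A]. *)
Definition right_rep (theta : R) (f : Cl n -> Cl n) (F : {set 'I_n} -> C -> C) : Prop :=
  forall r t J, 0 < r -> in_I theta t -> imag_unit J ->
    f (cplx (r * cos t) (r * sin t) J) =
    plus ([ffun A => Re (F A (polar r t))] : A_n) (cl_mul [ffun A => Im (F A (polar r t))] J).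

Definition intrinsic_rep (theta : R) (f : Cl n -> Cl n) (F : C -> C) : Prop :=
  forall r t J, 0 < r -> in_I theta t -> imag_unit J ->
    f (cplx (r * cos t) (r * sin t) J) = cplx (Re (F (polar r t))) (Im (F (polar r t))) J.

Lemma sqr_eq1 (sigma : R) : sigma ^ 2 = 1 -> sigma = 1 \/ sigma = - 1.
Proof. by move=> h; apply: Rsqr_eq; rewrite /Rsqr; rlra. Qed.

(** The point with [sigma = -1] is the original one with the unit [- J] in place of [J]. *)
Lemma right_rep_sign theta f F r t sigma J : right_rep theta f F ->
  0 < r -> in_I theta t -> imag_unit J -> sigma ^ 2 = 1 ->
  f (cplx (r * cos t) (sigma * (r * sin t)) J) =
  plus ([ffun A => Re (F A (polar r t))] : A_n)
       (scal sigma (cl_mul [ffun A => Im (F A (polar r t))] J : A_n)).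
Proof.
move=> H r0 ht hJ /sqr_eq1 [->|->].
- by rewrite Rmult_1_l H // (@scal_one R_AbsRing A_n).
- have -> : cplx (r * cos t) (-1 * (r * sin t)) J = cplx (r * cos t) (r * sin t) (opp (J : A_n)).
    by rewrite cplx_opp; congr cplx; ring.
  rewrite H //; last exact: imag_unit_opp.
  congr plus; rewrite /cl_mul -!lopE blinN.
  by lin; ring.
Qed.

Lemma intrinsic_rep_sign theta f F r t sigma J : intrinsic_rep theta f F ->
  0 < r -> in_I theta t -> imag_unit J -> sigma ^ 2 = 1 ->
  f (cplx (r * cos t) (sigma * (r * sin t)) J) =
  cplx (Re (F (polar r t))) (sigma * Im (F (polar r t))) J.
Proof.
move=> H r0 ht hJ /sqr_eq1 [->|->]; first by rewrite !Rmult_1_l H.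
have -> : cplx (r * cos t) (-1 * (r * sin t)) J = cplx (r * cos t) (r * sin t) (opp (J : A_n)).
  by rewrite cplx_opp; congr cplx; ring.
rewrite H //; last exact: imag_unit_opp.
by rewrite cplx_opp; congr cplx; ring.
Qed.

End Representations.

(** * From the calculus of scalar functions to contour integrals *)

Section OperatorRays.
Variables (n : nat) (VR : CompleteNormedModule R_AbsRing) (T : mvop n VR).
Local Notation V := (clmod_NormedModule n VR).
Local Notation X := (clmod_CompleteNormedModule n VR).
Local Notation A_n := (clmod_NormedModule n R_NormedModule).
Local Notation bop := (blin_NormedModule V V).
Local Notation rlin := (@right_linear n VR).

Hypothesis T_closed : closed_operator T.
Variables (omega theta : R) (Kz Lz : C -> bop).
Hypotheses (omega_bounds : 0 < omega < PI / 2) (theta_bounds : omega < theta < PI / 2).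
Hypotheses (HKz : forall z, sector omega (PI - omega) z ->
     [/\ pseudo_resolvent (X := X) (op_rel T) (Re z) (Cmod z ^ 2) (Kz z) (Lz z), rlin (Kz z) & rlin (Lz z)]).

Local Notation P := (Pz (X := X) Kz Lz).
Local Notation q := (qz (X := X) Kz).
Local Notation oray := (op_ray (X := X) P q).

Lemma op_ray_expand F t r v : oray F t r v =
  minus (scal (sin t * Re (F (polar r t)) + cos t * Im (F (polar r t))) (P (polar r t) v))
        (scal (cos t * Re (F (polar r t)) - sin t * Im (F (polar r t))) (q (polar r t) v)).
Proof.
rewrite op_rayE; congr minus; congr scal;
  by rewrite /ray; move: (F (polar r t)) => z; rewrite /polar /Re /Im /=; ring.
Qed.

Lemma op_ray_expand_Ci F t r v : oray (fun z => Cmult Ci (F z)) t r v =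
  plus (scal (cos t * Re (F (polar r t)) - sin t * Im (F (polar r t))) (P (polar r t) v))
       (scal (sin t * Re (F (polar r t)) + cos t * Im (F (polar r t))) (q (polar r t) v)).
Proof.
rewrite op_ray_expand /Re /Im /=; lin; ring.
Qed.

(** [B] stands for left multiplication by [J], and [p], [u] for [P v], [q v]. The product [(g0 +
    sigma g1 J) (sigma s - c J) (p - sigma J u)] is sorted by parity in [sigma]: the odd part is
    free of [J], the even part carries it on the left. *)
Lemma right_form_aux (Y : NormedModule R_AbsRing) (B : blin Y Y) (p u : Y) (c s g0 g1 sigma : R) :
  (forall v, B (B v) = opp v) -> sigma ^ 2 = 1 ->
  let w := plus (scal (sigma * s) (minus p (scal sigma (B u))))
                (scal (- c) (B (minus p (scal sigma (B u))))) in
  plus (scal g0 w) (scal (sigma * g1) (B w)) =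
  minus (scal sigma (minus (scal (s * g0 + c * g1) p) (scal (c * g0 - s * g1) u)))
        (B (plus (scal (c * g0 - s * g1) p) (scal (s * g0 + c * g1) u))).
Proof.
move=> hB hs /=; rewrite /minus !(blinD, blinZ, blinN) !hB !blinN.
by case: (sqr_eq1 hs) => ->; lin; ring.
Qed.

Lemma right_form_identity (p u : V) J (c s g0 g1 sigma : R) : imag_unit J -> sigma ^ 2 = 1 ->
  let w := lmul (cplx (sigma * s) (- c) J) (minus p (scal sigma (lmul J u : V)) : V) : V in
  plus (scal g0 w) (scal (sigma * g1) (lmul J w : V)) =
  minus (scal sigma (minus (scal (s * g0 + c * g1) p) (scal (c * g0 - s * g1) u)))
        (lmul J (plus (scal (c * g0 - s * g1) p) (scal (s * g0 + c * g1) u) : V) : V).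
Proof.
move=> hJ hs /=; rewrite lmul_cplx -!(lopE J); apply: (@right_form_aux V (lop VR J)) => //.
by move=> w; rewrite !lopE lmul_imag_unit2.
Qed.

(** In the left calculus the resolvent stands on the left, so [J] acts on [v] first; the odd part is
    the same as in the right calculus. *)
Lemma left_form_identity (p u : blin V V) J v (c s g0 g1 sigma : R) : imag_unit J -> sigma ^ 2 = 1 ->
  let w := lmul (cplx (sigma * s) (- c) J) (lmul (cplx g0 (sigma * g1) J) v) : V in
  minus (p w) (scal sigma (u (lmul J w))) =
  minus (scal sigma (minus (scal (s * g0 + c * g1) (p v)) (scal (c * g0 - s * g1) (u v))))
        (plus (scal (c * g0 - s * g1) (p (lmul J v))) (scal (s * g0 + c * g1) (u (lmul J v)))).
Proof.
move=> hJ hs /=; have E w : lop VR J (lop VR J w) = opp w by rewrite !lopE lmul_imag_unit2.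
rewrite !lmul_cplx -!(lopE J) !(blinD, blinZ, blinN) E !(blinD, blinZ, blinN).
by case: (sqr_eq1 hs) => ->; lin; ring.
Qed.

Lemma polar_resolvent r t : 0 < r -> omega < t < PI - omega ->
  [/\ pseudo_resolvent (X := X) (op_rel T) (r * cos t) ((r * cos t) ^ 2 + (r * sin t) ^ 2)
        (Kz (polar r t)) (Lz (polar r t)), rlin (P (polar r t)), rlin (q (polar r t)) &
      forall v, P (polar r t) v = minus (scal (r * cos t) (Kz (polar r t) v)) (Lz (polar r t) v) /\
                q (polar r t) v = scal (r * sin t) (Kz (polar r t) v)].
Proof.
move=> r0 ht; have Dz : sector omega (PI - omega) (polar r t) by exists r, t.
have [HK rK rL] := HKz Dz; rewrite Cmod2_alt in HK; split=> //.
- by apply: minus_right_linear => //; apply: scal_right_linear.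
- exact: scal_right_linear.
- by move=> v; rewrite PzE qzE.
Qed.

Lemma op_ray_right_linear F r t : 0 < r -> omega < t < PI - omega -> rlin (oray F t r).
Proof.
move=> r0 ht; have [_ rP rq _] := polar_resolvent r0 ht.
by apply: minus_right_linear; apply: scal_right_linear.
Qed.

Lemma is_bounded_opI (S : mvop n VR) (A : bop) :
  rlin A -> (forall v u, S (v, u) <-> u = A v) -> is_bounded_op S A.
Proof. by move=> rA H; split=> // [[v u]]; apply: H. Qed.

Lemma SR_inv_polar r t J sigma v u : 0 < r -> omega < t < PI - omega -> imag_unit J -> sigma ^ 2 = 1 ->
  SR_inv (cplx (r * cos t) (sigma * (r * sin t)) J) T (v, u) <->
  u = minus (P (polar r t) v) (scal sigma (lmul J (q (polar r t) v) : V)).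
Proof.
move=> r0 ht hJ hs; have [HK _ _ E] := polar_resolvent r0 ht.
rewrite (SR_invE T_closed HK hJ v u hs); have [-> ->] := E v.
by rewrite -!(lopE J) blinZ scal_assoc.
Qed.

Lemma SL_inv_polar r t J sigma v u : 0 < r -> omega < t < PI - omega -> imag_unit J -> sigma ^ 2 = 1 ->
  SL_inv (cplx (r * cos t) (sigma * (r * sin t)) J) T (v, u) <->
  u = minus (P (polar r t) v) (scal sigma (q (polar r t) (lmul J v))).
Proof.
move=> r0 ht hJ hs; have [HK _ _ E] := polar_resolvent r0 ht.
rewrite (SL_invE T_closed HK hJ v u hs); have [-> _] := E v; have [_ ->] := E (lmul J v).
by rewrite scal_assoc.
Qed.

Lemma op_comp_expand F (B : bop) r t v : (bcomp B (oray F t r) : blin V V) v =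
  B (minus (scal (sin t * Re (F (polar r t)) + cos t * Im (F (polar r t))) (P (polar r t) v))
        (scal (cos t * Re (F (polar r t)) - sin t * Im (F (polar r t))) (q (polar r t) v))).
Proof. by rewrite -op_ray_expand. Qed.

Lemma op_comp_expand_Ci F (B : bop) J r t v :
  (bcomp B (bcomp (lop VR J) (oray (fun z => Cmult Ci (F z)) t r)) : blin V V) v =
  B (lmul J (plus (scal (cos t * Re (F (polar r t)) - sin t * Im (F (polar r t))) (P (polar r t) v))
       (scal (sin t * Re (F (polar r t)) + cos t * Im (F (polar r t))) (q (polar r t) v)))).
Proof. by rewrite -op_ray_expand_Ci -lopE. Qed.

(** [f (s)] is the sum of [e_A (f0_A + sigma f1_A J)] with real [f0_A], [f1_A]. Every basis element
    is thus on the far left, and the identity for one scalar function applies to each component. *)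
Lemma ray_form_right f F J t : right_rep theta f F -> in_I theta t -> omega < t < PI - omega ->
  imag_unit J ->
  ray_form (fun s ds => mv_comp (mv_cl (f s)) (mv_comp (mv_cl ds) (SR_inv s T))) J t
    (fun r => \big[plus/zero]_(A : {set 'I_n}) (bcomp (eop A) (oray (F A) t r) : bop))
    (fun r => \big[plus/zero]_(A : {set 'I_n})
       (bcomp (eop A) (bcomp (lop VR J) (oray (fun z => Cmult Ci (F A z)) t r)) : bop)).
Proof.
move=> HF ht ht2 hJ r sigma eps r0 hs; apply: is_bounded_opI.
  apply: scal_right_linear; apply: minus_right_linear; first apply: scal_right_linear;
    apply: sum_right_linear => A; apply: bcomp_right_linear; try exact: eop_right_linear.
  - exact: op_ray_right_linear.
  - by apply: bcomp_right_linear; [apply: lop_right_linear|apply: op_ray_right_linear].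
move=> v u; set x := minus (P (polar r t) v) (scal sigma (lmul J (q (polar r t) v) : V)).
set w : V := lmul (cplx (sigma * sin t) (- cos t) J) x.
have E : lmul (f (cplx (r * cos t) (sigma * (r * sin t)) J))
    (lmul (scal eps (cplx (sigma * sin t) (- cos t) J : A_n)) x) =
  (scal eps (minus (scal sigma (\big[plus/zero]_(A : {set 'I_n}) (bcomp (eop A) (oray (F A) t r) : bop)))
     (\big[plus/zero]_(A : {set 'I_n})
       (bcomp (eop A) (bcomp (lop VR J) (oray (fun z => Cmult Ci (F A z)) t r)) : bop))) : bop) v.
  rewrite lmulZl lmulZr -[RHS]/(scal eps ((minus (scal sigma _) _ : bop) v)); congr scal.
  rewrite minus_blinE -/w (right_rep_sign HF) // lmulDl lmulZl lmulA (lmul_sumE _ w) (lmul_sumE _ (lmul J w)).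
  rewrite -[X in _ = minus X _]/(scal sigma ((\big[plus/zero]_(A : {set 'I_n}) _ : bop) v)).
  rewrite !sum_blinE !scal_sum /minus -(scal_opp_one (\big[plus/zero]_(A : {set 'I_n}) _ : V)) scal_sum.
  rewrite -!big_split; apply: eq_bigr => A _; rewrite (op_comp_expand _ _ r t).
  rewrite (op_comp_expand_Ci _ _ J r t) !ffunE scal_assoc scal_opp_one.
  transitivity (eop A (plus (scal (Re (F A (polar r t))) w)
      (scal (sigma * Im (F A (polar r t))) (lmul J w : V)))).
    by rewrite (@blinD V V) !(@blinZ V V).
  by rewrite /w /x right_form_identity // (@blinB V V) (@blinZ V V).
split.
- move=> [a [[b [/(SR_inv_polar v b r0 ht2 hJ hs) hb ha]] hu]].
  by rewrite /mv_cl /graph /= in ha hu; rewrite -E hu ha hb.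
- move=> ->; rewrite -E; exists (lmul (scal eps (cplx (sigma * sin t) (- cos t) J : A_n)) x).
  by split=> //; exists x; split=> //; apply/(SR_inv_polar v x r0 ht2 hJ hs).
Qed.

Lemma ray_form_right_intrinsic f F J t : intrinsic_rep theta f F -> in_I theta t ->
  omega < t < PI - omega -> imag_unit J ->
  ray_form (fun s ds => mv_comp (mv_cl (f s)) (mv_comp (mv_cl ds) (SR_inv s T))) J t
    (oray F t) (fun r => bcomp (lop VR J) (oray (fun z => Cmult Ci (F z)) t r)).
Proof.
move=> HF ht ht2 hJ r sigma eps r0 hs; apply: is_bounded_opI.
  apply: scal_right_linear; apply: minus_right_linear; first apply: scal_right_linear.
  - exact: op_ray_right_linear.
  - by apply: bcomp_right_linear; [apply: lop_right_linear|apply: op_ray_right_linear].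
move=> v u; set x := minus (P (polar r t) v) (scal sigma (lmul J (q (polar r t) v) : V)).
have E : lmul (f (cplx (r * cos t) (sigma * (r * sin t)) J))
    (lmul (scal eps (cplx (sigma * sin t) (- cos t) J : A_n)) x) =
  (scal eps (minus (scal sigma (oray F t r))
     (bcomp (lop VR J) (oray (fun z => Cmult Ci (F z)) t r))) : bop) v.
  rewrite lmulZl lmulZr -[RHS]/(scal eps ((minus (scal sigma _) _ : bop) v)); congr scal.
  rewrite minus_blinE (intrinsic_rep_sign HF) // lmul_cplx.
  rewrite -[X in _ = minus X _]/(scal sigma (oray F t r v)).
  rewrite -[X in _ = minus _ X]/(lop VR J (oray (fun z => Cmult Ci (F z)) t r v)).
  by rewrite lopE op_ray_expand op_ray_expand_Ci; apply: right_form_identity.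
split.
- move=> [a [[b [/(SR_inv_polar v b r0 ht2 hJ hs) hb ha]] hu]].
  by rewrite /mv_cl /graph /= in ha hu; rewrite -E hu ha hb.
- move=> ->; rewrite -E; exists (lmul (scal eps (cplx (sigma * sin t) (- cos t) J : A_n)) x).
  by split=> //; exists x; split=> //; apply/(SR_inv_polar v x r0 ht2 hJ hs).
Qed.

Lemma ray_form_left_intrinsic f F J t : intrinsic_rep theta f F -> in_I theta t ->
  omega < t < PI - omega -> imag_unit J ->
  ray_form (fun s ds => mv_comp (SL_inv s T) (mv_comp (mv_cl ds) (mv_cl (f s)))) J t
    (oray F t) (fun r => bcomp (oray (fun z => Cmult Ci (F z)) t r) (lop VR J)).
Proof.
move=> HF ht ht2 hJ r sigma eps r0 hs; apply: is_bounded_opI.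
  apply: scal_right_linear; apply: minus_right_linear; first apply: scal_right_linear.
  - exact: op_ray_right_linear.
  - by apply: bcomp_right_linear; [apply: op_ray_right_linear|apply: lop_right_linear].
move=> v u; set w : V := lmul (scal eps (cplx (sigma * sin t) (- cos t) J : A_n))
  (lmul (f (cplx (r * cos t) (sigma * (r * sin t)) J)) v).
have E : minus (P (polar r t) w) (scal sigma (q (polar r t) (lmul J w))) =
  (scal eps (minus (scal sigma (oray F t r))
     (bcomp (oray (fun z => Cmult Ci (F z)) t r) (lop VR J))) : bop) v.
  have Ew : w = scal eps (lmul (cplx (sigma * sin t) (- cos t) J)
     (lmul (cplx (Re (F (polar r t))) (sigma * Im (F (polar r t))) J) v) : V).
    by rewrite /w lmulZl (intrinsic_rep_sign HF).
  rewrite Ew lmulZr !blinZ.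
  set w' := lmul (cplx (sigma * sin t) (- cos t) J) _.
  transitivity (scal eps (minus (P (polar r t) w') (scal sigma (q (polar r t) (lmul J w'))))).
    by lin; ring.
  rewrite -[RHS]/(scal eps ((minus (scal sigma _) _ : bop) v)); congr scal.
  rewrite [RHS]minus_blinE -[X in _ = minus X _]/(scal sigma (oray F t r v)).
  rewrite -[X in _ = minus _ X]/(oray (fun z => Cmult Ci (F z)) t r (lop VR J v)).
  by rewrite lopE op_ray_expand op_ray_expand_Ci; apply: left_form_identity.
split.
- move=> [a [[b [hb ha]] /(SL_inv_polar a u r0 ht2 hJ hs) hu]].
  by rewrite /mv_cl /graph /= in ha hb; rewrite -E hu ha hb.
- move=> ->; rewrite -E; exists w; split; last by apply/(SL_inv_polar w _ r0 ht2 hJ hs).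
  by exists (lmul (f (cplx (r * cos t) (sigma * (r * sin t)) J)) v).
Qed.

Variables K L : bop.
Hypothesis Rd : resolvent_data (X := X) omega P q K L.

Local Notation value := (calculus_value (X := X) omega P q theta).

Lemma ray_angle_left phi : omega < phi < theta ->
  [/\ ray_angle omega theta phi, in_I theta phi & omega < phi < PI - omega].
Proof. by move=> hp; split; [left|left; rlra|rlra]. Qed.

Lemma ray_angle_right phi : omega < phi < theta ->
  [/\ ray_angle omega theta (PI - phi), in_I theta (PI - phi) & omega < PI - phi < PI - omega].
Proof. by move=> hp; split; [right; rlra|right; rlra|rlra]. Qed.

Lemma op_ray_Ci_integral F t : admissible theta F -> ray_angle omega theta t ->
  exists I : bop, zinf (oray (fun z => Cmult Ci (F z)) t) I.
Proof.
move=> HF ht; exact: (@abs_int_cvg (blin_CompleteNormedModule X X) _ (abs_int_op_ray_mult Rd theta_bounds Ci HF ht)).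
Qed.

Lemma double_contour (I I' : bop) :
  scal (/ PI) (minus I' I) = scal (/ (2 * PI)) (scal 2 (minus I' I)).
Proof.
rewrite scal_assoc; congr scal; rewrite /mult /=; field; have := PI_RGT_0; rlra.
Qed.

Lemma omega_calc_right_intrinsic f F A : intrinsic_rep theta f F -> admissible theta F ->
  value F A -> omega_calc_R T omega theta f A.
Proof.
move=> Hf HF HA phi J hp hJ; have [I [I' [HI [HI' ->]]]] := HA phi hp.
have [r1 i1 o1] := ray_angle_left hp; have [r2 i2 o2] := ray_angle_right hp.
(* The even parts cancel in the contour integral, but each of the four rays has to converge
   separately. *)
have [N HN] := op_ray_Ci_integral HF r1; have [N' HN'] := op_ray_Ci_integral HF r2.
exists (scal 2 (minus I' I)); split; last exact: double_contour.
apply: contour_of_forms (ray_form_right_intrinsic Hf i1 o1 hJ)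
  (ray_form_right_intrinsic Hf i2 o2 hJ) HI _ HI' _ => //.
- exact: (@is_RInt_gen_blin _ _ (bcompl V (lop VR J)) _ _ _ _ HN).
- exact: (@is_RInt_gen_blin _ _ (bcompl V (lop VR J)) _ _ _ _ HN').
Qed.

Lemma omega_calc_left_intrinsic f F A : intrinsic_rep theta f F -> admissible theta F ->
  value F A -> omega_calc_L T omega theta f A.
Proof.
move=> Hf HF HA phi J hp hJ; have [I [I' [HI [HI' ->]]]] := HA phi hp.
have [r1 i1 o1] := ray_angle_left hp; have [r2 i2 o2] := ray_angle_right hp.
have [N HN] := op_ray_Ci_integral HF r1; have [N' HN'] := op_ray_Ci_integral HF r2.
exists (scal 2 (minus I' I)); split; last exact: double_contour.
apply: contour_of_forms (ray_form_left_intrinsic Hf i1 o1 hJ)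
  (ray_form_left_intrinsic Hf i2 o2 hJ) HI _ HI' _ => //.
- exact: (@is_RInt_gen_blin _ _ (bcompr V (lop VR J)) _ _ _ _ HN).
- exact: (@is_RInt_gen_blin _ _ (bcompr V (lop VR J)) _ _ _ _ HN').
Qed.

(** The bounded left factors [eop B] pass through the integrals, and the sum over [B] is finite. *)
Lemma omega_calc_right f F (A : {set 'I_n} -> bop) : right_rep theta f F ->
  (forall B, admissible theta (F B)) -> (forall B, value (F B) (A B)) ->
  omega_calc_R T omega theta f (\big[plus/zero]_(B : {set 'I_n}) (bcomp (eop B) (A B) : bop)).
Proof.
move=> Hf HF HA phi J hp hJ.
have [r1 i1 o1] := ray_angle_left hp; have [r2 i2 o2] := ray_angle_right hp.
have [I HI] := fun_choice (fun B => HA B phi hp).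
have [I' HI'] := fun_choice HI.
have [N HN] := fun_choice (fun B => op_ray_Ci_integral (HF B) r1).
have [N' HN'] := fun_choice (fun B => op_ray_Ci_integral (HF B) r2).
pose S (W : {set 'I_n} -> bop) : bop := \big[plus/zero]_(B : {set 'I_n}) (bcomp (eop B) (W B) : bop).
have nn : index_enum {set 'I_n} <> nil.
  by move=> E; have := mem_index_enum (set0 : {set 'I_n}); rewrite E.
have key (W : {set 'I_n} -> R -> bop) (Z : {set 'I_n} -> bop) : (forall B, zinf (W B) (Z B)) ->
    zinf (fun r => S (fun B => W B r)) (S Z).
  move=> H; apply: is_RInt_zinf_sum => // B; exact: (@is_RInt_gen_blin _ _ (bcompl V (eop B)) _ _ _ _ (H B)).
exists (scal 2 (minus (S I') (S I))); split.
- apply: contour_of_forms (ray_form_right Hf i1 o1 hJ) (ray_form_right Hf i2 o2 hJ) _ _ _ _ => //.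
  + by apply: key => B; case: (HI' B).
  + by apply: key => B; apply: (@is_RInt_gen_blin _ _ (bcompl V (lop VR J)) _ _ _ _ (HN B)).
  + by apply: key => B; case: (HI' B) => _ [].
  + by apply: key => B; apply: (@is_RInt_gen_blin _ _ (bcompl V (lop VR J)) _ _ _ _ (HN' B)).
- rewrite -double_contour; apply: blin_eq => v.
  rewrite -[RHS]/(scal (/ PI) ((minus (S I') (S I) : bop) v)) minus_blinE /S !sum_blinE.
  rewrite /minus -(scal_opp_one (\big[plus/zero]_(B : {set 'I_n}) _ : V)) scal_sum -big_split scal_sum.
  apply: eq_bigr => B _; case: (HI' B) => _ [_ ->].
  rewrite -[LHS]/(eop B (scal (/ PI) ((minus (I' B) (I B) : bop) v))) minus_blinE.
  by rewrite blinZ blinB scal_opp_one.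
Qed.

Lemma value_right_linear F A : admissible theta F -> value F A -> rlin A.
Proof.
move=> HF HA; apply/right_linearP => a.
apply: (calculus_value_commute Rd theta_bounds HF _ HA) => _ [r [t [r0 [ht ->]]]].
have [_ rP rq _] := polar_resolvent r0 ht.
by split; [apply: (proj1 (right_linearP _) rP)|apply: (proj1 (right_linearP _) rq)].
Qed.

End OperatorRays.

(** * Slice hyperholomorphic functions *)

Section SliceGeometry.
Variables (n : nat) (theta : R).
Hypothesis theta_bounds : 0 < theta < PI / 2.

(** A quarter turn moves the cone around the real axis to one around the imaginary axis, to which
    [polar_coordinates] applies with the angle [PI / 2 - theta]; the sign of [x] selects the
    sector. *)
Lemma polar_of_cone (x y : R) : Rabs y * cos theta < Rabs x * sin theta ->
  exists r t, [/\ 0 < r, in_I theta t & ((x, y) : C) = polar r t] /\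
    (0 < x -> - theta < t < theta) /\ (x < 0 -> PI - theta < t < PI + theta).
Proof.
move=> h; have c0 : 0 < cos theta by apply: cos_gt_0; rlra.
have hphi : 0 <= PI / 2 - theta < PI / 2 by rlra.
have cphi : cos (PI / 2 - theta) = sin theta by rewrite cos_shift.
have sphi : sin (PI / 2 - theta) = cos theta by rewrite sin_shift.
have hy : - (Rabs y * cos theta) <= y * cos theta <= Rabs y * cos theta.
  have := Rle_abs y; have := Rle_abs (- y); rewrite Rabs_Ropp => a b; nra.
case: (Rle_lt_dec x 0) => x0.
- have xneg : x < 0.
    case: (Req_dec x 0) => [E|]; last by rlra.
    by move: h; rewrite E Rabs_R0; have := Rabs_pos y; nra.
  have ax : Rabs x = - x by apply: Rabs_left.
  rewrite ax in h.
  have [||r [t [r0 [ht E]]]] := @polar_coordinates (PI / 2 - theta) y (- x) hphi; rewrite ?cphi ?sphi; try rlra.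
  have e1 : y = r * cos t := congr1 fst E.
  have e2 : - x = r * sin t := congr1 snd E.
  exists r, (t + PI / 2); split; last by split; rlra.
  split=> //; first by right; rlra.
  by rewrite /polar cos_plus sin_plus cos_PI2 sin_PI2; congr pair; rlra.
- have ax : Rabs x = x by apply: Rabs_right; rlra.
  rewrite ax in h.
  have [||r [t [r0 [ht E]]]] := @polar_coordinates (PI / 2 - theta) (- y) x hphi; rewrite ?cphi ?sphi; try rlra.
  have e1 : - y = r * cos t := congr1 fst E.
  have e2 : x = r * sin t := congr1 snd E.
  exists r, (t - PI / 2); split; last by split; rlra.
  split=> //; first by left; rlra.
  by rewrite /polar cos_minus sin_minus cos_PI2 sin_PI2; congr pair; rlra.
Qed.

Lemma cone_of_polar r t : 0 < r -> in_I theta t ->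
  Rabs (r * sin t) * cos theta < Rabs (r * cos t) * sin theta.
Proof.
move=> r0 ht; have c0 : 0 < cos theta by apply: cos_gt_0; rlra.
have s0 : 0 < sin theta by apply: sin_gt_0; rlra.
have h := in_I_cos theta_bounds ht.
rewrite !Rabs_mult (Rabs_pos_eq r); last rlra.
rewrite !Rmult_assoc; apply: Rmult_lt_compat_l => //.
have hs : Rabs (sin t) < sin theta.
  apply: Rsqr_incrst_0; rewrite -?Rsqr_abs; [|exact: Rabs_pos|rlra].
  have := sin2_cos2 t; have := sin2_cos2 theta; rewrite (Rsqr_abs (cos t)).
  have : Rsqr (cos theta) < Rsqr (Rabs (cos t)) by apply: Rsqr_incrst_1; [|rlra|apply: Rabs_pos].
  by rlra.
have a0 := Rabs_pos (sin t); nra.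
Qed.

Lemma cone_near (x y : R) : Rabs y * cos theta < Rabs x * sin theta ->
  exists d, 0 < d /\ forall u v, Rabs (u - x) < d -> Rabs (v - y) < d ->
    Rabs v * cos theta < Rabs u * sin theta.
Proof.
move=> h; exists ((Rabs x * sin theta - Rabs y * cos theta) / 2); split; first rlra.
move=> u v hu hv; have := COS_bound theta; have := SIN_bound theta.
have c0 : 0 < cos theta by apply: cos_gt_0; rlra.
have s0 : 0 < sin theta by apply: sin_gt_0; rlra.
move=> s1 c1.
have h1 : Rabs x <= Rabs u + Rabs (u - x).
  have := Rabs_triang u (- (u - x)); rewrite Rabs_Ropp.
  by have -> : u + - (u - x) = x by ring.
have h2 : Rabs v <= Rabs y + Rabs (v - y).
  have := Rabs_triang y (v - y); by have -> : y + (v - y) = v by ring.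
nra.
Qed.

End SliceGeometry.

(** * Holomorphy of the components *)

Section CauchyRiemann.
Variables (f0 f1 fx gx : R -> R -> R) (x y : R).
Hypotheses (H0 : locally (x, y) (fun p => is_derive (fun s => f0 s p.2) p.1 (fx p.1 p.2)))
  (H1 : locally (x, y) (fun p => is_derive (fun s => f1 s p.2) p.1 (gx p.1 p.2)))
  (H0y : is_derive (fun s => f0 x s) y (- gx x y)) (H1y : is_derive (fun s => f1 x s) y (fx x y))
  (cfx : continuous (fun p => fx p.1 p.2) (x, y)) (cgx : continuous (fun p => gx p.1 p.2) (x, y)).

Lemma filterdiff_2d_bound (f : R -> R -> R) a b :
  filterdiff (fun u : R * R => f u.1 u.2) (locally (x, y)) (fun u : R * R => plus (scal u.1 a) (scal u.2 b)) ->
  forall e, 0 < e -> exists d, 0 < d /\ forall w : C, Cmod (Cminus w (x, y)) < d ->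
    Rabs (f w.1 w.2 - f x y - ((w.1 - x) * a + (w.2 - y) * b)) <= e * Cmod (Cminus w (x, y)).
Proof.
move=> [_ /(_ (x, y))] H e e0.
have {}H := H (fun P h => h) (mkposreal _ e0).
have [d Hd] := H; exists d; split; first exact: cond_pos.
move=> w hw; have bw : ball (x, y) d w.
  split; [apply: Rle_lt_trans hw|apply: Rle_lt_trans hw].
  - exact: (re_le_Cmod (Cminus w (x, y))).
  - exact: (im_le_Cmod (Cminus w (x, y))).
apply: Rle_trans (Hd w bw) _; apply: Req_le; congr (_ * _).
rewrite /norm /= /prod_norm /= /Cmod /=; congr sqrt.
rewrite /norm /= /abs /=; have sq (k : R) : Rabs k * (Rabs k * 1) = k * (k * 1).
  by rewrite !Rmult_1_r; apply: esym; apply: Rsqr_abs.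
by rewrite !sq.
Qed.

(** Continuity of the partial derivatives in [x] gives real differentiability, and the
    Cauchy-Riemann equations make the differential a complex multiplication. *)
Lemma cauchy_riemann_cderiv :
  cderiv (fun z => (f0 z.1 z.2, f1 z.1 z.2)) (x, y) (fx x y, gx x y).
Proof.
move=> e e0; have e2 : 0 < e / 2 by rlra.
have [d [d0 Hd]] := filterdiff_2d_bound (is_derive_filterdiff f0 x y fx _ H0 H0y cfx) e2.
have [d' [d0' Hd']] := filterdiff_2d_bound (is_derive_filterdiff f1 x y gx _ H1 H1y cgx) e2.
exists (Rmin d d'); split; first exact: Rmin_glb_lt.
move=> w hw; have h1 := Hd w (Rlt_le_trans _ _ _ hw (Rmin_l _ _)).
have h2 := Hd' w (Rlt_le_trans _ _ _ hw (Rmin_r _ _)).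
apply: Rle_trans (Cmod_le_abs _) _.
move: h1 h2; set u := Cmod _ => h1 h2; rewrite /= in h1 h2 *.
have -> : f0 w.1 w.2 + - f0 x y + - (fx x y * (w.1 + - x) - gx x y * (w.2 + - y)) =
  f0 w.1 w.2 - f0 x y - ((w.1 - x) * fx x y + (w.2 - y) * - gx x y) by ring.
have -> : f1 w.1 w.2 + - f1 x y + - (fx x y * (w.2 + - y) + gx x y * (w.1 + - x)) =
  f1 w.1 w.2 - f1 x y - ((w.1 - x) * gx x y + (w.2 - y) * fx x y) by ring.
by rlra.
Qed.

End CauchyRiemann.

Section CliffordComponents.
Variable n : nat.
Local Notation A_n := (clmod_NormedModule n R_NormedModule).

Lemma coord_linear (A : {set 'I_n}) : is_linear (fun v : A_n => (v : Cl n) A : R_NormedModule).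
Proof.
split=> [u v|k v|]; rewrite ?ffunE //.
exists 1; split; first rlra.
by move=> v; rewrite Rmult_1_l; apply: clmod_norm_comp.
Qed.

Lemma is_derive_coord (g : R -> A_n) x l A : is_derive g x l ->
  is_derive (fun s => (g s : Cl n) A : R_NormedModule) x ((l : Cl n) A).
Proof.
move=> H; have := filterdiff_comp' g _ _ _ _ H (filterdiff_linear _ (coord_linear A)).
move=> h; apply: filterdiff_ext_lin h _ => y.
by rewrite ffunE.
Qed.

Lemma continuous_coord (U : UniformSpace) (g : U -> A_n) x A : continuous g x ->
  continuous (fun s => (g s : Cl n) A : R_NormedModule) x.
Proof.
move=> H; apply: (continuous_comp g (fun v : A_n => (v : Cl n) A : R_NormedModule)) => //.
exact: (linear_cont _ _ (coord_linear A)).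
Qed.

Lemma is_derive_big (X : NormedModule R_AbsRing) (I : Type) (s : seq I) (g : I -> R -> X) x (l : I -> X) :
  (forall i, is_derive (g i) x (l i)) ->
  is_derive (fun t => \big[plus/zero]_(i <- s) g i t) x (\big[plus/zero]_(i <- s) l i).
Proof.
move=> H; elim: s => [|i s IH].
  rewrite big_nil; apply: (@is_derive_ext _ _ (fun _ => zero)) => [t|]; first by rewrite big_nil.
  exact: is_derive_const.
rewrite big_cons; apply: (@is_derive_ext _ _ (fun t => plus (g i t) (\big[plus/zero]_(j <- s) g j t))).
  by move=> t; rewrite big_cons.
exact: is_derive_plus.
Qed.

Lemma continuous_big (U : UniformSpace) (X : NormedModule R_AbsRing) (I : Type) (s : seq I) (g : I -> U -> X) x :
  (forall i, continuous (g i) x) -> continuous (fun t => \big[plus/zero]_(i <- s) g i t) x.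
Proof.
move=> H; elim: s => [|i s IH].
  apply: (@continuous_ext U X (fun _ => zero : X)) => [t|]; first by rewrite big_nil.
  exact: continuous_const.
apply: (@continuous_ext U X (fun t => plus (g i t) (\big[plus/zero]_(j <- s) g j t))).
  by move=> t; rewrite big_cons.
exact: continuous_plus.
Qed.

Lemma is_derive_components (g : R -> A_n) x (l : A_n) :
  (forall A, is_derive (fun s => (g s : Cl n) A) x ((l : Cl n) A)) -> is_derive g x l.
Proof.
move=> H; rewrite (cl_expand l).
apply: (@is_derive_ext _ _ (fun s => \big[plus/zero]_A (scal ((g s : Cl n) A : R) (cl_base A : A_n)))).
  by move=> s; rewrite -cl_expand.
by apply: is_derive_big => A; apply: is_derive_scal_l.
Qed.

Lemma continuous_components (U : UniformSpace) (g : U -> A_n) x :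
  (forall A, continuous (fun s => (g s : Cl n) A : R_UniformSpace) x) -> continuous g x.
Proof.
move=> H; apply: (@continuous_ext U A_n (fun s => \big[plus/zero]_A (scal ((g s : Cl n) A : R) (cl_base A : A_n)))).
  by move=> s; rewrite -cl_expand.
by apply: continuous_big => A; apply: continuous_scal_l.
Qed.

End CliffordComponents.

Section SliceHolomorphic.
Variables (n : nat) (theta : R).
Hypotheses (n_ge1 : (1 <= n)%nat) (theta_bounds : 0 < theta < PI / 2).
Local Notation A_n := (clmod_NormedModule n R_NormedModule).

Definition bisector (z : C) : Prop := exists r t, [/\ 0 < r, in_I theta t & z = polar r t].

(** The complex form of one component of a slice pair [f0 + i f1]: the parities in [y] become
    symmetry under conjugation. *)
Definition slice_holo (G : C -> C) : Prop :=
  (exists G', hol bisector G G') /\ forall z, bisector z -> G (Cconj z) = Cconj (G z).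

Lemma bisector_cone (x y : R) : bisector (x, y) <-> Rabs y * cos theta < Rabs x * sin theta.
Proof.
split=> [[r [t [r0 ht [-> ->]]]]|h]; first exact: cone_of_polar.
by have [r [t [H _]]] := polar_of_cone theta_bounds h; exists r, t.
Qed.

Lemma bisector_slice_dom (x y : R) : bisector (x, y) <-> slice_dom (Dsec (n := n) theta) x y.
Proof.
split=> [[r [t [r0 ht [-> ->]]]]|h]; first exact: slice_dom_polar.
by have [r [t [r0 [ht E]]]] := slice_domP n_ge1 h; exists r, t.
Qed.

Lemma bisector_near (x y : R) : bisector (x, y) ->
  locally ((x, y) : R * R) (fun p => bisector (p.1, p.2)).
Proof.
move=> /bisector_cone /(cone_near theta_bounds) [d [d0 Hd]].
exists (mkposreal _ d0) => p [h1 h2]; apply/bisector_cone.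
exact: Hd h1 h2.
Qed.

Lemma ccont_pair (g h : R -> R -> R) (x y : R) :
  continuous (fun p : R * R => g p.1 p.2) (x, y) -> continuous (fun p : R * R => h p.1 p.2) (x, y) ->
  ccont (fun z => (g z.1 z.2, h z.1 z.2)) (x, y).
Proof.
move=> cg ch e e0; have e2 : 0 < e / 2 by rlra.
have [d Hd] := cg _ (locally_ball (g x y) (mkposreal _ e2)).
have [d' Hd'] := ch _ (locally_ball (h x y) (mkposreal _ e2)).
exists (Rmin d d'); split; first by apply: Rmin_glb_lt; apply: cond_pos.
move=> w hw; have b k : Cmod (Cminus w (x, y)) < k -> ball ((x, y) : R * R) k w.
  by move=> hk; split; apply: Rle_lt_trans hk; [apply: (re_le_Cmod (Cminus w (x, y)))|apply: (im_le_Cmod (Cminus w (x, y)))].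
have /= h1 := Hd w (b _ (Rlt_le_trans _ _ _ hw (Rmin_l _ _))).
have /= h2 := Hd' w (b _ (Rlt_le_trans _ _ _ hw (Rmin_r _ _))).
have {}h1 : Rabs (g w.1 w.2 - g x y) < e / 2 := h1.
have {}h2 : Rabs (h w.1 w.2 - h x y) < e / 2 := h2.
by apply: Rle_lt_trans (Cmod_le_abs _) _; rewrite /= -!/(Rminus _ _); rlra.
Qed.

Lemma slice_pair_holo f0 f1 A : slice_pair (Dsec (n := n) theta) f0 f1 ->
  slice_holo (fun z => (f0 z.1 z.2 A, f1 z.1 z.2 A)).
Proof.
move=> [f0x [f0y [f1x [f1y [H0 [H1 HE]]]]]]; split.
- exists (fun z => (f0x z.1 z.2 A, f1x z.1 z.2 A)) => [[x y]] Dz.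
  have near := bisector_near Dz.
  have /bisector_slice_dom Wz := Dz.
  have [_ [_ [E1 E2]]] := HE x y Wz.
  have [_ [d0y [c0 _]]] := H0 x y Wz; have [_ [d1y [c1 _]]] := H1 x y Wz.
  have cc0 := continuous_coord (A := A) c0; have cc1 := continuous_coord (A := A) c1.
  split; last exact: (@ccont_pair (fun x y => f0x x y A) (fun x y => f1x x y A) x y cc0 cc1).
  apply: (@cauchy_riemann_cderiv (fun x y => f0 x y A) (fun x y => f1 x y A)
    (fun x y => f0x x y A) (fun x y => f1x x y A)) => //.
  + apply: filter_imp near => p /bisector_slice_dom Wp.
    by have [d _] := H0 _ _ Wp; apply: is_derive_coord A d.
  + apply: filter_imp near => p /bisector_slice_dom Wp.
    by have [d _] := H1 _ _ Wp; apply: is_derive_coord A d.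
  + by have := is_derive_coord A d0y; rewrite E2 ffunE.
  + by have := is_derive_coord A d1y; rewrite -E1.
- move=> [x y] /bisector_slice_dom Wz; have [E0 [E1 _]] := HE x y Wz.
  by rewrite /Cconj /= E0 E1 ffunE.
Qed.

Lemma hol_partials (G G' : C -> C) (x y : R) : hol bisector G G' -> bisector (x, y) ->
  [/\ is_derive (fun s => Re (G (s, y))) x (Re (G' (x, y))),
      is_derive (fun s => Im (G (s, y))) x (Im (G' (x, y))),
      is_derive (fun s => Re (G (x, s))) y (- Im (G' (x, y))) &
      is_derive (fun s => Im (G (x, s))) y (Re (G' (x, y)))].
Proof.
move=> HG Dz; have [D _] := HG _ Dz.
have [a b] := @cderiv_curve G (fun s => s) (fun _ => y) x 1 0 (G' (x, y)) D (is_derive_id _) (is_derive_const _ _).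
have [c d] := @cderiv_curve G (fun _ => x) (fun s => s) y 0 1 (G' (x, y)) D (is_derive_const _ _) (is_derive_id _).
split.
- by apply: is_derive_eq a _; rewrite /Re /Im /=; ring.
- by apply: is_derive_eq b _; rewrite /Re /Im /=; ring.
- by apply: is_derive_eq c _; rewrite /Re /Im /=; ring.
- by apply: is_derive_eq d _; rewrite /Re /Im /=; ring.
Qed.

Lemma hol_partials_continuous (G G' : C -> C) (x y : R) : hol bisector G G' -> bisector (x, y) ->
  continuous (fun p : R * R => Re (G' (p.1, p.2))) (x, y) /\
  continuous (fun p : R * R => Im (G' (p.1, p.2))) (x, y).
Proof.
move=> HG Dz; have [_ D] := HG _ Dz.
have [a b] := @ccont_comp_2d G' (fun u _ => u) (fun _ v => v) x y D
  (continuity_2d_pt_id1 x y) (continuity_2d_pt_id2 x y).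
split.
- exact: (proj1 (continuity_2d_pt_filterlim (fun u v => Re (G' (u, v))) x y) a).
- exact: (proj1 (continuity_2d_pt_filterlim (fun u v => Im (G' (u, v))) x y) b).
Qed.

(** The converse of [slice_pair_holo], which brings [f e] and [e] back into the slice classes; the
    partial derivatives are the parts of the complex derivative. *)
Lemma holo_slice_pair (G : {set 'I_n} -> C -> C) : (forall A, slice_holo (G A)) ->
  slice_pair (Dsec (n := n) theta) (fun x y => [ffun A => Re (G A (x, y))] : Cl n)
    (fun x y => [ffun A => Im (G A (x, y))] : Cl n).
Proof.
move=> HG; have [G' HG'] := fun_choice (fun A => proj1 (HG A)).
exists (fun x y => [ffun A => Re (G' A (x, y))]), (fun x y => [ffun A => - Im (G' A (x, y))]),
  (fun x y => [ffun A => Im (G' A (x, y))]), (fun x y => [ffun A => Re (G' A (x, y))]).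
have ext (g : R -> {set 'I_n} -> R) x (l : {set 'I_n} -> R) : (forall A, is_derive (fun s => g s A) x (l A)) ->
    is_derive (fun s => [ffun A => g s A] : A_n) x ([ffun A => l A] : A_n).
  move=> H; apply: is_derive_components => A; rewrite ffunE.
  by apply: is_derive_ext (H A) => s; rewrite ffunE.
have extc (g : R * R -> {set 'I_n} -> R) p : (forall A, continuous (fun s => g s A) p) ->
    continuous (fun s => [ffun A => g s A] : A_n) p.
  move=> H; apply: continuous_components => A.
  by apply: continuous_ext (H A) => s; rewrite ffunE.
split; [|split].
- move=> x y /bisector_slice_dom Dz; split; [|split; [|split]].
  + by apply: ext => A; case: (hol_partials (HG' A) Dz).
  + by apply: ext => A; case: (hol_partials (HG' A) Dz).
  + by apply: extc => A; case: (hol_partials_continuous (HG' A) Dz).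
  + apply: extc => A; case: (hol_partials_continuous (HG' A) Dz) => _ c.
    exact: (@continuous_opp _ R_AbsRing R_NormedModule).
- move=> x y /bisector_slice_dom Dz; split; [|split; [|split]].
  + by apply: ext => A; case: (hol_partials (HG' A) Dz).
  + by apply: ext => A; case: (hol_partials (HG' A) Dz).
  + by apply: extc => A; case: (hol_partials_continuous (HG' A) Dz).
  + by apply: extc => A; case: (hol_partials_continuous (HG' A) Dz).
- move=> x y /bisector_slice_dom Dz; have E A := proj2 (HG A) _ Dz.
  split; [|split; [|split]]; apply/ffunP => A; rewrite !ffunE //.
  + by have /(congr1 Re) := E A.
  + by have /(congr1 Im) := E A.
Qed.

End SliceHolomorphic.

Section SliceClasses.
Variables (n : nat) (theta : R).
Hypotheses (n_ge1 : (1 <= n)%nat) (theta_bounds : 0 < theta < PI / 2).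
Local Notation A_n := (clmod_NormedModule n R_NormedModule).
Implicit Types f : Cl n -> Cl n.

Lemma slice_holo_mult F G : slice_holo theta F -> slice_holo theta G ->
  slice_holo theta (fun z => Cmult (F z) (G z)).
Proof.
move=> [[F' HF] cF] [[G' HG] cG]; split.
- exact: (holo_mult (ex_intro _ _ HF) (ex_intro _ _ HG)).
- by move=> z Dz; rewrite cF // cG // Cmult_conj.
Qed.

Lemma slice_holo_real (a : R) : slice_holo theta (fun _ => RtoC a).
Proof.
split; first exact: (holo_const (bisector theta) (RtoC a)).
by move=> z _; rewrite /Cconj /RtoC /=; congr pair; ring.
Qed.

Lemma bisector_one_plus_sq z : bisector theta z -> one_plus_sq z <> RtoC 0.
Proof. by move=> [r [t [_ ht ->]]]; apply: in_I_one_plus_sq_neq0 ht. Qed.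

Lemma slice_holo_e_one : slice_holo theta e_one.
Proof.
split.
- apply: (holo_mult (holo_id (bisector theta))).
  by apply: holo_inv; [apply: holo_one_plus_sq|apply: bisector_one_plus_sq].
- move=> z Dz; have nz := bisector_one_plus_sq Dz.
  have E : one_plus_sq (Cconj z) = Cconj (one_plus_sq z).
    by rewrite /one_plus_sq /Cconj /Cmult /Cplus /RtoC /=; congr pair; ring.
  by rewrite /e_one E Cmult_conj Cinv_conj.
Qed.

Lemma slice_holo_pow F m : slice_holo theta F -> slice_holo theta (fun z => Cpow (F z) m).
Proof.
move=> HF; elim: m => [|m IH]; first exact: slice_holo_real.
exact: slice_holo_mult.
Qed.

Lemma bisector_polar r t : 0 < r -> in_I theta t -> bisector theta (polar r t).
Proof. by move=> r0 ht; exists r, t. Qed.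

Lemma SH_R_rep f : SH_R (Dsec theta) f ->
  exists F, right_rep theta f F /\ forall A, slice_holo theta (F A).
Proof.
move=> [f0 [f1 [Hp Hf]]]; exists (fun A z => (f0 z.1 z.2 A, f1 z.1 z.2 A)); split.
- move=> r t J r0 ht hJ; rewrite Hf //; last exact: slice_dom_polar.
  by congr plus; [apply/ffunP => A; rewrite ffunE|congr cl_mul; apply/ffunP => A; rewrite ffunE].
- by move=> A; apply: slice_pair_holo.
Qed.

Lemma rep_SH_R f (F : {set 'I_n} -> C -> C) : right_rep theta f F -> (forall A, slice_holo theta (F A)) ->
  SH_R (Dsec theta) f.
Proof.
move=> Hf HF; have Hp := holo_slice_pair n_ge1 HF.
exists (fun x y => [ffun A => Re (F A (x, y))]), (fun x y => [ffun A => Im (F A (x, y))]).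
split=> // x y J /(bisector_slice_dom theta n_ge1) [r [t [r0 ht [-> ->]]]] hJ.
exact: Hf.
Qed.

Lemma intrinsic_rep_of f : intrinsic (Dsec theta) f ->
  exists F, intrinsic_rep theta f F /\ slice_holo theta F.
Proof.
move=> [f0 [f1 [Hp [Hf Hr]]]]; exists (fun z => (f0 z.1 z.2 set0, f1 z.1 z.2 set0)); split.
- move=> r t J r0 ht hJ; have W := slice_dom_polar (n := n) r0 ht.
  rewrite Hf //; have [[a Ea] [b Eb]] := Hr _ _ W.
  have s0 c : cl_real n c set0 = c by rewrite !ffunE eqxx; rring.
  by rewrite /Re /Im /= Ea Eb !s0 cl_mul_real_r.
- exact: slice_pair_holo.
Qed.

Lemma rep_intrinsic f F : intrinsic_rep theta f F -> slice_holo theta F ->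
  intrinsic (Dsec theta) f.
Proof.
(* The scalar function is placed at [set0], the index of the unit of the algebra. *)
move=> Hf HF; pose G (A : {set 'I_n}) := if A == set0 then F else fun _ => RtoC 0.
have HG A : slice_holo theta (G A) by rewrite /G; case: eqP => _ //; apply: slice_holo_real.
have Hp := holo_slice_pair n_ge1 HG.
have E0 x y : [ffun A => Re (G A (x, y))] = cl_real n (Re (F (x, y))).
  by apply/ffunP => A; rewrite !ffunE /G; case: eqP => _; rring.
have E1 x y : [ffun A => Im (G A (x, y))] = cl_real n (Im (F (x, y))).
  by apply/ffunP => A; rewrite !ffunE /G; case: eqP => _; rring.
exists (fun x y => [ffun A => Re (G A (x, y))]), (fun x y => [ffun A => Im (G A (x, y))]).
split=> //; split.
- move=> x y J /(bisector_slice_dom theta n_ge1) [r [t [r0 ht [-> ->]]]] hJ.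
  by rewrite E0 E1 cl_mul_real_r; apply: Hf.
- by move=> x y _; split; [exists (Re (F (x, y)))|exists (Im (F (x, y)))].
Qed.

Lemma holo_of_slice F : slice_holo theta F ->
  holo (sector (- theta) theta) F /\ holo (sector (PI - theta) (PI + theta)) F.
Proof.
move=> [HF _]; split; apply: (@holo_sub _ (bisector theta)) HF => z [r [t [r0 [ht ->]]]].
- by exists r, t; split=> //; left.
- by exists r, t; split=> //; right.
Qed.

Lemma slice_ray_continuous F t r : slice_holo theta F -> in_I theta t -> 0 < r ->
  continuous (fun r => Cmod (F (polar r t))) r /\ continuous (fun r => Cmod (F (polar r t)) / r) r.
Proof.
move=> /holo_of_slice [[F1 H1] [F2 H2]] ht r0.
have c : continuous (fun r => Cmod (F (polar r t))) r.
  by case: ht => ht; [apply: (Cmod_ray_continuous H1)|apply: (Cmod_ray_continuous H2)].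
split=> //; apply: (@continuous_mult _ R_AbsRing) => //.
by apply: continuous_Rinv; rlra.
Qed.

(** On the real axis [Cconj z = z], so the symmetry forces real values there. *)
Lemma slice_admissible F : slice_holo theta F ->
  (exists M, 0 <= M /\ forall r t, 0 < r -> in_I theta t -> Cmod (F (polar r t)) <= M) ->
  (forall t, in_I theta t -> abs_int (fun r => Cmod (F (polar r t)) / r : R_NormedModule)) ->
  admissible theta F.
Proof.
move=> HF HM Hi; have [h1 h2] := holo_of_slice HF; split=> // r r0.
have real t : in_I theta t -> sin t = 0 -> Im (F (polar r t)) = 0.
  move=> ht st; have := proj2 HF (polar r t) (bisector_polar r0 ht).
  have -> : Cconj (polar r t) = polar r t by rewrite /Cconj /polar st /=; congr pair; ring.
  by move=> /(congr1 Im); rewrite /Im /=; rlra.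
split; apply: real; rewrite ?sin_0 ?sin_PI //; [left|right]; rlra.
Qed.

Lemma admissible_mult_bounded F G c : slice_holo theta G -> 0 <= c ->
  (forall r t, 0 < r -> in_I theta t -> Cmod (G (polar r t)) <= c) ->
  admissible theta F -> admissible theta (fun z => Cmult (G z) (F z)).
Proof.
move=> HG c0 Hc HF; have [g1 g2] := holo_of_slice HG.
have [M [M0 HM]] := adm_bounded HF.
have gr t : in_I theta t -> sin t = 0 -> forall r, 0 < r -> Im (G (polar r t)) = 0.
  move=> ht st r r0; have := proj2 HG (polar r t) (bisector_polar r0 ht).
  have -> : Cconj (polar r t) = polar r t by rewrite /Cconj /polar st /=; congr pair; ring.
  by move=> /(congr1 Im); rewrite /Im /=; rlra.
have i0 : in_I theta 0 by left; rlra.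
have iP : in_I theta PI by right; rlra.
have hr : holo (sector (- theta) theta) (fun z => Cmult (G z) (F z)).
  by apply: holo_mult => //; apply: adm_right HF.
have hl : holo (sector (PI - theta) (PI + theta)) (fun z => Cmult (G z) (F z)).
  by apply: holo_mult => //; apply: adm_left HF.
split=> //.
- move=> r r0; have [a b] := adm_real HF r0.
  have ga := gr 0 i0 sin_0 r r0; have gb := gr PI iP sin_PI r r0.
  move: a b ga gb; rewrite /Im /= => -> -> -> ->; split; ring.
- exists (c * M); split; first exact: Rmult_le_pos.
  move=> r t r0 ht; rewrite Cmod_mult.
  by apply: Rmult_le_compat; [apply: Cmod_ge_0|apply: Cmod_ge_0|apply: Hc|apply: HM].
- move=> t ht; apply: (@abs_int_le _ _ _ _ c) (adm_int HF ht) _ => r r0.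
    apply: (@continuous_mult _ R_AbsRing); last by apply: continuous_Rinv; rlra.
    have [h1 H1] := hr; have [h2 H2] := hl.
    by case: ht => ht; [apply: (Cmod_ray_continuous H1)|apply: (Cmod_ray_continuous H2)].
  have i : 0 < / r by apply: Rinv_0_lt_compat.
  have p1 : 0 <= Cmod (F (polar r t)) / r by apply: Rmult_le_pos; [apply: Cmod_ge_0|rlra].
  rewrite !norm_R_pos //; last by apply: Rmult_le_pos; [apply: Cmod_ge_0|rlra].
  rewrite Cmod_mult /Rdiv Rmult_assoc; apply: Rmult_le_compat_r => //; exact: Hc.
Qed.

End SliceClasses.

(** * Integrable weights and polynomial growth *)

Section Weights.

(* [weight delta r / r] has the primitive [- / (delta (1 + r ^ delta))]. *)
Definition weight (delta r : R) : R := Rpower r delta / (1 + Rpower r delta) ^ 2.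

Lemma Rpower_pos r d : 0 < Rpower r d.
Proof. exact: exp_pos. Qed.

Lemma weight_bounds delta r : 0 < weight delta r <= 1.
Proof.
have u0 := Rpower_pos r delta; rewrite /weight; set u := Rpower r delta in u0 *.
have p : 0 < (1 + u) ^ 2 by apply: pow_lt; rlra.
split; first exact: Rdiv_lt_0_compat.
apply: (@Rmult_le_reg_r ((1 + u) ^ 2)) => //.
by rewrite /Rdiv Rmult_assoc Rinv_l; nra.
Qed.

Lemma continuous_weight delta r : 0 < r -> continuous (fun r => weight delta r / r) r.
Proof.
move=> r0; apply: (@ex_derive_continuous R_AbsRing R_NormedModule).
rewrite /weight /Rpower; auto_derive; have := exp_pos (delta * ln r) => h.
by split=> //; split=> //; split; [apply: Rgt_not_eq; nra|split; rlra].
Qed.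

Lemma weight_integral delta a b : 0 < delta -> 0 < a <= b ->
  RInt (fun r => weight delta r / r) a b <= / delta.
Proof.
move=> d0 ab.
have pr r : 0 < 1 + Rpower r delta by have := Rpower_pos r delta; rlra.
have E : is_RInt (fun r => weight delta r / r) a b
    (minus (- / (delta * (1 + Rpower b delta))) (- / (delta * (1 + Rpower a delta)))).
  apply: (@is_RInt_derive R_CompleteNormedModule (fun r => - / (delta * (1 + Rpower r delta)))
    (fun r => weight delta r / r)) => r [hr _].
  - rewrite Rmin_left in hr; last rlra.
    have r0 : 0 < r by rlra.
    have h := pr r; rewrite /weight /Rpower in h *; auto_derive.
      split=> //; split=> //; apply: Rgt_not_eq; apply: Rmult_lt_0_compat => //; rlra.
    field; split; [|split]; rlra.
  - rewrite Rmin_left in hr; last rlra.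
    by apply: continuous_weight; rlra.
rewrite (is_RInt_unique _ _ _ _ E) /minus /plus /opp /=.
have i1 : 0 < / (delta * (1 + Rpower b delta)) by apply: Rinv_0_lt_compat; apply: Rmult_lt_0_compat.
have i2 : / (delta * (1 + Rpower a delta)) <= / delta.
  apply: Rinv_le_contravar => //; have := Rpower_pos a delta => h; nra.
by rlra.
Qed.

Lemma abs_int_weight delta : 0 < delta -> abs_int (fun r => weight delta r / r : R_NormedModule).
Proof.
move=> d0; apply: (@abs_int_dom _ _ (fun r => weight delta r / r)).
- by move=> r r0; apply: continuous_weight.
- by move=> r r0; apply: continuous_weight.
- move=> r r0; have [w0 _] := weight_bounds delta r; rewrite norm_R_pos; first exact: Rle_refl.
  by apply: Rmult_le_pos; [rlra|apply: Rlt_le; apply: Rinv_0_lt_compat].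
- by exists (/ delta) => a b ab; apply: weight_integral.
Qed.

(** The quotient is below both [r] and [1 / r], and the smaller of these is [exp (- |ln r|)]. *)
Lemma ratio_le_exp r : 0 < r -> r / (1 + r ^ 2) <= exp (- Rabs (ln r)).
Proof.
move=> r0; have p : 0 < 1 + r ^ 2 by have := pow2_ge_0 r; rlra.
apply: (@Rmult_le_reg_r (1 + r ^ 2)) => //.
have -> : r / (1 + r ^ 2) * (1 + r ^ 2) = r by field; rlra.
rewrite /Rabs; case: Rcase_abs => h.
- rewrite Ropp_involutive exp_ln //; have := pow2_ge_0 r; nra.
- rewrite exp_Ropp exp_ln //; apply: (@Rmult_le_reg_l r) => //.
  have -> : r * (/ r * (1 + r ^ 2)) = 1 + r ^ 2 by field; rlra.
  by nra.
Qed.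

(** With [l = ln r] and [d = m - alpha], the left side is at most [2 exp (- d |l|)], and the weight
    is at least a quarter of [exp (- d |l|)]; hence the factor 8. *)
Lemma poly_growth_weight alpha m r : 0 <= alpha -> alpha < INR m -> 0 < r ->
  (Rpower r alpha + Rpower r (- alpha)) * (r / (1 + r ^ 2)) ^ m <= 8 * weight (INR m - alpha) r.
Proof.
move=> a0 am r0; set l := ln r; set d := INR m - alpha; have d0 : 0 < d by rewrite /d; rlra.
have l0 := Rabs_pos l; have [l1 l2] : - Rabs l <= l <= Rabs l.
  by have := Rle_abs l; have := Rle_abs (- l); rewrite Rabs_Ropp; rlra.
have exp_le x y : x <= y -> exp x <= exp y.
  by case=> [h|->]; [apply: Rlt_le; apply: exp_increasing|apply: Rle_refl].
set E := exp (d * Rabs l).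
have E1 : 1 <= E by rewrite -exp_0; apply: exp_le; nra.
have h1 : Rpower r alpha + Rpower r (- alpha) <= 2 * exp (alpha * Rabs l).
  have b1 : Rpower r alpha <= exp (alpha * Rabs l) by apply: exp_le; rewrite -/l; nra.
  have b2 : Rpower r (- alpha) <= exp (alpha * Rabs l) by apply: exp_le; rewrite -/l; nra.
  by rlra.
have h2 : (r / (1 + r ^ 2)) ^ m <= exp (- (INR m * Rabs l)).
  have -> : exp (- (INR m * Rabs l)) = exp (- Rabs l) ^ m.
    rewrite -Rpower_pow; last exact: exp_pos.
    by rewrite /Rpower ln_exp; congr exp; ring.
  apply: pow_incr; split; last exact: ratio_le_exp.
  by apply: Rlt_le; apply: Rdiv_lt_0_compat => //; have := pow2_ge_0 r; rlra.
have h3 : (Rpower r alpha + Rpower r (- alpha)) * (r / (1 + r ^ 2)) ^ m <= 2 * / E.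
  apply: (@Rle_trans _ (2 * exp (alpha * Rabs l) * exp (- (INR m * Rabs l)))).
    apply: Rmult_le_compat => //.
    - have := Rpower_pos r alpha; have := Rpower_pos r (- alpha); rlra.
    - apply: pow_le; apply: Rlt_le; apply: Rdiv_lt_0_compat => //; have := pow2_ge_0 r; rlra.
  apply: Req_le; rewrite Rmult_assoc -exp_plus /E -exp_Ropp; congr (2 * exp _).
  by rewrite /d; ring.
apply: Rle_trans h3 _.
have u0 := Rpower_pos r d; rewrite /weight; set u := Rpower r d in u0 *.
have u1 : u <= E by apply: exp_le; rewrite -/l; nra.
have u2 : / u <= E.
  rewrite /u /Rpower -exp_Ropp; apply: exp_le; rewrite -/l; nra.
have e0 : 0 < E by rlra.
have u3 : 1 <= E * u.
  have := Rmult_le_compat_r _ _ _ (Rlt_le _ _ u0) u2; rewrite Rinv_l; rlra.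
have p : 0 < (1 + u) ^ 2 by apply: pow_lt; rlra.
apply: (@Rmult_le_reg_r ((1 + u) ^ 2 * E)); first exact: Rmult_lt_0_compat.
have -> : 2 * / E * ((1 + u) ^ 2 * E) = 2 * (1 + u) ^ 2 by field; rlra.
have -> : 8 * (u / (1 + u) ^ 2) * ((1 + u) ^ 2 * E) = 8 * (E * u) by field; rlra.
nra.
Qed.

(** For a nonnegative function, enlarging [[a, b]] to end points in the filter sets only increases
    the integral, which is then within 1 of the limit. *)
Lemma ex_RInt_gen_bound (g : R -> R) : (forall r, 0 < r -> 0 <= g r) ->
  ex_RInt_gen g (at_right 0) (Rbar_locally p_infty) ->
  exists M, forall a b, 0 < a <= b -> ex_RInt g a b /\ RInt g a b <= M.
Proof.
move=> g0 [l Hl]; have [Q S HQ HS H] := Hl _ (locally_ball l (mkposreal _ Rlt_0_1)).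
exists (l + 1) => a b [a0 ab].
have [a' [[a'0 a'a] Qa']] : exists a', 0 < a' < a /\ Q a'.
  have [d Hd] := HQ; exists (Rmin (d / 2) (a / 2)).
  have d0 := cond_pos d; have m1 := Rmin_l (d / 2) (a / 2); have m2 := Rmin_r (d / 2) (a / 2).
  have m0 : 0 < Rmin (d / 2) (a / 2) by apply: Rmin_glb_lt; rlra.
  split; first rlra; apply: Hd => //.
  by rewrite /ball /= /AbsRing_ball /abs /minus /plus /opp /= Rabs_pos_eq; rlra.
have [b' [bb' Sb']] : exists b', b < b' /\ S b'.
  have [N HN] := HS; exists (Rmax (N + 1) (b + 1)).
  have m1 := Rmax_l (N + 1) (b + 1); have m2 := Rmax_r (N + 1) (b + 1).
  by split; [rlra|apply: HN; rlra].
have [z [Hz Bz]] := H a' b' Qa' Sb'; rewrite /= in Hz Bz.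
have zl : z <= l + 1.
  have : Rabs (z - l) < 1 := Bz; by have := Rle_abs (z - l); rlra.
have e3 : ex_RInt g a b'.
  by apply: (@ex_RInt_Chasles_2 R_CompleteNormedModule _ a'); [rlra|exists z].
have e1 : ex_RInt g a b.
  by apply: (@ex_RInt_Chasles_1 R_CompleteNormedModule _ _ _ b'); [rlra|].
split=> //; apply: Rle_trans zl; rewrite -(is_RInt_unique _ _ _ _ Hz).
have e2 : ex_RInt g a' a.
  by apply: (@ex_RInt_Chasles_1 R_CompleteNormedModule _ _ _ b'); [rlra|exists z].
have e4 : ex_RInt g b b'.
  by apply: (@ex_RInt_Chasles_2 R_CompleteNormedModule _ a); [rlra|].
rewrite -(@RInt_Chasles R_CompleteNormedModule g a' a b') // -(@RInt_Chasles R_CompleteNormedModule g a b b') //.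
have p1 : 0 <= RInt g a' a by apply: RInt_ge_0 => //; [rlra|move=> r hr; apply: g0; rlra].
have p2 : 0 <= RInt g b b' by apply: RInt_ge_0 => //; [rlra|move=> r hr; apply: g0; rlra].
by rewrite /plus /=; rlra.
Qed.

End Weights.

Lemma abs_int_big (X : NormedModule R_AbsRing) (I : Type) (s : seq I) (g : I -> R -> X) :
  (forall i, abs_int (g i)) -> abs_int (fun r => \big[plus/zero]_(i <- s) g i r).
Proof.
move=> H; elim: s => [|i s IH].
  have E : (fun r => \big[plus/zero]_(i <- [::]) g i r) = (fun _ : R => zero : X).
    by apply: functional_extensionality => r; rewrite big_nil.
  rewrite E; split=> [r _|]; first exact: continuous_const.
  exists 0 => a b _; rewrite norm_zero RInt_const scal_zero_r.
  exact: Rle_refl.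
have E : (fun r => \big[plus/zero]_(j <- i :: s) g j r) =
    (fun r => plus (g i r) (\big[plus/zero]_(j <- s) g j r)).
  by apply: functional_extensionality => r; rewrite big_cons.
by rewrite E; apply: abs_int_plus.
Qed.

(** * Comparing a function with its components *)

Section RepresentationBounds.
Variable n : nat.
Local Notation A_n := (clmod_NormedModule n R_NormedModule).

Lemma cl_mul_bound : exists c, 0 <= c /\
  forall w J : Cl n, norm (cl_mul w J : A_n) <= c * (norm (w : A_n) * norm (J : A_n)).
Proof.
pose k A := norm (eop (VR := R_NormedModule) A : blin_NormedModule A_n A_n) : R.
have k0 A : 0 <= k A by apply: norm_ge_0.
exists (\big[Rplus/0]_(A : {set 'I_n}) k A); split.
  by elim/big_rec: _ => [|A x _ h]; [rlra|have := k0 A; rlra].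
move=> w J; rewrite /cl_mul lmul_sumE Rmult_comm.
rewrite (big_morph (Rmult (norm (w : A_n) * norm (J : A_n))) (Rmult_plus_distr_l _) (Rmult_0_r _)).
apply: norm_sum_le => A.
apply: Rle_trans (norm_scal_le _ (opnorm_bound (eop (VR := R_NormedModule) A) J)) _.
have h : Rabs (w A) <= norm (w : A_n) := clmod_norm_comp (w : clmod n R_NormedModule) A.
have j0 : 0 <= norm (J : A_n) by apply: norm_ge_0.
have := Rmult_le_compat_r _ _ _ (Rmult_le_pos _ _ (k0 A) j0) h.
rewrite /k /norm /=; rlra.
Qed.

Lemma norm_components_le (w : Cl n) (c : {set 'I_n} -> R) : (forall A, Rabs (w A) <= c A) ->
  norm (w : A_n) <= \big[Rplus/0]_(A : {set 'I_n}) (c A * norm (cl_base A : A_n)).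
Proof.
move=> H; rewrite {1}(cl_expand w); apply: norm_sum_le => A.
apply: Rle_trans (norm_scal_le _ (Rle_refl _)) _.
by apply: Rmult_le_compat_r => //; apply: norm_ge_0.
Qed.

Variables (theta : R) (f : Cl n -> Cl n) (F : {set 'I_n} -> C -> C).
Hypothesis Hf : right_rep theta f F.

(** The values at [J] and [- J] are [g0 + h] and [g0 - h] with [h = g1 J]. Half their sum and
    difference give [g0] and [h], and [g1 = - h J]. *)
Lemma right_rep_component_bound : exists c, 0 <= c /\ forall r t J A, 0 < r -> in_I theta t ->
  imag_unit J -> Cmod (F A (polar r t)) <=
    c * (norm (f (cplx (r * cos t) (r * sin t) J) : A_n) +
         norm (f (cplx (r * cos t) (r * sin t) (opp (J : A_n))) : A_n)).
Proof.
have [c [c0 Hc]] := cl_mul_bound; exists (1 + c); split; first rlra.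
move=> r t J A r0 ht hJ; have hJ' := imag_unit_opp hJ; have [_ [_ nJ]] := hJ.
rewrite (Hf r0 ht hJ) (Hf r0 ht hJ').
set g0 : A_n := [ffun B => Re (F B (polar r t))]; set g1 : A_n := [ffun B => Im (F B (polar r t))].
have -> : cl_mul g1 (opp (J : A_n)) = opp (cl_mul g1 J : A_n) by rewrite /cl_mul -!lopE blinN.
set h : A_n := cl_mul g1 J; set N1 := norm (plus g0 h); set N2 := norm (plus g0 (opp h)).
have b0 : norm g0 <= / 2 * (N1 + N2).
  have -> : g0 = scal (/ 2) (plus (plus g0 h) (plus g0 (opp h))) by lin; field.
  apply: Rle_trans (norm_scal_le _ (norm_plus_le (Rle_refl _) (Rle_refl _))) _.
  by rewrite -/N1 -/N2 Rabs_pos_eq; [apply: Rle_refl|rlra].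
have bh : norm h <= / 2 * (N1 + N2).
  have -> : h = scal (/ 2) (minus (plus g0 h) (plus g0 (opp h))) by lin; field.
  apply: Rle_trans (norm_scal_le _ (norm_minus_le (Rle_refl _) (Rle_refl _))) _.
  by rewrite -/N1 -/N2 Rabs_pos_eq; [apply: Rle_refl|rlra].
have b1 : norm g1 <= c * norm h.
  have -> : g1 = opp (cl_mul h J : A_n).
    rewrite /h cl_mulA imag_unit_sqr // cl_mul_real_r.
    by lin; ring.
  by rewrite norm_opp; apply: Rle_trans (Hc _ _) _; rewrite nJ Rmult_1_r; apply: Rle_refl.
have m0 : Rabs (Re (F A (polar r t))) <= norm g0.
  by have := clmod_norm_comp (g0 : clmod n R_NormedModule) A; rewrite ffunE.
have m1 : Rabs (Im (F A (polar r t))) <= norm g1.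
  by have := clmod_norm_comp (g1 : clmod n R_NormedModule) A; rewrite ffunE.
apply: Rle_trans (Cmod_le_abs _) _.
apply: Rle_trans (Rplus_le_compat _ _ _ _ m0 m1) _.
have n1 : 0 <= N1 by apply: norm_ge_0.
have n2 : 0 <= N2 by apply: norm_ge_0.
have := Rmult_le_compat_l _ _ _ c0 bh; nra.
Qed.

Hypotheses (n_ge1 : (1 <= n)%nat) (theta_bounds : 0 < theta < PI / 2)
  (HF : forall A, slice_holo theta (F A)).

Lemma right_rep_admissible : bounded_integrable theta f -> forall A, admissible theta (F A).
Proof.
move=> [[M HM] Hi] A; have [J hJ] := imag_unit_exists n_ge1; have hJ' := imag_unit_opp hJ.
have [c [c0 Hc]] := right_rep_component_bound.
have M0 : 0 <= M.
  apply: Rle_trans (HM _ (Dsec_polar Rlt_0_1 (_ : in_I theta 0) hJ)); first exact: norm_ge_0.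
  by left; rlra.
apply: slice_admissible => //.
- exists (c * (M + M)); split; first by apply: Rmult_le_pos; rlra.
  move=> r t r0 ht; apply: Rle_trans (Hc r t J A r0 ht hJ) _.
  apply: Rmult_le_compat_l => //; apply: Rplus_le_compat; apply: HM; exact: Dsec_polar.
- move=> t ht; split; first by move=> r r0; case: (slice_ray_continuous (HF A) ht r0).
  pose g K r := norm (f (scal r (expJ K t : A_n)) : A_n) / r.
  have g0 K r : 0 < r -> 0 <= g K r.
    by move=> r0; apply: Rmult_le_pos; [apply: norm_ge_0|apply: Rlt_le; apply: Rinv_0_lt_compat].
  have [M1 H1] := ex_RInt_gen_bound (g0 J) (Hi J t hJ ht).
  have [M2 H2] := ex_RInt_gen_bound (g0 _) (Hi _ t hJ' ht).
  exists (c * (M1 + M2)) => a b ab; have [e1 b1] := H1 a b ab; have [e2 b2] := H2 a b ab.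
  apply: (@Rle_trans _ (RInt (fun r => c * (g J r + g (opp (J : A_n)) r)) a b)).
    have e3 : ex_RInt (fun r => g J r + g (opp (J : A_n)) r) a b by apply: (@ex_RInt_plus R_NormedModule).
    apply: RInt_le; first rlra.
    + apply: (@ex_RInt_norm R_NormedModule); try rlra.
      by move=> r r0; case: (slice_ray_continuous (HF A) ht r0).
    + exact: (@ex_RInt_scal R_NormedModule (fun r => g J r + g (opp (J : A_n)) r) a b c e3).
    + move=> r hr; have r0 : 0 < r by rlra.
      rewrite norm_R_pos; last first.
        by apply: Rmult_le_pos; [apply: Cmod_ge_0|apply: Rlt_le; apply: Rinv_0_lt_compat].
      rewrite /g !cplx_expJ /Rdiv -Rmult_plus_distr_r -Rmult_assoc.
      apply: Rmult_le_compat_r; first by apply: Rlt_le; apply: Rinv_0_lt_compat.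
      exact: Hc.
  have E : RInt (fun r => c * (g J r + g (opp (J : A_n)) r)) a b = c * (RInt (g J) a b + RInt (g (opp (J : A_n))) a b).
    rewrite (@RInt_scal R_CompleteNormedModule (fun r => g J r + g (opp (J : A_n)) r)); last exact: (@ex_RInt_plus R_NormedModule).
    by rewrite (@RInt_plus R_CompleteNormedModule (g J)).
  by rewrite E; apply: Rmult_le_compat_l => //; rlra.
Qed.

Lemma admissible_part_continuous (k : C) A t r : in_I theta t -> 0 < r ->
  continuous (fun r => Re (Cmult k (F A (polar r t)))) r.
Proof.
move=> ht r0; have [h1 h2] := holo_of_slice (HF A).
(* The constant [Cconj (polar 1 t)] cancels the factor [e^(i t)] contained in [ray], so continuity
   of rays applies. *)
have [h [a [b [hh ab]]]] : exists h a b,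
    hol (sector a b) (fun z => Cmult (Cmult k (Cconj (polar 1 t))) (F A z)) h /\ a < t < b.
  case: ht => ht.
  - have [h Hh] := holo_mult (@holo_const _ (Cmult k (Cconj (polar 1 t)))) h1.
    by exists h, (- theta), theta.
  - have [h Hh] := holo_mult (@holo_const _ (Cmult k (Cconj (polar 1 t)))) h2.
    by exists h, (PI - theta), (PI + theta).
apply: continuous_ext (ray_continuous hh r0 ab) => s; rewrite /ray; congr Re.
have E : Cmult (polar 1 t) (Cconj (polar 1 t)) = RtoC 1.
  by rewrite -Cmod2_conj Cmod_polar; [rewrite pow1|rlra].
transitivity (Cmult (Cmult (polar 1 t) (Cconj (polar 1 t))) (Cmult k (F A (polar s t)))); first ring.
by rewrite E; ring.
Qed.

Lemma admissible_bounded_integrable : (forall A, admissible theta (F A)) -> bounded_integrable theta f.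
Proof.
move=> adm; have [c [c0 Hc]] := cl_mul_bound.
have [M HM] := fun_choice (fun A => adm_bounded (adm A)).
have bound r t J (m : {set 'I_n} -> R) : 0 < r -> in_I theta t -> imag_unit J ->
    (forall A, Cmod (F A (polar r t)) <= m A) ->
    norm (f (cplx (r * cos t) (r * sin t) J) : A_n) <=
    (1 + c) * \big[Rplus/0]_(A : {set 'I_n}) (m A * norm (cl_base A : A_n)).
  move=> r0 ht hJ Hm; have [_ [_ nJ]] := hJ; rewrite (Hf r0 ht hJ).
  set S := \big[Rplus/0]_(A : {set 'I_n}) _.
  have b0 : norm ([ffun A => Re (F A (polar r t))] : A_n) <= S.
    by apply: norm_components_le => A; rewrite ffunE; apply: Rle_trans (re_le_Cmod _) (Hm A).
  have b1 : norm ([ffun A => Im (F A (polar r t))] : A_n) <= S.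
    by apply: norm_components_le => A; rewrite ffunE; apply: Rle_trans (im_le_Cmod _) (Hm A).
  have b2 := Hc [ffun A => Im (F A (polar r t))] J; rewrite nJ Rmult_1_r in b2.
  apply: Rle_trans (norm_plus_le b0 (Rle_trans _ _ _ b2 (Rmult_le_compat_l _ _ _ c0 b1))) _.
  by apply: Req_le; ring.
split.
- exists ((1 + c) * \big[Rplus/0]_(A : {set 'I_n}) (M A * norm (cl_base A : A_n))).
  move=> _ [r [J [t [r0 [hJ [ht ->]]]]]]; rewrite cplx_expJ; apply: bound => // A.
  by case: (HM A) => _; apply.
- move=> J t hJ ht.
  (* The integrand is the norm of the vector function [h]. This is a finite sum of real functions
     times constant vectors, so continuity and integrability are proved for the summands. *)
  pose h r : A_n := scal (/ r) (f (scal r (expJ J t : A_n)) : A_n).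
  pose hA A r : A_n := plus (scal (Re (F A (polar r t)) / r) (cl_base A : A_n))
      (scal (Im (F A (polar r t)) / r) (eop (VR := R_NormedModule) A J : A_n)).
  have hE r : 0 < r -> h r = \big[plus/zero]_(A : {set 'I_n}) hA A r.
    move=> r0; rewrite /h cplx_expJ (Hf r0 ht hJ) {1}(cl_expand [ffun A => Re (F A (polar r t))]).
    rewrite /cl_mul lmul_sumE scal_distr_l !scal_sum -big_split; apply: eq_bigr => A _ /=.
    by rewrite !scal_assoc !ffunE; congr plus; congr scal; rewrite /mult /=; field; rlra.
  have pc k A r : 0 < r -> continuous (fun r => Re (Cmult k (F A (polar r t))) / r) r.
    move=> r0; apply: (@continuous_mult _ R_AbsRing); first exact: admissible_part_continuous.
    by apply: continuous_Rinv; rlra.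
  have cA A r : 0 < r -> continuous (hA A) r.
    move=> r0; apply: continuous_plus; apply: continuous_scal_l.
    + apply: continuous_ext (pc (RtoC 1) A r r0) => s; congr (_ / _).
      by rewrite /Re /=; ring.
    + apply: continuous_ext (pc (Copp Ci) A r r0) => s; congr (_ / _).
      by rewrite /Re /Im /=; ring.
  have ch r : 0 < r -> continuous h r.
    move=> r0; apply: (@continuous_ext_loc R_UniformSpace A_n h (fun r => \big[plus/zero]_(A : {set 'I_n}) hA A r)).
      exists (mkposreal _ r0) => s hs; rewrite hE //.
      have : Rabs (s - r) < r := hs; by move=> /Rabs_def2; rlra.
    by apply: continuous_big => A; apply: cA.
  have aA A : abs_int (hA A).
    apply: (@abs_int_le _ _ _ _ (norm (cl_base A : A_n) + norm (eop (VR := R_NormedModule) A J : A_n)))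
      (adm_int (adm A) ht) _ => r r0; first exact: cA.
    have ri : 0 <= / r by apply: Rlt_le; apply: Rinv_0_lt_compat.
    have f0 := Cmod_ge_0 (F A (polar r t)).
    rewrite norm_R_pos; last exact: Rmult_le_pos.
    have q0 : 0 <= norm (cl_base A : A_n) by apply: norm_ge_0.
    have q1 : 0 <= norm (eop (VR := R_NormedModule) A J : A_n) by apply: norm_ge_0.
    apply: Rle_trans (norm_plus_le (norm_scal_le _ (Rle_refl _)) (norm_scal_le _ (Rle_refl _))) _.
    have a1 : Rabs (Re (F A (polar r t)) / r) <= Cmod (F A (polar r t)) / r.
      rewrite /Rdiv Rabs_mult (Rabs_pos_eq (/ r)) //; apply: Rmult_le_compat_r => //; exact: re_le_Cmod.
    have a2 : Rabs (Im (F A (polar r t)) / r) <= Cmod (F A (polar r t)) / r.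
      rewrite /Rdiv Rabs_mult (Rabs_pos_eq (/ r)) //; apply: Rmult_le_compat_r => //; exact: im_le_Cmod.
    have := Rmult_le_compat_r _ _ _ q0 a1; have := Rmult_le_compat_r _ _ _ q1 a2; rlra.
  have ah : abs_int (fun r => \big[plus/zero]_(A : {set 'I_n}) hA A r).
    apply: abs_int_big => A; exact: aA.
  have nE r : 0 < r -> norm (h r) = norm (f (scal r (expJ J t : A_n)) : A_n) / r.
    move=> r0; have ri : 0 < / r by apply: Rinv_0_lt_compat.
    apply: Rle_antisym.
    + apply: Rle_trans (norm_scal_le _ (Rle_refl _)) _.
      by rewrite Rabs_pos_eq; [apply: Req_le; rewrite Rmult_comm|rlra].
    + apply: (@Rmult_le_reg_l r) => //.
      have -> : r * (norm (f (scal r (expJ J t : A_n)) : A_n) / r) = norm (f (scal r (expJ J t : A_n)) : A_n) by field; rlra.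
      have {1}-> : (f (scal r (expJ J t : A_n)) : A_n) = scal r (h r).
        rewrite /h scal_assoc /mult /= Rinv_r; last rlra.
        by rewrite (@scal_one R_AbsRing A_n).
      by apply: Rle_trans (norm_scal_le _ (Rle_refl _)) _; rewrite Rabs_pos_eq; rlra.
  have an : abs_int (fun r => norm (h r) : R_NormedModule).
    apply: (@abs_int_le _ _ _ _ 1) ah _ => r r0.
      by apply: continuous_comp; [apply: ch|apply: (@filterlim_norm _ A_n)].
    by rewrite norm_R_pos ?Rmult_1_l ?hE //; [apply: Rle_refl|apply: norm_ge_0].
  have [I HI] := @abs_int_cvg R_CompleteNormedModule _ an; exists I.
  by apply: is_RInt_zinf_ext HI => r r0; rewrite nE.
Qed.

End RepresentationBounds.

(** * The regularised functions *)

Section Regularizer.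
Variables (n : nat) (theta : R).
Hypotheses (n_ge1 : (1 <= n)%nat) (theta_bounds : 0 < theta < PI / 2).
Local Notation A_n := (clmod_NormedModule n R_NormedModule).

Lemma e_reg_rep m : intrinsic_rep theta (@e_reg n m) (fun z => Cpow (e_one z) m).
Proof.
move=> r t J r0 ht hJ; set z := polar r t.
have nz : one_plus_sq z <> RtoC 0 by apply: in_I_one_plus_sq_neq0 ht.
have -> : cplx (r * cos t) (r * sin t) J = cplx (Re z) (Im z) J by [].
rewrite /e_reg !cl_pow_cplx //.
have -> : plus (cl_real n 1) (cplx (Re (Cpow z 2)) (Im (Cpow z 2)) J) =
    cplx (Re (one_plus_sq z)) (Im (one_plus_sq z)) J.
  have -> : one_plus_sq z = Cplus (RtoC 1) (Cpow z 2) by rewrite /one_plus_sq /=; ring.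
  apply/ffunP => A; rewrite ffunE !cplxE !ffunE /Re /Im /RtoC /Cplus /=.
  by case: eqP => _; rring.
rewrite cl_pow_cplx // cl_inv_cplx //; last exact: Cpow_nz.
rewrite cplx_mul //.
have E : Cpow (e_one z) m = Cmult (Cpow z m) (Cinv (Cpow (one_plus_sq z) m)).
  by rewrite /e_one Cpow_mult_l Cpow_inv.
by rewrite E; congr cplx; rewrite /Re /Im /=; ring.
Qed.

Lemma cl_mul_cplx_r (w : Cl n) (x y : R) J :
  cl_mul w (cplx x y J) = plus (scal x (w : A_n)) (scal y (cl_mul w J : A_n)).
Proof. by rewrite /cplx cl_mulDr cl_mul_real_r cl_mulZr. Qed.

(** An intrinsic [g] takes values in the plane of [J], so multiplying [f0 + f1 J] by it on the right
    multiplies each complex component by [G]. *)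
Lemma right_rep_mult f (F : {set 'I_n} -> C -> C) g G : right_rep theta f F -> intrinsic_rep theta g G ->
  right_rep theta (fun s => cl_mul (f s) (g s)) (fun A z => Cmult (G z) (F A z)).
Proof.
move=> Hf Hg r t J r0 ht hJ; rewrite (Hf r t J r0 ht hJ) (Hg r t J r0 ht hJ).
set z := polar r t; set a := Re (G z); set b := Im (G z).
set g0 : A_n := [ffun A => Re (F A z)]; set g1 : A_n := [ffun A => Im (F A z)].
have -> : [ffun A => Re (Cmult (G z) (F A z))] = minus (scal a g0) (scal b g1).
  by apply/ffunP => A; rewrite !ffunE /a /b /Re /Im /=; rring.
have -> : [ffun A => Im (Cmult (G z) (F A z))] = plus (scal a g1) (scal b g0).
  by apply/ffunP => A; rewrite !ffunE /a /b /Re /Im /=; rring.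
rewrite cl_mul_cplx_r !cl_mulDl !cl_mulZl cl_mulA imag_unit_sqr // cl_mul_real_r.
by lin; ring.
Qed.

Lemma intrinsic_rep_mult f F g G : intrinsic_rep (n := n) theta f F -> intrinsic_rep theta g G ->
  intrinsic_rep theta (fun s => cl_mul (f s) (g s)) (fun z => Cmult (G z) (F z)) /\
  intrinsic_rep theta (fun s => cl_mul (g s) (f s)) (fun z => Cmult (G z) (F z)).
Proof.
move=> Hf Hg; split=> r t J r0 ht hJ; rewrite (Hf r t J r0 ht hJ) (Hg r t J r0 ht hJ) cplx_mul //;
  by congr cplx; rewrite /Re /Im /=; ring.
Qed.

Lemma e_one_bound r t : 0 < r -> in_I theta t ->
  Cmod (e_one (polar r t)) <= / cos theta * (r / (1 + r ^ 2)).
Proof.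
move=> r0 ht; have h := in_I_one_plus_sq r theta_bounds ht.
have c0 : 0 < cos theta by apply: cos_gt_0; rlra.
have p : 0 < 1 + r ^ 2 by have := pow2_ge_0 r; rlra.
have cp : 0 < cos theta * (1 + r ^ 2) by apply: Rmult_lt_0_compat.
rewrite /e_one Cmod_mult Cmod_inv; last by apply: in_I_one_plus_sq_neq0 ht.
rewrite Cmod_polar; last rlra.
apply: (@Rle_trans _ (r * / (cos theta * (1 + r ^ 2)))).
  by apply: Rmult_le_compat_l; [rlra|apply: Rinv_le_contravar].
by apply: Req_le; field; rlra.
Qed.

Lemma e_one_bounded r t : 0 < r -> in_I theta t -> Cmod (e_one (polar r t)) <= / cos theta.
Proof.
move=> r0 ht; apply: Rle_trans (e_one_bound r0 ht) _.
have c0 : 0 < cos theta by apply: cos_gt_0; rlra.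
have p : 0 < 1 + r ^ 2 by have := pow2_ge_0 r; rlra.
rewrite -[X in _ <= X]Rmult_1_r; apply: Rmult_le_compat_l.
  by apply: Rlt_le; apply: Rinv_0_lt_compat.
apply: (@Rmult_le_reg_r (1 + r ^ 2)) => //.
by rewrite /Rdiv Rmult_assoc Rinv_l; nra.
Qed.

Lemma e_one_mult_admissible F : admissible theta F -> admissible theta (fun z => Cmult (e_one z) (F z)).
Proof.
have k0 : 0 < / cos theta by apply: Rinv_0_lt_compat; apply: cos_gt_0; rlra.
move=> HF.
exact: (admissible_mult_bounded theta_bounds (slice_holo_e_one theta_bounds) (Rlt_le _ _ k0) e_one_bounded HF).
Qed.

(** [e_one ^ m] has size at most [(r / (1 + r^2)) ^ m] times [(1 / cos theta) ^ m]. Because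
    [alpha < m], it absorbs the growth of [G] and leaves a weight of positive exponent. *)
Lemma poly_growth_admissible G m alpha c : slice_holo theta G -> 0 <= c -> 0 <= alpha -> alpha < INR m ->
  (forall r t, 0 < r -> in_I theta t -> Cmod (G (polar r t)) <= c * (Rpower r alpha + Rpower r (- alpha))) ->
  admissible theta (fun z => Cmult (Cpow (e_one z) m) (G z)).
Proof.
move=> HG c0 a0 am Hc; set d := INR m - alpha; have d0 : 0 < d by rewrite /d; rlra.
have k0 : 0 < / cos theta by apply: Rinv_0_lt_compat; apply: cos_gt_0; rlra.
set M := 8 * c * (/ cos theta) ^ m.
have M0 : 0 <= M by apply: Rmult_le_pos; [rlra|apply: pow_le; rlra].
have HH : slice_holo theta (fun z => Cmult (Cpow (e_one z) m) (G z)).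
  apply: slice_holo_mult => //; apply: slice_holo_pow; exact: slice_holo_e_one.
have key r t : 0 < r -> in_I theta t -> Cmod (Cmult (Cpow (e_one (polar r t)) m) (G (polar r t))) <= M * weight d r.
  move=> r0 ht; rewrite Cmod_mult Cmod_pow.
  have b1 : Cmod (e_one (polar r t)) ^ m <= (/ cos theta * (r / (1 + r ^ 2))) ^ m.
    by apply: pow_incr; split; [apply: Cmod_ge_0|apply: e_one_bound].
  have b2 := Hc r t r0 ht; have b3 := poly_growth_weight a0 am r0; rewrite -/d in b3.
  apply: Rle_trans (Rmult_le_compat _ _ _ _ _ _ b1 b2) _; [|exact: Cmod_ge_0|].
    by apply: pow_le; apply: Cmod_ge_0.
  rewrite Rpow_mult_distr /M.
  have km : 0 <= (/ cos theta) ^ m * c by apply: Rmult_le_pos => //; apply: pow_le; rlra.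
  have := Rmult_le_compat_l _ _ _ km b3; rlra.
apply: slice_admissible => //.
- exists M; split=> // r t r0 ht; apply: Rle_trans (key r t r0 ht) _.
  by have [_ w1] := weight_bounds d r; nra.
- move=> t ht; apply: (@abs_int_le _ _ _ _ M) (abs_int_weight d0) _ => r r0.
    by case: (slice_ray_continuous HH ht r0).
  have ri : 0 < / r by apply: Rinv_0_lt_compat.
  have [w0 _] := weight_bounds d r.
  rewrite !norm_R_pos; [|by apply: Rmult_le_pos; rlra|by apply: Rmult_le_pos; [apply: Cmod_ge_0|rlra]].
  have := Rmult_le_compat_r _ _ _ (Rlt_le _ _ ri) (key r t r0 ht).
  by rewrite /Rdiv; rlra.
Qed.

Lemma e_pow_admissible m : 0 < INR m -> admissible theta (fun z => Cpow (e_one z) m).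
Proof.
move=> m0; have E : (fun z => Cpow (e_one z) m) = (fun z => Cmult (Cpow (e_one z) m) (RtoC 1)).
  by apply: functional_extensionality => z; ring.
(* The constant 1 has growth exponent 0, for which the strict inequality becomes [0 < m]. *)
rewrite E; apply: (@poly_growth_admissible _ m 0 1) => //; try rlra.
  exact: slice_holo_real.
move=> r t r0 _; rewrite Cmod_1 Ropp_0 Rpower_O //; rlra.
Qed.

Lemma intrinsic_bounded_integrable f F : intrinsic_rep (n := n) theta f F -> slice_holo theta F ->
  admissible theta F -> bounded_integrable theta f.
Proof.
move=> Hf HS HF.
have nE r J t : 0 < r -> in_I theta t -> imag_unit J ->
    norm (f (scal r (expJ J t : A_n)) : A_n) = Cmod (F (polar r t)).
  by move=> r0 ht hJ; rewrite cplx_expJ (Hf r t J r0 ht hJ) norm_cplx // -surjective_pairing.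
split.
- have [M [_ HM]] := adm_bounded HF; exists M => _ [r [J [t [r0 [hJ [ht ->]]]]]].
  by rewrite nE //; apply: HM.
- move=> J t hJ ht; have [I HI] := @abs_int_cvg R_CompleteNormedModule _ (adm_int HF ht).
  by exists I; apply: is_RInt_zinf_ext HI => r r0; rewrite nE.
Qed.

End Regularizer.

(** * The H-infinity calculus *)

Section GraphClosure.
Variables (n : nat) (VR : NormedModule R_AbsRing).
Local Notation V := (clmod_NormedModule n VR).
Local Notation bop := (blin_NormedModule V V).
Local Notation closure S := (seq_closure (X := prod_UniformSpace V V) S).

Lemma seq_closureP (S : mvop n VR) (v w : V) : closure S (v, w) <->
  forall e, 0 < e -> exists v' w' : V, S (v', w') /\ norm (minus v' v) < e /\ norm (minus w' w) < e.
Proof.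
split.
- move=> [u [Su cu]] e e0.
  have [N HN] := cu _ (locally_ball ((v, w) : prod_UniformSpace V V) (mkposreal _ e0)).
  have [h1 h2] := HN N (Nat.le_refl N); have := Su N.
  by case: (u N) h1 h2 => v' w' h1 h2 Suv; exists v', w'.
- move=> H; have pos k : 0 < / INR k.+1 by apply: Rinv_0_lt_compat; apply: lt_0_INR; lia.
  have ex k : exists p : V * V, S p /\ norm (minus p.1 v) < / INR k.+1 /\ norm (minus p.2 w) < / INR k.+1.
    by have [v' [w' h]] := H _ (pos k); exists (v', w').
  have [u Hu] := fun_choice ex; exists u; split; first by move=> k; case: (Hu k).
  apply/filterlim_locally => e.
  have [N [HN N0]] := archimed_cor1 e (cond_pos e).
  exists N => k hk; have [_ [h1 h2]] := Hu k.
  have le : / INR k.+1 <= / INR N.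
    by apply: Rinv_le_contravar; [apply: lt_0_INR|apply: le_INR; lia].
  by split; [apply: Rlt_le_trans h1 _|apply: Rlt_le_trans h2 _]; rlra.
Qed.

(** The composition of [A] with the inverse relation of [E], parametrised by the intermediate vector
    [u]. *)
Definition range_pairs (E A : bop) : mvop n VR := fun p => exists u, p.1 = E u /\ p.2 = A u.

Lemma opnorm_small (A : bop) (e : R) : 0 < e -> exists d, 0 < d /\ forall v, norm v < d -> norm (A v) < e.
Proof.
move=> e0; have A0 : 0 <= norm A by apply: norm_ge_0.
exists (e / (norm A + 1)); split; first by apply: Rdiv_lt_0_compat; rlra.
move=> v hv; apply: Rle_lt_trans (opnorm_bound A v) _.
have v0 : 0 <= norm v by apply: norm_ge_0.
have h : norm v * (norm A + 1) < e.
  have := Rmult_lt_compat_r (norm A + 1) _ _ (_ : 0 < norm A + 1) hv.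
  by rewrite /Rdiv Rmult_assoc Rinv_l; [rewrite Rmult_1_r; apply; rlra|rlra].
by have -> : opnorm A = norm A by []; nra.
Qed.

(** The parameter [u] is approximated by some [B x], and [E], [A] are continuous; so the closure
    does not notice the restriction to a dense set of parameters. *)
Lemma range_pairs_closure_comp (E A B : bop) :
  (forall x e, 0 < e -> exists v, norm (minus x (B v)) < e) ->
  mv_eq (closure (range_pairs E A)) (closure (range_pairs (bcomp E B) (bcomp A B))).
Proof.
move=> HB [v w]; rewrite !seq_closureP; split=> H e e0.
- have e2 : 0 < e / 2 by rlra.
  have [v' [w' [[u [Ev Ew]] [h1 h2]]]] := H _ e2; rewrite /= in Ev Ew.
  have [d1 [d10 H1]] := opnorm_small E e2; have [d2 [d20 H2]] := opnorm_small A e2.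
  have d0 : 0 < Rmin d1 d2 by apply: Rmin_glb_lt.
  have [x Hx] := HB u _ d0.
  exists (E (B x)), (A (B x)); split; first by exists x.
  have k1 := H1 _ (Rlt_le_trans _ _ _ Hx (Rmin_l _ _)).
  have k2 := H2 _ (Rlt_le_trans _ _ _ Hx (Rmin_r _ _)).
  split.
  + have -> : minus (E (B x)) v = minus (minus v' v) (E (minus u (B x))).
      by rewrite Ev blinB; lin; ring.
    by apply: Rle_lt_trans (norm_minus_le (Rle_refl _) (Rle_refl _)) _; rlra.
  + have -> : minus (A (B x)) w = minus (minus w' w) (A (minus u (B x))).
      by rewrite Ew blinB; lin; ring.
    by apply: Rle_lt_trans (norm_minus_le (Rle_refl _) (Rle_refl _)) _; rlra.
- have [v' [w' [[u [Ev Ew]] h]]] := H e e0.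
  by exists v', w'; split=> //; exists (B u).
Qed.

(** [E w = A v] is a closed condition on [(v, w)], as [E] and [A] are bounded. *)
Lemma closure_kernel (S : mvop n VR) (E A : bop) (v w : V) :
  (forall v' w', S (v', w') -> E w' = A v') -> closure S (v, w) -> E w = A v.
Proof.
move=> HS /seq_closureP H; apply: NNPP => ne.
have d0 : 0 < norm (minus (E w) (A v)) / 2.
  have : norm (minus (E w) (A v)) <> 0.
    move=> /norm_eq_zero h; apply: ne.
    have -> : E w = plus (minus (E w) (A v)) (A v) by lin; ring.
    by rewrite h plus_zero_l.
  by have := norm_ge_0 (minus (E w) (A v)); rlra.
have [d1 [d10 H1]] := opnorm_small E d0; have [d2 [d20 H2]] := opnorm_small A d0.
have dm : 0 < Rmin d1 d2 by apply: Rmin_glb_lt.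
have [v' [w' [Svw [h1 h2]]]] := H _ dm.
have k1 := H1 _ (Rlt_le_trans _ _ _ h2 (Rmin_l _ _)).
have k2 := H2 _ (Rlt_le_trans _ _ _ h1 (Rmin_r _ _)).
have E1 : minus (E w) (A v) = minus (A (minus v' v)) (E (minus w' w)).
  by rewrite !blinB (HS v' w' Svw); lin; ring.
have := norm_minus_le (Rle_refl (norm (A (minus v' v)))) (Rle_refl (norm (E (minus w' w)))).
by rewrite -E1; rlra.
Qed.

End GraphClosure.

(** * The right calculus of [T] *)

Section MainConstruction.
Variables (n : nat) (VR : CompleteNormedModule R_AbsRing) (T : mvop n VR).
Local Notation V := (clmod_NormedModule n VR).
Local Notation X := (clmod_CompleteNormedModule n VR).
Local Notation A_n := (clmod_NormedModule n R_NormedModule).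
Local Notation bop := (blin_NormedModule V V).
Local Notation rlin := (@right_linear n VR).
Hypotheses (n_ge1 : (1 <= n)%nat) (T_closed : closed_operator T) (T_injective : mv_injective T).
Hypothesis V_reflexive : reflexive_space V.
Variables (omega theta : R) (Kz Lz : C -> bop).
Hypotheses (omega_bounds : 0 < omega < PI / 2) (theta_bounds : omega < theta < PI / 2).
Hypotheses (HKz : forall z, sector omega (PI - omega) z ->
     [/\ pseudo_resolvent (X := X) (op_rel T) (Re z) (Cmod z ^ 2) (Kz z) (Lz z), rlin (Kz z) & rlin (Lz z)])
  (z_bound : forall phi, omega < phi < PI / 2 -> exists c, 0 <= c /\
    forall r t, 0 < r -> phi <= t <= PI - phi ->
      norm (Pz (X := X) Kz Lz (polar r t)) <= c / r /\ norm (qz (X := X) Kz (polar r t)) <= c / r).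

Local Notation P := (Pz (X := X) Kz Lz).
Local Notation q := (qz (X := X) Kz).
Local Notation value := (calculus_value (X := X) omega P q theta).
Local Notation Ky := (fun y => Kz (polar y (PI / 2))).
Local Notation Ly := (fun y => Lz (polar y (PI / 2))).
Local Notation L := (Lz (polar 1 (PI / 2))).
Local Notation Lpow := (bpow (X := X) L).
Local Notation closure S := (seq_closure (X := prod_UniformSpace V V) S).

Let Tadd := op_rel_add T_closed.
Let Tscal := op_rel_scal T_closed.
Let Tfun := op_rel_fun T_closed.
Let Tinj := op_rel_inj T_injective.
Let theta_bounds' : 0 < theta < PI / 2. Proof. by rlra. Qed.

Lemma resolvent_data_main : resolvent_data (X := X) omega P q (Kz (polar 1 (PI / 2))) L.
Proof.
apply: (resolvent_data_of_operator Tadd Tscal Tfun omega_bounds _ z_bound) => z Dz.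
by case: (HKz Dz).
Qed.
Let Rd := resolvent_data_main.

Lemma value_e_step F A : admissible theta F -> value F A ->
  value (fun z => Cmult (e_one z) (F z)) (bcomp A L).
Proof.
move=> HF HA; have HeF := e_one_mult_admissible theta_bounds' HF.
exact: (calculus_value_e_one Rd theta_bounds HF HeF HA).
Qed.

(** Admissibility is carried along, because the next factor [e_one] requires it. *)
Lemma value_e_pow_mult F A k : admissible theta F -> value F A ->
  admissible theta (fun z => Cmult (Cpow (e_one z) k) (F z)) /\
  value (fun z => Cmult (Cpow (e_one z) k) (F z)) (bcomp A (Lpow k)).
Proof.
move=> HF HA; elim: k => [|k [IH1 IH2]].
  have -> : (fun z => Cmult (Cpow (e_one z) 0) (F z)) = F.
    by apply: functional_extensionality => z /=; ring.
  by split=> //; have -> : bcomp A (Lpow 0) = A by apply: blin_eq.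
have -> : (fun z => Cmult (Cpow (e_one z) k.+1) (F z)) =
    (fun z => Cmult (e_one z) (Cmult (Cpow (e_one z) k) (F z))).
  by apply: functional_extensionality => z /=; ring.
split; first exact: e_one_mult_admissible.
have -> : bcomp A (Lpow k.+1) = bcomp (bcomp A (Lpow k)) L.
  by apply: blin_eq => v; rewrite -[LHS]/(A (Lpow k.+1 v)) bpowSr.
exact: value_e_step.
Qed.

(** The induction starts at [e_one], as the constant function 1 is not admissible. *)
Lemma value_e_pow m : 0 < INR m ->
  admissible theta (fun z => Cpow (e_one z) m) /\ value (fun z => Cpow (e_one z) m) (Lpow m).
Proof.
case: m => [|m] m0; first by move: m0 => /=; rlra.
have He1 : admissible theta e_one.
  have := @e_pow_admissible theta theta_bounds' 1 Rlt_0_1.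
  by congr admissible; apply: functional_extensionality => z /=; ring.
have [h1 h2] := value_e_pow_mult m He1 (calculus_value_base Rd theta_bounds He1).
have E : (fun z => Cpow (e_one z) m.+1) = (fun z => Cmult (Cpow (e_one z) m) (e_one z)).
  by apply: functional_extensionality => z /=; ring.
by rewrite E.
Qed.

Lemma omega_calc_e_reg m : 0 < INR m ->
  omega_calc_R T omega theta (@e_reg n m) (Lpow m) /\ omega_calc_L T omega theta (@e_reg n m) (Lpow m).
Proof.
move=> m0; have [h1 h2] := value_e_pow m0; have He := e_reg_rep (n := n) theta_bounds' m.
split; [exact: (omega_calc_right_intrinsic T_closed omega_bounds theta_bounds HKz Rd He h1 h2)
       |exact: (omega_calc_left_intrinsic T_closed omega_bounds theta_bounds HKz Rd He h1 h2)].
Qed.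

Let HKy y : 0 < y -> pseudo_resolvent (X := X) (op_rel T) 0 (y ^ 2) (Ky y) (Ly y).
Proof. exact: (axis_pseudo_resolvent omega_bounds HKz). Qed.
Let Ky_bound := axis_bound omega_bounds z_bound.

Lemma e_reg_injective m : mv_injective (graph (Lpow m)).
Proof.
move=> v w w'; rewrite /mv_inv /graph /= => E1 E2.
by apply: (bpow_L_injective Tfun Tinj HKy (k := m)); rewrite -E1.
Qed.

Lemma range_Lpow_dense k (x : V) e : 0 < e -> exists v : V, norm (minus x (Lpow k v)) < e.
Proof. exact: (range_bpow_L_dense Tadd Tscal Tfun Tinj HKy Ky_bound V_reflexive). Qed.

Lemma omega_op_RE f A (p : V * V) : omega_calc_R T omega theta f A ->
  omega_op_R T omega theta f p <-> p.2 = A p.1.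
Proof.
move=> HA; split=> [[B [HB hB]]|h]; last by exists A.
by rewrite (omega_calc_unique n_ge1 (proj1 theta_bounds) HA HB).
Qed.

Lemma omega_op_LE f A (p : V * V) : omega_calc_L T omega theta f A ->
  omega_op_L T omega theta f p <-> p.2 = A p.1.
Proof.
move=> HA; split=> [[B [HB hB]]|h]; last by exists A.
by rewrite (omega_calc_unique n_ge1 (proj1 theta_bounds) HA HB).
Qed.

Lemma Hinf_RE m f A : 0 < INR m ->
  omega_calc_R T omega theta (fun s => cl_mul (f s) (e_reg m s)) A ->
  Hinf_R T omega theta m f = closure (range_pairs (Lpow m) A).
Proof.
move=> m0 HA; congr seq_closure; apply: functional_extensionality => [[v w]].
apply: propositional_extensionality; have [HE _] := omega_calc_e_reg m0; split.
- move=> [u [/(omega_op_RE _ HE) /= h1 /(omega_op_RE _ HA) /= h2]].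
  by exists u.
- move=> [u [h1 h2]]; exists u; split; [apply/(omega_op_RE _ HE)|apply/(omega_op_RE _ HA)] => //.
Qed.

Lemma Hinf_LE m f A (v w : V) : 0 < INR m ->
  omega_calc_L T omega theta (fun s => cl_mul (e_reg m s) (f s)) A ->
  Hinf_L T omega theta m f (v, w) <-> Lpow m w = A v.
Proof.
move=> m0 HA; have [_ HE] := omega_calc_e_reg m0; split.
- by move=> [u [/(omega_op_LE _ HA) /= h1 /(omega_op_LE _ HE) /= h2]]; rewrite -h1 -h2.
- move=> h; exists (A v); split; [exact/(omega_op_LE _ HA)|].
  by apply/(omega_op_LE _ HE) => /=; rewrite h.
Qed.

(** The factors [L] appear to the right of every [e_A], so they come out of the sum. The function
    [g] enters only through its representation, which allows [f e_(m+j)] to be used for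
    [f e_m e_j]. *)
Lemma right_calculus_tower f (F : {set 'I_n} -> C -> C) : right_rep theta f F ->
  (forall A, admissible theta (F A)) ->
  exists A : bop, [/\ rlin A, omega_calc_R T omega theta f A & forall j g,
    right_rep theta g (fun B z => Cmult (Cpow (e_one z) j) (F B z)) ->
    omega_calc_R T omega theta g (bcomp A (Lpow j))].
Proof.
move=> Hf adm.
have [Phi HPhi] := fun_choice (fun A => calculus_value_exists Rd theta_bounds (adm A)).
exists (\big[plus/zero]_(B : {set 'I_n}) (bcomp (eop B) (Phi B) : bop)); split.
- apply: sum_right_linear => B; apply: bcomp_right_linear; first exact: eop_right_linear.
  exact: (value_right_linear theta_bounds HKz Rd (adm B) (HPhi B)).
- exact: (omega_calc_right T_closed omega_bounds theta_bounds HKz Rd Hf adm HPhi).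
- move=> j g Hg; have h A := value_e_pow_mult j (adm A) (HPhi A).
  have -> : bcomp (\big[plus/zero]_(B : {set 'I_n}) (bcomp (eop B) (Phi B) : bop)) (Lpow j) =
      \big[plus/zero]_(B : {set 'I_n}) (bcomp (eop B) (bcomp (Phi B) (Lpow j)) : bop).
    apply: blin_eq => v; rewrite -[LHS]/((\big[plus/zero]_(B : {set 'I_n}) _ : bop) (Lpow j v)).
    by rewrite !sum_blinE.
  by apply: (omega_calc_right T_closed omega_bounds theta_bounds HKz Rd Hg) => B; case: (h B).
Qed.

Lemma Lpow_add j k : Lpow (j + k) = bcomp (Lpow j) (Lpow k).
Proof. by apply: blin_eq => v; rewrite bpow_add. Qed.

(** [(f e_(m+j))(T) = (f e_m)(T) L^j] and [e_(m+j)(T) = L^m L^j]: raising the exponent merely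
    restricts the parameter of the pairs to the dense range of [L^j]. *)
Lemma Hinf_R_shift f (F : {set 'I_n} -> C -> C) m j : right_rep theta f F -> 0 < INR m ->
  (forall A, admissible theta (fun z => Cmult (Cpow (e_one z) m) (F A z))) ->
  mv_eq (Hinf_R T omega theta m f) (Hinf_R T omega theta (m + j) f).
Proof.
move=> Hf m0 adm.
have Hfe k := right_rep_mult Hf (e_reg_rep (n := n) theta_bounds' k).
have [A [_ HA Hj]] := right_calculus_tower (Hfe m) adm.
have mj0 : 0 < INR (m + j) by rewrite plus_INR; have := pos_INR j; rlra.
have HAj : omega_calc_R T omega theta (fun s => cl_mul (f s) (e_reg (m + j) s)) (bcomp A (Lpow j)).
  apply: Hj; have := Hfe (m + j)%nat; congr right_rep.
  by apply: functional_extensionality => B; apply: functional_extensionality => z;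
    rewrite Cpow_add_r; ring.
rewrite (Hinf_RE m0 HA) (Hinf_RE mj0 HAj) Lpow_add.
by apply: range_pairs_closure_comp => x e; apply: range_Lpow_dense.
Qed.

(** With [A = f(T)] bounded, the pairs are [(L^m u, A L^m u)], the graph of [A] over a dense range;
    its closure is the whole graph. *)
Lemma Hinf_R_omega f (F : {set 'I_n} -> C -> C) m : right_rep theta f F -> 0 < INR m ->
  (forall A, admissible theta (F A)) ->
  mv_eq (Hinf_R T omega theta m f) (omega_op_R T omega theta f).
Proof.
move=> Hf m0 adm; have [A [_ HA Hj]] := right_calculus_tower Hf adm.
have HAm := Hj m _ (right_rep_mult Hf (e_reg_rep (n := n) theta_bounds' m)).
have dense x e : 0 < e -> exists v, norm (minus x (Lpow m v)) < e by apply: range_Lpow_dense.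
rewrite (Hinf_RE m0 HAm) => [[v w]]; rewrite (omega_op_RE _ HA) /=.
have -> : Lpow m = bcomp (bid V) (Lpow m) by apply: blin_eq.
rewrite -(range_pairs_closure_comp (bid V) A dense (v, w)); split.
- by apply: (closure_kernel (E := bid V)) => v' w' [u [/= -> ->]].
- move=> ->; apply/seq_closureP => e e0; exists v, (A v); split; first by exists v.
  by rewrite !minus_eq_zero norm_zero.
Qed.

(** [K_y] and [L_y] commute with [T], hence with all its resolvents and with integrals of these. *)
Lemma value_commute F A y : admissible theta F -> value F A -> 0 < y ->
  (forall v, A (Ky y v) = Ky y (A v)) /\ (forall v, A (Ly y v) = Ly y (A v)).
Proof.
move=> HF HA y0.
have [cK cL] := pseudo_resolvent_commutes Tadd Tscal Tfun (HKy y0).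
have key (B : bop) : commutes_with (X := X) (op_rel T) B -> forall v, A (B v) = B (A v).
  move=> cB v; apply: esym; apply: (@blin_app_eq _ _ (bcomp B A) (bcomp A B)).
  apply: (calculus_value_commute Rd theta_bounds HF _ HA) => z Dz.
  have [HK _ _] := HKz Dz.
  have [/blin_app_eq eK /blin_app_eq eL] := commutes_with_pseudo_resolvent Tfun HK cB.
  split; apply: blin_eq => u; have /= eKu := eK u; have /= eLu := eL u.
  - rewrite -[LHS]/(B (P z u)) -[RHS]/(P z (B u)) !PzE.
    by rewrite (@blinB V V) (@blinZ V V) eKu eLu.
  - by rewrite -[LHS]/(B (q z u)) -[RHS]/(q z (B u)) !qzE (@blinZ V V) eKu.
by split; apply: key.
Qed.

Lemma bpow_comp_commute (A B : bop) k : (forall v, A (B v) = B (A v)) ->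
  forall v, bpow (X := X) (bcomp A B) k v = bpow (X := X) A k (bpow (X := X) B k v).
Proof.
move=> H v; elim: k => // k IH.
rewrite -[LHS]/(A (B (bpow (X := X) (bcomp A B) k v))) IH.
have e := @bpow_commute X A B k H (bpow (X := X) B k v).
exact: (congr1 A (esym e)).
Qed.

(* With [H_nu = L G_nu -> 1] strongly, [u = G_nu ^ k v] satisfies
   [L ^ k u = H_nu ^ k v -> v] and [A u = G_nu ^ k L ^ k w = H_nu ^ k w -> w]. *)
Lemma closure_range_intrinsic F A k (v w : V) : admissible theta F -> value F A ->
  closure (range_pairs (Lpow k) A) (v, w) <-> Lpow k w = A v.
Proof.
move=> HF HA; have cA y (y0 : 0 < y) := value_commute HF HA y0.
have cL y : 0 < y -> (forall u, L (Ky y u) = Ky y (L u)) /\ (forall u, L (Ly y u) = Ly y (L u)).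
  move=> y0; have [a b c] := Ky_commute Tadd Tscal Tfun HKy y0 Rlt_0_1.
  by split=> u; [rewrite b|rewrite c].
split.
- apply: closure_kernel => v' w' [u [/= -> ->]].
  by rewrite (@bpow_commute X L A) // => x; case: (cA 1 Rlt_0_1) => _ ->.
- move=> E; apply/seq_closureP => e e0; have e2 : 0 < e / 2 by rlra.
  have [N1 H1] := approx_pow_strong Tadd Tscal Tfun Tinj HKy Ky_bound V_reflexive k v e2.
  have [N2 H2] := approx_pow_strong Tadd Tscal Tfun Tinj HKy Ky_bound V_reflexive k w e2.
  set m := maxn N1 N2; have {}H1 := H1 m (leq_maxl _ _); have {}H2 := H2 m (leq_maxr _ _).
  have m0 : 0 < INR m.+1 by apply: lt_0_INR; lia.
  set G := approx_factor (X := X) Ky Ly (INR m.+1).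
  have [cLG _] := approx_commute m0 cL; have [cAG _] := approx_commute m0 cA.
  have EH x : bpow (X := X) (approx (X := X) Ky Ly (INR m.+1)) k x = Lpow k (bpow (X := X) G k x).
    by rewrite -(@bpow_comp_commute L G).
  rewrite EH in H1; rewrite EH in H2.
  exists (Lpow k (bpow (X := X) G k v)), (A (bpow (X := X) G k v)).
  split; first by exists (bpow (X := X) G k v).
  split; first by apply: Rle_lt_trans H1 _; rlra.
  have -> : A (bpow (X := X) G k v) = Lpow k (bpow (X := X) G k w).
    rewrite -(@bpow_commute X G A) // -E.
    have cGL x : G (Lpow k x) = Lpow k (G x) by rewrite (@bpow_commute X L G).
    by rewrite (@bpow_commute X G (Lpow k)).
  by apply: Rle_lt_trans H2 _; rlra.
Qed.

(** For intrinsic [f] the right and left integrands have the same odd part, so a single [A] is both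
    [(fe)(T)] and [(ef)(T)]. *)
Lemma Hinf_R_left f F k : intrinsic_rep theta f F -> 0 < INR k ->
  admissible theta (fun z => Cmult (Cpow (e_one z) k) (F z)) ->
  mv_eq (Hinf_R T omega theta k f) (Hinf_L T omega theta k f).
Proof.
move=> Hf k0 adm; have [A HA] := calculus_value_exists Rd theta_bounds adm.
have [Hr Hl] := intrinsic_rep_mult Hf (e_reg_rep (n := n) theta_bounds' k).
have HR := omega_calc_right_intrinsic T_closed omega_bounds theta_bounds HKz Rd Hr adm HA.
have HL := omega_calc_left_intrinsic T_closed omega_bounds theta_bounds HKz Rd Hl adm HA.
rewrite (Hinf_RE k0 HR) => [[v w]].
by rewrite (closure_range_intrinsic _ _ _ adm HA) (Hinf_LE _ _ k0 HL).
Qed.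

End MainConstruction.

Theorem theorem4p8 (n : nat) (hn : (1 <= n)%nat)
  (VR : CompleteNormedModule R_AbsRing)
  (T : mvop n VR) (omega theta : R) (f : Cl n -> Cl n) (C alpha : R) :
  reflexive_space (clmod_NormedModule n VR) ->
  closed_operator T -> mv_injective T ->
  0 < omega < PI / 2 -> bisectorial omega T ->
  omega < theta < PI / 2 ->
  SH_R (Dsec theta) f -> 0 <= C -> 0 <= alpha -> poly_bound theta C alpha f ->
  (forall m : nat, alpha < INR m ->
     SH_R0 theta (fun s => cl_mul (f s) (e_reg m s)) /\
     intrinsic0 theta (@e_reg n m) /\
     exists A E : blin (clmod_NormedModule n VR) (clmod_NormedModule n VR),
       omega_calc_R T omega theta (fun s => cl_mul (f s) (e_reg m s)) A /\
       right_linear A /\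
       omega_calc_R T omega theta (e_reg m) E /\
       right_linear E /\ mv_injective (graph E)) /\
  (forall m k : nat, alpha < INR m -> alpha < INR k ->
     mv_eq (Hinf_R T omega theta m f) (Hinf_R T omega theta k f)) /\
  (intrinsic_poly theta f ->
     forall m k : nat, alpha < INR m -> alpha < INR k ->
     mv_eq (Hinf_R T omega theta m f) (Hinf_L T omega theta k f)) /\
  (SH_R0 theta f ->
     forall m : nat, alpha < INR m ->
     mv_eq (Hinf_R T omega theta m f) (omega_op_R T omega theta f)).
Proof.
move=> Vr Tc Ti ob Tb tb HfR C0 a0 pb.
have tb' : 0 < theta < PI / 2 by rlra.
have [Kz [Lz [HKz zb]]] := resolvent_family Tc hn ob Tb.
have [F [Hf HF]] := SH_R_rep hn tb' HfR.
have adm m : alpha < INR m -> forall A, admissible theta (fun z => Cmult (Cpow (e_one z) m) (F A z)).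
  move=> am A; have [c [c0 Hc]] := right_rep_component_bound Hf.
  (* The factor 2 counts the values of [f] at [J] and at [- J]. *)
  have cC : 0 <= 2 * c * C by apply: Rmult_le_pos => //; rlra.
  apply: (poly_growth_admissible tb' (HF A) cC a0 am) => r t r0 ht.
  have [J hJ] := imag_unit_exists hn; have hJ' := imag_unit_opp hJ.
  apply: Rle_trans (Hc r t J A r0 ht hJ) _.
  have b1 := pb _ (Dsec_polar r0 ht hJ); have b2 := pb _ (Dsec_polar r0 ht hJ').
  rewrite !norm_paravector_polar // in b1 b2; try rlra.
  by have := Rmult_le_compat_l _ _ _ c0 (Rplus_le_compat _ _ _ _ b1 b2); rlra.
have pos m : alpha < INR m -> 0 < INR m by rlra.
have Hfe m := right_rep_mult Hf (e_reg_rep (n := n) tb' m).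
have shift m k : alpha < INR m -> alpha < INR k ->
    mv_eq (Hinf_R T omega theta m f) (Hinf_R T omega theta k f).
  (* The shift only raises the exponent; the opposite direction is the symmetry of [mv_eq]. *)
  move=> hm hk; have key j l : alpha < INR j -> (j <= l)%nat ->
      mv_eq (Hinf_R T omega theta j f) (Hinf_R T omega theta l f).
    move=> hj jl; rewrite -(subnKC jl).
    exact: (Hinf_R_shift hn Tc Ti Vr ob tb HKz zb (l - j) Hf (pos _ hj) (adm _ hj)).
  case/orP: (leq_total m k) => h; first exact: key.
  by move=> p; apply: iff_sym; apply: key.
split; [|split; [|split]] => //.
- move=> m hm; split; [|split].
  + have HG A : slice_holo theta (fun z => Cmult (Cpow (e_one z) m) (F A z)).
      by apply: slice_holo_mult => //; apply: slice_holo_pow; apply: slice_holo_e_one.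
    split; first exact: (rep_SH_R hn (Hfe m) HG).
    exact: (admissible_bounded_integrable (Hfe m) HG (adm m hm)).
  + have HS : slice_holo theta (fun z => Cpow (e_one z) m).
      by apply: slice_holo_pow; apply: slice_holo_e_one.
    have He := e_reg_rep (n := n) tb' m.
    split; first exact: (rep_intrinsic hn He HS).
    exact: intrinsic_bounded_integrable He HS (e_pow_admissible tb' (pos m hm)).
  + have [A [rA HA _]] := right_calculus_tower Tc ob tb HKz zb (Hfe m) (adm m hm).
    have [aE vE] := value_e_pow Tc ob tb HKz zb (pos m hm).
    have [HE _] := omega_calc_e_reg Tc ob tb HKz zb (pos m hm).
    exists A, (bpow (X := clmod_CompleteNormedModule n VR) (Lz (polar 1 (PI / 2))) m).
    split=> //; split=> //; split=> //; split.
      exact: (value_right_linear tb HKz (resolvent_data_main Tc ob HKz zb) aE vE).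
    exact: (e_reg_injective Tc Ti ob HKz).
- move=> [Hi _] m k hm hk p; have [G [Hg HG]] := intrinsic_rep_of hn tb' Hi.
  (* The right calculus is moved to the exponent [k], where it can be compared with the left one. *)
  rewrite (shift m k hm hk p); apply: (Hinf_R_left hn Tc Ti Vr ob tb HKz zb Hg (pos _ hk)).
  apply: (poly_growth_admissible tb' HG C0 a0 hk) => r t r0 ht.
  have [J hJ] := imag_unit_exists hn; have b1 := pb _ (Dsec_polar r0 ht hJ).
  rewrite (Hg r t J r0 ht hJ) norm_paravector_polar // in b1; last rlra.
  by rewrite norm_cplx // -surjective_pairing in b1.
- move=> [_ Hb] m hm.
  exact: (Hinf_R_omega hn Tc Ti Vr ob tb HKz zb Hf (pos _ hm)
    (right_rep_admissible Hf hn tb' HF Hb)).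
Qed.
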